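(* Let $X_1,X_2$ be Hausdorff locally compact spaces with Radon measures $\nu_1,\nu_2$, let $X=X_1\times X_2$, $\nu=\nu_1\times\nu_2$, let $\mathcal G=X\times X$ be the pair groupoid, and let $\mathcal G_1=\{(x_1,x_2,y_1,x_2)\}$, $\mathcal G_2=\{(x_1,x_2,x_1,y_2)\}$ be the matched pair of subgroupoids described in the context, with the associated $\mathfrak a$, crossed product $L^\infty(\mathcal G_2)\rtimes_{\mathfrak a}\mathfrak G(\mathcal G_1)$ and coproduct $\Gamma$. With $\tilde{\mathfrak a},\Sigma,\Sigma'$ as in the context: i) $\tilde{\mathfrak a}=\mathrm{Ad}\,\Sigma\circ\mathfrak a$. ii) $\theta=\mathrm{Ad}(\Sigma'\Sigma)$ realizes a spatial von Neumann isomorphism between $L^\infty(\mathcal G_2)\rtimes_{\mathfrak a}\mathfrak G(\mathcal G_1)$ and $L^\infty(X_2^2,\nu_2^{\otimes2})\otimes\mathbb C1_{\mathcal L(L^2(X_1,\nu_1))}\otimes\mathcal L(L^2(X_1,\nu_1))$; thus $L^\infty(\mathcal G_2)\rtimes_{\mathfrak a}\mathfrak G(\mathcal G_1)$ is isomorphic to $L^\infty(X_2\times X_2,\nu_2\times\nu_2)\otimes\mathcal L(L^2(X_1,\nu_1))$ and to $\mathfrak G(X_2\times X_2)\otimes\hat{\mathfrak G}'(X_1\times X_1)$. iii) If $\tau:L^2(X_2^3\times X_1^3,\nu_2^3\times\nu_1^3)\to L^2(X_2^2\times X_1\times X_2\times X_1^2,\nu_2^2\times\nu_1\times\nu_2\times\nu_1^2)$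 is the map which flips the third and fourth factors, then $$(\theta\,{}_s\star_m\theta)\,\Gamma\,\theta^{-1}=\mathrm{Ad}\,\tau\,\big(\Gamma_{X_2^2}\otimes\hat\Gamma'_{X_1^2}\big).$$
   Context: **Groupoids.** The pair groupoid $Y\times Y$ of a locally compact ($\sigma$-compact, Hausdorff) space $Y$ with Radon measure $\kappa$ (of full support) has $r(x,y)=x$, $s(x,y)=y$, $(x,y)(y,z)=(x,z)$, unit space $Y$, Haar system $(\delta_x\times\kappa)_x$ and invariant measure $\kappa$. For $\mathcal G=X\times X$ elements are written $(x_1,x_2,y_1,y_2)$, with $r=(x_1,x_2)$, $s=(y_1,y_2)$; $\mu=\nu\times\nu$. $\mathcal G_1=\{(x_1,x_2,y_1,x_2)\}$ is identified with $X_1\times X_1\times X_2$ via $(x_1,x_2,y_1,x_2)\mapsto(x_1,y_1,x_2)$, with Haar system $\delta_{x_1}\times\nu_1\times\delta_{x_2}$ and $\mu_1=\nu_1\times\nu_1\times\nu_2$; $\mathcal G_2=\{(x_1,x_2,x_1,y_2)\}$ is identified with $X_2\times X_2\times X_1$ via $(x_1,x_2,x_1,y_2)\mapsto(x_2,y_2,x_1)$, with Haar system $\delta_{x_2}\times\nu_2\times\delta_{x_1}$ and $\mu_2=\nu_2\times\nu_2\times\nu_1$. Each $g=(x_1,x_2,y_1,y_2)$ factors uniquely as $g=p_1(g)p_2(g)$, $p_1(g)=(x_1,x_2,y_1,x_2)\in\mathcal G_1$, $p_2(g)=(y_1,x_2,y_1,y_2)\in\mathcal G_2$; $m(g)=s(p_1(g))=(y_1,x_2)$.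 $r_i,s_i$ are the restrictions of $r,s$ to $\mathcal G_i$; $r,s,m,r_i,s_i$ also denote the representations $f\mapsto f\circ r$ etc. of $N=L^\infty(X,\nu)$. **Crossed product and coproduct.** $\mathfrak a(f)(\gamma_2,\gamma_1)=f(p_2(\gamma_2\gamma_1))$ for $f\in L^\infty(\mathcal G_2)$, $\gamma_i\in\mathcal G_i$ composable; in coordinates $\mathfrak a(f)\big((x_2,y_2,x_1),(x_1,y_1,y_2)\big)=f(x_2,y_2,y_1)$. The crossed product $L^\infty(\mathcal G_2)\rtimes_{\mathfrak a}\mathfrak G(\mathcal G_1)$ is generated on $L^2(\mathcal G_2)\,{}_{s_2}\otimes_{r_1}L^2(\mathcal G_1)$ (relative tensor product over $N$, identified with $L^2(\mathcal G,\mu)$ via $((x_2,y_2,x_1),(x_1,y_1,y_2))\mapsto(x_1,x_2,y_1,y_2)$) by $\mathfrak a(L^\infty(\mathcal G_2))$ and $1\otimes\mathcal R(\mathcal G_1)$, where $\mathcal R(\mathcal G_1)$ is the right regular von Neumann algebra, generated by $\rho(h)\xi(g)=\int h(g_1)\xi(gg_1)d\lambda_1^{s(g)}(g_1)$, $h\in\mathcal K(\mathcal G_1)$ (continuous, compactly supported). For $i,j\in\{r,s,m\}$, $\mathcal G^2_{i,j}=\{(g,g'):i(g)=j(g')\}$ with the fibre product measure of $\mu$ with itself over $\nu$; $W:L^2(\mathcal G^2_{s,m})\to L^2(\mathcal G^2_{m,r})$ is the unitary $W\xi(g,g')=D(g,g')^{1/2}\xi\big(gp_1(p_2(g)^{-1}g'),p_2(g)^{-1}g'\big)$,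 $D$ being the corresponding Radon–Nikodym derivative, and $\Gamma(x)=W^*(1\,{}_m\otimes_rx)W$. **Maps.** The groupoid $X_1\times X_1$ acts on $X_2\times X_2\times X_1$ (fibred over $X_1$ by the third projection $pr_3$) by $(x_2,y_2,x_1).(x_1,y_1)=(x_2,y_2,y_1)$; $(pr_3,\tilde{\mathfrak a})$ is the corresponding action of $\mathfrak G(X_1\times X_1)$ on $L^\infty(X_2\times X_2\times X_1)$: $\tilde{\mathfrak a}(f)\big((x_2,y_2,x_1),(x_1,y_1)\big)=f(x_2,y_2,y_1)$. $\Sigma$ is the unitary from $L^2(X_2\times X_2\times X_1)\,{}_{s_2}\otimes_{r_1}L^2(X_1\times X_1\times X_2)$ (over $L^\infty(X_1\times X_2)$) to $L^2(X_2\times X_2\times X_1)\,{}_{pr_3}\otimes_rL^2(X_1\times X_1)$ (over $L^\infty(X_1)$), $\Sigma(\phi)\big((x_2,y_2,x_1),(x_1,y_1)\big)=\phi\big((x_2,y_2,x_1),(x_1,y_1,y_2)\big)$. $\Sigma'$ is the unitary from the latter space to $L^2(X_2\times X_2\times X_1\times X_1)$, $\Sigma'(\phi)(x_2,y_2,x_1,y_1)=\phi\big((x_2,y_2,x_1),(x_1,y_1)\big)$. $(\theta\,{}_s\star_m\theta)$ is the fibre product of $\theta$ with itself, with values in operators on $L^2(X_2^2\times X_1^2)\,{}_{\theta\circ s}\otimes_{\theta\circ m}L^2(X_2^2\times X_1^2)$, identified with $L^2(X_2^2\times X_1\times X_2\times X_1^2)$ by $\Psi(\xi^1\otimes\xi^2)(x_2,y_2,x_1,z_2,y_1,z_1)=\xi^1(x_2,y_2,x_1,y_1)\,\xi^2(y_2,z_2,z_1,y_1)$.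 **Pair groupoid structures.** $\mathfrak G(X_2\times X_2)$ has algebra $L^\infty(X_2\times X_2)$ and coproduct $\Gamma_{X_2^2}(f)=f_{13}$ on $L^2(X_2^3)$, i.e. multiplication by $(x,y,t)\mapsto f(x,t)$. $\hat{\mathfrak G}'(X_1\times X_1)$ has as algebra the right regular algebra $\mathcal R(X_1\times X_1)=\mathbb C1\otimes\mathcal L(L^2(X_1,\nu_1))$ on $L^2(X_1\times X_1)$ and coproduct $\hat\Gamma'_{X_1^2}(1\otimes T)=1\otimes T\otimes1$ on $L^2(X_1^3)$ (where $\{((x,y),(t,y))\}$ is identified with $X_1^3$ by $((x,y),(t,y))\mapsto(x,y,t)$). In ii), $\mathfrak G(X_2\times X_2)\otimes\hat{\mathfrak G}'(X_1\times X_1)$ refers to the tensor product of these von Neumann algebras. *)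

(* Defs.v *)
From HB Require Import structures.
From mathcomp Require Import all_boot all_order all_algebra.
From mathcomp Require Import generic_quotient complex ring lra.
From mathcomp Require Import all_classical all_reals all_analysis measurable_realfun.
Import Order.TTheory GRing.Theory Num.Theory.
Import numFieldNormedType.Exports.

Set Implicit Arguments.
Unset Strict Implicit.
Unset Printing Implicit Defensive.

Local Open Scope classical_set_scope.
Local Open Scope ring_scope.
Local Open Scope complex_scope.

Definition cmeasurable (R : realType) d (T : measurableType d) (f : T -> R[i]) :=
  measurable_fun [set: T] (fun x => complex.Re (f x)) /\
  measurable_fun [set: T] (fun x => complex.Im (f x)).

Definition sqabs (R : realType) (z : R[i]) : R :=
  complex.Re z ^+ 2 + complex.Im z ^+ 2.

Definition square_integrable (R : realType) d (T : measurableType d)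
    (mu : {measure set T -> \bar R}) (f : T -> R[i]) :=
  cmeasurable f /\ (\int[mu]_x (sqabs (f x))%:E < +oo)%E.

Definition cintegral (R : realType) d (T : measurableType d)
    (mu : {measure set T -> \bar R}) (f : T -> R[i]) : R[i] :=
  (\int[mu]_x complex.Re (f x)) +i* (\int[mu]_x complex.Im (f x)).

Section L2_type.
Context (R : realType) d (T : measurableType d) (mu : {measure set T -> \bar R}).
Local Notation C := R[i].

Record sqfun := SqFun {
  sqfun_fun :> T -> C;
  sqfunP : square_integrable mu sqfun_fun }.

HB.instance Definition _ := gen_eqMixin sqfun.
HB.instance Definition _ := gen_choiceMixin sqfun.

Definition sqfun_eq (f g : sqfun) : bool := `[< {ae mu, forall x, f x = g x} >].

Lemma sqfun_eq_refl : reflexive sqfun_eq.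
Proof. by move=> f; apply/asboolP; apply/nearW. Qed.

Lemma sqfun_eq_sym : symmetric sqfun_eq.
Proof.
by move=> f g; apply/idP/idP => /asboolP h; apply/asboolP; apply: filterS h.
Qed.

Lemma sqfun_eq_trans : transitive sqfun_eq.
Proof.
move=> g f h /asboolP fg /asboolP gh; apply/asboolP.
by apply: filterS2 fg gh => x -> ->.
Qed.

Canonical sqfun_equiv :=
  EquivRel sqfun_eq sqfun_eq_refl sqfun_eq_sym sqfun_eq_trans.

Definition L2 : Type := {eq_quot sqfun_eq}%qT.
HB.instance Definition _ := Choice.on L2.
HB.instance Definition _ := EqQuotient.on L2.

Definition L2_fun (u : L2) : T -> C := repr u.
Coercion L2_fun : L2 >-> Funclass.

Lemma square_integrable0 : square_integrable mu (fun _ => 0).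
Proof.
split; first by split; exact: measurable_cst.
by rewrite /sqabs /= expr0n /= addr0 integral0.
Qed.

(* The class of f; functions that are not square integrable are sent to 0. *)
Definition toL2 (f : T -> C) : L2 :=
  if pselect (square_integrable mu f) is left h
  then (\pi_L2 (SqFun h))%qT else (\pi_L2 (SqFun square_integrable0))%qT.

Lemma L2_sqint (u : L2) : square_integrable mu u.
Proof. exact: sqfunP. Qed.

Lemma toL2E f : square_integrable mu f -> {ae mu, forall x, toL2 f x = f x}.
Proof.
move=> h; rewrite /toL2; case: pselect => [h'|//].
by have /eqmodP/asboolP := reprK (\pi_L2 (SqFun h'))%qT.
Qed.

Lemma L2P (u v : L2) : u = v <-> {ae mu, forall x, u x = v x}.
Proof.
split=> [->|uv]; first exact/nearW.
rewrite -[u]reprK -[v]reprK; apply/eqmodP/asboolP.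
exact: uv.
Qed.

Lemma sqabsD (a b : C) : sqabs (a + b) <= 2 * sqabs a + 2 * sqabs b.
Proof.
case: a b => [a1 a2] [b1 b2]; rewrite /sqabs /=.
have H x y : (x + y) ^+ 2 <= 2 * x ^+ 2 + 2 * y ^+ 2 :> R.
  rewrite -subr_ge0 [leRHS](_ : _ = (x - y) ^+ 2) ?sqr_ge0//.
  by rewrite sqrrD sqrrB !mulr_natl !mulr2n; ring.
by rewrite !mulrDr addrACA lerD.
Qed.

Lemma sqabsM (a b : C) : sqabs (a * b) = sqabs a * sqabs b.
Proof. by case: a b => [a1 a2] [b1 b2]; rewrite /sqabs /=; ring. Qed.

Lemma sqabs_ge0 (a : C) : 0 <= sqabs a.
Proof. by rewrite /sqabs addr_ge0// sqr_ge0. Qed.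

Lemma measurable_sqabs (f : T -> C) : cmeasurable f ->
  measurable_fun [set: T] (fun x => sqabs (f x)).
Proof. by move=> [mr mi]; apply: measurable_funD; exact: measurable_funX. Qed.

Lemma square_integrableD (f g : T -> C) : square_integrable mu f ->
  square_integrable mu g -> square_integrable mu (fun x => f x + g x).
Proof.
move=> [[fr fi] f2] [[gr gi] g2]; have mfg : cmeasurable (fun x => f x + g x).
  split; [apply: eq_measurable_fun (measurable_funD fr gr)
         |apply: eq_measurable_fun (measurable_funD fi gi)] => x _ /=;
  by case: (f x) (g x) => [? ?] [? ?].
split => //.
have mf2 : measurable_fun setT (fun x => (2 * sqabs (f x))%:E : \bar R).
  apply/measurable_EFinP/measurable_funM => //.
  exact: measurable_sqabs.
have mg2 : measurable_fun setT (fun x => (2 * sqabs (g x))%:E : \bar R).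
  apply/measurable_EFinP/measurable_funM => //.
  exact: measurable_sqabs.
apply: (@le_lt_trans _ _
    (\int[mu]_x ((2 * sqabs (f x))%:E + (2 * sqabs (g x))%:E))%E).
  apply: ge0_le_integral => //.
  - by move=> x _; rewrite lee_fin sqabs_ge0.
  - by apply/measurable_EFinP; exact: measurable_sqabs.
  - by apply: emeasurable_funD.
  - by move=> x _; rewrite lee_fin sqabsD.
have I (h : T -> C) : cmeasurable h -> (\int[mu]_x (sqabs (h x))%:E < +oo)%E ->
    (\int[mu]_x (2 * sqabs (h x))%:E < +oo)%E.
  move=> mh h2; under eq_integral do rewrite EFinM.
  rewrite ge0_integralZl//.
  - by rewrite lte_mul_pinfty.
  - by apply/measurable_EFinP; exact: measurable_sqabs.
  - by move=> x _; rewrite lee_fin sqabs_ge0.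
rewrite ge0_integralD//.
- by rewrite lte_add_pinfty// I.
- by move=> x _; rewrite lee_fin mulr_ge0// sqabs_ge0.
- by move=> x _; rewrite lee_fin mulr_ge0// sqabs_ge0.
Qed.

Lemma square_integrableZ (c : C) (f : T -> C) : square_integrable mu f ->
  square_integrable mu (fun x => c * f x).
Proof.
move=> [[fr fi] f2]; split.
  have mc (x : R) : measurable_fun [set: T] (fun=> x) by exact: measurable_cst.
  split.
  - apply: eq_measurable_fun (measurable_funB
      (measurable_funM (mc (complex.Re c)) fr)
      (measurable_funM (mc (complex.Im c)) fi)).
    by move=> x _ /=; case: c (f x) => [? ?] [? ?].
  - apply: eq_measurable_fun (measurable_funD
      (measurable_funM (mc (complex.Re c)) fi)
      (measurable_funM (mc (complex.Im c)) fr)).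
    by move=> x _ /=; case: c (f x) => [? ?] [? ?].
under eq_integral do rewrite sqabsM EFinM.
rewrite ge0_integralZl//.
- by rewrite lte_mul_pinfty// lee_fin sqabs_ge0.
- by apply/measurable_EFinP; exact: measurable_sqabs.
- by move=> x _; rewrite lee_fin sqabs_ge0.
- by rewrite lee_fin sqabs_ge0.
Qed.

Definition L2_zero : L2 := toL2 (fun=> 0).
Definition L2_add (u v : L2) : L2 := toL2 (fun x => u x + v x).
Definition L2_scale (c : C) (u : L2) : L2 := toL2 (fun x => c * u x).
Definition L2_opp (u : L2) : L2 := L2_scale (-1) u.

Lemma L2_zeroE : {ae mu, forall x, L2_zero x = 0}.
Proof. exact: toL2E square_integrable0. Qed.

Lemma L2_addE u v : {ae mu, forall x, L2_add u v x = u x + v x}.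
Proof. by apply: toL2E; apply: square_integrableD; exact: L2_sqint. Qed.

Lemma L2_scaleE c u : {ae mu, forall x, L2_scale c u x = c * u x}.
Proof. by apply: toL2E; apply: square_integrableZ; exact: L2_sqint. Qed.

Lemma L2_addC : commutative L2_add.
Proof.
move=> u v; apply/L2P; apply: filterS2 (L2_addE u v) (L2_addE v u).
by move=> x -> ->; rewrite addrC.
Qed.

Lemma L2_addA : associative L2_add.
Proof.
move=> u v w; apply/L2P.
apply: filterS3 (L2_addE u (L2_add v w)) (L2_addE (L2_add u v) w)
  (filterI (L2_addE v w) (L2_addE u v)) => x -> -> [-> ->].
by rewrite addrA.
Qed.

Lemma L2_add0 : left_id L2_zero L2_add.
Proof.
move=> u; apply/L2P; apply: filterS2 (L2_addE L2_zero u) L2_zeroE.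
by move=> x -> ->; rewrite add0r.
Qed.

Lemma L2_addN : left_inverse L2_zero L2_opp L2_add.
Proof.
move=> u; apply/L2P.
apply: filterS3 (L2_addE (L2_opp u) u) (L2_scaleE (-1) u) L2_zeroE.
by move=> x -> -> ->; rewrite mulN1r addNr.
Qed.

HB.instance Definition _ :=
  GRing.isZmodule.Build L2 L2_addA L2_addC L2_add0 L2_addN.

Lemma L2_scaleA a b u : L2_scale a (L2_scale b u) = L2_scale (a * b) u.
Proof.
apply/L2P; apply: filterS3 (L2_scaleE a (L2_scale b u)) (L2_scaleE b u)
  (L2_scaleE (a * b) u).
by move=> x -> -> ->; rewrite mulrA.
Qed.

Lemma L2_scale1 : left_id 1 L2_scale.
Proof.
by move=> u; apply/L2P; apply: filterS (L2_scaleE 1 u) => x ->; rewrite mul1r.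
Qed.

Lemma L2_scaleDr : right_distributive L2_scale +%R.
Proof.
move=> c u v; apply/L2P.
apply: filterS3 (filterI (L2_scaleE c (u + v)) (L2_addE u v))
  (L2_addE (L2_scale c u) (L2_scale c v))
  (filterI (L2_scaleE c u) (L2_scaleE c v)) => x [-> ->] -> [-> ->].
by rewrite mulrDr.
Qed.

Lemma L2_scaleDl v : {morph L2_scale^~ v : a b / a + b}.
Proof.
move=> a b; apply/L2P.
apply: filterS3 (L2_scaleE (a + b) v) (L2_addE (L2_scale a v) (L2_scale b v))
  (filterI (L2_scaleE a v) (L2_scaleE b v)) => x -> -> [-> ->].
by rewrite mulrDl.
Qed.

HB.instance Definition _ := GRing.Zmodule_isLmodule.Build C L2
  L2_scaleA L2_scale1 L2_scaleDr L2_scaleDl.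

Definition inner (u v : L2) : C := cintegral mu (fun x => u x * (v x)^*).
Definition normL2 (u : L2) : R := Num.sqrt (complex.Re (inner u u)).

End L2_type.

Section operators.
Context (R : realType) d (T : measurableType d) (mu : {measure set T -> \bar R}).
Context d' (U : measurableType d') (nu : {measure set U -> \bar R}).

Definition bounded_op (a : L2 mu -> L2 nu) :=
  linear a /\ exists M : R, forall u, normL2 (a u) <= M * normL2 u.

Definition is_adjoint (a : L2 mu -> L2 nu) (b : L2 nu -> L2 mu) :=
  forall u v, inner (a u) v = inner u (b v).

Definition adj (a : L2 mu -> L2 nu) : L2 nu -> L2 mu :=
  xget (fun=> 0) [set b | is_adjoint a b].

Definition unitary (a : L2 mu -> L2 nu) :=
  [/\ linear a, forall u v, inner (a u) (a v) = inner u v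
    & forall v, exists u, a u = v].

Definition Ad (a : L2 mu -> L2 nu) (x : L2 mu -> L2 mu) : L2 nu -> L2 nu :=
  a \o x \o adj a.

(* The operator u |-> u \o c induced by a map c of the underlying spaces. *)
Definition comp_op (c : U -> T) (u : L2 mu) : L2 nu := toL2 nu (fun y => u (c y)).

End operators.
Arguments comp_op {R d T mu d' U nu} c u.

Section von_Neumann.
Context (R : realType) d (T : measurableType d) (mu : {measure set T -> \bar R}).
Local Notation op := (L2 mu -> L2 mu).

Definition all_ops : set op := [set a | bounded_op a].

Definition scalar_ops : set op := [set (fun u => c *: u) | c in [set: R[i]]].

Definition commutant (S : set op) : set op :=
  [set a | bounded_op a /\ forall s, S s -> a \o s = s \o a].

(* The von Neumann algebra generated by S: double commutant of S and S^*. *)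
Definition vN_gen (S : set op) : set op :=
  commutant (commutant (S `|` [set b | exists2 a, S a & is_adjoint a b])).

Definition Linf : set (T -> R[i]) :=
  [set f | cmeasurable f /\ exists M : R, {ae mu, forall x, sqabs (f x) <= M}].

Definition mulop (f : T -> R[i]) : op := fun u => toL2 mu (fun x => f x * u x).

Definition Linf_ops : set op := [set mulop f | f in Linf].

End von_Neumann.
Arguments all_ops {R d T} mu _.
Arguments scalar_ops {R d T} mu _.
Arguments Linf_ops {R d T} mu _.
Arguments mulop {R d T mu} f u.

Section morphisms.
Context (R : realType) d (T : measurableType d) (mu : {measure set T -> \bar R}).
Context d' (U : measurableType d') (nu : {measure set U -> \bar R}).
Implicit Types (M : set (L2 mu -> L2 mu)) (N : set (L2 nu -> L2 nu))
  (phi : (L2 mu -> L2 mu) -> (L2 nu -> L2 nu)).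

Definition star_hom M phi :=
  [/\ forall a, M a -> bounded_op (phi a),
      forall (c : R[i]) a b, M a -> M b ->
        phi (fun u => c *: a u + b u) = (fun u => c *: phi a u + phi b u),
      forall a b, M a -> M b -> phi (a \o b) = phi a \o phi b
    & forall a b, M a -> M b -> is_adjoint a b -> is_adjoint (phi a) (phi b)].

(* *-isomorphisms of von Neumann algebras are automatically normal. *)
Definition vN_iso M N phi := star_hom M phi /\ set_bij M N phi.

Definition vN_isomorphic M N := exists phi, vN_iso M N phi.

End morphisms.

Definition square_summable (R : realType) d (T : measurableType d)
    (mu : {measure set T -> \bar R}) (u : nat -> L2 mu) :=
  (\sum_(n <oo) (normL2 (u n) ^+ 2)%:E < +oo)%E.

Definition csum (R : realType) (z : nat -> R[i]) : R[i] :=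
  limn (series (fun n => complex.Re (z n))) +i*
  limn (series (fun n => complex.Im (z n))).

(* Normality is sigma-weak continuity: the preadjoint of phi maps the normal
   functionals b |-> sum_n <b u_n, v_n> to normal functionals on M. *)
Definition normal_map (R : realType)
    d (T : measurableType d) (mu : {measure set T -> \bar R})
    d' (U : measurableType d') (nu : {measure set U -> \bar R})
    (M : set (L2 mu -> L2 mu)) (phi : (L2 mu -> L2 mu) -> (L2 nu -> L2 nu)) :=
  forall u v : nat -> L2 nu, square_summable u -> square_summable v ->
  exists u' v' : nat -> L2 mu,
    [/\ square_summable u', square_summable v' & forall a, M a ->
      csum (fun n => inner (phi a (u n)) (v n)) =
      csum (fun n => inner (a (u' n)) (v' n))].

Definition image_mes (R : realType) d1 (T1 : measurableType d1)
    d2 (T2 : measurableType d2) (m : {measure set T1 -> \bar R}) (f : T1 -> T2)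
    (mf : measurable_fun [set: T1] f) : {measure set T2 -> \bar R} :=
  measure_function_pushforward__canonical__measure_function_Measure m mf.

(* The Radon-Nikodym derivative D = d(m o v) / dn of an (almost everywhere
   bijective) map v, determined by m = v_*(D n). *)
Definition density_along (R : realType) d1 (T1 : measurableType d1)
    d2 (T2 : measurableType d2) (m : {measure set T1 -> \bar R})
    (n : {measure set T2 -> \bar R}) (v : T2 -> T1) : T2 -> R :=
  xget (fun=> 0) [set D : T2 -> R | [/\ measurable_fun [set: T2] D,
    forall y, 0 <= D y
    & forall S, measurable S ->
        m S = (\int[n]_(y in v @^-1` S) (D y)%:E)%E]].

(* The product measure m1 \x m2 with its sigma-finite structure. *)
Section product_measure.
Context (R : realType).
Context d1 (T1 : measurableType d1) (m1 : {sigma_finite_measure set T1 -> \bar R}).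
Context d2 (T2 : measurableType d2) (m2 : {sigma_finite_measure set T2 -> \bar R}).

Definition prodm : set (T1 * T2) -> \bar R := (m1 \x m2)%E.

HB.instance Definition _ := Measure.copy prodm (m1 \x m2)%E.

Lemma prodm_sigma_finite : sigma_finite [set: T1 * T2] prodm.
Proof.
have /sigma_finiteP[F [TF ndF Foo]] := sigma_finiteT m1.
have /sigma_finiteP[G [TG ndG Goo]] := sigma_finiteT m2.
exists (fun n => F n `*` G n).
  rewrite -setXTT TF TG predeqE => -[x y]; split.
    move=> [/= [n _ Fnx] [k _ Gky]]; exists (maxn n k) => //; split.
    - by move: x Fnx; exact/subsetPset/ndF/leq_maxl.
    - by move: y Gky; exact/subsetPset/ndG/leq_maxr.
  by move=> [n _ []/= ? ?]; split; exists n.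
move=> k; have [? ?] := Foo k; have [? ?] := Goo k.
split; first exact: measurableX.
by rewrite /prodm product_measure1E// lte_mul_pinfty// ge0_fin_numE.
Qed.

HB.instance Definition _ := Measure_isSigmaFinite.Build _ _ _ prodm
  prodm_sigma_finite.

End product_measure.

Notation "m1 '\X' m2" := (prodm m1 m2) (at level 40, left associativity).

Definition mpres (R : realType) d1 (T1 : measurableType d1)
    d2 (T2 : measurableType d2) (m1 : set T1 -> \bar R) (m2 : set T2 -> \bar R)
    (f : T1 -> T2) :=
  measurable_fun [set: T1] f /\
  forall S, measurable S -> m2 S = m1 (f @^-1` S).

Lemma mpres_id (R : realType) d1 (T1 : measurableType d1)
    (m1 : set T1 -> \bar R) : mpres m1 m1 id.
Proof. by split. Qed.

Lemma mpres_comp (R : realType) d1 (T1 : measurableType d1)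
    d2 (T2 : measurableType d2) d3 (T3 : measurableType d3)
    (m1 : set T1 -> \bar R) (m2 : set T2 -> \bar R) (m3 : set T3 -> \bar R)
    (g : T2 -> T3) (f : T1 -> T2) :
  mpres m2 m3 g -> mpres m1 m2 f -> mpres m1 m3 (g \o f).
Proof.
move=> [mg g23] [mf f12]; split; first exact: measurableT_comp.
move=> S mS; rewrite g23// f12//.
by rewrite -[X in measurable X]setTI; exact: mg.
Qed.

Definition swap_pair (A B : Type) (w : A * B) := (w.2, w.1).
Definition assoc_pair (A B C : Type) (w : A * B * C) := (w.1.1, (w.1.2, w.2)).
Definition unassoc_pair (A B C : Type) (w : A * (B * C)) := ((w.1, w.2.1), w.2.2).
Definition map_pair (A B C D : Type) (f : A -> C) (g : B -> D) (w : A * B) :=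
  (f w.1, g w.2).

Section measure_preserving.
Context (R : realType).
Context d1 (T1 : measurableType d1) (m1 : {sigma_finite_measure set T1 -> \bar R}).
Context d2 (T2 : measurableType d2) (m2 : {sigma_finite_measure set T2 -> \bar R}).
Context d3 (T3 : measurableType d3) (m3 : {sigma_finite_measure set T3 -> \bar R}).
Context d4 (T4 : measurableType d4) (m4 : {sigma_finite_measure set T4 -> \bar R}).
Local Open Scope ereal_scope.

Lemma prodmE A B : measurable A -> measurable B ->
  (m1 \X m2) (A `*` B) = m1 A * m2 B.
Proof. exact: product_measure1E. Qed.

Lemma mpres_swap : mpres (m1 \X m2) (m2 \X m1) (@swap_pair T1 T2).
Proof.
have ms : measurable_fun [set: T1 * T2] (@swap_pair T1 T2).
  exact: measurable_swap.
split=> // S mS.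
apply: (product_measure_unique (m' := image_mes (m1 \X m2) ms)) => // A B mA mB.
rewrite /= /pushforward muleC -prodmE//; congr (prodm _ _ _).
by apply/seteqP; split => -[a b] /= [].
Qed.

Lemma mpres_assoc :
  mpres (m1 \X m2 \X m3) (m1 \X (m2 \X m3)) (@assoc_pair T1 T2 T3).
Proof.
have ms : measurable_fun [set: T1 * T2 * T3] (@assoc_pair T1 T2 T3).
  apply/measurable_fun_pair; first exact: measurableT_comp.
  by apply/measurable_fun_pair; do ?exact: measurableT_comp.
split=> // S mS.
have := @product_measure_unique _ _ _ _ R m1 (m2 \X m3)%E (image_mes (m1 \X m2 \X m3) ms).
apply=> //.
move=> A B mA mB /=; rewrite /pushforward.
have mAB : measurable (@assoc_pair T1 T2 T3 @^-1` (A `*` B)).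
  by rewrite -[X in measurable X]setTI; apply: ms => //; exact: measurableX.
rewrite {1}/prodm {1}/product_measure1.
rewrite (eq_integral
    (fun w => (\1_A w.1)%:E * m3 (xsection B w.2))); last first.
  move=> -[a b] _ /=; rewrite indicE; have [aA|aA] /= := boolP (a \in A).
    rewrite mul1e; congr (m3 _); move: aA; rewrite inE => aA.
    by apply/seteqP; split => c; rewrite /xsection /= !inE /= => // -[].
  rewrite mul0e -[RHS](measure0 m3); congr (m3 _); apply/seteqP.
  split => c //; rewrite /xsection /= !inE /= => -[Aa _].
  by move: aA; rewrite notin_setE.
have mB3 : measurable_fun [set: T2] (fun b => m3 (xsection B b)).
  exact: (measurable_fun_xsection m3 mB).
rewrite fubini_tonelli1//.
- rewrite (eq_integral (fun a => (\1_A a)%:E * (m2 \X m3) B)); last first.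
    by move=> a _; rewrite /fubini_F /= ge0_integralZl.
  rewrite ge0_integralZr//.
  + by rewrite integral_indic// setIT.
  + exact/measurable_EFinP/measurable_indic.
- apply: emeasurable_funM.
    apply/measurable_EFinP.
    by apply: (measurableT_comp (@measurable_indic _ _ R setT A mA)).
  by apply: (measurableT_comp mB3).
- by move=> w; rewrite mule_ge0// lee_fin.
Qed.

Lemma mpres_unassoc :
  mpres (m1 \X (m2 \X m3)) (m1 \X m2 \X m3) (@unassoc_pair T1 T2 T3).
Proof.
have ms : measurable_fun [set: T1 * (T2 * T3)] (@unassoc_pair T1 T2 T3).
  apply/measurable_fun_pair; last exact: measurableT_comp.
  by apply/measurable_fun_pair; do ?exact: measurableT_comp.
split=> // S mS.
have mS' : measurable (@unassoc_pair T1 T2 T3 @^-1` S).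
  by rewrite -[X in measurable X]setTI; exact: ms.
rewrite (mpres_assoc.2 _ mS'); congr ((_ \X _) _).
by apply/seteqP; split => -[[]].
Qed.

Lemma mpres_map (f : T1 -> T3) (g : T2 -> T4) :
  mpres m1 m3 f -> mpres m2 m4 g -> mpres (m1 \X m2) (m3 \X m4) (map_pair f g).
Proof.
move=> [mf f13] [mg g24].
have ms : measurable_fun [set: T1 * T2] (map_pair f g).
  by apply/measurable_fun_pair; exact: measurableT_comp.
split=> // S mS.
apply: (product_measure_unique (m' := image_mes (m1 \X m2) ms)) => // A B mA mB.
rewrite f13// g24// -prodmE//.
- by rewrite -[X in measurable X]setTI; exact: mf.
- by rewrite -[X in measurable X]setTI; exact: mg.
Qed.

End measure_preserving.

Section interchange.
Context (R : realType).
Context d1 (T1 : measurableType d1) (m1 : {sigma_finite_measure set T1 -> \bar R}).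
Context d2 (T2 : measurableType d2) (m2 : {sigma_finite_measure set T2 -> \bar R}).
Context d3 (T3 : measurableType d3) (m3 : {sigma_finite_measure set T3 -> \bar R}).
Context d4 (T4 : measurableType d4) (m4 : {sigma_finite_measure set T4 -> \bar R}).

Definition interchange (w : T1 * T2 * (T3 * T4)) :=
  ((w.1.1, w.2.1), (w.1.2, w.2.2)).

Lemma mpres_interchange :
  mpres (m1 \X m2 \X (m3 \X m4)) (m1 \X m3 \X (m2 \X m4)) interchange.
Proof.
have h1 := mpres_assoc m1 m2 (m3 \X m4).
have h2 := mpres_map (mpres_id m1) (mpres_unassoc m2 m3 m4).
have h3 := mpres_map (mpres_id m1)
  (mpres_map (mpres_swap m2 m3) (mpres_id m4)).
have h4 := mpres_map (mpres_id m1) (mpres_assoc m3 m2 m4).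
have h5 := mpres_unassoc m1 m3 (m2 \X m4).
exact: mpres_comp h5 (mpres_comp h4 (mpres_comp h3 (mpres_comp h2 h1))).
Qed.

End interchange.

Section tensor.
Context (R : realType).
Context d1 (T1 : measurableType d1) (m1 : {sigma_finite_measure set T1 -> \bar R}).
Context d2 (T2 : measurableType d2) (m2 : {sigma_finite_measure set T2 -> \bar R}).

(* L^2(T1) (x) L^2(T2) is realized as L^2(T1 * T2). *)
Definition tens (u : L2 m1) (v : L2 m2) : L2 (m1 \X m2) :=
  toL2 _ (fun w => u w.1 * v w.2).

Definition tens_op (a : L2 m1 -> L2 m1) (b : L2 m2 -> L2 m2) :
    L2 (m1 \X m2) -> L2 (m1 \X m2) :=
  xget (fun=> 0) [set c | bounded_op c /\
    forall u v, c (tens u v) = tens (a u) (b v)].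

Definition vN_tens (M1 : set (L2 m1 -> L2 m1)) (M2 : set (L2 m2 -> L2 m2)) :=
  vN_gen [set tens_op a b | a in M1 & b in M2].

End tensor.

Section tensor_hom.
Context (R : realType).
Context d1 (T1 : measurableType d1) (m1 : {sigma_finite_measure set T1 -> \bar R}).
Context d2 (T2 : measurableType d2) (m2 : {sigma_finite_measure set T2 -> \bar R}).
Context e1 (U1 : measurableType e1) (n1 : {sigma_finite_measure set U1 -> \bar R}).
Context e2 (U2 : measurableType e2) (n2 : {sigma_finite_measure set U2 -> \bar R}).

(* The tensor product phi1 (x) phi2 of normal *-homomorphisms. *)
Definition tens_hom (M1 : set (L2 m1 -> L2 m1)) (M2 : set (L2 m2 -> L2 m2))
    (phi1 : (L2 m1 -> L2 m1) -> (L2 n1 -> L2 n1))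
    (phi2 : (L2 m2 -> L2 m2) -> (L2 n2 -> L2 n2)) :
    (L2 (m1 \X m2) -> L2 (m1 \X m2)) -> L2 (n1 \X n2) -> L2 (n1 \X n2) :=
  xget (fun _ => fun=> 0) [set phi |
    [/\ star_hom (vN_tens M1 M2) phi, normal_map (vN_tens M1 M2) phi
      & forall a b, M1 a -> M2 b ->
          phi (tens_op a b) = tens_op (phi1 a) (phi2 b)]].

End tensor_hom.

(* A disintegration mu = \int mu_z dzeta(z) along p : A -> Z, in which mu_z is
   the image of one fixed measure dis_mes by the parametrization
   t |-> dis_par (z, t) of the fibre p^-1(z). *)
Record disintegration (R : realType)
    d (A : measurableType d) (mu : {measure set A -> \bar R})
    d' (Z : measurableType d') (zeta : {sigma_finite_measure set Z -> \bar R})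
    (p : A -> Z) := Disintegration {
  dis_disp : measure_display;
  dis_type : measurableType dis_disp;
  dis_mes : {sigma_finite_measure set dis_type -> \bar R};
  dis_par : Z * dis_type -> A;
  dis_parK : forall z t, p (dis_par (z, t)) = z;
  dis_mpres : mpres (zeta \X dis_mes) mu dis_par }.
Arguments dis_disp {R d A mu d' Z zeta p} _.
Arguments dis_type {R d A mu d' Z zeta p} _.
Arguments dis_mes {R d A mu d' Z zeta p} _.
Arguments dis_par {R d A mu d' Z zeta p} _ _.

Section fibre_product.
Context (R : realType) d0 (Z : measurableType d0).
Context (zeta : {sigma_finite_measure set Z -> \bar R}).
Context dA (A : measurableType dA) (mA : {measure set A -> \bar R}) (p : A -> Z).
Context dB (B : measurableType dB) (mB : {measure set B -> \bar R}) (q : B -> Z).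
Context (DA : disintegration mA zeta p) (DB : disintegration mB zeta q).

Definition fibre_par (w : Z * dis_type DA * dis_type DB) : A * B :=
  (dis_par DA (w.1.1, w.1.2), dis_par DB (w.1.1, w.2)).

Lemma measurable_fibre_par : measurable_fun [set: _] fibre_par.
Proof.
have m11 : measurable_fun setT (fun w : Z * dis_type DA * dis_type DB => w.1.1).
  exact: (measurableT_comp measurable_fst measurable_fst).
have m12 : measurable_fun setT (fun w : Z * dis_type DA * dis_type DB => w.1.2).
  exact: (measurableT_comp measurable_snd measurable_fst).
apply/measurable_fun_pair.
- apply: (measurableT_comp (dis_mpres DA).1).
  exact/measurable_fun_pair.
- apply: (measurableT_comp (dis_mpres DB).1).
  exact/measurable_fun_pair.
Qed.

(* The fibre product measure \int (mA_z x mB_z) dzeta(z). It is carried by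
   {(a, b) | p a = q b}, and is taken as a measure on A * B: functions on A * B
   are thus identified when they agree almost everywhere on the fibre product. *)
Definition fibre_mes : {measure set (A * B) -> \bar R} :=
  image_mes (zeta \X dis_mes DA \X dis_mes DB) measurable_fibre_par.

(* The zeta-bounded vectors of L^2(A): z |-> \int |u|^2 dmA_z is in L^oo. *)
Definition zeta_bounded (u : L2 mA) := exists M : R,
  {ae zeta, forall z,
    (\int[dis_mes DA]_t (sqabs (u (dis_par DA (z, t))))%:E <= M%:E)%E}.

(* The relative tensor product of L^2(A) and L^2(B) is L^2(fibre_mes); u is
   meant to be zeta-bounded here. *)
Definition rtens (u : L2 mA) (v : L2 mB) : L2 fibre_mes :=
  toL2 _ (fun w => u w.1 * v w.2).

End fibre_product.

Definition rtens_op (R : realType) d0 (Z : measurableType d0)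
    (zeta : {sigma_finite_measure set Z -> \bar R})
    dA (A : measurableType dA) (mA : {measure set A -> \bar R}) (p : A -> Z)
    dB (B : measurableType dB) (mB : {measure set B -> \bar R}) (q : B -> Z)
    dA' (A' : measurableType dA') (mA' : {measure set A' -> \bar R}) (p' : A' -> Z)
    dB' (B' : measurableType dB') (mB' : {measure set B' -> \bar R}) (q' : B' -> Z)
    (DA : disintegration mA zeta p) (DB : disintegration mB zeta q)
    (DA' : disintegration mA' zeta p') (DB' : disintegration mB' zeta q')
    (a : L2 mA -> L2 mA') (b : L2 mB -> L2 mB') :
    L2 (fibre_mes DA DB) -> L2 (fibre_mes DA' DB') :=
  xget (fun=> 0) [set c | bounded_op c /\
    forall u v, zeta_bounded DA u ->
      c (rtens DA DB u v) = rtens DA' DB' (a u) (b v)].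

Arguments rtens_op {R d0 Z zeta dA A mA p dB B mB q dA' A' mA' p' dB' B' mB' q'}
  DA DB DA' DB' a b _.

Definition Cc (R : realType) (T : topologicalType) : set (T -> R[i]) :=
  [set h | [/\ continuous (fun x => complex.Re (h x) : R),
               continuous (fun x => complex.Im (h x) : R)
             & compact (closure [set x | h x != 0])]].

Section right_regular.
Context (R : realType) d (T : measurableType d) (mu : {measure set T -> \bar R}).
Context (U : Type) (s : T -> U) (mul : T -> T -> T).
Context (lam : U -> {measure set T -> \bar R}).

Definition right_conv (h : T -> R[i]) (xi : L2 mu) : L2 mu :=
  toL2 mu (fun g => cintegral (lam (s g)) (fun g1 => h g1 * xi (mul g g1))).

Definition right_regular (K : set (T -> R[i])) : set (L2 mu -> L2 mu) :=
  vN_gen [set right_conv h | h in K].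

End right_regular.

(* Products of such spaces carry the product sigma-algebra. For Radon measures
   on sigma-compact locally compact Hausdorff spaces every Borel set of the
   topological product agrees up to a null set with a set of the product
   sigma-algebra, so that the L^2 and L^oo spaces are the usual ones. *)
Notation borel X := (g_sigma_algebraType (@open X)).

Section Radon.
Context (R : realType) (X : ptopologicalType).

Definition sigma_compact := exists K : nat -> set X,
  (forall n, compact (K n)) /\ \bigcup_n K n = [set: X].

Definition radon (m : {measure set (borel X) -> \bar R}) :=
  [/\ forall K : set X, compact K -> (m K < +oo)%E,
      forall A : set (borel X), measurable A ->
        m A = ereal_inf [set m U | U in [set U : set X | open U /\ A `<=` U]]
    & forall U : set X, open U ->
        m U = ereal_sup [set m K | K in [set K : set X | compact K /\ K `<=` U]]].

Definition full_support (m : {measure set (borel X) -> \bar R}) :=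
  forall U : set X, open U -> U !=set0 -> (0 < m U)%E.

End Radon.
Arguments sigma_compact : clear implicits.

Section matched_pair.
Context (R : realType) (X1 X2 : ptopologicalType).
Local Notation Y1 := (borel X1).
Local Notation Y2 := (borel X2).
Local Notation X := (Y1 * Y2)%type.
Local Notation G := (X * X)%type.
(* ((x1, y1), x2) stands for (x1, x2, y1, x2) *)
Local Notation G1 := (Y1 * Y1 * Y2)%type.
(* ((x2, y2), x1) stands for (x1, x2, x1, y2) *)
Local Notation G2 := (Y2 * Y2 * Y1)%type.

Implicit Types g h : G.

Definition gr g : X := g.1.
Definition gs g : X := g.2.
(* only meaningful when gs g = gr h *)
Definition gmul g h : G := (g.1, h.2).
Definition ginv g : G := (g.2, g.1).

Definition gp1 g : G := ((g.1.1, g.1.2), (g.2.1, g.1.2)).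
Definition gp2 g : G := ((g.2.1, g.1.2), (g.2.1, g.2.2)).
Definition gm g : X := gs (gp1 g).

Definition emb1 (g : G1) : G := ((g.1.1, g.2), (g.1.2, g.2)).
Definition emb2 (g : G2) : G := ((g.2, g.1.1), (g.2, g.1.2)).
(* left inverses of emb1 and emb2 *)
Definition co1 g : G1 := (g.1.1, g.2.1, g.1.2).
Definition co2 g : G2 := (g.1.2, g.2.2, g.1.1).

Definition r1 (g : G1) : X := gr (emb1 g).
Definition s1 (g : G1) : X := gs (emb1 g).
Definition s2 (g : G2) : X := gs (emb2 g).
Definition mul1 (g h : G1) : G1 := co1 (gmul (emb1 g) (emb1 h)).

Definition pr3 (g : G2) : Y1 := g.2.

Context (nu1 : {sigma_finite_measure set Y1 -> \bar R}).
Context (nu2 : {sigma_finite_measure set Y2 -> \bar R}).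
Local Notation nu := (nu1 \X nu2).
Local Notation mu := (nu \X nu).
Local Notation mu1 := (nu1 \X nu1 \X nu2).
Local Notation mu2 := (nu2 \X nu2 \X nu1).
Local Notation mX1 := (nu1 \X nu1).
Local Notation mH := (nu2 \X nu2 \X (nu1 \X nu1)).

Lemma dis_r_subproof :
  mpres (nu \X nu) mu (fun w => (w.1, w.2)).
Proof.
rewrite (_ : (fun w => _) = id); first exact: mpres_id.
by apply/funext => -[].
Qed.
Definition dis_r : disintegration mu nu gr :=
  Disintegration (fun _ _ => erefl) dis_r_subproof.

Definition dis_s : disintegration mu nu gs :=
  @Disintegration _ _ _ _ _ _ _ gs _ _ nu (fun w => (w.2, w.1))
    (fun _ _ => erefl) (mpres_swap nu nu).

Lemma dis_m_subproof : mpres (nu \X nu) mu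
  (fun w => ((w.2.1, w.1.2), (w.1.1, w.2.2))).
Proof.
have h1 := mpres_interchange nu1 nu2 nu1 nu2.
have h2 := mpres_map (mpres_swap nu1 nu1) (mpres_id (nu2 \X nu2)).
have h3 := mpres_interchange nu1 nu1 nu2 nu2.
exact: mpres_comp h3 (mpres_comp h2 h1).
Qed.
(* z = (y1, x2) and t = (x1, y2) parametrize (x1, x2, y1, y2) *)
Definition dis_m : disintegration mu nu gm :=
  @Disintegration _ _ _ _ _ _ _ gm _ _ nu
    (fun w => ((w.2.1, w.1.2), (w.1.1, w.2.2)))
    (fun z _ => esym (surjective_pairing z)) dis_m_subproof.

Lemma dis_s2_subproof : mpres (nu \X nu2) mu2
  (fun w => ((w.2, w.1.2), w.1.1)).
Proof.
have h1 := mpres_swap nu nu2.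
have h2 := mpres_map (mpres_id nu2) (mpres_swap nu1 nu2).
have h3 := mpres_unassoc nu2 nu2 nu1.
exact: mpres_comp h3 (mpres_comp h2 h1).
Qed.
Definition dis_s2 : disintegration mu2 nu s2 :=
  @Disintegration _ _ _ _ _ _ _ s2 _ _ nu2
    (fun w => ((w.2, w.1.2), w.1.1))
    (fun z _ => esym (surjective_pairing z)) dis_s2_subproof.

Lemma dis_r1_subproof : mpres (nu \X nu1) mu1
  (fun w => ((w.1.1, w.2), w.1.2)).
Proof.
have h1 := mpres_assoc nu1 nu2 nu1.
have h2 := mpres_map (mpres_id nu1) (mpres_swap nu2 nu1).
have h3 := mpres_unassoc nu1 nu1 nu2.
exact: mpres_comp h3 (mpres_comp h2 h1).
Qed.
Definition dis_r1 : disintegration mu1 nu r1 :=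
  @Disintegration _ _ _ _ _ _ _ r1 _ _ nu1
    (fun w => ((w.1.1, w.2), w.1.2))
    (fun z _ => esym (surjective_pairing z)) dis_r1_subproof.

Definition dis_pr3 : disintegration mu2 nu1 pr3 :=
  @Disintegration _ _ _ _ _ _ _ pr3 _ _ (nu2 \X nu2) (fun w => (w.2, w.1))
    (fun _ _ => erefl) (mpres_swap nu1 (nu2 \X nu2)).

Definition dis_rX1 : disintegration mX1 nu1 (@fst Y1 Y1) :=
  @Disintegration _ _ _ _ _ _ _ fst _ _ nu1 (fun w => w)
    (fun _ _ => erefl) (mpres_id _).

(* The point ((x2, y2), (x1, y1)) of X2^2 * X1^2 stands for (x1, x2, y1, y2);
   under theta the representations f |-> f \o gs and f |-> f \o gm of L^oo(X)
   become f |-> f \o ths and f |-> f \o thm on L^2(X2^2 * X1^2). *)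
Definition toG (w : Y2 * Y2 * (Y1 * Y1)) : G :=
  ((w.2.1, w.1.1), (w.2.2, w.1.2)).
Definition ths (w : Y2 * Y2 * (Y1 * Y1)) : X := gs (toG w).
Definition thm (w : Y2 * Y2 * (Y1 * Y1)) : X := gm (toG w).

Lemma dis_ths_subproof : mpres (nu \X nu) mH
  (fun w => ((w.2.2, w.1.2), (w.2.1, w.1.1))).
Proof.
have h1 := mpres_interchange nu1 nu2 nu1 nu2.
have h2 := mpres_map (mpres_swap nu1 nu1) (mpres_swap nu2 nu2).
have h3 := mpres_swap (nu1 \X nu1) (nu2 \X nu2).
exact: mpres_comp h3 (mpres_comp h2 h1).
Qed.
Definition dis_ths : disintegration mH nu ths :=
  @Disintegration _ _ _ _ _ _ _ ths _ _ nu
    (fun w => ((w.2.2, w.1.2), (w.2.1, w.1.1)))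
    (fun z _ => esym (surjective_pairing z)) dis_ths_subproof.

Lemma dis_thm_subproof : mpres (nu \X nu) mH
  (fun w => ((w.1.2, w.2.2), (w.2.1, w.1.1))).
Proof.
have h1 := mpres_interchange nu1 nu2 nu1 nu2.
have h2 := mpres_map (mpres_swap nu1 nu1) (mpres_id (nu2 \X nu2)).
have h3 := mpres_swap (nu1 \X nu1) (nu2 \X nu2).
exact: mpres_comp h3 (mpres_comp h2 h1).
Qed.
Definition dis_thm : disintegration mH nu thm :=
  @Disintegration _ _ _ _ _ _ _ thm _ _ nu
    (fun w => ((w.1.2, w.2.2), (w.2.1, w.1.1)))
    (fun z _ => esym (surjective_pairing z)) dis_thm_subproof.

Definition haar1 (x : X) : {measure set G1 -> \bar R} :=
  (dirac x.1 : {sigma_finite_measure set Y1 -> \bar R}) \X nu1 \X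
  (dirac x.2 : {sigma_finite_measure set Y2 -> \bar R}).

Definition R_G1 : set (L2 mu1 -> L2 mu1) :=
  right_regular s1 mul1 haar1 (@Cc R (X1 * X1 * X2)%type).

(* L^2(G2) _{s2}(x)_{r1} L^2(G1) *)
Local Notation L2_G2G1 := (L2 (fibre_mes dis_s2 dis_r1)).

Definition act (f : G2 -> R[i]) : L2_G2G1 -> L2_G2G1 :=
  mulop (fun w : G2 * G1 => f (co2 (gp2 (gmul (emb2 w.1) (emb1 w.2))))).

Definition crossed_product : set (L2_G2G1 -> L2_G2G1) :=
  vN_gen ([set act f | f in Linf mu2] `|`
          [set rtens_op dis_s2 dis_r1 dis_s2 dis_r1 id x | x in R_G1]).

(* identification of L^2(G2) _{s2}(x)_{r1} L^2(G1) with L^2(G) *)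
Definition ident : L2_G2G1 -> L2 mu :=
  comp_op (fun g : G => (co2 g, (g.1.1, g.2.1, g.2.2))).

Local Notation mu_sm := (fibre_mes dis_s dis_m).
Local Notation mu_mr := (fibre_mes dis_m dis_r).

Definition W_map (w : G * G) : G * G :=
  let k := gmul (ginv (gp2 w.1)) w.2 in (gmul w.1 (gp1 k), k).

Definition W_density : G * G -> R := density_along mu_sm mu_mr W_map.

Definition W (xi : L2 mu_sm) : L2 mu_mr :=
  toL2 mu_mr (fun w => (Num.sqrt (W_density w))%:C * xi (W_map w)).

Definition Gamma (x : L2_G2G1 -> L2_G2G1) : L2 mu_sm -> L2 mu_sm :=
  adj W \o rtens_op dis_m dis_r dis_m dis_r id (Ad ident x) \o W.

(* L^2(X2^2 * X1) _{pr3}(x)_r L^2(X1^2) *)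
Local Notation L2_G2X1 := (L2 (fibre_mes dis_pr3 dis_rX1)).

(* (x2, y2, x1).(x1, y1) = (x2, y2, y1) *)
Definition X1_action (g : G2) (h : Y1 * Y1) : G2 := (g.1, h.2).

Definition act_tilde (f : G2 -> R[i]) : L2_G2X1 -> L2_G2X1 :=
  mulop (fun w : G2 * (Y1 * Y1) => f (X1_action w.1 w.2)).

Definition Sigma : L2_G2G1 -> L2_G2X1 :=
  comp_op (fun w : G2 * (Y1 * Y1) => (w.1, (w.2.1, w.2.2, w.1.1.2))).

Definition Sigma' : L2_G2X1 -> L2 mH :=
  comp_op (fun w : Y2 * Y2 * (Y1 * Y1) => ((w.1, w.2.1), w.2)).

Definition theta : (L2_G2G1 -> L2_G2G1) -> L2 mH -> L2 mH :=
  Ad (Sigma' \o Sigma).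

(* the inverse of theta, as Sigma' \o Sigma is unitary *)
Definition theta_inv : (L2 mH -> L2 mH) -> L2_G2G1 -> L2_G2G1 :=
  Ad (adj (Sigma' \o Sigma)).

(* Sigma' \o Sigma as an operator on L^2(G) *)
Definition Theta : L2 mu -> L2 mH := Sigma' \o Sigma \o adj ident.

(* X2^2 * X1 * X2 * X1^2, with points (x2, y2, x1, z2, y1, z1) *)
Local Notation K := (Y2 * Y2 * Y1 * Y2 * Y1 * Y1)%type.
Local Notation mK := (nu2 \X nu2 \X nu1 \X nu2 \X nu1 \X nu1).
(* X2^3 * X1^3, with points ((x2, y2, z2), (x1, y1, z1)) *)
Local Notation mK' := (nu2 \X nu2 \X nu2 \X (nu1 \X nu1 \X nu1)).

Definition Psi : L2 (fibre_mes dis_ths dis_thm) -> L2 mK :=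
  comp_op (fun k : K => let: (x2, y2, x1, z2, y1, z1) := k in
    (((x2, y2), (x1, y1)), ((y2, z2), (z1, y1)))).

(* theta being spatial, its fibre product with itself is implemented by
   Theta _s(x)_m Theta. *)
Definition theta_star_theta : (L2 mu_sm -> L2 mu_sm) -> L2 mK -> L2 mK :=
  fun y => Ad Psi (Ad (rtens_op dis_s dis_m dis_ths dis_thm Theta Theta) y).

Definition Gamma_X2 (x : L2 (nu2 \X nu2) -> L2 (nu2 \X nu2)) :
    L2 (nu2 \X nu2 \X nu2) -> L2 (nu2 \X nu2 \X nu2) :=
  xget (fun=> 0) [set y | exists f, [/\ Linf (nu2 \X nu2) f, x = mulop f
    & y = mulop (fun w : Y2 * Y2 * Y2 => f (w.1.1, w.2))]].

Definition haar_X1 (x : Y1) : {measure set (Y1 * Y1) -> \bar R} :=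
  (dirac x : {sigma_finite_measure set Y1 -> \bar R}) \X nu1.

Definition R_X1 : set (L2 mX1 -> L2 mX1) :=
  right_regular snd (fun g h : Y1 * Y1 => (g.1, h.2)) haar_X1
    (@Cc R (X1 * X1)%type).

(* 1 (x) T |-> 1 (x) T (x) 1 *)
Definition Gamma_hat_X1 (x : L2 mX1 -> L2 mX1) :
    L2 (nu1 \X nu1 \X nu1) -> L2 (nu1 \X nu1 \X nu1) :=
  xget (fun=> 0) [set y | exists a : L2 nu1 -> L2 nu1,
    [/\ bounded_op a, x = tens_op id a & y = tens_op (tens_op id a) id]].

Definition tau : L2 mK' -> L2 mK :=
  comp_op (fun k : K => let: (x2, y2, x1, z2, y1, z1) := k in
    ((x2, y2, z2), (x1, y1, z1))).

Definition Gamma_tens : (L2 mH -> L2 mH) -> L2 mK' -> L2 mK' :=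
  tens_hom (Linf_ops (nu2 \X nu2)) R_X1 Gamma_X2 Gamma_hat_X1.

End matched_pair.

Arguments crossed_product {R X1 X2} nu1 nu2 _.
Arguments act {R X1 X2} nu1 nu2 f _.
Arguments act_tilde {R X1 X2} nu1 nu2 f _.
Arguments Gamma {R X1 X2} nu1 nu2 x _.
Arguments Sigma {R X1 X2} nu1 nu2 _.
Arguments Sigma' {R X1 X2} nu1 nu2 _.
Arguments theta {R X1 X2} nu1 nu2 _ _.
Arguments theta_inv {R X1 X2} nu1 nu2 _ _.
Arguments theta_star_theta {R X1 X2} nu1 nu2 _ _.
Arguments R_X1 {R X1} nu1 _.
Arguments tau {R X1 X2} nu1 nu2 _.
Arguments Gamma_tens {R X1 X2} nu1 nu2 _ _.

(* Main.v *)
Require Import Defs.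
From HB Require Import structures.
From mathcomp Require Import all_boot all_order all_algebra.
From mathcomp Require Import complex ring lra.
From mathcomp Require Import all_classical all_reals all_analysis measurable_realfun.
Import Order.TTheory GRing.Theory Num.Theory.
Import numFieldNormedType.Exports.
Set Implicit Arguments.
Unset Strict Implicit.
Unset Printing Implicit Defensive.
Local Open Scope classical_set_scope.
Local Open Scope ring_scope.
Local Open Scope complex_scope.

(* Every map of spaces involved is measure preserving and almost everywhere
   invertible, hence implements a unitary by composition.  Up to such permutations
   of coordinates the algebras are amplifications of algebras of decomposable
   operators: L^oo(X2^2) (x) L(L^2(X1)) is the commutant of L^oo(X2^2).

   ii) Inserting a trivial factor X1 turns f into a(f).  Compactly supported
   kernels yield all the rank one operators, so that R(X1 * X1) is the amplified
   L(L^2(X1)), while R(G1) is an amplification of an algebra of operators on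
   L^2(X2 * X1) which commute with L^oo(X2) and contains 1 (x) L(L^2(X1)).

   iii) The Radon-Nikodym derivative D is 1, so that W permutes coordinates.  Both
   sides are then amplifications of the same decomposable operator y, where x is y
   with a trivial factor X1 inserted; the two permutations differ only in the
   factors on which y does not act.  The tensor product of the two coproducts
   exists because amplifications are normal, and it is unique because the corners
   of x cut out by rank one operators are elementary tensors. *)

(** * Complex-valued functions and integrals *)

(** Most operators of the statement ([adj], [tens_op], [rtens_op], [tens_hom], the density) are
    selected by a property, with a junk value as default, so every use rests on an existence and a
    uniqueness proof. Bounded operators are obtained from Riesz representation on formal linear
    combinations; uniqueness comes from agreement on vectors with trivial orthogonal complement.
    Commutants are reached by slicing: the matrix coefficients of an operator in one tensor factor
    turn commutation with an amplification into commutation with the original operator. A unit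
    vector of L^2(X1), provided by full support, recovers an operator from its amplification. The
    relative tensor product 1 (x) x is constructed for x commuting with the functions on the base;
    in fibre coordinates it is an ordinary amplification of x. The commutation holds because each
    base variable is either idle or diagonal for the decomposable operator behind x. *)

Section complex_arithmetic.
Context (R : realType).
Local Notation C := R[i].
Local Notation Re := (@complex.Re R).
Local Notation Im := (@complex.Im R).
Implicit Types z w : C.

(** The l^1 norm of (Re, Im). It is free of square roots and dominates both parts at once, so that
    [cintegrable] yields their integrability directly. *)
Definition cabs z : R := `|Re z| + `|Im z|.

Lemma cabs_ge0 z : 0 <= cabs z.
Proof. by rewrite addr_ge0. Qed.

Lemma complex_ext z w : Re z = Re w -> Im z = Im w -> z = w.
Proof. by case: z w => [a b] [c d] /= -> ->. Qed.

Lemma ReD z w : Re (z + w) = Re z + Re w.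
Proof. by case: z w => [? ?] [? ?]. Qed.

Lemma ReB z w : Re (z - w) = Re z - Re w.
Proof. by case: z w => [? ?] [? ?]. Qed.

Lemma Re_conj z : Re (conjc z) = Re z.
Proof. by case: z. Qed.

Lemma conjcD z w : (conjc (z + w)) = (conjc z) + (conjc w).
Proof. by case: z w => [a b] [c d]; apply: complex_ext => //=; rewrite opprD. Qed.

Lemma conjcN z : (conjc (- z)) = - (conjc z).
Proof. by case: z. Qed.

Lemma conjcM z w : (conjc (z * w)) = (conjc z) * (conjc w).
Proof. by case: z w => [a b] [c d]; apply: complex_ext => /=; ring. Qed.

Lemma cabsM z w : cabs (z * w) <= cabs z * cabs w.
Proof.
case: z w => [a b] [c d]; rewrite /cabs /= mulrDl !mulrDr -!normrM.
have := ler_normB (a * c) (b * d); have := ler_normD (a * d) (b * c).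
by move=> h1 h2; apply: (le_trans (lerD h2 h1)); rewrite addrACA addrA [X in _ <= X]addrAC -!addrA lerD2l; lra.
Qed.

Lemma sqabs_conj z : sqabs (conjc z) = sqabs z.
Proof. by case: z => a b; rewrite /sqabs /= sqrrN. Qed.

Lemma cabs_le_sqabs z : cabs z ^+ 2 <= 2 * sqabs z.
Proof.
rewrite /sqabs /cabs -(real_normK (num_real (Re z))).
rewrite -(real_normK (num_real (Im z))).
have := sqr_ge0 (`|Re z| - `|Im z|); rewrite sqrrB sqrrD; lra.
Qed.

Lemma cabs_mul_le z w : cabs (z * w) <= sqabs z + sqabs w.
Proof.
apply: (le_trans (cabsM z w)).
have := cabs_le_sqabs z; have := cabs_le_sqabs w.
have := sqr_ge0 (cabs z - cabs w); rewrite sqrrB; lra.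
Qed.

Lemma sqabs_eq0 z : (sqabs z == 0) = (z == 0).
Proof.
case: z => a b; rewrite /sqabs /= paddr_eq0 ?sqr_ge0// !sqrf_eq0.
by rewrite eq_complex.
Qed.

Lemma mulcJ z : z * (conjc z) = (sqabs z)%:C.
Proof. by case: z => a b; apply: complex_ext; rewrite /sqabs /=; ring. Qed.

Lemma sqabs_real (r : R) : sqabs r%:C = r ^+ 2.
Proof. by rewrite /sqabs /= expr0n addr0. Qed.

Lemma sqabs0 : sqabs (0 : C) = 0.
Proof. by rewrite /sqabs /= expr0n addr0. Qed.

End complex_arithmetic.

Section complex_measurability.
Context (R : realType) d (T : measurableType d).
Local Notation C := R[i].
Local Notation Re := (@complex.Re R).
Local Notation Im := (@complex.Im R).
Implicit Types f g : T -> C.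

Lemma cmeasurable_cst (c : C) : cmeasurable (fun _ : T => c).
Proof. by split; exact: measurable_cst. Qed.

Lemma cmeasurableD f g : cmeasurable f -> cmeasurable g ->
  cmeasurable (fun x => f x + g x).
Proof.
move=> [fr fi] [gr gi]; split.
  apply: eq_measurable_fun (measurable_funD fr gr) => x _ /=.
  by case: (f x) (g x) => [? ?] [? ?].
apply: eq_measurable_fun (measurable_funD fi gi) => x _ /=.
by case: (f x) (g x) => [? ?] [? ?].
Qed.

Lemma cmeasurableM f g : cmeasurable f -> cmeasurable g ->
  cmeasurable (fun x => f x * g x).
Proof.
move=> [fr fi] [gr gi]; split.
- apply: eq_measurable_fun (measurable_funB
    (measurable_funM fr gr) (measurable_funM fi gi)) => x _ /=.
  by case: (f x) (g x) => [? ?] [? ?].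
- apply: eq_measurable_fun (measurable_funD
    (measurable_funM fr gi) (measurable_funM fi gr)) => x _ /=.
  by case: (f x) (g x) => [? ?] [? ?].
Qed.

Lemma cmeasurableB f g : cmeasurable f -> cmeasurable g ->
  cmeasurable (fun x => f x - g x).
Proof.
move=> mf mg; have := cmeasurableD mf (cmeasurableM (cmeasurable_cst (-1)) mg).
by under eq_fun do rewrite mulN1r.
Qed.

Lemma cmeasurable_conj f : cmeasurable f -> cmeasurable (fun x => (conjc (f x))).
Proof.
move=> [fr fi]; split.
  by apply: eq_measurable_fun fr => x _ /=; case: (f x).
apply: eq_measurable_fun (measurable_funN fi) => x _ /=.
by case: (f x).
Qed.

Lemma cmeasurable_real (f : T -> R) : measurable_fun setT f ->
  cmeasurable (fun x => (f x)%:C).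
Proof. by move=> mf; split => //; exact: measurable_cst. Qed.

Lemma cmeasurable_indic (A : set T) : measurable A ->
  cmeasurable (fun x => (\1_A x : R)%:C).
Proof. by move=> mA; apply: cmeasurable_real; exact: measurable_indic. Qed.

Lemma cmeasurable_cabs f : cmeasurable f -> measurable_fun setT (fun x => cabs (f x)).
Proof.
by move=> [fr fi]; apply: measurable_funD; exact: measurableT_comp.
Qed.

Lemma cmeasurable_comp d' (U : measurableType d') (phi : U -> T) f :
  measurable_fun setT phi -> cmeasurable f -> cmeasurable (f \o phi).
Proof.
move=> mphi [fr fi].
by split; [exact: (measurableT_comp fr mphi)|exact: (measurableT_comp fi mphi)].
Qed.

(** Exceptional sets of almost everywhere identities have this form. Being measurable, they can be
    pulled back along measure preserving maps and their measure computed. *)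
Lemma cmeasurable_neq f g : cmeasurable f -> cmeasurable g ->
  measurable [set x | f x != g x].
Proof.
move=> [fr fi] [gr gi].
rewrite (_ : [set _ | _] = ([set: T] `&` [set x | (Re (f x))%:E != (Re (g x))%:E])
    `|` ([set: T] `&` [set x | (Im (f x))%:E != (Im (g x))%:E])).
  by apply: measurableU; apply: measurable_neqe => //; exact/measurable_EFinP.
apply/seteqP; split=> x /=.
  by rewrite eq_complex negb_and => /orP[]; [left|right].
by rewrite !eqe eq_complex negb_and => -[[_ ->]//|[_ ->]]; rewrite orbT.
Qed.

End complex_measurability.

Section complex_integral.
Context (R : realType) d (T : measurableType d) (mu : {measure set T -> \bar R}).
Local Notation C := R[i].
Local Notation Re := (@complex.Re R).
Local Notation Im := (@complex.Im R).
Implicit Types f g : T -> C.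

Definition cintegrable f :=
  cmeasurable f /\ (\int[mu]_x (cabs (f x))%:E < +oo)%E.

Lemma cintegrable_Re f : cintegrable f -> mu.-integrable setT (EFin \o (Re \o f)).
Proof.
move=> [[fr fi] foo]; apply/integrableP; split; first exact/measurable_EFinP.
apply: le_lt_trans foo; apply: ge0_le_integral => //.
- by apply: measurableT_comp => //; exact/measurable_EFinP.
- by apply/measurable_EFinP; exact: cmeasurable_cabs.
- by move=> x _ /=; rewrite lee_fin lerDl.
Qed.

Lemma cintegrable_Im f : cintegrable f -> mu.-integrable setT (EFin \o (Im \o f)).
Proof.
move=> [[fr fi] foo]; apply/integrableP; split; first exact/measurable_EFinP.
apply: le_lt_trans foo; apply: ge0_le_integral => //.
- by apply: measurableT_comp => //; exact/measurable_EFinP.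
- by apply/measurable_EFinP; exact: cmeasurable_cabs.
- by move=> x _ /=; rewrite lee_fin lerDr.
Qed.

Lemma cintegrable_dom f (g : T -> \bar R) : cmeasurable f ->
  measurable_fun setT g -> (forall x, (cabs (f x))%:E <= g x)%E ->
  (\int[mu]_x g x < +oo)%E -> cintegrable f.
Proof.
move=> mf mg fg goo; split => //; apply: le_lt_trans goo.
apply: ge0_le_integral => //.
- by move=> x _; rewrite lee_fin cabs_ge0.
- by apply/measurable_EFinP; exact: cmeasurable_cabs.
Qed.

Lemma cintegralD f g : cintegrable f -> cintegrable g ->
  cintegral mu (fun x => f x + g x) = cintegral mu f + cintegral mu g.
Proof.
move=> fi gi; rewrite /cintegral; apply: complex_ext => /=.
- rewrite -RintegralD//; [|exact: (cintegrable_Re fi)|exact: (cintegrable_Re gi)].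
  by apply: eq_Rintegral => x _; case: (f x) (g x) => [? ?] [? ?].
- rewrite -RintegralD//; [|exact: (cintegrable_Im fi)|exact: (cintegrable_Im gi)].
  by apply: eq_Rintegral => x _; case: (f x) (g x) => [? ?] [? ?].
Qed.

Lemma cintegralZ (c : C) f : cintegrable f ->
  cintegral mu (fun x => c * f x) = c * cintegral mu f.
Proof.
move=> fi; have fr := cintegrable_Re fi; have fim := cintegrable_Im fi.
have iZ (a : R) (h : T -> R) : mu.-integrable setT (EFin \o h) ->
    mu.-integrable setT (EFin \o (fun x => a * h x)).
  by move=> hi; apply: eq_integrable (integrableZl measurableT a hi).
case: c => a b; rewrite /cintegral; apply: complex_ext => /=.
- rewrite -!RintegralZl// -RintegralB//; do ?exact: iZ.
  by apply: eq_Rintegral => x _; case: (f x).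
- rewrite -!RintegralZl// -RintegralD//; do ?exact: iZ.
  by apply: eq_Rintegral => x _; case: (f x).
Qed.

Lemma RintegralN (h : T -> R) : mu.-integrable setT (EFin \o h) ->
  \int[mu]_x (- h x) = - \int[mu]_x h x.
Proof.
move=> hi; rewrite -mulN1r -RintegralZl//.
by apply: eq_Rintegral => x _; rewrite mulN1r.
Qed.

Lemma cintegral_conj f : cintegrable f ->
  cintegral mu (fun x => (conjc (f x))) = (conjc (cintegral mu f)).
Proof.
move=> fi; rewrite /cintegral; apply: complex_ext => /=.
  by apply: eq_Rintegral => x _; case: (f x).
rewrite -RintegralN; last exact: cintegrable_Im.
by apply: eq_Rintegral => x _; case: (f x).
Qed.

Lemma ae_eq_cintegral f g : cmeasurable f -> cmeasurable g ->
  {ae mu, forall x, f x = g x} -> cintegral mu f = cintegral mu g.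
Proof.
move=> [fr fi] [gr gi] fg; rewrite /cintegral /Rintegral.
congr (fine _ +i* fine _); apply: ae_eq_integral => //; try exact/measurable_EFinP.
- by apply: filterS fg => x -> _.
- by apply: filterS fg => x -> _.
Qed.

Lemma eq_cintegral f g : f =1 g -> cintegral mu f = cintegral mu g.
Proof. by move=> /funext ->. Qed.

Lemma sq_cintegrableM f g : square_integrable mu f -> square_integrable mu g ->
  cintegrable (fun x => f x * g x).
Proof.
move=> [mf foo] [mg goo].
have mcf : measurable_fun setT (fun x => (sqabs (f x))%:E : \bar R).
  by apply/measurable_EFinP; exact: measurable_sqabs.
have mcg : measurable_fun setT (fun x => (sqabs (g x))%:E : \bar R).
  by apply/measurable_EFinP; exact: measurable_sqabs.
apply: (@cintegrable_dom _ (fun x => (sqabs (f x))%:E + (sqabs (g x))%:E)%E).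
- exact: cmeasurableM.
- exact: emeasurable_funD.
- by move=> x; rewrite lee_fin cabs_mul_le.
- rewrite ge0_integralD//; last 2 first.
  + by move=> x _; rewrite lee_fin sqabs_ge0.
  + by move=> x _; rewrite lee_fin sqabs_ge0.
  by rewrite lte_add_pinfty.
Qed.

Lemma square_integrable_conj f : square_integrable mu f ->
  square_integrable mu (fun x => (conjc (f x))).
Proof.
move=> [mf foo]; split; first exact: cmeasurable_conj.
by under eq_integral do rewrite sqabs_conj.
Qed.

Lemma sq_cintegrable f g : square_integrable mu f -> square_integrable mu g ->
  cintegrable (fun x => f x * (conjc (g x))).
Proof.
by move=> hf hg; apply: sq_cintegrableM => //; exact: square_integrable_conj.
Qed.

End complex_integral.

(** * The inner product of L^2 *)

Section L2_values.
Context (R : realType) d (T : measurableType d) (mu : {measure set T -> \bar R}).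
Local Notation C := R[i].
Local Notation H := (L2 mu).
Implicit Types u v w : H.

Lemma L2_meas u : cmeasurable u.
Proof. by have [] := L2_sqint u. Qed.

Lemma L2_DE u v : {ae mu, forall x, (u + v : H) x = u x + v x}.
Proof. exact: L2_addE. Qed.

Lemma L2_ZE (c : C) u : {ae mu, forall x, (c *: u : H) x = c * u x}.
Proof. exact: L2_scaleE. Qed.

Lemma L2_subE u v : {ae mu, forall x, (u - v : H) x = u x - v x}.
Proof.
apply: filterS2 (L2_addE u (- v)) (L2_scaleE (-1) v) => x -> h.
by rewrite [X in _ + X]h mulN1r.
Qed.

Lemma L2_0E : {ae mu, forall x, (0 : H) x = 0}.
Proof. exact: L2_zeroE. Qed.

End L2_values.

(* Unification must not unfold the operations of L2 down to representatives. *)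
Global Opaque L2_fun L2_add L2_scale L2_zero.

Section inner_product.
Context (R : realType) d (T : measurableType d) (mu : {measure set T -> \bar R}).
Local Notation C := R[i].
Local Notation Re := (@complex.Re R).
Local Notation Im := (@complex.Im R).
Local Notation H := (L2 mu).
Implicit Types u v w : H.

Lemma innerE u v : inner u v = cintegral mu (fun x => u x * conjc (v x)).
Proof. by []. Qed.

Lemma inner_cintegrable u v : cintegrable mu (fun x => u x * (conjc (v x))).
Proof. by apply: sq_cintegrable; exact: L2_sqint. Qed.

Lemma inner_ae u v (f g : T -> C) : cmeasurable f -> cmeasurable g ->
  {ae mu, forall x, u x = f x} -> {ae mu, forall x, v x = g x} ->
  inner u v = cintegral mu (fun x => f x * (conjc (g x))).
Proof.
move=> mf mg uf vg; apply: ae_eq_cintegral.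
- by apply: cmeasurableM; [|apply: cmeasurable_conj]; exact: L2_meas.
- by apply: cmeasurableM; [|apply: cmeasurable_conj].
- by apply: filterS2 uf vg => x -> ->.
Qed.

Lemma innerDl u v w : inner (u + v) w = inner u w + inner v w.
Proof.
rewrite (inner_ae (f := fun x => u x + v x) (g := w)); last 4 first.
- by apply: cmeasurableD; exact: L2_meas.
- exact: L2_meas.
- exact: L2_DE.
- exact: nearW.
rewrite -cintegralD; [|exact: inner_cintegrable..].
by apply: eq_cintegral => x; rewrite mulrDl.
Qed.

Lemma innerZl (c : C) u w : inner (c *: u) w = c * inner u w.
Proof.
rewrite (inner_ae (f := fun x => c * u x) (g := w)); last 4 first.
- by apply: cmeasurableM; [exact: cmeasurable_cst|exact: L2_meas].
- exact: L2_meas.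
- exact: L2_ZE.
- exact: nearW.
rewrite -cintegralZ; last exact: inner_cintegrable.
by apply: eq_cintegral => x; rewrite mulrA.
Qed.

Lemma innerC u v : inner v u = (conjc (inner u v)).
Proof.
rewrite !innerE -cintegral_conj; last exact: inner_cintegrable.
by apply: eq_cintegral => x; rewrite conjcM conjcK mulrC.
Qed.

Lemma innerDr u v w : inner w (u + v) = inner w u + inner w v.
Proof. by rewrite innerC innerDl conjcD -!innerC. Qed.

Lemma innerZr (c : C) u w : inner w (c *: u) = (conjc c) * inner w u.
Proof. by rewrite innerC innerZl conjcM -innerC. Qed.

Lemma inner0l w : inner 0 w = 0.
Proof. by rewrite -(scale0r (0 : H)) innerZl mul0r. Qed.

Lemma inner0r w : inner w 0 = 0.
Proof. by rewrite innerC inner0l conjc0. Qed.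

Lemma innerNl u w : inner (- u) w = - inner u w.
Proof. by rewrite -scaleN1r innerZl mulN1r. Qed.

Lemma innerNr u w : inner w (- u) = - inner w u.
Proof. by rewrite innerC innerNl conjcN -innerC. Qed.

Lemma innerBl u v w : inner (u - v) w = inner u w - inner v w.
Proof. by rewrite innerDl innerNl. Qed.

Lemma innerBr u v w : inner w (u - v) = inner w u - inner w v.
Proof. by rewrite innerDr innerNr. Qed.

Lemma inner_suml I (r : seq I) (F : I -> H) w :
  inner (\sum_(i <- r) F i) w = \sum_(i <- r) inner (F i) w.
Proof.
elim: r => [|i r IH]; first by rewrite !big_nil inner0l.
by rewrite !big_cons innerDl IH.
Qed.

(** Squared norm. Estimates on squares stay polynomial, and [bounded_opP] translates boundedness
    into them. *)
Definition nsq u : R := Re (inner u u).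

Lemma sqabs_integral u : (\int[mu]_x (sqabs (u x))%:E = (nsq u)%:E)%E.
Proof.
have [mu' uoo] := L2_sqint u.
rewrite /nsq innerE /cintegral /= /Rintegral fineK.
  by apply: eq_integral => x _; rewrite mulcJ.
rewrite ge0_fin_numE.
  apply: le_lt_trans uoo; rewrite le_eqVlt; apply/orP; left; apply/eqP.
  by apply: eq_integral => x _; rewrite mulcJ.
by apply: integral_ge0 => x _; rewrite mulcJ lee_fin /= sqabs_ge0.
Qed.

Lemma nsq_ge0 u : 0 <= nsq u.
Proof.
rewrite -lee_fin -sqabs_integral.
by apply: integral_ge0 => x _; rewrite lee_fin sqabs_ge0.
Qed.

Lemma inner_self u : inner u u = (nsq u)%:C.
Proof.
suff : Im (inner u u) = 0 by rewrite /nsq; case: (inner u u) => a b /= ->.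
have : Im (inner u u) = Im (conjc (inner u u)) by rewrite -innerC.
by case: (inner u u) => a b /= h; lra.
Qed.

Lemma nsq_eq0 u : nsq u = 0 -> u = 0.
Proof.
move=> h; apply/L2P.
have := sqabs_integral u; rewrite h => h0.
have m : measurable_fun setT (fun x => (sqabs (u x))%:E : \bar R).
  by apply/measurable_EFinP; apply: measurable_sqabs; exact: L2_meas.
have /(ae_eq_integral_abs mu measurableT m) :
    (\int[mu]_x `|(sqabs (u x))%:E| = 0)%E.
  by under eq_integral do rewrite gee0_abs ?lee_fin ?sqabs_ge0//.
move=> h1; apply: filterS2 h1 (L2_0E mu) => x /(_ I)/= [/eqP].
by rewrite sqabs_eq0 => /eqP -> ->.
Qed.

Lemma inner_ext u v : (forall w, inner u w = inner v w) -> u = v.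
Proof.
move=> h; apply/eqP; rewrite -subr_eq0; apply/eqP/nsq_eq0.
by rewrite /nsq innerBl h subrr.
Qed.

Lemma inner_extr u v : (forall w, inner w u = inner w v) -> u = v.
Proof. by move=> h; apply: inner_ext => w; rewrite innerC h -innerC. Qed.

Lemma nsqZ (c : C) u : nsq (c *: u) = sqabs c * nsq u.
Proof.
rewrite /nsq innerZl innerZr mulrA mulcJ inner_self.
by case: c => a b /=; rewrite !mul0r subr0.
Qed.

Lemma nsq0 : nsq 0 = 0.
Proof. by rewrite /nsq inner0l. Qed.

Lemma nsqN u : nsq (- u) = nsq u.
Proof. by rewrite /nsq innerNl innerNr opprK. Qed.

Lemma nsqD u v : nsq (u + v) = nsq u + nsq v + 2 * Re (inner u v).
Proof.
rewrite /nsq innerDl !innerDr (innerC u v) !inner_self.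
by case: (inner u v) => a b /=; ring.
Qed.

Lemma nsqB u v : nsq (u - v) = nsq u + nsq v - 2 * Re (inner u v).
Proof. by rewrite nsqD nsqN innerNr; case: (inner u v) => a b /=; ring. Qed.

Lemma nsq_sym u v : nsq (u - v) = nsq (v - u).
Proof. by rewrite -opprB nsqN. Qed.

Lemma parallelogram u v : nsq (u + v) + nsq (u - v) = 2 * nsq u + 2 * nsq v.
Proof. by rewrite nsqD nsqB; ring. Qed.

Lemma nsqD_le u v : nsq (u + v) <= 2 * nsq u + 2 * nsq v.
Proof. by rewrite -parallelogram lerDl nsq_ge0. Qed.

Lemma cauchy_schwarz u v : sqabs (inner u v) <= nsq u * nsq v.
Proof.
have [/eqP v0|vn0] := boolP (nsq v == 0).
  by rewrite (nsq_eq0 v0) inner0r sqabs0 nsq0 mulr0.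
have vp : 0 < nsq v by rewrite lt_neqAle eq_sym vn0 nsq_ge0.
(* Scaling the component of [u] orthogonal to [v] by |v|^2 avoids a division: the expansion is |v|^2
   times the desired inequality. *)
have := nsq_ge0 ((nsq v)%:C *: u - inner u v *: v).
rewrite nsqB !nsqZ innerZl innerZr sqabs_real.
have -> : Re ((nsq v)%:C * ((conjc (inner u v)) * inner u v)) = nsq v * sqabs (inner u v).
  by rewrite (mulrC (conjc _)) mulcJ /=; ring.
move=> h; have {h} : 0 <= nsq v * (nsq u * nsq v - sqabs (inner u v)).
  by move: h; rewrite expr2; lra.
by rewrite pmulr_rge0// subr_ge0.
Qed.

Lemma normL2_ge0 u : 0 <= normL2 u.
Proof. exact: sqrtr_ge0. Qed.

Lemma sqr_normL2 u : normL2 u ^+ 2 = nsq u.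
Proof. by rewrite sqr_sqrtr// nsq_ge0. Qed.

Lemma Re_le_sqabs (z : C) : Re z ^+ 2 <= sqabs z.
Proof. by rewrite lerDl sqr_ge0. Qed.

Lemma normL2_leP u (M : R) : 0 <= M -> nsq u <= M ^+ 2 -> normL2 u <= M.
Proof.
move=> M0 h; rewrite -(ler_pXn2r (n := 2))// ?nnegrE ?normL2_ge0//.
by rewrite sqr_normL2.
Qed.

End inner_product.

(** * Bounded operators and adjoints *)

Section operators_basic.
Context (R : realType) d (T : measurableType d) (mu : {measure set T -> \bar R}).
Context d' (U : measurableType d') (nu : {measure set U -> \bar R}).

Lemma bounded_opP (a : L2 mu -> L2 nu) : bounded_op a <->
  linear a /\ exists2 M : R, 0 <= M & forall u, nsq (a u) <= M * nsq u.
Proof.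
split=> -[la [M]]; last first.
  move=> M0 h; split => //; exists (Num.sqrt M) => u; apply: normL2_leP.
    by rewrite mulr_ge0 ?sqrtr_ge0 ?normL2_ge0.
  by rewrite exprMn sqr_normL2 sqr_sqrtr.
move=> h; split => //; exists (M ^+ 2); first exact: sqr_ge0.
move=> u; rewrite -sqr_normL2 -(sqr_normL2 u) -exprMn.
rewrite ler_pXn2r ?nnegrE ?normL2_ge0//.
exact: le_trans (normL2_ge0 _) (h u).
Qed.

Lemma linD (a : L2 mu -> L2 nu) u v : linear a -> a (u + v) = a u + a v.
Proof. by move=> la; have := la 1 u v; rewrite !scale1r. Qed.

Lemma lin0 (a : L2 mu -> L2 nu) : linear a -> a 0 = 0.
Proof.
move=> la; have := la 1 0 0; rewrite !scale1r addr0 => /eqP.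
by rewrite -subr_eq0 opprD addNKr oppr_eq0 => /eqP.
Qed.

Lemma linZ (a : L2 mu -> L2 nu) c u : linear a -> a (c *: u) = c *: a u.
Proof. by move=> la; have := la c u 0; rewrite lin0// !addr0. Qed.

Lemma linN (a : L2 mu -> L2 nu) u : linear a -> a (- u) = - a u.
Proof. by move=> la; rewrite -scaleN1r linZ// scaleN1r. Qed.

Lemma linB (a : L2 mu -> L2 nu) u v : linear a -> a (u - v) = a u - a v.
Proof. by move=> la; rewrite linD// linN. Qed.

Lemma lin_sum (a : L2 mu -> L2 nu) I (r : seq I) (F : I -> L2 mu) : linear a ->
  a (\sum_(i <- r) F i) = \sum_(i <- r) a (F i).
Proof.
move=> la; elim: r => [|i r IH]; first by rewrite !big_nil lin0.
by rewrite !big_cons linD// IH.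
Qed.

Lemma adjoint_uniq (a : L2 mu -> L2 nu) b b' :
  is_adjoint a b -> is_adjoint a b' -> b = b'.
Proof.
by move=> h h'; apply/funext => v; apply: inner_extr => u; rewrite -h -h'.
Qed.

Lemma adjE (a : L2 mu -> L2 nu) b : is_adjoint a b -> adj a = b.
Proof.
move=> h; apply: (adjoint_uniq _ h).
by apply: (@xgetPex _ (fun=> 0) [set b | is_adjoint a b]); exists b.
Qed.

Lemma is_adjoint_sym (a : L2 mu -> L2 nu) b : is_adjoint a b -> is_adjoint b a.
Proof. by move=> h u v; rewrite innerC -h -innerC. Qed.

Lemma is_adjoint_linear (a : L2 mu -> L2 nu) b : is_adjoint a b -> linear a.
Proof.
move=> h c u v; apply: inner_ext => w.
by rewrite h innerDl innerZl -!h -innerZl -innerDl.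
Qed.

End operators_basic.

Section operators_composition.
Context (R : realType) d (T : measurableType d) (mu : {measure set T -> \bar R}).
Context d' (U : measurableType d') (nu : {measure set U -> \bar R}).
Context d'' (V : measurableType d'') (xi : {measure set V -> \bar R}).

Lemma is_adjoint_comp (a : L2 mu -> L2 nu) a' (b : L2 nu -> L2 xi) b' :
  is_adjoint a a' -> is_adjoint b b' -> is_adjoint (b \o a) (a' \o b').
Proof. by move=> h h' u v /=; rewrite h' h. Qed.

Lemma bounded_comp (a : L2 mu -> L2 nu) (b : L2 nu -> L2 xi) :
  bounded_op a -> bounded_op b -> bounded_op (b \o a).
Proof.
move=> /bounded_opP[la [M M0 aM]] /bounded_opP[lb [N N0 bN]]; apply/bounded_opP.
split; first by move=> c u v /=; rewrite la lb.
exists (N * M); first exact: mulr_ge0.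
move=> u /=; apply: (le_trans (bN _)).
by rewrite -mulrA ler_wpM2l.
Qed.

Lemma bounded_adjoint (a : L2 mu -> L2 nu) b :
  bounded_op a -> is_adjoint a b -> bounded_op b.
Proof.
move=> /bounded_opP[la [M M0 aM]] h; apply/bounded_opP.
split; first exact: is_adjoint_linear (is_adjoint_sym h).
exists M => // v.
have [/eqP b0|bn0] := boolP (nsq (b v) == 0); first by rewrite b0 mulr_ge0// nsq_ge0.
have bp : 0 < nsq (b v) by rewrite lt_neqAle eq_sym bn0 nsq_ge0.
(* As <a (b v), v> = |b v|^2, the bound of [a] turns this into |b v|^4 <= M |b v|^2 |v|^2, and one
   factor |b v|^2 cancels. *)
have := cauchy_schwarz (a (b v)) v; rewrite h inner_self sqabs_real expr2 => h1.
have h2 : nsq (b v) * nsq (b v) <= nsq (b v) * (M * nsq v).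
  apply: (le_trans h1); rewrite mulrA (mulrC _ M).
  by rewrite ler_wpM2r ?nsq_ge0.
by rewrite ler_pM2l in h2.
Qed.

Lemma bounded_comb (c : R[i]) (a b : L2 mu -> L2 nu) :
  bounded_op a -> bounded_op b -> bounded_op (fun u => c *: a u + b u).
Proof.
move=> /bounded_opP[la [M M0 aM]] /bounded_opP[lb [N N0 bN]]; apply/bounded_opP.
split.
  move=> k u v; rewrite la lb !scalerDr !scalerA (mulrC c k).
  exact: addrACA.
exists (2 * (sqabs c * M) + 2 * N).
  by rewrite addr_ge0// mulr_ge0// mulr_ge0// sqabs_ge0.
move=> u; apply: (le_trans (nsqD_le _ _)); rewrite nsqZ.
have := ler_wpM2l (sqabs_ge0 c) (aM u); have := bN u.
by rewrite mulrA; move=> h1 h2; lra.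
Qed.

End operators_composition.

Lemma bounded_id (R : realType) d (T : measurableType d)
  (mu : {measure set T -> \bar R}) : bounded_op (@id (L2 mu)).
Proof. by apply/bounded_opP; split => //; exists 1 => // u; rewrite mul1r. Qed.

Lemma bounded_op0 (R : realType) d (T : measurableType d)
    (mu : {measure set T -> \bar R}) d' (U : measurableType d')
    (nu : {measure set U -> \bar R}) : bounded_op (fun _ : L2 mu => 0 : L2 nu).
Proof.
apply/bounded_opP; split; first by move=> c u v; rewrite scaler0 addr0.
by exists 0 => // u; rewrite nsq0 mul0r.
Qed.

(** * Completeness and Riesz representation *)

Section completeness.
Context (R : realType) d (T : measurableType d) (mu : {measure set T -> \bar R}).
Local Notation C := R[i].
Local Notation Re := (@complex.Re R).
Local Notation Im := (@complex.Im R).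

Lemma limn_einf_le (v : nat -> \bar R) (c : \bar R) (N : nat) :
  (forall n, (N <= n)%N -> (v n <= c)%E) -> (limn_einf v <= c)%E.
Proof.
move=> h; rewrite limn_einf_lim; apply: lime_le; first exact: is_cvg_einfs.
near=> n; apply: (@le_trans _ _ (v n)).
  by apply: ereal_inf_lbound; exists n => //=.
by apply: h; near: n; exact: nbhs_infty_ge.
Unshelve. all: by end_near. Qed.

Lemma cvg_geometric_dom (s : nat -> R) (K : R) :
  (forall n, `|s n| <= K * (1 / 2) ^+ n) -> cvgn (series s).
Proof.
move=> h; apply: normed_cvg.
apply: (@series_le_cvg _ (fun n => `|s n|) (geometric K (1 / 2))).
- by move=> n.
- by move=> n; apply: le_trans (h n).
- exact: h.
- by apply: is_cvg_geometric_series; rewrite ger0_norm; lra.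
Qed.

Lemma series_diff_cvg (s : nat -> R) (K : R) :
  (forall n, `|s n.+1 - s n| <= K * (1 / 2) ^+ n) -> cvgn s.
Proof.
move=> h; have := cvg_geometric_dom h; rewrite -/(telescope s) => hs.
rewrite (_ : s = (fun n => s 0%N + series (telescope s) n)).
  exact: is_cvgD (@is_cvg_cst _ _ _ _ _) hs.
by apply/funext => n; rewrite seriesEnat /= telescope_sumr// addrCA subrr addr0.
Qed.

(** The rate leaves room for weights: the sum of the 4^n |f (n+1) - f n|^2 still has a finite
    integral, hence is finite almost everywhere, and where it is finite the increments decay like
    2^-n. *)
Lemma fast_cauchy_cvg (f : nat -> L2 mu) :
  (forall n, nsq (f n.+1 - f n) <= (1 / 8) ^+ n) ->
  exists g : T -> C, cmeasurable g /\ {ae mu, forall x,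
    ((fun n => Re (f n x)) @ \oo --> Re (g x)) /\
    ((fun n => Im (f n x)) @ \oo --> Im (g x))}.
Proof.
move=> hf; pose D n : T -> C := fun x => f n.+1 x - f n x.
have DE n : {ae mu, forall x, (f n.+1 - f n : L2 mu) x = D n x} by exact: L2_subE.
have mD n : cmeasurable (D n).
  exact: cmeasurableB (L2_meas _) (L2_meas _).
(* The integral of the n-th term is at most (4/8)^n = 2^-n, whence the total bound 2 below. *)
pose h n x : \bar R := (4 ^+ n * sqabs (D n x))%:E.
have mh n : measurable_fun setT (h n).
  by apply/measurable_EFinP; apply: measurable_funM => //; exact: measurable_sqabs.
have h0 n x : (0 <= h n x)%E by rewrite lee_fin mulr_ge0 ?exprn_ge0 ?sqabs_ge0.
pose H x : \bar R := (\sum_(n <oo) h n x)%E.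
have mH : measurable_fun setT H.
  by exact: ge0_emeasurable_sum.
have Hoo : (\int[mu]_x H x < +oo)%E.
  rewrite integral_nneseries//; apply: (@le_lt_trans _ _ 2%:E); last exact: ltry.
  apply: le_trans (@epsilon_trick0 R 2 xpredT _) => //.
  apply: lee_nneseries => [i _ _|n _].
    by apply: integral_ge0 => x _; exact: h0.
  under eq_integral do rewrite /h EFinM.
  rewrite ge0_integralZl//; last 2 first.
  - by apply/measurable_EFinP; exact: measurable_sqabs.
  - by move=> x _; rewrite lee_fin sqabs_ge0.
  have -> : (\int[mu]_x (sqabs (D n x))%:E = (nsq (f n.+1 - f n))%:E)%E.
    rewrite -sqabs_integral; apply: ge0_ae_eq_integral => //.
    - by apply/measurable_EFinP; exact: measurable_sqabs.
    - by apply/measurable_EFinP; apply: measurable_sqabs; exact: L2_meas.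
    - by move=> x _; rewrite lee_fin sqabs_ge0.
    - by move=> x _; rewrite lee_fin sqabs_ge0.
    - by apply: filterS (DE n) => x ->.
  rewrite -EFinM lee_fin.
  apply: (@le_trans _ _ (4 ^+ n * (1 / 8) ^+ n)).
    by rewrite ler_wpM2l// exprn_ge0.
  rewrite -exprMn (_ : 4 * (1 / 8) = 2^-1 :> R); last by field.
  rewrite exprVn expnS natrM natrX invfM mulrA divff// mul1r.
  exact: lexx.
pose P x := (H x < +oo)%E.
have mP : measurable_fun setT (fun x => P x : bool).
  by apply: measurable_fun_lte => //; exact: measurable_cst.
(* Truncating to 0 where [H] is infinite makes the sequence converge everywhere, so that its limit
   is measurable. *)
pose g_ n x : C := if P x then f n x else 0.
have mg_ n : cmeasurable (g_ n).
  have [fr fi] := L2_meas (f n); split.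
    apply: eq_measurable_fun (measurable_fun_ifT mP fr (measurable_cst _)).
    by move=> x _; rewrite /g_; case: ifP.
  apply: eq_measurable_fun (measurable_fun_ifT mP fi (measurable_cst _)).
  by move=> x _; rewrite /g_; case: ifP.
have key (phi : C -> R) : (forall z w, phi (z - w) = phi z - phi w) -> phi 0 = 0 ->
    (forall z, phi z ^+ 2 <= sqabs z) ->
    forall x, cvgn (fun n => phi (g_ n x)).
  move=> phiB phi0 phile x; have [Px|/negbTE Px] := boolP (P x); last first.
    by under eq_fun do rewrite /g_ Px phi0; exact: is_cvg_cst.
  under eq_fun do rewrite /g_ Px.
  have Hfin : H x \is a fin_num.
    by rewrite ge0_fin_numE//; apply: nneseries_ge0 => n _ _.
  apply: (@series_diff_cvg _ (Num.sqrt (fine (H x)))) => n.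
  rewrite -phiB -[f n.+1 x - f n x]/(D n x).
  rewrite -(ler_pXn2r (n := 2))// ?nnegrE ?normr_ge0//.
  rewrite real_normK ?num_real// exprMn sqr_sqrtr; last first.
    by apply: fine_ge0; apply: nneseries_ge0 => k _ _.
  apply: (le_trans (phile _)).
  have : (h n x <= H x)%E.
    rewrite /H (@nneseriesD1 _ (h^~ x) n xpredT)//.
    by rewrite leeDl//; apply: nneseries_ge0 => k _ _.
  rewrite -(fineK Hfin) lee_fin => hH.
  have -> : ((1 / 2) ^+ n) ^+ 2 = (4 ^+ n)^-1 :> R.
    by rewrite -exprM mulnC exprM -exprVn; congr (_ ^+ n); field.
  by rewrite ler_pdivlMr ?exprn_gt0// mulrC.
have cre : forall x, cvgn (fun n => Re (g_ n x)).
  apply: key => //; last exact: Re_le_sqabs.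
  by move=> [? ?] [? ?].
have cim : forall x, cvgn (fun n => Im (g_ n x)).
  apply: key => //; last by move=> z; rewrite /sqabs lerDr sqr_ge0.
  by move=> [? ?] [? ?].
exists (fun x => limn (fun n => Re (g_ n x)) +i* limn (fun n => Im (g_ n x))).
split.
  split; apply: (@measurable_fun_cvg _ _ _ setT) => [n|x _].
  - exact: (mg_ n).1.
  - exact: cre.
  - exact: (mg_ n).2.
  - exact: cim.
have iH : mu.-integrable setT H.
  apply/integrableP; split => //; apply: le_lt_trans Hoo.
  rewrite le_eqVlt; apply/orP; left; apply/eqP; apply: eq_integral => x _.
  by rewrite gee0_abs//; apply: nneseries_ge0 => k _ _.
apply: filterS (integrable_ae measurableT iH) => x /(_ I) Hx.
have Px : P x by rewrite /P ltey_eq Hx.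
have E n : g_ n x = f n x by rewrite /g_ Px.
split.
- by under eq_fun do rewrite -E; exact: cre.
- by under eq_fun do rewrite -E; exact: cim.
Qed.

Definition L2_cauchy (u : nat -> L2 mu) := forall e : R, 0 < e ->
  exists N, forall m n, (N <= m)%N -> (N <= n)%N -> nsq (u m - u n) < e.

Lemma cvg_sqabsB (z : nat -> C) (l w : C) :
  (fun n => Re (z n)) @ \oo --> Re l -> (fun n => Im (z n)) @ \oo --> Im l ->
  (fun n => (sqabs (z n - w))%:E : \bar R) @ \oo --> (sqabs (l - w))%:E.
Proof.
move=> hr hi; apply: cvg_EFin; first by near=> n.
rewrite /sqabs (_ : fine \o _ = (fun n => (Re (z n) - Re w) * (Re (z n) - Re w)
    + (Im (z n) - Im w) * (Im (z n) - Im w))); last first.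
  by apply/funext => n /=; rewrite !expr2; case: (z n) w => [? ?] [? ?].
rewrite (_ : _ + _ = (Re l - Re w) * (Re l - Re w) + (Im l - Im w) * (Im l - Im w)).
  by apply: cvgD; apply: cvgM; apply: cvgB => //; exact: cvg_cst.
by rewrite !expr2; case: (l) w => [? ?] [? ?].
Unshelve. all: by end_near. Qed.

(** Riesz-Fischer: a fast subsequence converges almost everywhere, and Fatou's lemma bounds the
    distance from its limit to the members of the original sequence. *)
Lemma L2_complete (u : nat -> L2 mu) : L2_cauchy u ->
  exists w, forall e : R, 0 < e -> exists N, forall n, (N <= n)%N -> nsq (u n - w) <= e.
Proof.
move=> hu.
have [phi hphi] : {phi : nat -> nat & forall n m, (phi n <= m)%N ->
    nsq (u m - u (phi n)) <= (1 / 8) ^+ n /\ (forall k, (phi n <= k)%N -> nsq (u m - u k) <= (1 / 8) ^+ n)}.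
  have h n : {N : nat | forall m k, (N <= m)%N -> (N <= k)%N -> nsq (u m - u k) < (1 / 8) ^+ n}.
    by apply: cid; apply: hu; rewrite exprn_gt0.
  exists (fun n => projT1 (h n)) => n m; case: (h n) => N /= hN Nm.
  by split=> [|k Nk]; apply/ltW/hN.
(* Summing the indices makes the subsequence monotone while it stays beyond [phi]. *)
pose psi n := (\sum_(i < n.+1) phi i)%N.
have phile n : (phi n <= psi n)%N by rewrite /psi big_ord_recr /= leq_addl.
have psile n : (psi n <= psi n.+1)%N.
  by rewrite /psi [X in (_ <= X)%N]big_ord_recr /= leq_addr.
have psi_homo : {homo psi : m n / (m <= n)%N} by exact: homo_leq leqnn leq_trans psile.
have [|g [mg hg]] := @fast_cauchy_cvg (fun n => u (psi n)).
  move=> n; apply: (hphi n (psi n.+1) _).2; last exact: phile.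
  exact: leq_trans (phile n) (psile n).
have bound n m : (phi n <= m)%N ->
    (\int[mu]_x (sqabs (g x - u m x))%:E <= ((1 / 8) ^+ n)%:E)%E.
  move=> nm.
  pose F k x : \bar R := (sqabs (u (psi k) x - u m x))%:E.
  have mF k : measurable_fun setT (F k).
    apply/measurable_EFinP/measurable_sqabs/(cmeasurableB (L2_meas _) (L2_meas _)).
  apply: (@le_trans _ _ (\int[mu]_x limn_einf (F^~ x))%E).
    rewrite le_eqVlt; apply/orP; left; apply/eqP; apply: ge0_ae_eq_integral => //.
    - by apply/measurable_EFinP/measurable_sqabs/(cmeasurableB mg (L2_meas _)).
    - apply: (@emeasurable_fun_cvg _ _ _ _ (fun k x => einfs (F^~ x) k)) => [k|x _].
        exact: measurable_fun_einfs.
      by rewrite limn_einf_lim; exact: is_cvg_einfs.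
    - by move=> x _; rewrite lee_fin sqabs_ge0.
    - move=> x _; rewrite limn_einf_lim; apply: lime_ge; first exact: is_cvg_einfs.
      near=> k; apply: le_ereal_inf_tmp => _ [j _ <-]; rewrite lee_fin; exact: sqabs_ge0.
    - apply: filterS hg => x [h1 h2] _.
      by have [<-] := cvg_limn_einf_sup (cvg_sqabsB (w := u m x) h1 h2).
  apply: (le_trans (fatou mu measurableT mF _)).
    by move=> k x _; rewrite lee_fin sqabs_ge0.
  apply: (@limn_einf_le _ _ n) => k nk.
  rewrite (_ : (\int[mu]_x _)%E = (nsq (u (psi k) - u m))%:E); last first.
    rewrite -sqabs_integral; apply: ge0_ae_eq_integral => //.
    - by apply/measurable_EFinP/measurable_sqabs/L2_meas.
    - by move=> x _; rewrite lee_fin sqabs_ge0.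
    - by move=> x _; rewrite lee_fin sqabs_ge0.
    - by apply: filterS (L2_subE (u (psi k)) (u m)) => x ->.
  rewrite lee_fin; apply: (hphi n (psi k) _).2 => //.
  by apply: leq_trans (phile n) _; exact: psi_homo.
have sg : square_integrable mu g.
  have h0 : square_integrable mu (fun x => g x - u (phi 0%N) x).
    split; first exact: cmeasurableB mg (L2_meas _).
    by apply: le_lt_trans (bound 0%N (phi 0%N) (leqnn _)) _; exact: ltry.
  have := square_integrableD h0 (L2_sqint (u (phi 0%N))).
  by under eq_fun do rewrite subrK.
exists (toL2 mu g) => e e0.
have [n ne] : exists n, (1 / 8) ^+ n <= e.
  have h8 : `|1 / 8 : R| < 1 by rewrite ger0_norm; lra.
  have /cvgrPdist_le/(_ e e0) [n _ /(_ n (leqnn _))] := cvg_expr h8.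
  rewrite sub0r normrN ger0_norm; last by rewrite exprn_ge0//; lra.
  by exists n.
exists (phi n) => m nm; rewrite -lee_fin; apply: le_trans (_ : ((1/8) ^+ n)%:E <= _)%E.
  rewrite nsq_sym -sqabs_integral; apply: le_trans (bound n m nm).
  rewrite le_eqVlt; apply/orP; left; apply/eqP; apply: ge0_ae_eq_integral => //.
  - by apply/measurable_EFinP/measurable_sqabs/L2_meas.
  - by apply/measurable_EFinP/measurable_sqabs/(cmeasurableB mg (L2_meas _)).
  - by move=> x _; rewrite lee_fin sqabs_ge0.
  - by move=> x _; rewrite lee_fin sqabs_ge0.
  - by apply: filterS2 (L2_subE (toL2 mu g) (u m)) (toL2E sg) => x -> ->.
by rewrite lee_fin.
Unshelve. all: by end_near. Qed.

End completeness.

Section riesz.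
Context (R : realType) d (T : measurableType d) (mu : {measure set T -> \bar R}).
Local Notation C := R[i].
Local Notation Re := (@complex.Re R).
Local Notation H := (L2 mu).

Definition L2_cvg (u : nat -> H) (w : H) := (fun n => nsq (u n - w)) @ \oo --> (0 : R).

Lemma L2_cvg_Re_inner (u : nat -> H) w x : L2_cvg u w ->
  (fun n => Re (inner x (u n))) @ \oo --> Re (inner x w).
Proof.
move=> uw; apply/cvgrPdist_le => e e0.
have K0 : 0 < nsq x + 1 by rewrite ltr_wpDl ?nsq_ge0.
have e20 : 0 < e ^+ 2 / (nsq x + 1) by rewrite divr_gt0// exprn_gt0.
move/cvgrPdist_le : uw => /(_ _ e20); apply: filterS => n /=.
rewrite sub0r normrN ger0_norm ?nsq_ge0// ler_pdivlMr// => h.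
rewrite -(ler_pXn2r (n := 2))// ?nnegrE ?normr_ge0 ?(ltW e0)//.
rewrite real_normK ?num_real//; apply: (le_trans _ h).
apply: (@le_trans _ _ (sqabs (inner x (u n - w)))).
  rewrite innerBr; apply: le_trans (Re_le_sqabs _).
  by rewrite ReB -sqrrN opprB.
apply: (le_trans (cauchy_schwarz _ _)); rewrite mulrC ler_wpM2l ?nsq_ge0//.
by rewrite lerDl.
Qed.

Lemma L2_cvg_nsq (u : nat -> H) w : L2_cvg u w -> (fun n => nsq (u n)) @ \oo --> nsq w.
Proof.
move=> uw; rewrite (_ : (fun n => _) =
    (fun n => nsq (u n - w) - nsq w + 2 * Re (inner w (u n)))); last first.
  by apply/funext => n; rewrite nsqB (innerC (u n) w) Re_conj; ring.
rewrite [X in _ --> X](_ : _ = 0 - nsq w + 2 * Re (inner w w)); last first.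
  by rewrite -/(nsq w); ring.
apply: cvgD; first by apply: cvgB => //; exact: cvg_cst.
by apply: cvgMl_tmp; exact: L2_cvg_Re_inner.
Qed.

(** A nonnegative quadratic without constant term has no linear part: at t = - conj z / (K + 1) its
    value is already negative unless z = 0. *)
Lemma complex_eq0_small (z : C) (K : R) : 0 <= K ->
  (forall t : C, 0 <= 2 * Re (t * z) + sqabs t * K) -> z = 0.
Proof.
move=> K0 h; apply/eqP; rewrite -sqabs_eq0; apply/eqP.
have s0 := sqabs_ge0 z; have {h} := h (- ((K + 1)^-1)%:C * conjc z).
rewrite -mulrA (mulrC (conjc z)) mulcJ sqabsM sqabs_conj.
have -> : Re (- ((K + 1)^-1)%:C * (sqabs z)%:C) = - (K + 1)^-1 * sqabs z.
  by rewrite /=; ring.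
have -> : sqabs (- ((K + 1)^-1)%:C : C) = (K + 1)^-1 ^+ 2.
  by rewrite /sqabs /=; ring.
have k1 : 0 < K + 1 by lra.
have -> : 2 * (- (K + 1)^-1 * sqabs z) + (K + 1)^-1 ^+ 2 * sqabs z * K =
  - (sqabs z * ((K + 2) / (K + 1) ^+ 2)) by field; rewrite gt_eqF.
rewrite oppr_ge0 pmulr_lle0; last by rewrite divr_gt0 ?exprn_gt0//; lra.
by move=> h; apply/le_anti/andP.
Qed.

Section formal.
Context (V : Type) (v0 : V) (addV : V -> V -> V) (scaleV : C -> V -> V).
Context (e : V -> H) (F : V -> C) (K : R).
Hypotheses (K0 : 0 <= K) (eD : forall v w, e (addV v w) = e v + e w)
  (FD : forall v w, F (addV v w) = F v + F w)
  (eZ : forall c v, e (scaleV c v) = c *: e v)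
  (FZ : forall c v, F (scaleV c v) = c * F v)
  (FK : forall v, sqabs (F v) <= K * nsq (e v)).

(** If F is represented by w, this is |e v - w|^2 - |w|^2, so minimizing it approximates the
    representing vector. *)
Let J v := nsq (e v) - 2 * Re (F v).

Let J_lb v : - K <= J v.
Proof.
rewrite /J; suff : 2 * Re (F v) <= K + nsq (e v) by lra.
have k1 : 0 <= K + nsq (e v) by rewrite addr_ge0 ?nsq_ge0.
have [/ltW h|h] := ltP (2 * Re (F v)) 0; first exact: le_trans h k1.
rewrite -(ler_pXn2r (n := 2))// ?nnegrE//.
rewrite exprMn; have := le_trans (Re_le_sqabs _) (FK v).
have := sqr_ge0 (K - nsq (e v)); rewrite sqrrB sqrrD; lra.
Qed.

Let m := inf (range J).

Let J_ge v : m <= J v.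
Proof.
apply: ge_inf; last by exists v.
by exists (- K) => _ [w _ <-].
Qed.

Let J_app (r : R) : 0 < r -> exists v, J v < m + r.
Proof.
move=> r0; have [|_ [v _ <-] h] := @inf_adherent _ (range J) r r0.
  by split; [exists (J v0), v0|exists (- K) => _ [w _ <-]].
by exists v.
Qed.

(** Parallelogram law, with [m] as a lower bound at the midpoint of [v] and [w]. Minimizing
    sequences are therefore Cauchy. *)
Let J_par v w : nsq (e v - e w) <= 2 * (J v + J w - 2 * m).
Proof.
have := J_ge (scaleV (1 / 2)%:C (addV v w)).
rewrite /J eZ eD FZ FD nsqZ sqabs_real.
have := parallelogram (e v) (e w).
have -> : Re ((1 / 2)%:C * (F v + F w)) = 1 / 2 * (Re (F v) + Re (F w)).
  by case: (F v) (F w) => [? ?] [? ?] /=; ring.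
move: (nsq (e v + e w)) (nsq (e v - e w)) (nsq (e v)) (nsq (e w)) (Re (F v)) (Re (F w)).
by move=> a b c g h k; rewrite expr2; lra.
Qed.

(** [V] is a set of formal expressions with operations but without axioms. The result thus serves
    for functionals on the whole space and also for functionals on formal linear combinations, where
    well-definedness comes out together with the representing vector. *)
Lemma riesz_formal : exists2 w, nsq w <= K & forall v, F v = inner (e v) w.
Proof.
have app n : {v | J v < m + (n.+1%:R)^-1} by apply: cid; exact: J_app.
pose vn n := projT1 (app n).
have Jn n : J (vn n) < m + (n.+1%:R)^-1 by rewrite /vn; case: (app n).
have hc : L2_cauchy (fun n => e (vn n)).
  move=> r r0; have r4 : 0 < r / 4 by lra.
  have /(cvgrPdist_lt)/(_ _ r4) [N _ hN] := @cvg_harmonic R.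
  exists N => p q Np Nq; apply: le_lt_trans (J_par _ _) _.
  have hk k : (N <= k)%N -> (k.+1%:R)^-1 < r / 4.
    by move/hN; rewrite /= sub0r normrN ger0_norm// invr_ge0.
  have := hk p Np; have := hk q Nq; have := Jn p; have := Jn q.
  by move: (J _) (J _) (_^-1) (_^-1) => a b c g; lra.
have [w hw] := L2_complete hc.
have cw : L2_cvg (fun n => e (vn n)) w.
  apply/cvgrPdist_le => r /hw[N hN]; exists N => // n Nn.
  by rewrite /= sub0r normrN ger0_norm ?nsq_ge0//; exact: hN.
have Fw v : F v = inner (e v) w.
  apply/eqP; rewrite eq_sym -subr_eq0; apply/eqP.
  apply: (@complex_eq0_small _ (nsq (e v)) (nsq_ge0 _)) => t.
  (* The value of [J] at [vn n] perturbed by [t] times [v] is at least [m], whereas [J (vn n)] is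
     below m + 1/(n+1). The difference is this quadratic in [t]. *)
  have h1 n : 0 <= 2 * Re (inner (t *: e v) (e (vn n))) - 2 * Re (t * F v)
      + sqabs t * nsq (e v) + (n.+1%:R)^-1.
    have := J_ge (addV (vn n) (scaleV t v)); have := Jn n.
    rewrite /J eD eZ FD FZ nsqD nsqZ (innerC (t *: e v) (e (vn n))).
    rewrite Re_conj ReD; move: (sqabs t * _) (_^-1) (Re _) (nsq _) => a b c g.
    by move: (Re _) (Re _) => h k; lra.
  have -> : 2 * Re (t * (inner (e v) w - F v)) =
      2 * Re (inner (t *: e v) w) - 2 * Re (t * F v).
    by rewrite innerZl mulrBr ReB; ring.
  have L : (fun n => 2 * Re (inner (t *: e v) (e (vn n))) - 2 * Re (t * F v)
      + sqabs t * nsq (e v) + (n.+1%:R)^-1) @ \oo -->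
      2 * Re (inner (t *: e v) w) - 2 * Re (t * F v) + sqabs t * nsq (e v) + 0.
    apply: cvgD; last exact: cvg_harmonic.
    apply: cvgD; last exact: cvg_cst.
    apply: cvgB; last exact: cvg_cst.
    by apply: cvgMl_tmp; exact: L2_cvg_Re_inner.
  have := cvgr_to_ge L (nearW _ h1).
  by rewrite addr0; apply.
exists w => //.
(* In the limit this becomes |w|^4 <= K |w|^2. *)
have h n : Re (inner w (e (vn n))) ^+ 2 <= K * nsq (e (vn n)).
  apply: le_trans (FK _); rewrite Fw (innerC w) sqabs_conj.
  exact: Re_le_sqabs.
have : nsq w ^+ 2 <= K * nsq w.
  have L1 : (fun n => Re (inner w (e (vn n))) ^+ 2) @ \oo --> nsq w ^+ 2.
    rewrite expr2; under eq_fun do rewrite expr2.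
    by apply: cvgM; exact: L2_cvg_Re_inner.
  have L2 : (fun n => K * nsq (e (vn n))) @ \oo --> K * nsq w.
    by apply: cvgMl_tmp; exact: L2_cvg_nsq.
  by have := ler_cvg_to L1 L2 (nearW _ h); apply.
have [-> _|w0] := eqVneq (nsq w) 0; first exact: K0.
by rewrite expr2 ler_pM2r// lt_neqAle eq_sym w0 nsq_ge0.
Qed.

End formal.

Definition total_in (E : set H) := forall w, (forall x, E x -> inner x w = 0) -> w = 0.

End riesz.

Section adjoints.
Context (R : realType) d (T : measurableType d) (mu : {measure set T -> \bar R}).
Context d' (U : measurableType d') (nu : {measure set U -> \bar R}).

Lemma adjP (a : L2 mu -> L2 nu) : bounded_op a -> is_adjoint a (adj a).
Proof.
move=> /bounded_opP[la [M M0 aM]].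
suff [b hb] : exists b, is_adjoint a b by rewrite (adjE hb).
suff /choice[b hb] : forall v, exists w, forall u, inner (a u) v = inner u w.
  by exists b => u v; exact: hb.
move=> v.
have [||||||w _ hw] := @riesz_formal _ _ _ mu (L2 mu) 0 +%R *:%R id
  (fun u => inner (a u) v) (M * nsq v).
- by rewrite mulr_ge0// nsq_ge0.
- by [].
- by move=> u w; rewrite linD// innerDl.
- by [].
- by move=> c u; rewrite linZ// innerZl.
- move=> u; apply: (le_trans (cauchy_schwarz _ _)).
  by rewrite -mulrA (mulrC (nsq v)) mulrA ler_wpM2r// nsq_ge0.
- by exists w.
Qed.

Lemma bounded_adj (a : L2 mu -> L2 nu) : bounded_op a -> bounded_op (adj a).
Proof. by move=> ba; exact: bounded_adjoint ba (adjP ba). Qed.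

(** Passing to adjoints turns agreement on [E] into orthogonality to [E], so that no approximation
    by linear combinations is involved. *)
Lemma bounded_eq_total (a b : L2 mu -> L2 nu) (E : set (L2 mu)) :
  bounded_op a -> bounded_op b -> total_in E -> (forall x, E x -> a x = b x) -> a = b.
Proof.
move=> ba bb tE ab; have ha := adjP ba; have hb := adjP bb.
have E1 v : adj a v = adj b v.
  apply/eqP; rewrite -subr_eq0; apply/eqP/tE => x Ex.
  by rewrite innerBr -ha -hb ab// subrr.
apply: (@adjoint_uniq _ _ _ _ _ _ _ (adj a)).
  exact: is_adjoint_sym.
by rewrite (funext E1); exact: is_adjoint_sym.
Qed.

End adjoints.

Section extension.
Context (R : realType) d (T : measurableType d) (mu : {measure set T -> \bar R}).
Context d' (U : measurableType d') (nu : {measure set U -> \bar R}).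

(** The adjoint is built first: its value at [v] represents the functional <fv s, v> of the formal
    combination [s], and totality of the [e i] makes it linear. The extension is the adjoint of that
    operator. *)
Lemma bounded_extension (I : Type) (e : I -> L2 mu) (f : I -> L2 nu) (M : R) :
  0 <= M -> total_in (range e) ->
  (forall s : seq (R[i] * I), nsq (\sum_(p <- s) p.1 *: f p.2) <=
    M * nsq (\sum_(p <- s) p.1 *: e p.2)) ->
  exists2 c : L2 mu -> L2 nu, bounded_op c & forall i, c (e i) = f i.
Proof.
move=> M0 te hM.
pose V := seq (R[i] * I).
pose ev (s : V) := \sum_(p <- s) p.1 *: e p.2.
pose fv (s : V) := \sum_(p <- s) p.1 *: f p.2.
pose sc (c : R[i]) (s : V) : V := [seq (c * p.1, p.2) | p <- s].
have evZ c s : ev (sc c s) = c *: ev s.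
  by rewrite /ev big_map scaler_sumr; apply: eq_bigr => p _; rewrite scalerA.
have fvZ c s : fv (sc c s) = c *: fv s.
  by rewrite /fv big_map scaler_sumr; apply: eq_bigr => p _; rewrite scalerA.
have ex v : exists w, nsq w <= M * nsq v /\ forall s, inner (fv s) v = inner (ev s) w.
  have [||||||w hw1 hw2] := @riesz_formal _ _ _ mu V [::] (@cat _) sc ev
    (fun s => inner (fv s) v) (M * nsq v).
  - by rewrite mulr_ge0// nsq_ge0.
  - by move=> s t; rewrite /ev big_cat.
  - by move=> s t; rewrite /fv big_cat innerDl.
  - exact: evZ.
  - by move=> c s; rewrite fvZ innerZl.
  - move=> s; apply: (le_trans (cauchy_schwarz _ _)).
    by rewrite -mulrA (mulrC (nsq v)) mulrA ler_wpM2r// ?nsq_ge0//; exact: hM.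
  - by exists w.
have [b hb] := choice ex.
have eb i v : inner (e i) (b v) = inner (f i) v.
  have := (hb v).2 [:: (1, i)]; rewrite /fv /ev !big_seq1 /= !scale1r.
  by move=> ->.
have bb : bounded_op b.
  apply/bounded_opP; split; last by exists M => // v; exact: (hb v).1.
  move=> c u v; apply/eqP; rewrite -subr_eq0; apply/eqP/te => _ [i _ <-].
  by rewrite innerBr innerDr innerZr !eb innerDr innerZr subrr.
exists (adj b); first exact: bounded_adj.
by move=> i; apply: inner_extr => v; rewrite -(adjP bb) [LHS]innerC eb -innerC.
Qed.

End extension.

(** * Operators induced by point maps *)

Section measure_transfer.
Context (R : realType) d (T : measurableType d) (mu : {measure set T -> \bar R}).
Context d' (U : measurableType d') (nu : {measure set U -> \bar R}).
Variables (c : U -> T) (hc : mpres nu mu c).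

Lemma ge0_integral_mpres (g : T -> \bar R) : measurable_fun setT g ->
  (forall x, (0 <= g x)%E) -> (\int[mu]_x g x = \int[nu]_y g (c y))%E.
Proof.
move=> mg g0; rewrite (eq_measure_integral (image_mes nu hc.1)); last first.
  by move=> A mA _; exact: hc.2.
by rewrite ge0_integral_pushforward//; exact: hc.1.
Qed.

Lemma ae_mpres (P : T -> Prop) : {ae mu, forall x, P x} -> {ae nu, forall y, P (c y)}.
Proof.
move=> [N [mN N0 PN]]; exists (c @^-1` N); split.
- by rewrite -[_ @^-1` _]setTI; exact: hc.1.
- by rewrite -hc.2.
- by move=> y /= Py; apply: PN.
Qed.

Lemma cintegral_mpres (f : T -> R[i]) : cintegrable mu f ->
  cintegral mu f = cintegral nu (f \o c).
Proof.
move=> fi; have [mr mi] := fi.1.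
have key (h : T -> R) : mu.-integrable setT (EFin \o h) ->
    \int[mu]_x h x = \int[nu]_y h (c y).
  move=> hi; rewrite /Rintegral; congr fine.
  rewrite (eq_measure_integral (image_mes nu hc.1)); last first.
    by move=> A mA _; exact: hc.2.
  have mh := measurable_int _ hi.
  rewrite integral_pushforward//; first exact: hc.1.
  apply/integrableP; split; first by rewrite preimage_setT; exact: measurableT_comp mh hc.1.
  rewrite preimage_setT; move/integrableP : hi => [_]; apply: le_lt_trans.
  rewrite (ge0_integral_mpres (g := fun x => `|(h x)%:E|%E))//.
  exact: measurableT_comp.
rewrite /cintegral; congr (_ +i* _); apply: key.
  exact: cintegrable_Re.
exact: cintegrable_Im.
Qed.

Lemma square_integrable_mpres (f : T -> R[i]) :
  square_integrable mu f -> square_integrable nu (f \o c).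
Proof.
move=> [mf foo]; split; first exact: cmeasurable_comp hc.1 mf.
rewrite (ge0_integral_mpres (g := fun x => (sqabs (f x))%:E)) in foo => //.
- by apply/measurable_EFinP; exact: measurable_sqabs.
- by move=> x; rewrite lee_fin sqabs_ge0.
Qed.

End measure_transfer.

Section L2_representatives.
Context (R : realType) d (T : measurableType d) (mu : {measure set T -> \bar R}).
Implicit Types f g : T -> R[i].

Lemma toL2_ae f g : square_integrable mu f -> square_integrable mu g ->
  {ae mu, forall x, f x = g x} -> toL2 mu f = toL2 mu g.
Proof.
move=> sf sg fg; apply/L2P.
by apply: filterS3 (toL2E sf) (toL2E sg) fg => x -> -> ->.
Qed.

Lemma toL2K (u : L2 mu) : toL2 mu u = u.
Proof. by apply/L2P; apply: toL2E; exact: L2_sqint. Qed.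

Lemma eq_toL2 f (u : L2 mu) : square_integrable mu f ->
  {ae mu, forall x, f x = u x} -> toL2 mu f = u.
Proof. by move=> sf fu; rewrite -(toL2K u); apply: toL2_ae => //; exact: L2_sqint. Qed.

Lemma square_integrable_ae f g : cmeasurable g -> square_integrable mu f ->
  {ae mu, forall x, f x = g x} -> square_integrable mu g.
Proof.
move=> mg [mf foo] fg; split => //; apply: le_lt_trans foo.
rewrite le_eqVlt; apply/orP; left; apply/eqP; apply: ge0_ae_eq_integral => //.
- by apply/measurable_EFinP; exact: measurable_sqabs.
- by apply/measurable_EFinP; exact: measurable_sqabs.
- by move=> x _; rewrite lee_fin sqabs_ge0.
- by move=> x _; rewrite lee_fin sqabs_ge0.
- by apply: filterS fg => x -> _.
Qed.

Lemma Linf_bound f : Linf mu f ->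
  exists2 M : R, 0 <= M & {ae mu, forall x, sqabs (f x) <= M}.
Proof.
move=> [mf [M hM]]; exists (Num.max M 0); first by rewrite le_max lexx orbT.
by apply: filterS hM => x; rewrite le_max => ->.
Qed.

Lemma Linf_sqint f (u : T -> R[i]) : Linf mu f -> square_integrable mu u ->
  square_integrable mu (fun x => f x * u x) /\
  forall M : R, 0 <= M -> {ae mu, forall x, sqabs (f x) <= M} ->
  (\int[mu]_x (sqabs (f x * u x))%:E <= M%:E * \int[mu]_x (sqabs (u x))%:E)%E.
Proof.
move=> lf [mu_ uoo].
have mfu : cmeasurable (fun x => f x * u x) by apply: cmeasurableM => //; exact: lf.1.
have le (M : R) : 0 <= M -> {ae mu, forall x, sqabs (f x) <= M} ->
    (\int[mu]_x (sqabs (f x * u x))%:E <= M%:E * \int[mu]_x (sqabs (u x))%:E)%E.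
  move=> M0 hM; rewrite -ge0_integralZl//; last 2 first.
  - by apply/measurable_EFinP; exact: measurable_sqabs.
  - by move=> x _; rewrite lee_fin sqabs_ge0.
  apply: ae_ge0_le_integral => //.
  - by move=> x _; rewrite lee_fin sqabs_ge0.
  - by apply/measurable_EFinP; exact: measurable_sqabs.
  - by move=> x _; rewrite -EFinM lee_fin mulr_ge0// sqabs_ge0.
  - by apply: measurable_funeM; apply/measurable_EFinP; exact: measurable_sqabs.
  - apply: filterS hM => x h _; rewrite -EFinM lee_fin sqabsM.
    by rewrite ler_wpM2r// sqabs_ge0.
split => //; split => //.
have [M M0 hM] := Linf_bound lf.
by apply: le_lt_trans (le M M0 hM) _; rewrite lte_mul_pinfty.
Qed.

Lemma mulopE f (u : L2 mu) : Linf mu f ->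
  {ae mu, forall x, mulop f u x = f x * u x}.
Proof. by move=> lf; apply: toL2E; exact: (Linf_sqint lf (L2_sqint u)).1. Qed.

End L2_representatives.

Section comp_op_values.
Context (R : realType) d (T : measurableType d) (mu : {measure set T -> \bar R}).
Context d' (U : measurableType d') (nu : {measure set U -> \bar R}).
Variables (c : U -> T) (hc : mpres nu mu c).

Lemma comp_opE (u : L2 mu) : {ae nu, forall y, comp_op (nu := nu) c u y = u (c y)}.
Proof. by apply: toL2E; exact: (square_integrable_mpres hc (L2_sqint u)). Qed.

Lemma comp_op_toL2 (f : T -> R[i]) : square_integrable mu f ->
  comp_op c (toL2 mu f) = toL2 nu (f \o c).
Proof.
move=> sf; apply: toL2_ae.
- exact: (square_integrable_mpres hc (L2_sqint _)).
- exact: (square_integrable_mpres hc sf).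
- exact: (ae_mpres hc (toL2E sf)).
Qed.

End comp_op_values.

Global Opaque toL2 mulop comp_op.

Section toL2_theory.
Context (R : realType) d (T : measurableType d) (mu : {measure set T -> \bar R}).
Implicit Types f g : T -> R[i].

Lemma bounded_mulop f : Linf mu f -> bounded_op (@mulop _ _ _ mu f).
Proof.
move=> lf; apply/bounded_opP; split.
  move=> c u v; apply/L2P.
  apply: filterS3 (filterI (mulopE (c *: u + v) lf) (L2_DE (c *: u) v))
    (filterI (mulopE u lf) (mulopE v lf))
    (filterI (L2_DE (c *: mulop f u) (mulop f v))
       (filterI (L2_ZE c u) (L2_ZE c (mulop f u)))).
  move=> x [e1 e2] [h1 h2] [e3 [e4 e5]].
  by rewrite e1 e2 e3 e4 e5 h1 h2 mulrDr mulrCA.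
have [M M0 hM] := Linf_bound lf; exists M => // u.
rewrite -lee_fin EFinM -!sqabs_integral.
apply: le_trans ((Linf_sqint lf (L2_sqint u)).2 M M0 hM).
rewrite le_eqVlt; apply/orP; left; apply/eqP; apply: ge0_ae_eq_integral => //.
- by apply/measurable_EFinP/measurable_sqabs/L2_meas.
- by apply/measurable_EFinP/measurable_sqabs/cmeasurableM; [exact: lf.1|exact: L2_meas].
- by move=> x _; rewrite lee_fin sqabs_ge0.
- by move=> x _; rewrite lee_fin sqabs_ge0.
- by apply: filterS (mulopE u lf) => x ->.
Qed.

Lemma Linf_conj f : Linf mu f -> Linf mu (fun x => conjc (f x)).
Proof.
move=> [mf [M hM]]; split; first exact: cmeasurable_conj.
by exists M; apply: filterS hM => x; rewrite sqabs_conj.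
Qed.

Lemma adjoint_mulop f : Linf mu f ->
  is_adjoint (@mulop _ _ _ mu f) (mulop (fun x => conjc (f x))).
Proof.
move=> lf u v; rewrite !innerE; apply: ae_eq_cintegral.
- by apply: cmeasurableM; [|apply: cmeasurable_conj]; exact: L2_meas.
- by apply: cmeasurableM; [|apply: cmeasurable_conj]; exact: L2_meas.
- apply: filterS2 (mulopE u lf) (mulopE v (Linf_conj lf)) => x -> ->.
  by rewrite conjcM conjcK mulrCA mulrA.
Qed.

Lemma Linf_cst (z : R[i]) : Linf mu (fun=> z).
Proof. by split; [exact: cmeasurable_cst|exists (sqabs z); exact: nearW]. Qed.

Lemma Linf_indic (A : set T) : measurable A -> Linf mu (fun x => (\1_A x : R)%:C).
Proof.
move=> mA; split; first exact: cmeasurable_indic.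
exists 1; apply: nearW => x; rewrite sqabs_real indicE.
by case: (_ \in _); rewrite ?expr1n ?expr0n//= ler01.
Qed.

Lemma LinfM f g : Linf mu f -> Linf mu g -> Linf mu (fun x => f x * g x).
Proof.
move=> lf lg; split; first by apply: cmeasurableM; [exact: lf.1|exact: lg.1].
have [M M0 hM] := Linf_bound lf; have [N N0 hN] := Linf_bound lg.
exists (M * N); apply: filterS2 hM hN => x h h'; rewrite sqabsM.
by apply: ler_pM => //; exact: sqabs_ge0.
Qed.

Lemma mulop_comp f g : Linf mu f -> Linf mu g ->
  @mulop _ _ _ mu f \o mulop g = mulop (fun x => f x * g x).
Proof.
move=> lf lg; apply/funext => u; apply/L2P => /=.
apply: filterS3 (mulopE (mulop g u) lf) (mulopE u lg) (mulopE u (LinfM lf lg)).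
by move=> x -> -> ->; rewrite mulrA.
Qed.

Lemma mulop_cst (z : R[i]) : @mulop _ _ _ mu (fun=> z) = (fun u => z *: u).
Proof.
apply/funext => u /=; apply/L2P.
by apply: filterS2 (mulopE u (Linf_cst z)) (L2_ZE z u) => x e1 e2; rewrite e1 ?e2.
Qed.

End toL2_theory.

Section composition_operators.
Context (R : realType) d (T : measurableType d) (mu : {measure set T -> \bar R}).
Context d' (U : measurableType d') (nu : {measure set U -> \bar R}).
Variables (c : U -> T) (hc : mpres nu mu c).

Lemma comp_op_linear : linear (@comp_op _ _ _ mu _ _ nu c).
Proof.
move=> k u v; apply/L2P.
apply: filterS3 (filterI (comp_opE hc (k *: u + v)) (ae_mpres hc (L2_DE (k *: u) v)))
  (filterI (comp_opE hc u) (comp_opE hc v))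
  (filterI (L2_DE (k *: comp_op c u) (comp_op c v))
     (filterI (ae_mpres hc (L2_ZE k u)) (L2_ZE k (comp_op c u)))).
by move=> x [e1 e2] [h1 h2] [e3 [e4 e5]]; rewrite e1 e2 e3 e4 e5 h1 h2.
Qed.

Lemma comp_op_inner (u v : L2 mu) :
  inner (comp_op (nu := nu) c u) (comp_op c v) = inner u v.
Proof.
rewrite [RHS]innerE (cintegral_mpres hc (inner_cintegrable u v)).
apply: inner_ae.
- exact: cmeasurable_comp hc.1 (L2_meas u).
- exact: cmeasurable_comp hc.1 (L2_meas v).
- exact: (comp_opE hc).
- exact: (comp_opE hc).
Qed.

Lemma bounded_comp_op : bounded_op (@comp_op _ _ _ mu _ _ nu c).
Proof.
apply/bounded_opP; split; first exact: comp_op_linear.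
by exists 1 => // u; rewrite mul1r /nsq comp_op_inner.
Qed.

Lemma Linf_comp f : Linf mu f -> Linf nu (f \o c).
Proof.
move=> [mf [M hM]]; split; first exact: cmeasurable_comp hc.1 mf.
by exists M; exact: (ae_mpres hc hM).
Qed.

Lemma comp_op_mulop f (u : L2 mu) : Linf mu f ->
  comp_op (nu := nu) c (mulop f u) = mulop (f \o c) (comp_op c u).
Proof.
move=> lf; apply/L2P.
apply: filterS3 (filterI (comp_opE hc (mulop f u)) (comp_opE hc u))
  (ae_mpres hc (mulopE u lf)) (mulopE (comp_op c u) (Linf_comp lf)).
by move=> y [-> h] -> ->; rewrite h.
Qed.

End composition_operators.

Section composition_iso.
Context (R : realType) d (T : measurableType d) (mu : {measure set T -> \bar R}).
Context d' (U : measurableType d') (nu : {measure set U -> \bar R}).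

(* The diagonal of a square need not be measurable, so "c' is an almost
   everywhere inverse of c" is expressed through measurable functions. *)
Definition miso (c : U -> T) (c' : T -> U) :=
  [/\ mpres nu mu c, measurable_fun setT c' &
    forall v : U -> R[i], cmeasurable v -> {ae nu, forall y, v (c' (c y)) = v y}].

End composition_iso.
Arguments miso {R d T} mu {d' U} nu c c'.

Section composition_iso_theory.
Context (R : realType) d (T : measurableType d) (mu : {measure set T -> \bar R}).
Context d' (U : measurableType d') (nu : {measure set U -> \bar R}).

Lemma miso_cancel (c : U -> T) (c' : T -> U) : mpres nu mu c -> measurable_fun setT c' -> cancel c c' ->
  miso mu nu c c'.
Proof. by move=> hc mc' K; split => // v _; apply: nearW => y; rewrite K. Qed.

(** Tested on indicators: the preimage of [S] under [c' \o c] agrees with [S] up to a null set. *)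
Lemma miso_mpres (c : U -> T) (c' : T -> U) : miso mu nu c c' -> mpres mu nu c'.
Proof.
move=> [hc mc' K]; split => // S mS.
have mS' : measurable (c' @^-1` S) by rewrite -[_ @^-1` _]setTI; exact: mc'.
have mS'' : measurable (c @^-1` (c' @^-1` S)) by rewrite -[_ @^-1` _]setTI; exact: hc.1.
rewrite (hc.2 _ mS').
have h := K _ (cmeasurable_indic R mS).
have I A : measurable A -> (nu A = \int[nu]_y (\1_A y : R)%:E)%E.
  by move=> mA; rewrite integral_indic// setIT.
rewrite (I _ mS) (I _ mS''); apply: ge0_ae_eq_integral => //.
- by apply/measurable_EFinP; exact: measurable_indic.
- by apply/measurable_EFinP; exact: measurable_indic.
- by apply: filterS h => y /= [] h _; rewrite -h.
Qed.

(** The points where [c \o c'] fails for [v] pull back along [c] to the points where [c' \o c] fails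
    for [v \o c]. *)
Lemma miso_sym (c : U -> T) (c' : T -> U) : miso mu nu c c' -> miso nu mu c' c.
Proof.
move=> hcc; have hc' := miso_mpres hcc; case: hcc => hc mc' K.
split => // [|v mv]; first exact: hc.1.
have mN : measurable [set x | v (c (c' x)) != v x].
  apply: cmeasurable_neq => //.
  by apply: (cmeasurable_comp mc' (f := v \o c)); exact: cmeasurable_comp hc.1 mv.
exists [set x | v (c (c' x)) != v x]; split => //; last by move=> x /= /eqP.
rewrite (hc.2 _ mN).
have [N [mN' N0 sub]] := K (v \o c) (cmeasurable_comp hc.1 mv).
apply: (subset_measure0 _ mN' _ N0); last by move=> y /= h; apply: sub => /= /eqP; exact/negP.
by rewrite -[_ @^-1` _]setTI; exact: hc.1.
Qed.

Lemma miso_cancel_op (c : U -> T) (c' : T -> U) (v : L2 nu) : miso mu nu c c' ->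
  comp_op c (comp_op (nu := mu) c' v) = v.
Proof.
move=> hcc; have hc' := miso_mpres hcc; case: hcc => hc mc' K; apply/L2P.
apply: filterS3 (comp_opE hc (comp_op c' v)) (ae_mpres hc (comp_opE hc' v))
  (K v (L2_meas v)) => y e1 e2 e3.
by rewrite e1 e2.
Qed.

Lemma adjoint_miso (c : U -> T) (c' : T -> U) : miso mu nu c c' ->
  is_adjoint (@comp_op _ _ _ mu _ _ nu c) (comp_op c').
Proof.
move=> hcc u v; rewrite -{1}(miso_cancel_op v hcc) comp_op_inner//.
by case: hcc.
Qed.

End composition_iso_theory.

Section composition_comp.
Context (R : realType) d (T : measurableType d) (mu : {measure set T -> \bar R}).
Context d' (U : measurableType d') (nu : {measure set U -> \bar R}).
Context d'' (V : measurableType d'') (xi : {measure set V -> \bar R}).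

Lemma comp_op_comp (c : U -> T) (c1 : V -> U) (u : L2 mu) : mpres nu mu c -> mpres xi nu c1 ->
  comp_op (nu := xi) c1 (comp_op (nu := nu) c u) = comp_op (c \o c1) u.
Proof.
move=> hc hc1; apply/L2P.
apply: filterS3 (comp_opE hc1 (comp_op c u)) (ae_mpres hc1 (comp_opE hc u))
  (comp_opE (mpres_comp hc hc1) u) => y e1 e2 e3.
by rewrite e1 e2 e3.
Qed.

Lemma miso_comp (c : U -> T) c' (c1 : V -> U) c1' : miso mu nu c c' -> miso nu xi c1 c1' ->
  miso mu xi (c \o c1) (c1' \o c').
Proof.
move=> [hc mc' K] [hc1 mc1' K1]; split.
- exact: mpres_comp hc hc1.
- exact: measurableT_comp.
- move=> v mv; apply: filterS2 (ae_mpres hc1 (K (v \o c1') (cmeasurable_comp mc1' mv)))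
    (K1 v mv) => z /= e1 e2.
  by rewrite e1 e2.
Qed.

(** A push-forward along [phi] is carried by the range of [phi], so it is enough to invert [c]
    there. For fibre products [phi] is the parametrization, and [c'] inverts [c] on compatible
    pairs. *)
Lemma miso_base (c : U -> T) c' (phi : V -> U) : mpres xi nu phi ->
  mpres nu mu c -> measurable_fun setT c' -> (forall z, c' (c (phi z)) = phi z) ->
  miso mu nu c c'.
Proof.
move=> hphi hc mc' K; split => // v mv.
have mN : measurable [set y | v (c' (c y)) != v y].
  apply: cmeasurable_neq => //.
  by apply: (cmeasurable_comp hc.1 (f := v \o c')); exact: cmeasurable_comp mc' mv.
exists [set y | v (c' (c y)) != v y]; split => //; last by move=> y /= /eqP.
rewrite (hphi.2 _ mN) (_ : _ @^-1` _ = set0) ?measure0//.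
by apply/seteqP; split => z //=; rewrite K eqxx.
Qed.

End composition_comp.

Section miso_id.
Context (R : realType) d (T : measurableType d) (mu : {measure set T -> \bar R}).

Lemma comp_op_id (u : L2 mu) : comp_op (nu := mu) id u = u.
Proof. by apply/L2P; exact: (comp_opE (mpres_id mu)). Qed.

End miso_id.

(** * Fubini's theorem for complex-valued functions *)

Section fubini.
Context (R : realType).
Context d1 (T1 : measurableType d1) (m1 : {sigma_finite_measure set T1 -> \bar R}).
Context d2 (T2 : measurableType d2) (m2 : {sigma_finite_measure set T2 -> \bar R}).

(** Measurability does not depend on integrability: [fine] is applied to a difference of two
    integrals of nonnegative functions, each measurable by Tonelli. *)
Lemma measurable_fine_fubini_F (h : T1 * T2 -> R) : measurable_fun setT h ->
  measurable_fun setT (fun x => \int[m2]_y h (x, y)).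
Proof.
move=> mh; apply: (@measurableT_comp _ _ _ _ _ _ fine) => //.
have mE : measurable_fun setT (EFin \o h) by exact/measurable_EFinP.
pose F (g : T1 * T2 -> \bar R) x := (\int[m2]_y (g (x, y) : \bar R))%E.
rewrite (_ : (fun x => _) = (F (EFin \o h)^\+%E \- F (EFin \o h)^\-%E)%E); last first.
  apply/funext => x; rewrite /F [LHS]integralE; congr (_ - _)%E.
    by apply: eq_integral => y _; rewrite /= !funeposE.
  by apply: eq_integral => y _; rewrite /= !funenegE.
apply: emeasurable_funB.
- by apply: measurable_fun_fubini_tonelli_F => //; exact: measurable_funepos.
- by apply: measurable_fun_fubini_tonelli_F => //; exact: measurable_funeneg.
Qed.

Lemma Rfubini (h : T1 * T2 -> R) : (m1 \X m2).-integrable setT (EFin \o h) ->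
  \int[m1 \X m2]_w h w = \int[m1]_x \int[m2]_y h (x, y).
Proof.
move=> hi; rewrite /Rintegral -(integral12_prod_meas1 hi); congr fine.
have iF := integrable_fubini_F hi.
have mh : measurable_fun setT h by apply/measurable_EFinP; exact: measurable_int hi.
apply: ae_eq_integral => //.
- exact: measurable_int iF.
- by apply/measurable_EFinP; exact: measurable_fine_fubini_F.
- by apply: filterS (integrable_ae measurableT iF) => x /(_ I) hx _; rewrite /Rintegral fineK.
Qed.

Lemma cfubini (f : T1 * T2 -> R[i]) : cintegrable (m1 \X m2) f ->
  cintegral (m1 \X m2) f = cintegral m1 (fun x => cintegral m2 (fun y => f (x, y))).
Proof.
move=> fi; rewrite /cintegral; congr (_ +i* _).
  by rewrite (Rfubini (cintegrable_Re fi)).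
by rewrite (Rfubini (cintegrable_Im fi)).
Qed.

Lemma cmeasurable_cfubini (f : T1 * T2 -> R[i]) : cmeasurable f ->
  cmeasurable (fun x => cintegral m2 (fun y => f (x, y))).
Proof.
move=> [mr mi]; split; rewrite /cintegral /=.
  exact: (measurable_fine_fubini_F mr).
exact: (measurable_fine_fubini_F mi).
Qed.

End fubini.

(** * Tensor products *)

Section rectangles.
Context (R : realType) d1 (T1 : measurableType d1) d2 (T2 : measurableType d2).
Variable mu : {measure set (T1 * T2) -> \bar R}.

(** Rectangles form a pi-system generating the product sigma-algebra, and the sets over which [h]
    has zero integral form a Dynkin system. *)
Lemma integral_rect_eq0 (h : T1 * T2 -> R) : mu.-integrable setT (EFin \o h) ->
  (forall A B, measurable A -> measurable B ->
    (\int[mu]_(w in A `*` B) (h w)%:E = 0)%E) ->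
  {ae mu, forall w, h w = 0}.
Proof.
move=> hi h0.
have mhE := measurable_int _ hi.
have P S : measurable S -> (\int[mu]_(w in S) (h w)%:E = 0)%E.
  rewrite measurable_prod_measurableType; move: S; apply: dynkin_induction.
  - exact: measurable_prod_measurableType.
  - move=> _ _ [A mA [B mB <-]] [A' mA' [B' mB' <-]].
    exists (A `&` A'); first exact: measurableI.
    exists (B `&` B'); first exact: measurableI.
    by rewrite setXI.
  - by rewrite -setXTT; exact: h0.
  - by move=> _ [A mA [B mB <-]]; exact: h0.
  - move=> S mS hS.
    have : (\int[mu]_(w in setT) (h w)%:E = 0)%E by rewrite -setXTT; exact: h0.
    rewrite -(setUv S) integral_setU//.
    + by rewrite hS add0e.
    + exact: measurableC.
    + by rewrite setUv.
    + by apply/disj_setPCl.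
  - move=> F mF tF hF; rewrite integral_bigcup//.
      by rewrite eseries0.
    by apply: integrableS hi => //; exact: bigcup_measurable.
have H0 : ae_eq mu setT (EFin \o h) (cst 0%E).
  apply: integral_ae_eq => // E _ mE.
  by rewrite P// integral0.
by apply: filterS H0 => w /(_ I) /= [->].
Qed.

Lemma cintegral_rect_eq0 (h : T1 * T2 -> R[i]) : cintegrable mu h ->
  (forall A B, measurable A -> measurable B ->
    cintegral mu (fun w => ((\1_A w.1)%:C * (\1_B w.2)%:C) * h w) = 0) ->
  {ae mu, forall w, h w = 0}.
Proof.
move=> hi h0.
have key (phi : R[i] -> R) : (forall (r : R) z, phi (r%:C * z) = r * phi z) ->
   mu.-integrable setT (EFin \o (phi \o h)) ->
   (forall A B, measurable A -> measurable B ->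
     \int[mu]_w phi (((\1_A w.1)%:C * (\1_B w.2)%:C) * h w) = 0) ->
   {ae mu, forall w, phi (h w) = 0}.
  move=> phiZ ip ph0; apply: (integral_rect_eq0 ip) => A B mA mB.
  have mAB : measurable (A `*` B) by exact: measurableX.
  have fin : (\int[mu]_(w in A `*` B) ((phi \o h) w)%:E)%E \is a fin_num.
    by apply: integrable_fin_num => //; apply: integrableS ip.
  rewrite -(fineK fin); congr EFin; rewrite -[RHS](ph0 A B mA mB).
  rewrite -/(Rintegral _ _ _) Rintegral_mkcond; apply: eq_Rintegral => -[x y] _.
  rewrite -rmorphM phiZ patchE /= !indicE -natrM mulnb in_setX /=.
  by case: (_ && _); rewrite ?mul1r ?mul0r.
have hr := key (@complex.Re R) _ (cintegrable_Re hi) _.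
have him := key (@complex.Im R) _ (cintegrable_Im hi) _.
apply: filterS2 (hr _ _) (him _ _) => [w e1 e2||A B mA mB||A B mA mB].
- exact: complex_ext.
- by move=> r [a b] /=; ring.
- by have /(congr1 (@complex.Re R)) := h0 A B mA mB.
- by move=> r [a b] /=; ring.
- by have /(congr1 (@complex.Im R)) := h0 A B mA mB.
Qed.

End rectangles.

Section total_rectangles.
Context (R : realType) d1 (T1 : measurableType d1) d2 (T2 : measurableType d2).
Variable mu : {measure set (T1 * T2) -> \bar R}.

Lemma sqint_indic d (T : measurableType d) (m : {measure set T -> \bar R}) (A : set T) :
  measurable A -> (m A < +oo)%E -> square_integrable m (fun x => (\1_A x)%:C).
Proof.
move=> mA Aoo; split; first exact: cmeasurable_indic.
rewrite (eq_integral (fun x => (\1_A x : R)%:E)).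
  by rewrite integral_indic// setIT.
move=> x _; rewrite sqabs_real indicE; by case: (_ \in _); rewrite ?expr1n ?expr0n.
Qed.

(** The measure on the product is arbitrary, since this has to serve for fibre product measures as
    well as for product measures. *)
Lemma total_rect (E : nat -> set T1) (F : nat -> set T2) :
  (forall n, measurable (E n)) -> (forall n, measurable (F n)) ->
  (forall n, (mu (E n `*` F n) < +oo)%E) ->
  (forall w, exists n, E n w.1 /\ F n w.2) ->
  total_in [set toL2 mu (fun w => (\1_A w.1)%:C * (\1_B w.2)%:C) |
     A in [set A | measurable A /\ exists n, A `<=` E n] &
     B in [set B | measurable B /\ exists n, B `<=` F n]].
Proof.
move=> mE mF EFoo EF w hw.
(* Cutting off by a rectangle of finite measure makes the conjugate of [w] integrable. *)
pose h n := fun z : T1 * T2 => ((\1_(E n) z.1 : R)%:C * (\1_(F n) z.2 : R)%:C) * conjc (w z).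
have indM A A' B B' (z : T1 * T2) :
    (\1_(A `&` A') z.1 : R)%:C * (\1_(B `&` B') z.2)%:C =
    ((\1_A z.1)%:C * (\1_B z.2)%:C) * ((\1_A' z.1)%:C * (\1_B' z.2)%:C).
  by rewrite !indicI !rmorphM /= mulrACA.
have indX (A : set T1) (B : set T2) :
    (fun z : T1 * T2 => (\1_A z.1 : R)%:C * (\1_B z.2)%:C) = (fun z => (\1_(A `*` B) z : R)%:C).
  apply/funext => z; rewrite -rmorphM !indicE -natrM mulnb.
  by case: z => x y; rewrite in_setX.
have sq n A B : measurable A -> measurable B -> A `<=` E n -> B `<=` F n ->
    square_integrable mu (fun z => (\1_A z.1 : R)%:C * (\1_B z.2)%:C).
  move=> mA mB AE BF; rewrite indX; apply: sqint_indic; first exact: measurableX.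
  apply: le_lt_trans (EFoo n); apply: le_measure; rewrite ?inE.
  - exact: measurableX.
  - exact: measurableX.
  - by move=> z [/AE ? /BF].
have hn n : {ae mu, forall z, h n z = 0}.
  apply: cintegral_rect_eq0 => [|A B mA mB].
    apply: sq_cintegrable; last exact: L2_sqint.
    by apply: (sq n) => //.
  have mAE : measurable (A `&` E n) by exact: measurableI.
  have mBF : measurable (B `&` F n) by exact: measurableI.
  have s := sq n _ _ mAE mBF (@subIsetr _ _ _) (@subIsetr _ _ _).
  have := hw (toL2 mu (fun z => (\1_(A `&` E n) z.1 : R)%:C * (\1_(B `&` F n) z.2)%:C)).
  have -> : inner (toL2 mu (fun z => (\1_(A `&` E n) z.1 : R)%:C * (\1_(B `&` F n) z.2)%:C)) w
     = cintegral mu (fun z => ((\1_A z.1)%:C * (\1_B z.2)%:C) * h n z).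
    rewrite (inner_ae s.1 (L2_meas w) (toL2E s)); last exact: nearW.
    by apply: eq_cintegral => z; rewrite /h indM -mulrA.
  apply; exists (A `&` E n); first by split => //; exists n; exact: subIsetr.
  by exists (B `&` F n) => //; split => //; exists n; exact: subIsetr.
apply/L2P.
have all : {ae mu, forall z, forall n, h n z = 0} by apply: ae_foralln.
apply: filterS2 all (L2_0E mu) => z hz ->.
have [n [En Fn]] := EF z; have := hz n.
rewrite /h !indicE !mem_set// !mul1r => /eqP.
by rewrite conjc_eq0 => /eqP.
Qed.

End total_rectangles.

Section tensor_values.
Context (R : realType).
Context d1 (T1 : measurableType d1) (m1 : {sigma_finite_measure set T1 -> \bar R}).
Context d2 (T2 : measurableType d2) (m2 : {sigma_finite_measure set T2 -> \bar R}).

Lemma ae_fst (P : T1 -> Prop) : {ae m1, forall x, P x} ->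
  {ae m1 \X m2, forall w, P w.1}.
Proof.
move=> [N [mN N0 PN]]; exists (N `*` setT); split.
- exact: measurableX.
- by rewrite prodmE// N0 mul0e.
- by move=> w /= /PN.
Qed.

Lemma ae_snd (P : T2 -> Prop) : {ae m2, forall x, P x} ->
  {ae m1 \X m2, forall w, P w.2}.
Proof.
move=> [N [mN N0 PN]]; exists (setT `*` N); split.
- exact: measurableX.
- by rewrite prodmE// N0 mule0.
- by move=> w /= /PN.
Qed.

Lemma cmeasurable_fst (f : T1 -> R[i]) : cmeasurable f ->
  cmeasurable (fun w : T1 * T2 => f w.1).
Proof. by move=> mf; apply: (cmeasurable_comp (f := f) measurable_fst). Qed.

Lemma cmeasurable_snd (f : T2 -> R[i]) : cmeasurable f ->
  cmeasurable (fun w : T1 * T2 => f w.2).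
Proof. by move=> mf; apply: (cmeasurable_comp (f := f) measurable_snd). Qed.

Lemma sqint_tens (u : T1 -> R[i]) (v : T2 -> R[i]) :
  square_integrable m1 u -> square_integrable m2 v ->
  square_integrable (m1 \X m2) (fun w => u w.1 * v w.2).
Proof.
move=> [mu uoo] [mv voo].
have m : cmeasurable (fun w : T1 * T2 => u w.1 * v w.2).
  by apply: cmeasurableM; [exact: cmeasurable_fst|exact: cmeasurable_snd].
split => //.
have mE : measurable_fun setT (fun w : T1 * T2 => (sqabs (u w.1 * v w.2))%:E : \bar R).
  by apply/measurable_EFinP; exact: measurable_sqabs.
rewrite (@fubini_tonelli1 _ _ _ _ _ m1 m2 _ mE); last first.
  by move=> w; rewrite lee_fin sqabs_ge0.
rewrite /fubini_F /=.
rewrite (eq_integral (fun x => (sqabs (u x))%:E * \int[m2]_y (sqabs (v y))%:E)%E); last first.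
  move=> x _; rewrite -ge0_integralZl//.
  - by apply: eq_integral => y _; rewrite sqabsM EFinM.
  - by apply/measurable_EFinP; exact: measurable_sqabs.
  - by move=> y _; rewrite lee_fin sqabs_ge0.
  - by rewrite lee_fin sqabs_ge0.
rewrite ge0_integralZr//.
- by rewrite lte_mul_pinfty//; [apply: integral_ge0 => x _; rewrite lee_fin sqabs_ge0|
    rewrite ge0_fin_numE//; apply: integral_ge0 => x _; rewrite lee_fin sqabs_ge0].
- by apply/measurable_EFinP; exact: measurable_sqabs.
- by move=> x _; rewrite lee_fin sqabs_ge0.
- by apply: integral_ge0 => x _; rewrite lee_fin sqabs_ge0.
Qed.

Lemma tensE (u : L2 m1) (v : L2 m2) :
  {ae m1 \X m2, forall w, tens u v w = u w.1 * v w.2}.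
Proof. by apply: toL2E; apply: sqint_tens; exact: L2_sqint. Qed.

Lemma tens_toL2 (f : T1 -> R[i]) (g : T2 -> R[i]) :
  square_integrable m1 f -> square_integrable m2 g ->
  tens (toL2 m1 f) (toL2 m2 g) = toL2 (m1 \X m2) (fun w => f w.1 * g w.2).
Proof.
move=> sf sg; apply: toL2_ae.
- by apply: sqint_tens; exact: L2_sqint.
- exact: sqint_tens.
- by apply: filterS2 (ae_fst (toL2E sf)) (ae_snd (toL2E sg)) => w e1 e2; rewrite e1 e2.
Qed.

Lemma inner_tens (u u' : L2 m1) (v v' : L2 m2) :
  inner (tens u v) (tens u' v') = inner u u' * inner v v'.
Proof.
pose g := fun w : T1 * T2 => (u w.1 * v w.2) * conjc (u' w.1 * v' w.2).
have s := sqint_tens (L2_sqint u) (L2_sqint v).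
have s' := sqint_tens (L2_sqint u') (L2_sqint v').
rewrite (inner_ae s.1 s'.1 (tensE u v) (tensE u' v')).
rewrite (cfubini (sq_cintegrable s s')) /=.
rewrite !innerE mulrC -(cintegralZ _ (inner_cintegrable u u')).
apply: eq_cintegral => x; rewrite mulrC -(cintegralZ _ (inner_cintegrable v v')).
by apply: eq_cintegral => y; rewrite conjcM mulrACA.
Qed.

Lemma total_inS d (T : measurableType d) (m : {measure set T -> \bar R}) (E F : set (L2 m)) :
  E `<=` F -> total_in E -> total_in F.
Proof. by move=> EF tE w hw; apply: tE => x /EF; exact: hw. Qed.

Lemma total_tens : total_in [set tens u v | u in [set: L2 m1] & v in [set: L2 m2]].
Proof.
have /sigma_finiteP[E [TE ndE Eoo]] := sigma_finiteT m1.
have /sigma_finiteP[F [TF ndF Foo]] := sigma_finiteT m2.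
apply: total_inS (_ : total_in _); last first.
  apply: (@total_rect _ _ _ _ _ (m1 \X m2) E F) => [n|n|n|w].
  - by have [] := Eoo n.
  - by have [] := Foo n.
  - have [mE En] := Eoo n; have [mF Fn] := Foo n.
    rewrite (_ : _ (_ `*` _) = m1 (E n) * m2 (F n))%E; last exact: prodmE.
    by rewrite lte_mul_pinfty// ge0_fin_numE.
  - have : [set: T1] w.1 by []. rewrite TE => -[n _ En].
    have : [set: T2] w.2 by []. rewrite TF => -[k _ Fk].
    exists (maxn n k); split.
      by move: En; exact/subsetPset/ndE/leq_maxl.
    by move: Fk; exact/subsetPset/ndF/leq_maxr.
move=> _ [A [mA [n AE]] [B [mB [k BF]] <-]].
have sA : square_integrable m1 (fun x => (\1_A x)%:C).
  apply: sqint_indic => //; have [mE En] := Eoo n; apply: le_lt_trans En.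
  by apply: le_measure; rewrite ?inE.
have sB : square_integrable m2 (fun x => (\1_B x)%:C).
  apply: sqint_indic => //; have [mF Fk] := Foo k; apply: le_lt_trans Fk.
  by apply: le_measure; rewrite ?inE.
exists (toL2 m1 (fun x => (\1_A x)%:C)) => //.
exists (toL2 m2 (fun x => (\1_B x)%:C)) => //.
by rewrite tens_toL2.
Qed.

Lemma tens_ext (z z' : L2 (m1 \X m2)) :
  (forall u v, inner z (tens u v) = inner z' (tens u v)) -> z = z'.
Proof.
move=> h; apply/eqP; rewrite -subr_eq0; apply/eqP/total_tens => _ [u _ [v _ <-]].
by rewrite innerC innerBl h subrr conjc0.
Qed.

Lemma tensDl u u' v : tens (u + u' : L2 m1) (v : L2 m2) = tens u v + tens u' v.
Proof. by apply: tens_ext => a b; rewrite innerDl !inner_tens innerDl mulrDl. Qed.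

Lemma tensDr u v v' : tens (u : L2 m1) (v + v' : L2 m2) = tens u v + tens u v'.
Proof. by apply: tens_ext => a b; rewrite innerDl !inner_tens innerDl mulrDr. Qed.

Lemma tensZl c u v : tens (c *: u : L2 m1) (v : L2 m2) = c *: tens u v.
Proof. by apply: tens_ext => a b; rewrite innerZl !inner_tens innerZl mulrA. Qed.

Lemma tensZr c u v : tens (u : L2 m1) (c *: v : L2 m2) = c *: tens u v.
Proof. by apply: tens_ext => a b; rewrite innerZl !inner_tens innerZl mulrCA. Qed.

Lemma nsq_tens (u : L2 m1) (v : L2 m2) : nsq (tens u v) = nsq u * nsq v.
Proof. by rewrite /nsq inner_tens !inner_self /=; ring. Qed.

(** A combination of tensors is treated as a function of x with values in L^2(T2): its squared norm
    is the integral of the pointwise ones. An estimate for [b] at each x thereby passes to 1 (x)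
    b. *)
Lemma nsq_tens_sum (s : seq (R[i] * (L2 m1 * L2 m2))) (b : L2 m2 -> L2 m2) :
  measurable_fun setT (fun x => (nsq (\sum_(p <- s) (p.1 * p.2.1 x) *: b p.2.2))%:E) /\
  ((nsq (\sum_(p <- s) p.1 *: tens p.2.1 (b p.2.2)))%:E =
  \int[m1]_x (nsq (\sum_(p <- s) (p.1 * p.2.1 x) *: b p.2.2))%:E)%E.
Proof.
pose g (w : T1 * T2) := \sum_(p <- s) p.1 * (p.2.1 w.1 * b p.2.2 w.2).
have mg : cmeasurable g.
  rewrite /g; elim: s {g} => [|p s IH].
    by under eq_fun do rewrite big_nil; exact: cmeasurable_cst.
  under eq_fun do rewrite big_cons; apply: cmeasurableD => //.
  apply: cmeasurableM; first exact: cmeasurable_cst.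
  by apply: cmeasurableM; [apply: cmeasurable_fst|apply: cmeasurable_snd]; exact: L2_meas.
have gE : {ae m1 \X m2, forall w,
    (\sum_(p <- s) p.1 *: tens p.2.1 (b p.2.2) : L2 (m1 \X m2)) w = g w}.
  rewrite /g; elim: s {g mg} => [|p s IH].
    by rewrite big_nil; apply: filterS (L2_0E _) => x h; rewrite big_nil.
  rewrite big_cons; apply: filterS3 (filterI IH (tensE p.2.1 (b p.2.2)))
    (L2_DE (p.1 *: tens p.2.1 (b p.2.2))
      (\sum_(q <- s) q.1 *: tens q.2.1 (b q.2.2)))
    (L2_ZE p.1 (tens p.2.1 (b p.2.2))) => w [e1 e2] e3 e4.
  by rewrite e3 e4 e1 e2 big_cons.
have mE : measurable_fun setT (fun w => (sqabs (g w))%:E : \bar R).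
  by apply/measurable_EFinP; exact: measurable_sqabs.
have FE x : (\int[m2]_y (sqabs (g (x, y)))%:E =
    (nsq (\sum_(p <- s) (p.1 * p.2.1 x) *: b p.2.2))%:E)%E.
  rewrite -sqabs_integral; apply: ge0_ae_eq_integral => //.
  - apply/measurable_EFinP/measurable_sqabs.
    by apply: (cmeasurable_comp (f := g) (phi := fun y => (x, y))) => //; exact: measurable_pair1.
  - by apply/measurable_EFinP/measurable_sqabs/L2_meas.
  - by move=> y _; rewrite lee_fin sqabs_ge0.
  - by move=> y _; rewrite lee_fin sqabs_ge0.
  suff : {ae m2, forall y,
      (\sum_(p <- s) (p.1 * p.2.1 x) *: b p.2.2 : L2 m2) y = g (x, y)}.
    by apply: filterS => y e _; rewrite e.
  rewrite /g; elim: s {g mg gE mE} => [|p s IH].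
    by rewrite big_nil; apply: filterS (L2_0E _) => y h; rewrite big_nil.
  rewrite big_cons; apply: filterS3 IH (L2_DE ((p.1 * p.2.1 x) *: b p.2.2)
      (\sum_(q <- s) (q.1 * q.2.1 x) *: b q.2.2))
    (L2_ZE (p.1 * p.2.1 x) (b p.2.2)) => y e1 e2 e3.
  by rewrite e2 e3 e1 big_cons mulrA.
have g0 w : (0 <= (sqabs (g w))%:E)%E by rewrite lee_fin sqabs_ge0.
split.
  under eq_fun do rewrite -FE.
  exact: (measurable_fun_fubini_tonelli_F (fun w => (sqabs (g w))%:E)).
rewrite -sqabs_integral.
transitivity (\int[m1 \X m2]_w (sqabs (g w))%:E)%E.
  apply: ge0_ae_eq_integral => //.
  - by apply/measurable_EFinP/measurable_sqabs/L2_meas.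
  - by move=> x _; rewrite lee_fin sqabs_ge0.
  - by apply: filterS gE => w e _; rewrite e.
rewrite (@fubini_tonelli1 _ _ _ _ _ m1 m2 _ mE)//.
by apply: eq_integral => x _; rewrite /fubini_F FE.
Qed.

End tensor_values.

Section tensor_operators.
Context (R : realType).
Context d1 (T1 : measurableType d1) (m1 : {sigma_finite_measure set T1 -> \bar R}).
Context d2 (T2 : measurableType d2) (m2 : {sigma_finite_measure set T2 -> \bar R}).

(** The pointwise inequality |b z(x)|^2 <= M |z(x)|^2 integrates to the bound on combinations that
    [bounded_extension] asks for. *)
Lemma tens_idop_exists (b : L2 m2 -> L2 m2) : bounded_op b ->
  exists2 c : L2 (m1 \X m2) -> L2 (m1 \X m2), bounded_op c &
    forall u v, c (tens u v) = tens u (b v).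
Proof.
move=> /bounded_opP[lb [M M0 bM]].
have [|||c bc hc] := @bounded_extension _ _ _ (m1 \X m2) _ _ (m1 \X m2) _
  (fun p : L2 m1 * L2 m2 => tens p.1 p.2) (fun p => tens p.1 (b p.2)) M.
- exact: M0.
- apply: total_inS (@total_tens _ _ _ m1 _ _ m2) => _ [u _ [v _ <-]].
  by exists (u, v).
- move=> s /=; have [mb eb] := nsq_tens_sum s b; have [mi ei] := nsq_tens_sum s id.
  have le x : ((nsq (\sum_(p <- s) (p.1 * p.2.1 x) *: b p.2.2))%:E <=
      M%:E * (nsq (\sum_(p <- s) (p.1 * p.2.1 x) *: id p.2.2))%:E)%E.
    rewrite -EFinM lee_fin; apply: le_trans (bM _); rewrite lin_sum//.
    rewrite le_eqVlt; apply/orP; left; apply/eqP; congr nsq.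
    by apply: eq_bigr => p _; rewrite linZ.
  have ei' : (nsq (\sum_(p <- s) p.1 *: tens p.2.1 p.2.2))%:E = _ := ei.
  rewrite -lee_fin EFinM [leLHS]eb [X in (_ * X)%E]ei'.
  rewrite -ge0_integralZl//; last by move=> x _; rewrite lee_fin nsq_ge0.
  apply: ge0_le_integral; first exact: measurableT.
  + by move=> x _; rewrite lee_fin nsq_ge0.
  + exact: mb.
  + exact: measurable_funeM.
  + by move=> x _; exact: le.
- by exists c => // u v; exact: (hc (u, v)).
Qed.

End tensor_operators.

Section tensor_swap.
Context (R : realType).
Context d1 (T1 : measurableType d1) (m1 : {sigma_finite_measure set T1 -> \bar R}).
Context d2 (T2 : measurableType d2) (m2 : {sigma_finite_measure set T2 -> \bar R}).

Lemma miso_swap : miso (m2 \X m1) (m1 \X m2) (@swap_pair T1 T2) (@swap_pair T2 T1).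
Proof.
apply: miso_cancel; first exact: mpres_swap.
  exact: (mpres_swap m2 m1).1.
by move=> -[].
Qed.

Lemma comp_swap_tens (u : L2 m2) (v : L2 m1) :
  comp_op (@swap_pair T1 T2) (tens u v) = tens v u.
Proof.
apply/L2P; apply: filterS3 (comp_opE (mpres_swap m1 m2) (tens u v))
  (ae_mpres (mpres_swap m1 m2) (tensE u v)) (tensE v u) => w e1 e2 e3.
by rewrite e1 e2 e3 mulrC.
Qed.

End tensor_swap.

Section tensor_op.
Context (R : realType).
Context d1 (T1 : measurableType d1) (m1 : {sigma_finite_measure set T1 -> \bar R}).
Context d2 (T2 : measurableType d2) (m2 : {sigma_finite_measure set T2 -> \bar R}).

(** Factor a (x) b as (a (x) 1)(1 (x) b); the first factor is a conjugate of 1 (x) a by the swap. *)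
Lemma tens_op_exists (a : L2 m1 -> L2 m1) (b : L2 m2 -> L2 m2) :
  bounded_op a -> bounded_op b ->
  exists2 c : L2 (m1 \X m2) -> L2 (m1 \X m2), bounded_op c &
    forall u v, c (tens u v) = tens (a u) (b v).
Proof.
move=> ba bb; have [c1 bc1 hc1] := tens_idop_exists m1 bb.
have [c2 bc2 hc2] := tens_idop_exists m2 ba.
exists (comp_op (@swap_pair T1 T2) \o c2 \o comp_op (@swap_pair T2 T1) \o c1).
  apply: bounded_comp bc1 _; apply: bounded_comp; last first.
    by apply: bounded_comp bc2 _; apply: bounded_comp_op; exact: mpres_swap.
  by apply: bounded_comp_op; exact: mpres_swap.
by move=> u v /=; rewrite hc1 comp_swap_tens hc2 comp_swap_tens.
Qed.

Lemma tens_opP (a : L2 m1 -> L2 m1) (b : L2 m2 -> L2 m2) :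
  bounded_op a -> bounded_op b -> bounded_op (tens_op a b) /\
    forall u v, tens_op a b (tens u v) = tens (a u) (b v).
Proof.
move=> ba bb; have [c bc hc] := tens_op_exists ba bb.
by apply: (@xgetPex _ (fun=> 0) [set c | bounded_op c /\
    forall u v, c (tens u v) = tens (a u) (b v)]); exists c.
Qed.

Lemma bounded_tens_op (a : L2 m1 -> L2 m1) (b : L2 m2 -> L2 m2) :
  bounded_op a -> bounded_op b -> bounded_op (tens_op a b).
Proof. by move=> ba bb; have [] := tens_opP ba bb. Qed.

Lemma tens_opE (a : L2 m1 -> L2 m1) (b : L2 m2 -> L2 m2) u v :
  bounded_op a -> bounded_op b -> tens_op a b (tens u v) = tens (a u) (b v).
Proof. by move=> ba bb; have [_] := tens_opP ba bb; apply. Qed.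

Lemma bounded_tens_ext d (T : measurableType d) (m : {measure set T -> \bar R})
    (c c' : L2 (m1 \X m2) -> L2 m) : bounded_op c -> bounded_op c' ->
  (forall u v, c (tens u v) = c' (tens u v)) -> c = c'.
Proof.
move=> bc bc' h; apply: (bounded_eq_total bc bc' (@total_tens _ _ _ m1 _ _ m2)).
by move=> _ [u _ [v _ <-]].
Qed.

Lemma tens_op_uniq (a : L2 m1 -> L2 m1) (b : L2 m2 -> L2 m2) c :
  bounded_op a -> bounded_op b -> bounded_op c ->
  (forall u v, c (tens u v) = tens (a u) (b v)) -> c = tens_op a b.
Proof.
move=> ba bb bc h; apply: (bounded_tens_ext bc (bounded_tens_op ba bb)).
by move=> u v; rewrite h tens_opE.
Qed.

Lemma tens_op_comp (a a' : L2 m1 -> L2 m1) (b b' : L2 m2 -> L2 m2) :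
  bounded_op a -> bounded_op a' -> bounded_op b -> bounded_op b' ->
  tens_op a b \o tens_op a' b' = tens_op (a \o a') (b \o b').
Proof.
move=> ba ba' bb bb'; apply: tens_op_uniq; try exact: bounded_comp.
  by apply: bounded_comp; exact: bounded_tens_op.
by move=> u v /=; rewrite !tens_opE.
Qed.

Lemma tens_op_id : tens_op (@id (L2 m1)) (@id (L2 m2)) = id.
Proof. by apply/esym/tens_op_uniq => //; exact: bounded_id. Qed.

Lemma tens_op_adjoint (a a' : L2 m1 -> L2 m1) (b b' : L2 m2 -> L2 m2) :
  bounded_op a -> bounded_op b -> is_adjoint a a' -> is_adjoint b b' ->
  is_adjoint (tens_op a b) (tens_op a' b').
Proof.
move=> ba bb ha hb.
have ba' := bounded_adjoint ba ha; have bb' := bounded_adjoint bb hb.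
have bt := bounded_tens_op ba bb.
suff <- : adj (tens_op a b) = tens_op a' b' by exact: adjP.
apply: (tens_op_uniq ba' bb' (bounded_adj bt)).
move=> u v; apply: tens_ext => u' v'.
by rewrite innerC -(adjP bt) tens_opE// -innerC !inner_tens innerC ha -innerC
  (innerC (b v')) hb -innerC.
Qed.

Lemma tens_op_combl c (a a' : L2 m1 -> L2 m1) (b : L2 m2 -> L2 m2) :
  bounded_op a -> bounded_op a' -> bounded_op b ->
  tens_op (fun u => c *: a u + a' u) b = (fun w => c *: tens_op a b w + tens_op a' b w).
Proof.
move=> ba ba' bb; have bt := bounded_tens_op ba bb; have bt' := bounded_tens_op ba' bb.
apply/esym/(tens_op_uniq (bounded_comb c ba ba') bb (bounded_comb c bt bt')).
by move=> u v; rewrite !tens_opE// tensDl tensZl.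
Qed.

(** Creation of a second tensor factor. Its adjoint is the partial inner product against [e], so
    that these two maps give access to the matrix coefficients of an operator in the second
    factor. *)
Definition ins (e : L2 m2) (u : L2 m1) : L2 (m1 \X m2) := tens u e.

Lemma bounded_ins e : bounded_op (ins e).
Proof.
apply/bounded_opP; split; first by move=> c u v; rewrite /ins tensDl tensZl.
by exists (nsq e); [exact: nsq_ge0|move=> u; rewrite nsq_tens mulrC].
Qed.

Lemma adj_ins_tens e u v : adj (ins e) (tens u v) = inner v e *: u.
Proof.
apply: inner_extr => w; rewrite -(adjP (bounded_ins e)) inner_tens innerZr.
by rewrite -innerC mulrC.
Qed.

Lemma ext_adj_ins (z z' : L2 (m1 \X m2)) :
  (forall e, adj (ins e) z = adj (ins e) z') -> z = z'.
Proof.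
move=> h; apply: tens_ext => u v.
have E w : inner w (tens u v) = conjc (inner u (adj (ins v) w)).
  by rewrite -(adjP (bounded_ins v)) /ins -innerC.
by rewrite !E h.
Qed.

End tensor_op.

Lemma comp_eqP (A B B' C : Type) (f : B -> C) (g : A -> B) (f' : B' -> C) (g' : A -> B') x :
  f \o g = f' \o g' -> f (g x) = f' (g' x).
Proof. by move=> /(congr1 (fun h => h x)). Qed.

(** * Generated von Neumann algebras *)

Section von_Neumann_algebras.
Context (R : realType) d (T : measurableType d) (mu : {measure set T -> \bar R}).
Local Notation op := (L2 mu -> L2 mu).
Implicit Types (S : set op) (a b x y t : op).

Definition star_closure S : set op :=
  S `|` [set b | exists2 a, S a & is_adjoint a b].

Lemma adj_invol a : bounded_op a -> adj (adj a) = a.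
Proof. by move=> ba; apply: adjE; exact: is_adjoint_sym (adjP ba). Qed.

Lemma adj_comp a b : bounded_op a -> bounded_op b -> adj (a \o b) = adj b \o adj a.
Proof. by move=> ba bb; apply: adjE; apply: is_adjoint_comp; exact: adjP. Qed.

Lemma star_closure_bounded S : S `<=` bounded_op (nu := mu) -> star_closure S `<=` bounded_op (nu := mu).
Proof. by move=> bS a [/bS//|[b Sb hb]]; exact: bounded_adjoint (bS _ Sb) hb. Qed.

Lemma star_closure_adj S a : S `<=` bounded_op (nu := mu) ->
  star_closure S a -> star_closure S (adj a).
Proof.
move=> bS [Sa|[b Sb hb]]; first by right; exists a => //; apply: adjP; exact: bS.
by left; rewrite (adjE (is_adjoint_sym hb)).
Qed.

Lemma adj_comm a b : bounded_op a -> bounded_op b ->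
  a \o b = b \o a -> adj a \o adj b = adj b \o adj a.
Proof. by move=> ba bb h; rewrite -adj_comp// -h adj_comp. Qed.

Lemma commutant_adj S t : S `<=` bounded_op (nu := mu) ->
  commutant (star_closure S) t -> commutant (star_closure S) (adj t).
Proof.
move=> bS [bt ht]; split; first exact: bounded_adj.
move=> s Ss; have bs := star_closure_bounded bS Ss.
rewrite -(adj_invol bs); apply: (adj_comm bt (bounded_adj bs)).
by apply: ht; exact: star_closure_adj.
Qed.

Lemma vN_genP S x : vN_gen S x <-> bounded_op x /\
  forall t, bounded_op t -> (forall s, star_closure S s -> t \o s = s \o t) ->
  x \o t = t \o x.
Proof.
split=> [[bx hx]|[bx hx]]; split => // t.
  by move=> bt ht; apply: hx.
by move=> [bt ht]; apply: hx.
Qed.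

Lemma vN_gen_bounded S x : vN_gen S x -> bounded_op x.
Proof. by move=> [bx _]. Qed.

Lemma sub_vN_gen S : S `<=` bounded_op (nu := mu) -> S `<=` vN_gen S.
Proof.
by move=> bS a Sa; apply/vN_genP; split; [exact: bS|move=> t bt ht; rewrite ht//; left].
Qed.

Lemma vN_gen_adj S x : S `<=` bounded_op (nu := mu) -> vN_gen S x -> vN_gen S (adj x).
Proof.
move=> bS [bx hx]; split; first exact: bounded_adj.
move=> t ct; have [bt _] := ct; rewrite -(adj_invol bt).
apply: (adj_comm bx (bounded_adj bt)).
by apply: hx; exact: commutant_adj.
Qed.

Lemma vN_gen_comp S x y : vN_gen S x -> vN_gen S y -> vN_gen S (x \o y).
Proof.
move=> [bx hx] [b_y hy]; split; first exact: bounded_comp.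
move=> t ct; apply/funext => u /=.
by rewrite -(comp_eqP (y u) (hx t ct)) -(comp_eqP u (hy t ct)).
Qed.

Lemma vN_gen_comb S (c : R[i]) x y : vN_gen S x -> vN_gen S y ->
  vN_gen S (fun u => c *: x u + y u).
Proof.
move=> [bx hx] [b_y hy]; split; first exact: bounded_comb.
move=> t ct; have [bt _] := ct; apply/funext => u /=.
by rewrite bt.1 (comp_eqP u (hx t ct)) (comp_eqP u (hy t ct)).
Qed.

Lemma vN_gen_sub S1 S2 : S1 `<=` bounded_op (nu := mu) -> S2 `<=` bounded_op (nu := mu) ->
  S1 `<=` vN_gen S2 -> vN_gen S1 `<=` vN_gen S2.
Proof.
move=> b1 b2 h x [bx hx]; split => // t [bt ht]; apply: hx; split => //.
have com y : vN_gen S2 y -> t \o y = y \o t by move=> [_ hy]; rewrite hy.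
move=> s [S1s|[a S1a hab]]; first by apply: com; exact: h.
by apply: com; rewrite -(adjE hab); apply: (vN_gen_adj b2); exact: h.
Qed.

Lemma vN_gen_eq S1 S2 : S1 `<=` bounded_op (nu := mu) -> S2 `<=` bounded_op (nu := mu) ->
  S1 `<=` vN_gen S2 -> S2 `<=` vN_gen S1 -> vN_gen S1 = vN_gen S2.
Proof. by move=> b1 b2 h1 h2; apply/seteqP; split; exact: vN_gen_sub. Qed.

End von_Neumann_algebras.

(** * Conjugation by unitaries *)

Section unitary_conjugation.
Context (R : realType) d (T : measurableType d) (mu : {measure set T -> \bar R}).
Context d' (U : measurableType d') (nu : {measure set U -> \bar R}).

(** The inverse is part of the data: it evaluates the selected [adj V], and hence [Ad V],
    explicitly. *)
Definition uni (V : L2 mu -> L2 nu) (V' : L2 nu -> L2 mu) :=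
  [/\ is_adjoint V V', cancel V V' & cancel V' V].

Lemma uni_miso c c' : miso mu nu c c' -> uni (comp_op c) (comp_op c').
Proof.
move=> h; split.
- exact: adjoint_miso.
- by move=> u; rewrite miso_cancel_op//; exact: miso_sym.
- by move=> u; rewrite miso_cancel_op.
Qed.

Lemma uni_bounded V V' : uni V V' -> bounded_op V.
Proof.
move=> [ha K K']; apply/bounded_opP; split; first exact: is_adjoint_linear ha.
by exists 1 => // u; rewrite mul1r /nsq ha K.
Qed.

End unitary_conjugation.

Section conjugation_by_unitary.
Context (R : realType) d (T : measurableType d) (mu : {measure set T -> \bar R}).
Context d' (U : measurableType d') (nu : {measure set U -> \bar R}).
Variables (V : L2 mu -> L2 nu) (V' : L2 nu -> L2 mu) (hV : uni V V').

Lemma uni_sym : uni V' V.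
Proof. by case: hV => ha K K'; split => //; exact: is_adjoint_sym. Qed.

Lemma uni_unitary : unitary V.
Proof.
case: (hV) => ha K K'; split.
- exact: is_adjoint_linear ha.
- by move=> u v; rewrite ha K.
- by move=> v; exists (V' v).
Qed.

Lemma uni_adj : adj V = V'.
Proof. by apply: adjE; case: hV. Qed.

Lemma AdE x : Ad V x = V \o x \o V'.
Proof. by rewrite /Ad uni_adj. Qed.

Lemma Ad_bounded x : bounded_op x -> bounded_op (Ad V x).
Proof.
move=> bx; rewrite AdE; apply: bounded_comp; first exact: uni_bounded uni_sym.
by apply: bounded_comp bx _; exact: uni_bounded hV.
Qed.

Lemma Ad_id : Ad V id = id.
Proof. by rewrite AdE; apply/funext => u /=; case: hV => _ _ K; rewrite K. Qed.

Lemma Ad_comp x y : Ad V (x \o y) = Ad V x \o Ad V y.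
Proof. by rewrite !AdE; apply/funext => u /=; case: hV => _ K _; rewrite K. Qed.

Lemma Ad_adjoint x y : is_adjoint x y -> is_adjoint (Ad V x) (Ad V y).
Proof.
move=> h u v; rewrite !AdE /=; case: hV => ha K K'.
have ha' := is_adjoint_sym ha.
by rewrite ha h -ha'.
Qed.

Lemma Ad_comb c x y : bounded_op x -> bounded_op y ->
  Ad V (fun u => c *: x u + y u) = (fun u => c *: Ad V x u + Ad V y u).
Proof.
move=> bx b_y; rewrite !AdE; apply/funext => u /=.
by rewrite (uni_bounded hV).1.
Qed.

End conjugation_by_unitary.

Section conjugation_injective.
Context (R : realType) d (T : measurableType d) (mu : {measure set T -> \bar R}).
Context d' (U : measurableType d') (nu : {measure set U -> \bar R}).
Variables (V : L2 mu -> L2 nu) (V' : L2 nu -> L2 mu) (hV : uni V V').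

Lemma AdK x : Ad V' (Ad V x) = x.
Proof.
rewrite (AdE (uni_sym hV)) (AdE hV); apply/funext => u /=.
by case: hV => _ K _; rewrite !K.
Qed.

Lemma Ad_inj x y : Ad V x = Ad V y -> x = y.
Proof. by move=> h; rewrite -(AdK x) h AdK. Qed.

End conjugation_injective.

Section conjugation_vN_gen_sub.
Context (R : realType) d (T : measurableType d) (mu : {measure set T -> \bar R}).
Context d' (U : measurableType d') (nu : {measure set U -> \bar R}).

Lemma Ad_vN_gen_sub (V : L2 mu -> L2 nu) (V' : L2 nu -> L2 mu) (S : set (L2 mu -> L2 mu)) x : uni V V' ->
  vN_gen S x -> vN_gen [set Ad V s | s in S] (Ad V x).
Proof.
move=> hV [bx hx]; have hV' := uni_sym hV.
split; first exact: Ad_bounded hV _ bx.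
move=> t [bt ht]; apply: (Ad_inj hV').
rewrite (Ad_comp hV' (Ad V x) t) (Ad_comp hV' t (Ad V x)) (AdK hV x).
apply: hx; split; first exact: Ad_bounded hV' _ bt.
move=> s Ss; apply: (Ad_inj hV).
rewrite (Ad_comp hV (Ad V' t) s) (Ad_comp hV s (Ad V' t)) (AdK hV' t).
apply: ht; case: Ss => [Ss|[a Sa hab]]; first by left; exists s.
by right; exists (Ad V a); [exists a|exact: Ad_adjoint hV _ _ hab].
Qed.

End conjugation_vN_gen_sub.

Section conjugation_vN_gen.
Context (R : realType) d (T : measurableType d) (mu : {measure set T -> \bar R}).
Context d' (U : measurableType d') (nu : {measure set U -> \bar R}).

Lemma Ad_vN_gen (V : L2 mu -> L2 nu) (V' : L2 nu -> L2 mu) (S : set (L2 mu -> L2 mu)) : uni V V' ->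
  vN_gen [set Ad V s | s in S] = [set Ad V x | x in vN_gen S].
Proof.
move=> hV; have hV' := uni_sym hV; apply/seteqP; split => [y hy|_ [x hx <-]]; last first.
  exact: Ad_vN_gen_sub hV hx.
exists (Ad V' y); last exact: (AdK hV').
have := Ad_vN_gen_sub hV' hy; congr vN_gen.
apply/seteqP; split => [_ [_ [s Ss <-] <-]|s Ss].
  by rewrite (AdK hV).
by exists (Ad V s); [exists s|exact: (AdK hV)].
Qed.

Lemma uni_star_hom (V : L2 mu -> L2 nu) (V' : L2 nu -> L2 mu) M : uni V V' ->
  M `<=` bounded_op (nu := mu) -> star_hom M (Ad V).
Proof.
move=> hV bM; split.
- by move=> a /bM; exact: Ad_bounded hV _.
- by move=> c a b /bM ba /bM bb; exact: Ad_comb hV _ _ _ ba bb.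
- by move=> a b _ _; exact: Ad_comp hV _ _.
- by move=> a b _ _; exact: Ad_adjoint hV _ _.
Qed.

End conjugation_vN_gen.

Section unitary_composition.
Context (R : realType) d (T : measurableType d) (mu : {measure set T -> \bar R}).
Context d' (U : measurableType d') (nu : {measure set U -> \bar R}).
Context d'' (W : measurableType d'') (xi : {measure set W -> \bar R}).

Lemma uni_comp (V : L2 mu -> L2 nu) V' (V1 : L2 nu -> L2 xi) V1' :
  uni V V' -> uni V1 V1' -> uni (V1 \o V) (V' \o V1').
Proof.
move=> [a K K'] [a1 K1 K1']; split.
- exact: is_adjoint_comp.
- by move=> u /=; rewrite K1 K.
- by move=> u /=; rewrite K' K1'.
Qed.

Lemma Ad_Ad (V : L2 mu -> L2 nu) V' (V1 : L2 nu -> L2 xi) V1' x :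
  uni V V' -> uni V1 V1' -> Ad V1 (Ad V x) = Ad (V1 \o V) x.
Proof.
by move=> hV hV1; rewrite (AdE hV1) (AdE hV) (AdE (uni_comp hV hV1)).
Qed.

End unitary_composition.

(** * Amplifications and their slices *)

Section amplification.
Context (R : realType).
Context d1 (T1 : measurableType d1) (m1 : {sigma_finite_measure set T1 -> \bar R}).
Context d2 (T2 : measurableType d2) (m2 : {sigma_finite_measure set T2 -> \bar R}).

(** The operator |e><f|. *)
Definition rank1 (e f : L2 m2) (v : L2 m2) : L2 m2 := inner v f *: e.

Lemma bounded_rank1 e f : bounded_op (rank1 e f).
Proof.
apply/bounded_opP; split.
  by move=> c u v; rewrite /rank1 innerDl innerZl scalerDl scalerA.
exists (nsq f * nsq e); first by rewrite mulr_ge0// nsq_ge0.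
move=> u; rewrite nsqZ mulrAC ler_wpM2r ?nsq_ge0// mulrC.
exact: cauchy_schwarz.
Qed.

Lemma tens_op_rank1 e f :
  tens_op (@id (L2 m1)) (rank1 e f) = ins e \o adj (ins f).
Proof.
apply/esym/tens_op_uniq.
- exact: bounded_id.
- exact: bounded_rank1.
- by apply: bounded_comp; [apply: bounded_adj; exact: bounded_ins|exact: bounded_ins].
- by move=> u v /=; rewrite adj_ins_tens /ins /rank1 tensZl tensZr.
Qed.

Definition ampl (a : L2 m1 -> L2 m1) := tens_op a (@id (L2 m2)).

(** The matrix coefficient of [t] at [e], [f] in the second factor, an operator on the first. *)
Definition slice (e f : L2 m2) (t : L2 (m1 \X m2) -> L2 (m1 \X m2)) : L2 m1 -> L2 m1 :=
  adj (ins e) \o t \o ins f.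

Lemma bounded_slice e f t : bounded_op t -> bounded_op (slice e f t).
Proof.
move=> bt; apply: bounded_comp; first exact: bounded_ins.
by apply: bounded_comp bt _; apply: bounded_adj; exact: bounded_ins.
Qed.

Lemma bounded_ampl a : bounded_op a -> bounded_op (ampl a).
Proof. by move=> ba; apply: bounded_tens_op => //; exact: bounded_id. Qed.

Lemma amplE a u v : bounded_op a -> ampl a (tens u v) = tens (a u) v.
Proof. by move=> ba; rewrite /ampl tens_opE//; exact: bounded_id. Qed.

Lemma ampl_uniq a c : bounded_op a -> bounded_op c ->
  (forall u v, c (tens u v) = tens (a u) v) -> c = ampl a.
Proof. by move=> ba bc h; apply: tens_op_uniq => //; exact: bounded_id. Qed.

Lemma ampl_comp a b : bounded_op a -> bounded_op b ->
  ampl (a \o b) = ampl a \o ampl b.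
Proof. by move=> ba bb; rewrite /ampl tens_op_comp//; exact: bounded_id. Qed.

Lemma ampl_adjoint a b : bounded_op a -> is_adjoint a b -> is_adjoint (ampl a) (ampl b).
Proof.
move=> ba h; apply: tens_op_adjoint => //; first exact: bounded_id.
Qed.

Lemma slice_ampl a e : bounded_op a -> nsq e = 1 -> slice e e (ampl a) = a.
Proof.
move=> ba e1; apply/funext => u; rewrite /slice /= /ins amplE//.
by rewrite adj_ins_tens inner_self e1 scale1r.
Qed.

Lemma ampl_inj a b (e : L2 m2) : bounded_op a -> bounded_op b -> nsq e = 1 ->
  ampl a = ampl b -> a = b.
Proof. by move=> ba bb e1 h; rewrite -(slice_ampl ba e1) h slice_ampl. Qed.

Lemma ampl_ins a e : bounded_op a -> ampl a \o ins e = ins e \o a.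
Proof. by move=> ba; apply/funext => u; rewrite /= /ins amplE. Qed.

Lemma adj_ins_ampl a e : bounded_op a -> adj (ins e) \o ampl a = a \o adj (ins e).
Proof.
move=> ba; apply: bounded_tens_ext.
- apply: bounded_comp; first exact: bounded_ampl.
  by apply: bounded_adj; exact: bounded_ins.
- apply: bounded_comp ba.
  by apply: bounded_adj; exact: bounded_ins.
- by move=> u v /=; rewrite amplE// !adj_ins_tens (linZ _ _ ba.1).
Qed.

Lemma slice_comm t a e f : bounded_op a -> t \o ampl a = ampl a \o t ->
  slice e f t \o a = a \o slice e f t.
Proof.
move=> ba h; apply/funext => u; rewrite /slice /=.
rewrite -(comp_eqP u (ampl_ins f ba)) (comp_eqP (ins f u) h) /=.
exact: (comp_eqP (t (ins f u)) (adj_ins_ampl e ba)).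
Qed.

Lemma slice_ext t t' : bounded_op t -> bounded_op t' ->
  (forall e f, slice e f t = slice e f t') -> t = t'.
Proof.
move=> bt bt' h; apply: bounded_tens_ext => // u v; apply: ext_adj_ins => e.
exact: (congr1 (fun g => g u) (h e v)).
Qed.

(** Since v = |v><e0| e0, commutation with 1 (x) |v><e0| expresses t (u (x) v) through t (u (x) e0),
    and only its coefficient at [e0] survives. *)
Lemma comm_rank1_ampl t e0 : bounded_op t -> nsq e0 = 1 ->
  (forall e, t \o tens_op id (rank1 e e0) = tens_op id (rank1 e e0) \o t) ->
  t = ampl (slice e0 e0 t).
Proof.
move=> bt e1 h; apply: ampl_uniq => //; first exact: bounded_slice.
move=> u v; have := congr1 (fun g => g (tens u e0)) (h v).
rewrite /= tens_op_rank1 /= adj_ins_tens inner_self e1 scale1r.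
by move=> ->.
Qed.

(** Slices of an operator commuting with the amplified generators commute with the generators, hence
    with [a]; and slices separate operators. *)
Lemma vN_gen_ampl_sub (S : set (L2 m1 -> L2 m1)) a :
  S `<=` bounded_op (nu := m1) -> vN_gen S a -> vN_gen [set ampl s | s in S] (ampl a).
Proof.
move=> bS [ba ha]; split; first exact: bounded_ampl.
move=> t [bt ht].
apply: slice_ext.
- exact: bounded_comp bt (bounded_ampl ba).
- exact: bounded_comp (bounded_ampl ba) bt.
move=> e f.
have ct : commutant (star_closure S) (slice e f t).
  split; first exact: bounded_slice.
  move=> s Ss; apply: slice_comm; first exact: star_closure_bounded Ss.
  apply: ht; case: Ss => [Ss|[x Sx hx]]; first by left; exists s.
  right; exists (ampl x); first by exists x.
  exact: ampl_adjoint (bS _ Sx) hx.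
have h1 : slice e f (ampl a \o t) = a \o slice e f t.
  apply/funext => u; rewrite /slice /=.
  exact: (comp_eqP (t (ins f u)) (adj_ins_ampl e ba)).
have h2 : slice e f (t \o ampl a) = slice e f t \o a.
  apply/funext => u; rewrite /slice /=.
  by have /= -> := comp_eqP u (ampl_ins f ba).
by rewrite h1 h2 ha.
Qed.

Lemma comm_ampl_idtens a c : bounded_op a -> bounded_op c ->
  tens_op id c \o ampl a = ampl a \o tens_op id c.
Proof.
move=> ba bc; rewrite /ampl; have b1 := bounded_id m1; have b2 := bounded_id m2.
exact: etrans (tens_op_comp b1 ba bc b2) (esym (tens_op_comp ba b1 b2 bc)).
Qed.

Lemma vN_gen_ampl (S : set (L2 m1 -> L2 m1)) (e : L2 m2) : nsq e = 1 ->
  S `<=` bounded_op (nu := m1) ->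
  vN_gen [set ampl s | s in S] = [set ampl a | a in vN_gen S].
Proof.
move=> e1 bS; apply/seteqP; split => [b [bb hb]|_ [a ha <-]]; last exact: vN_gen_ampl_sub.
have bE : b = ampl (slice e e b).
  apply: comm_rank1_ampl => // f.
  apply: hb; split; first by apply: bounded_tens_op; [exact: bounded_id|exact: bounded_rank1].
  move=> s' [[s Ss <-]|[a' [s Ss <-] hs]].
    by apply: comm_ampl_idtens; [exact: bS|exact: bounded_rank1].
  have bs := bS _ Ss.
  rewrite -(adjE hs) (adjE (ampl_adjoint bs (adjP bs))).
  by apply: comm_ampl_idtens; [exact: bounded_adj|exact: bounded_rank1].
exists (slice e e b) => //; split; first exact: bounded_slice.
move=> t [bt ht]; have bse : bounded_op (slice e e b) by exact: bounded_slice.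
apply: (@ampl_inj _ _ e); [exact: bounded_comp|exact: bounded_comp|exact: e1|].
rewrite (ampl_comp bse bt) (ampl_comp bt bse) -bE.
apply: hb; split; first exact: bounded_ampl.
move=> s' [[s Ss <-]|[a' [s Ss <-] hs]].
  have bs := bS _ Ss.
  exact: etrans (esym (ampl_comp bt bs)) (etrans (congr1 ampl (ht _ (or_introl Ss))) (ampl_comp bs bt)).
have bs := bS _ Ss; have bs' := bounded_adj bs.
rewrite -(adjE hs) (adjE (ampl_adjoint bs (adjP bs))).
have hs' : star_closure S (adj s) by right; exists s; [|exact: adjP].
exact: etrans (esym (ampl_comp bt bs')) (etrans (congr1 ampl (ht _ hs')) (ampl_comp bs' bt)).
Qed.

End amplification.
Arguments ampl {R d1 T1 m1 d2 T2} m2 a _.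

Section tensor_maps.
Context (R : realType).
Context d1 (T1 : measurableType d1) (m1 : {sigma_finite_measure set T1 -> \bar R}).
Context d2 (T2 : measurableType d2) (m2 : {sigma_finite_measure set T2 -> \bar R}).
Context d3 (T3 : measurableType d3) (m3 : {sigma_finite_measure set T3 -> \bar R}).
Context d4 (T4 : measurableType d4) (m4 : {sigma_finite_measure set T4 -> \bar R}).

Lemma miso_assoc : miso (m1 \X (m2 \X m3)) (m1 \X m2 \X m3)
  (@assoc_pair T1 T2 T3) (@unassoc_pair T1 T2 T3).
Proof.
apply: miso_cancel; first exact: mpres_assoc.
  exact: (mpres_unassoc m1 m2 m3).1.
by move=> [[]].
Qed.

Lemma comp_assoc_tens (u : L2 m1) (v : L2 m2) (w : L2 m3) :
  comp_op (@assoc_pair T1 T2 T3) (tens u (tens v w)) = tens (tens u v) w.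
Proof.
have ha := mpres_assoc m1 m2 m3; apply/L2P.
apply: filterS3 (filterI (comp_opE ha (tens u (tens v w))) (tensE (tens u v) w))
  (filterI (ae_mpres ha (tensE u (tens v w)))
     (ae_mpres ha (@ae_snd _ _ _ m1 _ _ (m2 \X m3) _ (tensE v w))))
  (@ae_fst _ _ _ (m1 \X m2) _ _ m3 _ (tensE u v)).
by move=> x [e1 e2] [e3 e4] e5; rewrite e1 e2 e3 e4 e5 mulrA.
Qed.

Lemma miso_map (f : T1 -> T3) f' (g : T2 -> T4) g' :
  mpres m1 m3 f -> measurable_fun setT f' -> cancel f f' ->
  mpres m2 m4 g -> measurable_fun setT g' -> cancel g g' ->
  miso (m3 \X m4) (m1 \X m2) (map_pair f g) (map_pair f' g').
Proof.
move=> hf mf' Kf hg mg' Kg; apply: miso_cancel; first exact: mpres_map.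
- by apply/measurable_fun_pair; exact: measurableT_comp.
- by move=> [x y]; rewrite /map_pair /= Kf Kg.
Qed.

Lemma comp_map_tens (f : T1 -> T3) (g : T2 -> T4) (u : L2 m3) (v : L2 m4) :
  mpres m1 m3 f -> mpres m2 m4 g ->
  comp_op (nu := m1 \X m2) (map_pair f g) (tens u v) = tens (comp_op f u) (comp_op g v).
Proof.
move=> hf hg; have h := mpres_map hf hg; apply/L2P.
apply: filterS3 (filterI (comp_opE h (tens u v)) (tensE (comp_op f u) (comp_op g v)))
  (ae_mpres h (tensE u v))
  (filterI (@ae_fst _ _ _ m1 _ _ m2 _ (comp_opE hf u))
     (@ae_snd _ _ _ m1 _ _ m2 _ (comp_opE hg v))).
by move=> x [e1 e2] e3 [e4 e5]; rewrite e1 e2 e3 e4 e5.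
Qed.

End tensor_maps.

Section tensor_Ad.
Context (R : realType).
Context d1 (T1 : measurableType d1) (m1 : {sigma_finite_measure set T1 -> \bar R}).
Context d2 (T2 : measurableType d2) (m2 : {sigma_finite_measure set T2 -> \bar R}).
Context d3 (T3 : measurableType d3) (m3 : {sigma_finite_measure set T3 -> \bar R}).

Lemma comp_unassoc_tens (u : L2 m1) (v : L2 m2) (w : L2 m3) :
  comp_op (@unassoc_pair T1 T2 T3) (tens (tens u v) w) = tens u (tens v w).
Proof.
rewrite -comp_assoc_tens; apply: miso_cancel_op; apply: miso_sym; exact: miso_assoc.
Qed.

Lemma tens_linr (u : L2 m1) : bounded_op (tens u : L2 m2 -> L2 (m1 \X m2)).
Proof.
apply/bounded_opP; split; first by move=> c v w; rewrite tensDr tensZr.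
by exists (nsq u); [exact: nsq_ge0|move=> v; rewrite nsq_tens].
Qed.

Lemma bounded_tens3_ext d (T : measurableType d) (m : {measure set T -> \bar R})
    (c c' : L2 (m1 \X m2 \X m3) -> L2 m) : bounded_op c -> bounded_op c' ->
  (forall u v w, c (tens (tens u v) w) = c' (tens (tens u v) w)) -> c = c'.
Proof.
move=> bc bc' h; apply: bounded_tens_ext => // z w.
have := @bounded_tens_ext _ _ _ m1 _ _ m2 _ _ m (c \o ins w) (c' \o ins w).
move=> /(_ (bounded_comp (bounded_ins _ w) bc) (bounded_comp (bounded_ins _ w) bc')).
by move=> /(_ (fun u v => h u v w)) /(congr1 (fun f => f z)).
Qed.

Lemma uni_assoc : uni (@comp_op _ _ _ (m1 \X (m2 \X m3)) _ _ (m1 \X m2 \X m3) (@assoc_pair T1 T2 T3))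
  (comp_op (@unassoc_pair T1 T2 T3)).
Proof. exact: uni_miso (miso_assoc m1 m2 m3). Qed.

Lemma Ad_assoc_tens a b c : bounded_op a -> bounded_op b -> bounded_op c ->
  Ad (@comp_op _ _ _ (m1 \X (m2 \X m3)) _ _ (m1 \X m2 \X m3) (@assoc_pair T1 T2 T3))
    (tens_op a (tens_op b c)) = tens_op (tens_op a b) c.
Proof.
move=> ba bb bc; have hu := uni_assoc.

have bbc := bounded_tens_op bb bc; have bab := bounded_tens_op ba bb.
apply: bounded_tens3_ext.
- by apply: (Ad_bounded hu); exact: bounded_tens_op.
- exact: bounded_tens_op.
- move=> u v w; rewrite (AdE hu) /= comp_unassoc_tens (tens_opE _ _ ba bbc).
  by rewrite (tens_opE _ _ bb bc) comp_assoc_tens (tens_opE _ _ bab bc) (tens_opE _ _ ba bb).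
Qed.

End tensor_Ad.

Section tensor_Ad_swap.
Context (R : realType).
Context d1 (T1 : measurableType d1) (m1 : {sigma_finite_measure set T1 -> \bar R}).
Context d2 (T2 : measurableType d2) (m2 : {sigma_finite_measure set T2 -> \bar R}).

Lemma uni_swap : uni (@comp_op _ _ _ (m2 \X m1) _ _ (m1 \X m2) (@swap_pair T1 T2))
  (comp_op (@swap_pair T2 T1)).
Proof. exact: uni_miso (miso_swap m1 m2). Qed.

Lemma Ad_swap_tens a b : bounded_op a -> bounded_op b ->
  Ad (@comp_op _ _ _ (m2 \X m1) _ _ (m1 \X m2) (@swap_pair T1 T2)) (tens_op b a) = tens_op a b.
Proof.
move=> ba bb; have hu := uni_swap.
apply: tens_op_uniq => //; first by apply: (Ad_bounded hu); exact: bounded_tens_op.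
by move=> u v; rewrite (AdE hu) /= comp_swap_tens (tens_opE _ _ bb ba) comp_swap_tens.
Qed.

Lemma vN_gen_idtens (S : set (L2 m2 -> L2 m2)) (e : L2 m1) : nsq e = 1 ->
  S `<=` bounded_op (nu := m2) ->
  vN_gen [set tens_op (@id (L2 m1)) s | s in S] = [set tens_op id a | a in vN_gen S].
Proof.
move=> e1 bS; have hu := uni_swap; have bi := bounded_id m1.
have E (P : set (L2 m2 -> L2 m2)) : P `<=` bounded_op (nu := m2) ->
    [set tens_op (@id (L2 m1)) s | s in P] =
    [set Ad (comp_op (@swap_pair T1 T2)) x | x in [set ampl m1 s | s in P]].
  move=> bP; apply/seteqP; split => [_ [s Ps <-]|_ [_ [s Ps <-] <-]].
    exists (ampl m1 s); first by exists s.
    by rewrite -(Ad_swap_tens bi (bP _ Ps)).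
  by exists s => //; rewrite -(Ad_swap_tens bi (bP _ Ps)).
rewrite E// (Ad_vN_gen _ hu) (vN_gen_ampl e1 bS) E//.
by move=> x; exact: vN_gen_bounded.
Qed.

Lemma vN_gen_all : vN_gen (all_ops m2) = all_ops m2.
Proof.
apply/seteqP; split => x; first exact: vN_gen_bounded.
by apply: sub_vN_gen.
Qed.

Lemma tens_op_scalarl (c : R[i]) (b : L2 m2 -> L2 m2) : bounded_op b ->
  tens_op (fun u : L2 m1 => c *: u) b = tens_op id (fun v => c *: b v).
Proof.
move=> bb; have bc : bounded_op (fun u : L2 m1 => c *: u).
  apply/bounded_opP; split.
    by move=> k u v; rewrite scalerDr !scalerA mulrC.
  by exists (sqabs c); [exact: sqabs_ge0|move=> u; rewrite nsqZ].
have bcb : bounded_op (fun v => c *: b v).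
  have := bounded_comb c bb (@bounded_op0 _ _ _ m2 _ _ m2).
  by under eq_fun do rewrite addr0.
apply: tens_op_uniq => //; first exact: bounded_id.
  exact: bounded_tens_op.
by move=> u v; rewrite tens_opE// tensZl tensZr.
Qed.

(** A scalar in the first factor is absorbed by the second, so that the generators are exactly the
    operators 1 (x) b. *)
Lemma vN_tens_scalar_all (e : L2 m1) : nsq e = 1 ->
  vN_tens (scalar_ops m1) (all_ops m2) = [set tens_op id b | b in all_ops m2].
Proof.
move=> e1; rewrite -[in RHS]vN_gen_all -(vN_gen_idtens e1)//.
rewrite /vN_tens; congr vN_gen; apply/seteqP; split.
  move=> _ [_ [c _ <-] [b bb <-]]; exists (fun v => c *: b v).
    have := bounded_comb c bb (@bounded_op0 _ _ _ m2 _ _ m2).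
    by under eq_fun do rewrite addr0.
  by rewrite tens_op_scalarl.
move=> _ [b bb <-]; exists id => //; last by exists b.
by exists 1 => //; apply/funext => u; rewrite scale1r.
Qed.

Lemma ampl_mulop f : Linf m1 f -> ampl m2 (@mulop _ _ _ m1 f) = mulop (fun w : T1 * T2 => f w.1).
Proof.
move=> lf; have lf1 : Linf (m1 \X m2) (fun w => f w.1).
  split; first exact: cmeasurable_fst lf.1.
  by have [M hM] := lf.2; exists M; exact: ae_fst hM.
apply/esym/ampl_uniq; [exact: bounded_mulop|exact: bounded_mulop|move=> u v; apply/L2P].
apply: filterS3 (filterI (mulopE (tens u v) lf1) (tensE u v)) (tensE (mulop f u) v)
  (@ae_fst _ _ _ m1 _ _ m2 _ (mulopE u lf)) => w [e1 e2] e3 e4.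
by rewrite e1 e2 e3 e4 mulrA.
Qed.

End tensor_Ad_swap.

Section unit_vector.
Context (R : realType) d (T : measurableType d) (m : {sigma_finite_measure set T -> \bar R}).

Lemma unit_exists : (0 < m setT)%E -> exists e : L2 m, nsq e = 1.
Proof.
move=> m0; have /sigma_finiteP[F [TF ndF Foo]] := sigma_finiteT m.
have [n Fn] : exists n, (0 < m (F n))%E.
  apply: contrapT => h; have F0 n : m (F n) = 0%E.
    apply/eqP; rewrite eq_le measure_ge0 andbT leNgt; apply/negP => h0.
    by apply: h; exists n.
  have : m setT = 0%E; last by move=> h'; move: m0; rewrite h' ltxx.
  rewrite TF; apply/eqP; rewrite eq_le measure_ge0 andbT.
  have mF n : measurable (F n) by have [] := Foo n.
  apply: le_trans (@measure_sigma_subadditive _ _ _ m _ _ mF _ (@subset_refl _ _)) _.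
    exact: bigcup_measurable.
  by rewrite eseries0// => n _ _; exact: F0.
have [mF Fnoo] := Foo n.
have s := sqint_indic mF Fnoo.
pose u := toL2 m (fun x => (\1_(F n) x : R)%:C).
have nu : (nsq u)%:E = m (F n).
  rewrite -sqabs_integral (ge0_ae_eq_integral (g := fun x => (\1_(F n) x : R)%:E))//.
  - by rewrite integral_indic// setIT.
  - by apply/measurable_EFinP/measurable_sqabs/L2_meas.
  - exact/measurable_EFinP/measurable_indic.
  - by move=> x _; rewrite lee_fin sqabs_ge0.
  - apply: filterS (toL2E s) => x e _; rewrite e sqabs_real indicE.
    by case: (_ \in _); rewrite ?expr1n ?expr0n.
have u0 : 0 < nsq u by rewrite -lte_fin nu.
exists ((Num.sqrt (nsq u))^-1%:C *: u).
by rewrite nsqZ sqabs_real exprVn sqr_sqrtr ?nsq_ge0// mulVf// gt_eqF.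
Qed.

End unit_vector.

(** * Decomposable operators *)

Section masa.
Context (R : realType) d (T : measurableType d) (m : {sigma_finite_measure set T -> \bar R}).

Lemma sqint_positive : exists2 w : T -> R, measurable_fun setT w &
  (forall x, 0 < w x) /\ square_integrable m (fun x => (w x)%:C).
Proof.
have /sigma_finiteP[F [TF ndF Foo]] := sigma_finiteT m.
have mF n : measurable (F n) by have [] := Foo n.
(* The power of 2 keeps the sum of the c_n 1_(F n) below 1; dividing by 1 + m(F n) keeps its
   integral below 1 as well. The square root of this sum is the function sought. *)
pose c n : R := (2 ^ n.+1)%:R^-1 / (1 + fine (m (F n))).
have c0 n : 0 < c n.
  rewrite divr_gt0// ?invr_gt0 ?ltr0n ?expn_gt0//.
  by rewrite ltr_pwDl// fine_ge0.
pose h n x : \bar R := (c n * \1_(F n) x)%:E.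
have h0 n x : (0 <= h n x)%E by rewrite lee_fin mulr_ge0// ltW.
pose g x := (\sum_(n <oo) h n x)%E.
have mh n : measurable_fun setT (h n).
  by apply/measurable_EFinP; apply: measurable_funM => //; exact: measurable_indic.
have mg : measurable_fun setT g by exact: ge0_emeasurable_sum.
have g1 x : (g x <= 1%:E)%E.
  apply: le_trans (@epsilon_trick0 R 1 xpredT _) => //.
  apply: lee_nneseries => [i _ _|n _]; first exact: h0.
  rewrite lee_fin mul1r indicE; case: (_ \in _); rewrite ?mulr0 ?mulr1 ?invr_ge0//.
  rewrite ler_pdivrMr; last by rewrite ltr_pwDl// fine_ge0.
  by rewrite ler_peMr ?invr_ge0// lerDl fine_ge0.
have gfin x : g x \is a fin_num.
  rewrite ge0_fin_numE; first exact: le_lt_trans (g1 x) (ltry _).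
  by apply: nneseries_ge0 => n _ _.
have gpos x : (0 < g x)%E.
  have : [set: T] x by []. rewrite TF => -[n _ Fn].
  apply: (@lt_le_trans _ _ (h n x)); first by rewrite lte_fin indicE mem_set// mulr1.
  rewrite /g (@nneseriesD1 _ (h^~ x) n xpredT)//.
  by rewrite leeDl//; apply: nneseries_ge0 => k _ _.
have gint : (\int[m]_x g x < +oo)%E.
  rewrite integral_nneseries//; apply: (@le_lt_trans _ _ 1%:E); last exact: ltry.
  apply: le_trans (@epsilon_trick0 R 1 xpredT _) => //.
  apply: lee_nneseries => [i _ _|n _]; first by apply: integral_ge0 => x _; exact: h0.
  under eq_integral do rewrite /h EFinM.
  rewrite ge0_integralZl//; [|by apply/measurable_EFinP; exact: measurable_indic
    |by rewrite lee_fin ltW].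
  rewrite integral_indic// setIT mul1r.
  have Fn : m (F n) \is a fin_num by rewrite ge0_fin_numE//; have [] := Foo n.
  rewrite [X in (_ * X)%E](_ : _ = (fine (m (F n)))%:E); last by rewrite fineK.
  rewrite -EFinM lee_fin mulrAC -mulrA ler_piMr ?invr_ge0//.
  by rewrite ler_pdivrMr ?mul1r ?lerDr// ltr_pwDl// fine_ge0.
exists (fun x => Num.sqrt (fine (g x))).
  apply: measurableT_comp; first by apply: continuous_measurable_fun; exact: sqrt_continuous.
  exact: measurableT_comp.
split; first by move=> x; rewrite sqrtr_gt0 fine_gt0// gpos (le_lt_trans (g1 x) (ltry _)).
split.
  apply: cmeasurable_real; apply: measurableT_comp; first by apply: continuous_measurable_fun; exact: sqrt_continuous.
  exact: measurableT_comp.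
apply: le_lt_trans gint; rewrite le_eqVlt; apply/orP; left; apply/eqP.
apply: eq_integral => x _; rewrite sqabs_real sqr_sqrtr ?fineK//.
by rewrite fine_ge0// ltW.
Qed.

(** A nowhere vanishing [w] is cyclic for L^oo: a vector orthogonal to all 1_E w has a product with
    [w] whose integral over each E is zero. *)
Lemma total_Linf_mul (w : T -> R) (sw : square_integrable m (fun x => (w x)%:C)) :
  (forall x, 0 < w x) ->
  total_in [set mulop g (toL2 m (fun x => (w x)%:C)) | g in Linf m].
Proof.
move=> w0 z hz.
pose h x := (w x)%:C * conjc (z x).
have hi : cintegrable m h by apply: sq_cintegrable => //; exact: L2_sqint.
have hE E : measurable E -> cintegral m (fun x => (\1_E x : R)%:C * h x) = 0.
  move=> mE; have lE := @Linf_indic _ _ _ m _ mE.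
  rewrite -(hz (mulop (fun x => (\1_E x : R)%:C) (toL2 m (fun x => (w x)%:C)))); last first.
    by exists (fun x => (\1_E x : R)%:C).
  rewrite (@inner_ae _ _ _ _ _ z (fun x => (\1_E x : R)%:C * (w x)%:C) z).
  - by apply: eq_cintegral => x; rewrite mulrA.
  - by apply: cmeasurableM; [exact: lE.1|exact: sw.1].
  - exact: L2_meas.
  - apply: filterS2 (mulopE (toL2 m (fun x => (w x)%:C)) lE) (toL2E sw) => x e1 e2.
    by rewrite e1 e2.
  - exact: nearW.
have key (phi : R[i] -> R) : (forall (r : R) u, phi (r%:C * u) = r * phi u) ->
   m.-integrable setT (EFin \o (phi \o h)) ->
   (forall E, measurable E -> \int[m]_x phi ((\1_E x)%:C * h x) = 0) ->
   {ae m, forall x, phi (h x) = 0}.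
  move=> phiZ ip ph0.
  have H0 : ae_eq m setT (EFin \o (phi \o h)) (cst 0%E).
    apply: integral_ae_eq => // E _ mE.
    rewrite integral0.
    have fin : (\int[m]_(x in E) ((phi \o h) x)%:E)%E \is a fin_num.
      by apply: integrable_fin_num => //; apply: integrableS ip.
    rewrite -(fineK fin); congr EFin; rewrite -[RHS](ph0 E mE).
    rewrite -/(Rintegral _ _ _) Rintegral_mkcond; apply: eq_Rintegral => x _.
    rewrite phiZ patchE /= !indicE.
    by case: (_ \in _); rewrite ?mul1r ?mul0r.
  by apply: filterS H0 => x /(_ I) /= [->].
have hr := key (@complex.Re R) _ (cintegrable_Re hi) _.
have him := key (@complex.Im R) _ (cintegrable_Im hi) _.
apply/L2P; apply: filterS3 (hr _ _) (him _ _) (L2_0E m) => [x e1 e2 e3||E mE||E mE].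
- have /eqP : h x = 0 by exact: complex_ext.
  rewrite e3 /h mulf_eq0 conjc_eq0 => /orP[|/eqP//].
  by rewrite eq_complex /= gt_eqF.
- by move=> r [a b] /=; ring.
- by have /(congr1 (@complex.Re R)) := hE E mE.
- by move=> r [a b] /=; ring.
- by have /(congr1 (@complex.Im R)) := hE E mE.
Qed.

(* With w > 0 square integrable, t must be multiplication by t(w)/w. *)
Lemma Linf_masa (t : L2 m -> L2 m) : bounded_op t ->
  (forall g, Linf m g -> t \o mulop g = mulop g \o t) ->
  exists2 tau, Linf m tau & t = mulop tau.
Proof.
move=> bt ht; have [w mw [w0 sw]] := sqint_positive.
pose W := toL2 m (fun x => (w x)%:C).
pose tau x := t W x * ((w x)^-1)%:C.
have mwV : measurable_fun setT (fun x => (w x)^-1).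
  rewrite (_ : (fun x => _) = (fun r => r `^ (-1)) \o w).
    exact: measurableT_comp mw.
  by apply/funext => x /=; rewrite powR_inv1// ltW.
have mtau : cmeasurable tau.
  by apply: cmeasurableM; [exact: L2_meas|exact: cmeasurable_real].
have tauW x : tau x * (w x)%:C = t W x.
  by rewrite /tau -mulrA -rmorphM /= mulVf ?mulr1// gt_eqF.
have tE g : Linf m g -> {ae m, forall x, t (mulop g W) x = g x * (tau x * (w x)%:C)}.
  move=> lg; have e := comp_eqP W (ht g lg).
  by rewrite e; apply: filterS (mulopE (t W) lg) => x h; rewrite h tauW.
have [_ [M M0 tM]] := (bounded_opP t).1 bt.
have ltau : Linf m tau.
  split => //; exists M.
  (* On this set |tau|^2 exceeds the bound of [t], while the integral of |tau|^2 w^2 over it is |t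
     (1_E w)|^2, at most M times that of w^2. As w > 0, the set is null. *)
  pose E := [set x | M < sqabs (tau x)].
  have mE : measurable E.
    have := measurable_fun_ltr (measurable_cst M) (measurable_sqabs mtau).
    by move=> /(_ measurableT [set true]); rewrite setTI; apply.
  have lE := @Linf_indic _ _ _ m _ mE.
  pose B x := \1_E x * (sqabs (tau x) * w x ^+ 2); pose A x := \1_E x * (M * w x ^+ 2).
  have mw2 : measurable_fun setT (fun x => w x ^+ 2) by exact: measurable_funX.
  have mA : measurable_fun setT A.
    by apply: measurable_funM; [exact: measurable_indic|exact: measurable_funM].
  have mB : measurable_fun setT B.
    apply: measurable_funM; first exact: measurable_indic.
    by apply: measurable_funM => //; exact: measurable_sqabs.
  have ind2 x : sqabs ((\1_E x : R)%:C) = \1_E x :> R.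
    by rewrite sqabs_real indicE; case: (_ \in _); rewrite ?expr1n ?expr0n.
  have i0 x : 0 <= \1_E x :> R by rewrite indicE ler0n.
  have A0 x : 0 <= A x by apply: mulr_ge0 => //; apply: mulr_ge0 => //; exact: sqr_ge0.
  have B0 x : 0 <= B x.
    apply: mulr_ge0 => //; apply: mulr_ge0; [exact: sqabs_ge0|exact: sqr_ge0].
  pose u := mulop (fun x => (\1_E x : R)%:C) W.
  have intB : (\int[m]_x (B x)%:E = (nsq (t u))%:E)%E.
    rewrite -sqabs_integral; apply: ge0_ae_eq_integral => //.
    - exact/measurable_EFinP.
    - by apply/measurable_EFinP/measurable_sqabs/L2_meas.
    - by move=> x _; rewrite lee_fin.
    - by move=> x _; rewrite lee_fin sqabs_ge0.
    - apply: filterS (tE _ lE) => x e _.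
      by rewrite e (sqabsM _ (tau x * _)) ind2 (sqabsM (tau x)) sqabs_real.
  have intA : (\int[m]_x (A x)%:E = M%:E * (nsq u)%:E)%E.
    rewrite -sqabs_integral -ge0_integralZl//; last 2 first.
    - by apply/measurable_EFinP/measurable_sqabs/L2_meas.
    - by move=> x _; rewrite lee_fin sqabs_ge0.
    apply: ge0_ae_eq_integral => //.
    - exact/measurable_EFinP.
    - apply: measurable_funeM.
      by apply/measurable_EFinP/measurable_sqabs/L2_meas.
    - by move=> x _; rewrite lee_fin.
    - by move=> x _; rewrite -EFinM lee_fin mulr_ge0 ?sqabs_ge0.
    - apply: filterS2 (mulopE W lE) (toL2E sw) => x e1 e2 _.
      by rewrite e1 e2 sqabsM ind2 sqabs_real -EFinM mulrCA.
  pose k x := B x - A x.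
  have k0 x : 0 <= k x.
    rewrite /k /B /A -mulrBr -mulrBl indicE; have [xE|xE] := boolP (x \in E).
      rewrite mul1r mulr_ge0 ?sqr_ge0// subr_ge0 ltW//.
      by move: xE; rewrite inE.
    by rewrite mul0r.
  have mk : measurable_fun setT k by exact: measurable_funB.
  have mkE : measurable_fun setT (fun x => (k x)%:E) by exact/measurable_EFinP.
  have kint : (\int[m]_x (k x)%:E = 0)%E.
    apply/eqP; rewrite eq_le; apply/andP; split; last first.
      by apply: integral_ge0 => x _; rewrite lee_fin.
    have e : (\int[m]_x (k x)%:E + \int[m]_x (A x)%:E = \int[m]_x (B x)%:E)%E.
      rewrite -ge0_integralD//; [|by move=> x _; rewrite lee_fin
        |by move=> x _; rewrite lee_fin|exact/measurable_EFinP].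
      by apply: eq_integral => x _; rewrite -EFinD subrK.
    have h : (\int[m]_x (k x)%:E + \int[m]_x (A x)%:E <= 0 + \int[m]_x (A x)%:E)%E.
      by rewrite e add0e intB intA -EFinM lee_fin.
    by move: h; rewrite leeD2rE// intA -EFinM.
  have /(ae_eq_integral_abs m measurableT mkE) : (\int[m]_x `|(k x)%:E| = 0)%E.
    by rewrite -[RHS]kint; apply: eq_integral => x _; rewrite gee0_abs ?lee_fin.
  apply: filterS => x /(_ I) /= [kx]; rewrite leNgt; apply/negP => Mx.
  have : 0 < k x; last by rewrite kx ltxx.
  rewrite /k /B /A -mulrBr -mulrBl indicE mem_set// mul1r.
  by rewrite mulr_gt0 ?subr_gt0 ?exprn_gt0.
exists tau => //.
apply: (bounded_eq_total bt (bounded_mulop ltau) (total_Linf_mul sw w0)).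
move=> _ [g lg <-]; apply/L2P.
apply: filterS3 (tE g lg) (filterI (mulopE (mulop g W) ltau) (mulopE W lg)) (toL2E sw).
by move=> x e1 [e2 e3] e4; rewrite e1 e2 e3 e4 mulrCA.
Qed.

End masa.

Section decomposable.
Context (R : realType).
Context d1 (T1 : measurableType d1) (m : {sigma_finite_measure set T1 -> \bar R}).
Context d2 (T2 : measurableType d2) (n : {sigma_finite_measure set T2 -> \bar R}).
Variables (e : L2 n) (e1 : nsq e = 1).

Definition decomp_gen : set (L2 (m \X n) -> L2 (m \X n)) :=
  [set tens_op a b | a in Linf_ops m & b in all_ops n].

Lemma Linf_fst (f : T1 -> R[i]) : Linf m f -> Linf (m \X n) (fun w => f w.1).
Proof.
move=> lf; split; first exact: cmeasurable_fst lf.1.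
by have [M hM] := lf.2; exists M; exact: ae_fst hM.
Qed.

Lemma Linf_ops_bounded : Linf_ops m `<=` bounded_op (nu := m).
Proof. by move=> _ [f lf <-]; exact: bounded_mulop. Qed.

Lemma decomp_gen_bounded : decomp_gen `<=` bounded_op (nu := m \X n).
Proof. by move=> _ [a la [b lb <-]]; apply: bounded_tens_op => //; exact: Linf_ops_bounded. Qed.

Lemma mulop1 : @mulop _ _ _ m (fun=> 1) = id.
Proof. by rewrite mulop_cst; apply/funext => u; rewrite scale1r. Qed.

Lemma Linf_ops_id : Linf_ops m id.
Proof. by exists (fun=> 1); [exact: Linf_cst|exact: mulop1]. Qed.

Lemma decomp_star_closure : star_closure decomp_gen = decomp_gen.
Proof.
apply/seteqP; split => [x [//|[_ [_ [f lf <-] [b bb <-]] h]]|x]; last by left.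
have bf := bounded_mulop lf.
have := tens_op_adjoint bf bb (adjoint_mulop lf) (adjP bb).
move=> /(adjoint_uniq h) ->.
exists (mulop (fun x => conjc (f x))); first by exists (fun x => conjc (f x)); [exact: Linf_conj|].
by exists (adj b); [exact: bounded_adj|].
Qed.

(** Commutation with 1 (x) L(L^2) makes [t] the amplification of a slice; commutation with L^oo (x)
    1 makes that slice a multiplication, L^oo being maximal abelian. *)
Lemma commutant_decomp t : commutant (star_closure decomp_gen) t ->
  exists2 tau, Linf m tau & t = mulop (fun w => tau w.1).
Proof.
rewrite decomp_star_closure => -[bt ht].
have tE : t = ampl n (slice e e t).
  apply: comm_rank1_ampl => // f; apply: ht.
  exists id; first exact: Linf_ops_id.
  by exists (rank1 f e) => //; exact: bounded_rank1.
have [|g lg|tau ltau tauE] := @Linf_masa _ _ _ m (slice e e t).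
- exact: bounded_slice.
- apply: slice_comm; first exact: bounded_mulop.
  apply: ht; exists (mulop g); first by exists g.
  by exists id; [exact: bounded_id|].
- by exists tau => //; rewrite tE tauE ampl_mulop.
Qed.

Lemma mulop_fst_comm (tau : T1 -> R[i]) x : Linf m tau -> decomp_gen x ->
  x \o mulop (fun w => tau w.1) = mulop (fun w => tau w.1) \o x.
Proof.
move=> lt [_ [f lf <-] [b bb <-]]; rewrite -(ampl_mulop n lt) /ampl.
have bf := bounded_mulop lf; have btau := bounded_mulop lt.
have bi := bounded_id n.
rewrite (tens_op_comp bf btau bb bi) (tens_op_comp btau bf bi bb).
rewrite (mulop_comp lf lt) (mulop_comp lt lf).
by under eq_fun do rewrite mulrC.
Qed.

Lemma decompP x : vN_tens (Linf_ops m) (all_ops n) x <-> bounded_op x /\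
  forall tau, Linf m tau -> x \o mulop (fun w => tau w.1) = mulop (fun w => tau w.1) \o x.
Proof.
split=> [[bx hx]|[bx hx]]; split => //.
  move=> tau lt; apply: hx; split; first by apply: bounded_mulop; exact: Linf_fst.
  move=> s; rewrite -/decomp_gen -/(star_closure decomp_gen) decomp_star_closure => hs.
  by rewrite mulop_fst_comm.
by move=> t /commutant_decomp[tau lt ->]; exact: hx.
Qed.

Lemma decomp_mulop F : Linf (m \X n) F -> vN_tens (Linf_ops m) (all_ops n) (mulop F).
Proof.
move=> lF; apply/decompP; split; first exact: bounded_mulop.
move=> tau lt; have lt1 := Linf_fst lt.
rewrite (mulop_comp lF lt1) (mulop_comp lt1 lF).
by under eq_fun do rewrite mulrC.
Qed.

(** [ampl] appends its idle factor at the end; this permutation moves it to the middle, where L^oo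
    (x) C1 (x) L has it. *)
Definition perm_J (w : T1 * (T2 * T2)) : T1 * T2 * T2 := ((w.1, w.2.2), w.2.1).
Definition perm_J' (w : T1 * T2 * T2) : T1 * (T2 * T2) := (w.1.1, (w.2, w.1.2)).

Lemma mpres_J : mpres (m \X (n \X n)) (m \X n \X n) perm_J.
Proof.
exact: mpres_comp (mpres_unassoc m n n) (mpres_map (mpres_id m) (mpres_swap n n)).
Qed.

Lemma mpres_J' : mpres (m \X n \X n) (m \X (n \X n)) perm_J'.
Proof.
exact: mpres_comp (mpres_map (mpres_id m) (mpres_swap n n)) (mpres_assoc m n n).
Qed.

Definition opJ : L2 (m \X n \X n) -> L2 (m \X (n \X n)) := comp_op perm_J.
Definition opJ' : L2 (m \X (n \X n)) -> L2 (m \X n \X n) := comp_op perm_J'.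

Lemma uni_J : uni opJ opJ'.
Proof.
apply: uni_miso; apply: miso_cancel; first exact: mpres_J.
  exact: mpres_J'.1.
by move=> [a [b c]].
Qed.

Lemma opJ_tens u v w : opJ (tens (tens u v) w) = tens u (tens w v).
Proof.
rewrite /opJ -[perm_J]/(@unassoc_pair T1 T2 T2 \o map_pair id (@swap_pair T2 T2)).
rewrite -(comp_op_comp _ (mpres_unassoc m n n) (mpres_map (mpres_id m) (mpres_swap n n))).
rewrite comp_unassoc_tens comp_map_tens; [|exact: mpres_id|exact: mpres_swap].
by rewrite comp_op_id comp_swap_tens.
Qed.

Lemma opJ'_tens u v w : opJ' (tens u (tens v w)) = tens (tens u w) v.
Proof. by rewrite -opJ_tens; have [_ K _] := uni_J; rewrite K. Qed.

Lemma AdJ_tens a b : bounded_op a -> bounded_op b ->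
  Ad opJ (ampl n (tens_op a b)) = tens_op a (tens_op id b).
Proof.
move=> ba bb; have hu := uni_J; have bi := bounded_id n.
have bab := bounded_tens_op ba bb; have bib := bounded_tens_op bi bb.
have E : ampl n (tens_op a b) = Ad opJ' (tens_op a (tens_op id b)).
  apply: bounded_tens3_ext.
  - exact: bounded_ampl.
  - by apply: (Ad_bounded (uni_sym hu)); exact: bounded_tens_op.
  - move=> u v w; rewrite (AdE (uni_sym hu)) /= opJ_tens (tens_opE _ _ ba bib).
    by rewrite (tens_opE _ _ bi bb) opJ'_tens amplE// (tens_opE _ _ ba bb).
by rewrite E (AdK (uni_sym hu)).
Qed.

Lemma vN_tens_ampl :
  vN_tens (Linf_ops m) (vN_tens (scalar_ops n) (all_ops n)) =
  [set Ad opJ (ampl n x) | x in vN_tens (Linf_ops m) (all_ops n)].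
Proof.
have hu := uni_J.
rewrite (vN_tens_scalar_all n e1) /vN_tens -/decomp_gen.
rewrite (_ : [set tens_op a b | a in _ & b in _] =
    [set Ad opJ x | x in [set ampl n x | x in decomp_gen]]); last first.
  apply/seteqP; split.
    move=> _ [a la [_ [b bb <-] <-]]; exists (ampl n (tens_op a b)).
      by exists (tens_op a b) => //; exists a => //; exists b.
    by rewrite AdJ_tens//; exact: Linf_ops_bounded.
  move=> _ [_ [_ [a la [b bb <-]] <-] <-]; exists a => //.
  exists (tens_op id b); first by exists b.
  by rewrite AdJ_tens//; exact: Linf_ops_bounded.
rewrite (Ad_vN_gen _ hu) (vN_gen_ampl e1 decomp_gen_bounded).
by apply/seteqP; split => [_ [_ [x hx <-] <-]|_ [x hx <-]]; [exists x|exists (ampl n x) => //; exists x].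
Qed.

End decomposable.

Section isomorphisms.
Context (R : realType).
Context d1 (T1 : measurableType d1) (m1 : {measure set T1 -> \bar R}).
Context d2 (T2 : measurableType d2) (m2 : {measure set T2 -> \bar R}).
Context d3 (T3 : measurableType d3) (m3 : {measure set T3 -> \bar R}).

Lemma vN_iso_trans (M1 : set (L2 m1 -> L2 m1)) (M2 : set (L2 m2 -> L2 m2))
    (M3 : set (L2 m3 -> L2 m3)) phi psi :
  vN_iso M1 M2 phi -> vN_iso M2 M3 psi -> vN_iso M1 M3 (psi \o phi).
Proof.
move=> [[f1 f2 f3 f4] fb] [[g1 g2 g3 g4] gb].
have [ff _ _] := fb; split.
  split.
  - by move=> a M1a; apply: g1; exact: ff.
  - by move=> c a b ha hb /=; rewrite f2// g2//; exact: ff.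
  - by move=> a b ha hb /=; rewrite f3// g3//; exact: ff.
  - by move=> a b ha hb h /=; apply: g4; [exact: ff|exact: ff|exact: f4].
have [gf gi gs] := gb; have [_ fi fs] := fb; split.
- by move=> a /ff /gf.
- move=> a b ha hb /= h; apply: fi => //; apply: gi => //; rewrite inE; apply: ff;
    by [rewrite inE in ha|rewrite inE in hb].
- by move=> c /gs[b /fs[a ha <-] <-]; exists a.
Qed.

End isomorphisms.

Section isomorphism_inverse.
Context (R : realType).
Context d1 (T1 : measurableType d1) (m1 : {measure set T1 -> \bar R}).
Context d2 (T2 : measurableType d2) (m2 : {measure set T2 -> \bar R}).

(** The inverse respects adjoints because a generated algebra contains the adjoint of each element,
    and the given map sends it to the adjoint of the image. *)
Lemma vN_iso_inv (S : set (L2 m1 -> L2 m1)) (M2 : set (L2 m2 -> L2 m2)) phi :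
  S `<=` bounded_op (nu := m1) ->
  vN_iso (vN_gen S) M2 phi -> exists psi, vN_iso M2 (vN_gen S) psi.
Proof.
move=> bS [[f1 f2 f3 f4] [ff fi fs]].
have ex b : exists a, M2 b -> vN_gen S a /\ phi a = b.
  have [/fs[a ha <-]|nb] := pselect (M2 b); first by exists a.
  by exists id.
have [psi hpsi] := choice ex.
have psiM b : M2 b -> vN_gen S (psi b) by move=> /hpsi[].
have psiK b : M2 b -> phi (psi b) = b by move=> /hpsi[].
have inj a a' : vN_gen S a -> vN_gen S a' -> phi a = phi a' -> a = a'.
  by move=> ha ha' h; apply: fi => //; rewrite inE.
have phiK a : vN_gen S a -> psi (phi a) = a.
  by move=> ha; apply: inj => //; [apply: psiM; exact: ff|apply: psiK; exact: ff].
exists psi; split.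
  split.
  - by move=> b /psiM; exact: vN_gen_bounded.
  - move=> c a b ha hb; have hc := vN_gen_comb c (psiM _ ha) (psiM _ hb).
    rewrite -(phiK _ hc); congr psi.
    by rewrite f2 ?psiK//; exact: psiM.
  - move=> a b ha hb; have hc := vN_gen_comp (psiM _ ha) (psiM _ hb).
    rewrite -(phiK _ hc); congr psi.
    by rewrite f3 ?psiK//; exact: psiM.
  - move=> a b ha hb h.
    have bp := vN_gen_bounded (psiM _ ha).
    have hadj := vN_gen_adj bS (psiM _ ha).
    have := f4 _ _ (psiM _ ha) hadj (adjP bp); rewrite psiK// => h'.
    by rewrite (adjoint_uniq h h') phiK//; exact: adjP.
split.
- exact: psiM.
- move=> a b; rewrite !inE => ha hb h.
  by rewrite -(psiK _ ha) h psiK.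
- by move=> a ha; exists (phi a); [exact: ff|exact: phiK].
Qed.

End isomorphism_inverse.

Section ampl_linear.
Context (R : realType).
Context d1 (T1 : measurableType d1) (m : {sigma_finite_measure set T1 -> \bar R}).
Context d2 (T2 : measurableType d2) (n : {sigma_finite_measure set T2 -> \bar R}).

Lemma ampl_comb c (a b : L2 m -> L2 m) : bounded_op a -> bounded_op b ->
  ampl n (fun u => c *: a u + b u) = (fun w => c *: ampl n a w + ampl n b w).
Proof. by move=> ba bb; apply: tens_op_combl => //; exact: bounded_id. Qed.

End ampl_linear.

Section spatial_amplification.
Context (R : realType).
Context d1 (T1 : measurableType d1) (m : {sigma_finite_measure set T1 -> \bar R}).
Context d2 (T2 : measurableType d2) (n : {sigma_finite_measure set T2 -> \bar R}).
Context d3 (T3 : measurableType d3) (l : {measure set T3 -> \bar R}).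

Lemma star_hom_Ad_ampl (V : L2 (m \X n) -> L2 l) V' (M : set (L2 m -> L2 m)) : uni V V' ->
  M `<=` bounded_op (nu := m) -> star_hom M (fun x => Ad V (ampl n x)).
Proof.
move=> hu bM; split.
- by move=> a /bM ba; exact: (Ad_bounded hu (bounded_ampl n ba)).
- move=> c a b /bM ba /bM bb.
  exact: etrans (congr1 (Ad V) (ampl_comb n c ba bb))
    (Ad_comb hu c (bounded_ampl n ba) (bounded_ampl n bb)).
- move=> a b /bM ba /bM bb.
  exact: etrans (congr1 (Ad V) (ampl_comp n ba bb)) (Ad_comp hu _ _).
- by move=> a b /bM ba _ h; apply: (Ad_adjoint hu); exact: ampl_adjoint ba h.
Qed.

End spatial_amplification.

Section decomposable_iso.
Context (R : realType).
Context d1 (T1 : measurableType d1) (m : {sigma_finite_measure set T1 -> \bar R}).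
Context d2 (T2 : measurableType d2) (n : {sigma_finite_measure set T2 -> \bar R}).
Variables (e : L2 n) (e1 : nsq e = 1).

Lemma vN_iso_decomp : vN_iso (vN_tens (Linf_ops m) (all_ops n))
  (vN_tens (Linf_ops m) (vN_tens (scalar_ops n) (all_ops n))) (fun x => Ad (@opJ _ _ _ m _ _ n) (ampl n x)).
Proof.
have hu := uni_J m n.
have bN x : vN_tens (Linf_ops m) (all_ops n) x -> bounded_op x by exact: vN_gen_bounded.
split; first exact: star_hom_Ad_ampl hu bN.
split.
- by move=> x hx; rewrite (vN_tens_ampl m e1); exists x.
- move=> x y; rewrite !inE => /bN bx /bN b_y /(Ad_inj hu).
  exact: (ampl_inj bx b_y e1).
- by rewrite (vN_tens_ampl m e1).
Qed.

End decomposable_iso.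

Section ae_fubini.
Context (R : realType).
Context d1 (T1 : measurableType d1) (m1 : {sigma_finite_measure set T1 -> \bar R}).
Context d2 (T2 : measurableType d2) (m2 : {sigma_finite_measure set T2 -> \bar R}).

Lemma ae_fubini (P : T1 * T2 -> Prop) : {ae m1 \X m2, forall w, P w} ->
  {ae m1, forall x, {ae m2, forall y, P (x, y)}}.
Proof.
move=> [N [mN N0 PN]].
have mF : measurable_fun setT (fun x => m2 (xsection N x)) by exact: measurable_fun_xsection.
have : (\int[m1]_x `|m2 (xsection N x)| = 0)%E.
  by rewrite -[RHS]N0; apply: eq_integral => x _; rewrite gee0_abs.
move=> /(ae_eq_integral_abs m1 measurableT mF); apply: filterS => x /(_ I) /= h.
exists (xsection N x); split => //; first exact: measurable_xsection.
by move=> y /= hy; rewrite /xsection /= inE; exact: PN.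
Qed.

End ae_fubini.

(** * Relative tensor products *)

Section relative_tensor.
Context (R : realType) d0 (Z : measurableType d0).
Context (zeta : {sigma_finite_measure set Z -> \bar R}).
Context dA (A : measurableType dA) (mA : {measure set A -> \bar R}) (p : A -> Z).
Context dB (B : measurableType dB) (mB : {sigma_finite_measure set B -> \bar R}) (q : B -> Z).
Context (DA : disintegration mA zeta p) (DB : disintegration mB zeta q).
Variable kA : A -> dis_type DA.
Hypotheses (mp : measurable_fun setT p) (mq : measurable_fun setT q)
  (mk : measurable_fun setT kA) (kAK : forall z t, kA (dis_par DA (z, t)) = t).
Local Notation nA := (dis_mes DA).
Local Notation fib := (fibre_mes DA DB).

(* Almost everywhere on the fibre product p a = q b, so that a is determined by
   b and its fibre coordinate kA a. *)
Definition kap (w : A * B) : B * dis_type DA := (w.2, kA w.1).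
Definition kap' (w : B * dis_type DA) : A * B := (dis_par DA (q w.1, w.2), w.1).

Let fpar := @fibre_par _ _ _ _ _ _ _ _ _ _ _ _ DA DB.

Lemma mpres_fpar : mpres (zeta \X nA \X dis_mes DB) fib fpar.
Proof. by split => //; exact: measurable_fibre_par. Qed.

(** Both measures are images of the parameter space of triples (z, s, t). There [kap] sends (z, s,
    t) to (b, s), with b the point of parameters (z, t), which only reorders the factors and applies
    the parametrization of [B]. *)
Lemma mpres_kap : mpres fib (mB \X nA) kap.
Proof.
have mkap : measurable_fun setT kap.
  by apply/measurable_fun_pair; [exact: measurable_snd|exact: (measurableT_comp mk measurable_fst)].
split => // S mS.
pose rr (w : Z * dis_type DA * dis_type DB) : B * dis_type DA :=
  (dis_par DB (w.1.1, w.2), w.1.2).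
have hr : mpres (zeta \X nA \X dis_mes DB) (mB \X nA) rr.
  exact: mpres_comp (mpres_map (dis_mpres DB) (mpres_id nA))
   (mpres_comp (mpres_unassoc zeta (dis_mes DB) nA)
     (mpres_comp (mpres_map (mpres_id zeta) (mpres_swap nA (dis_mes DB)))
       (mpres_assoc zeta nA (dis_mes DB)))).
rewrite (hr.2 _ mS) /fibre_mes /= /pushforward; congr ((_ \X _) _).
by apply/seteqP; split => -[[z s] t]; rewrite /rr /kap /= kAK.
Qed.

Lemma measurable_kap' : measurable_fun setT kap'.
Proof.
apply/measurable_fun_pair => //.
apply: (measurableT_comp (dis_mpres DA).1); apply/measurable_fun_pair => //.
exact: (measurableT_comp mq measurable_fst).
Qed.

Lemma miso_kap : miso (mB \X nA) fib kap kap'.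
Proof.
apply: (miso_base mpres_fpar mpres_kap measurable_kap') => -[[z s] t].
by rewrite /kap' /kap /fpar /fibre_par /= dis_parK kAK.
Qed.

Lemma ae_q (P : Z -> Prop) : {ae zeta, forall z, P z} -> {ae mB, forall b, P (q b)}.
Proof.
move=> [N [mN N0 PN]]; exists (q @^-1` N); split.
- by rewrite -[_ @^-1` _]setTI; exact: mq.
- have mqN : measurable (q @^-1` N) by rewrite -[_ @^-1` _]setTI; exact: mq.
  rewrite ((dis_mpres DB).2 _ mqN).
  rewrite (_ : _ @^-1` _ = N `*` setT); first by rewrite prodmE// N0 mul0e.
  by apply/seteqP; split => -[z t] /=; rewrite dis_parK => // -[].
- by move=> b /= h; apply: PN.
Qed.

Lemma ae_fib_fst (P : A -> Prop) : {ae mA, forall a, P a} -> {ae fib, forall w, P w.1}.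
Proof.
move=> [N [mN N0 PN]]; exists (N `*` setT); split.
- exact: measurableX.
- rewrite (mpres_fpar.2 _ (measurableX mN measurableT)).
  have mpN : measurable (dis_par DA @^-1` N).
    by rewrite -[_ @^-1` _]setTI; exact: (dis_mpres DA).1.
  rewrite (_ : _ @^-1` _ = (dis_par DA @^-1` N) `*` setT).
    have e : (zeta \X nA) (dis_par DA @^-1` N) = 0%E by rewrite -((dis_mpres DA).2 _ mN).
    by rewrite prodmE// [X in (X * _)%E](_ : _ = 0%E)// mul0e.
  by apply/seteqP; split => -[[z t] s] /= [].
- by move=> w /= /PN.
Qed.

Section product_with_bounded.
Variables (u : L2 mA) (hu : zeta_bounded DA u).

Lemma fibre_fun_meas : cmeasurable (fun w : Z * dis_type DA => u (dis_par DA w)).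
Proof. exact: cmeasurable_comp (dis_mpres DA).1 (L2_meas u). Qed.

(** The product of [u] and [v], read in the coordinates of [kap]. *)
Let Uf (v : B -> R[i]) (w : B * dis_type DA) := u (dis_par DA (q w.1, w.2)) * v w.1.

Let Uf_meas v : cmeasurable v -> cmeasurable (Uf v).
Proof.
move=> mv; apply: cmeasurableM; last exact: cmeasurable_fst.
apply: (cmeasurable_comp (f := fun w : Z * dis_type DA => u (dis_par DA w))
  (phi := fun w : B * dis_type DA => (q w.1, w.2))); last exact: fibre_fun_meas.
by apply/measurable_fun_pair => //; exact: (measurableT_comp mq measurable_fst).
Qed.

(** Integration over the fibre first leaves |v|^2 times the fibrewise squared norm of [u], which is
    essentially bounded: the purpose of [zeta_bounded]. *)
Lemma sqint_Uf v : square_integrable mB v -> square_integrable (mB \X nA) (Uf v).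
Proof.
move=> [mv voo]; have mU := Uf_meas mv; split => //.
have mE : measurable_fun setT (fun w => (sqabs (Uf v w))%:E : \bar R).
  by apply/measurable_EFinP; exact: measurable_sqabs.
have E0 w : (0 <= (sqabs (Uf v w))%:E)%E by rewrite lee_fin sqabs_ge0.
rewrite (@fubini_tonelli1 _ _ _ _ _ mB nA _ mE E0).
have [M hM] := hu.
have mF := measurable_fun_fubini_tonelli_F (m2 := nA) _ mE.
apply: (@le_lt_trans _ _ (\int[mB]_b ((Num.max M 0)%:E * (sqabs (v b))%:E))%E).
  apply: ae_ge0_le_integral => //.
  - by move=> b _; apply: integral_ge0 => s _; exact: E0.
  - exact: mF.
  - by move=> b _; rewrite -EFinM lee_fin mulr_ge0 ?sqabs_ge0// le_max lexx orbT.
  - by apply: measurable_funeM; apply/measurable_EFinP; exact: measurable_sqabs.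
  - apply: filterS (ae_q hM) => b hb _; rewrite /fubini_F /Uf /=.
    under eq_integral do rewrite sqabsM EFinM.
    rewrite ge0_integralZr//.
    + apply: lee_wpmul2r; first by rewrite lee_fin sqabs_ge0.
      by apply: le_trans hb _; rewrite lee_fin le_max lexx.
    + apply/measurable_EFinP/measurable_sqabs.
      apply: (cmeasurable_comp (f := fun w : Z * dis_type DA => u (dis_par DA w))
        (phi := fun s => (q b, s))); last exact: fibre_fun_meas.
      exact: measurable_pair1.
    + by move=> s _; rewrite lee_fin sqabs_ge0.
    + by rewrite lee_fin sqabs_ge0.
rewrite ge0_integralZl//.
- by rewrite lte_mul_pinfty// lee_fin le_max lexx orbT.
- by apply/measurable_EFinP; exact: measurable_sqabs.
- by move=> b _; rewrite lee_fin sqabs_ge0.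
- by rewrite lee_fin le_max lexx orbT.
Qed.

Lemma sqint_rtens v : square_integrable mB v ->
  square_integrable fib (fun w => u w.1 * v w.2) /\
  {ae fib, forall w, (Uf v \o kap) w = u w.1 * v w.2}.
Proof.
move=> sv; have s1 := square_integrable_mpres mpres_kap (sqint_Uf sv).
have mr : cmeasurable (fun w : A * B => u w.1 * v w.2).
  by apply: cmeasurableM; [exact: (cmeasurable_comp measurable_fst (L2_meas u))
    |exact: (cmeasurable_comp measurable_snd sv.1)].
have E : {ae fib, forall w, (Uf v \o kap) w = u w.1 * v w.2}.
  have mN := cmeasurable_neq s1.1 mr.
  exists [set w | (Uf v \o kap) w != u w.1 * v w.2]; split => //; last by move=> w /= /eqP.
  rewrite (mpres_fpar.2 _ mN) (_ : _ @^-1` _ = set0) ?measure0//.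
  by apply/seteqP; split => -[[z t] s'] //=; rewrite /Uf /= dis_parK kAK eqxx.
by split => //; exact: square_integrable_ae E.
Qed.

Lemma rtens_kap (v : L2 mB) :
  rtens DA DB u v = comp_op kap (toL2 (mB \X nA) (Uf v)).
Proof.
have s := sqint_Uf (L2_sqint v); have [sr E] := sqint_rtens (L2_sqint v).
rewrite (comp_op_toL2 mpres_kap s); apply/esym/toL2_ae => //.
exact: (square_integrable_mpres mpres_kap s).
Qed.

(** Fibrewise Cauchy-Schwarz: the bound is that of [u] times |beta|^2. *)
Lemma Uf_bounded_fibre (beta : L2 nA) :
  Linf zeta (fun z => cintegral nA (fun s => u (dis_par DA (z, s)) * conjc (beta s))).
Proof.
have mf : cmeasurable (fun w : Z * dis_type DA => u (dis_par DA w) * conjc (beta w.2)).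
  apply: cmeasurableM; first exact: fibre_fun_meas.
  by apply: cmeasurable_conj; apply: cmeasurable_snd; exact: L2_meas.
split; first exact: (cmeasurable_cfubini _ mf).
have [M hM] := hu; exists (M * nsq beta); apply: filterS hM => z hz.
have su : square_integrable nA (fun s => u (dis_par DA (z, s))).
  split; last exact: le_lt_trans hz (ltry _).
  apply: (cmeasurable_comp (f := fun w : Z * dis_type DA => u (dis_par DA w))
    (phi := fun s => (z, s))); last exact: fibre_fun_meas.
  exact: measurable_pair1.
have -> : cintegral nA (fun s => u (dis_par DA (z, s)) * conjc (beta s)) =
    inner (toL2 nA (fun s => u (dis_par DA (z, s)))) beta.
  by rewrite (inner_ae su.1 (L2_meas beta) (toL2E su))//; exact: nearW.
apply: (le_trans (cauchy_schwarz _ _)); rewrite ler_wpM2r ?nsq_ge0//.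
rewrite -lee_fin -sqabs_integral; apply: le_trans hz.
rewrite le_eqVlt; apply/orP; left; apply/eqP; apply: ge0_ae_eq_integral => //.
- by apply/measurable_EFinP/measurable_sqabs/L2_meas.
- by apply/measurable_EFinP/measurable_sqabs; exact: su.1.
- by move=> x _; rewrite lee_fin sqabs_ge0.
- by move=> x _; rewrite lee_fin sqabs_ge0.
- by apply: filterS (toL2E su) => s e _; rewrite e.
Qed.

(** The coefficient of [Uf v] at [beta] in the fibre variable is [v] multiplied by a bounded
    function of the base. This is how functions on the base come to act on [v]. *)
Lemma inner_Uf (v alpha : L2 mB) (beta : L2 nA) :
  inner (toL2 (mB \X nA) (Uf v)) (tens alpha beta) =
  inner (mulop (fun b => cintegral nA (fun s => u (dis_par DA (q b, s)) * conjc (beta s))) v) alpha.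
Proof.
have s := sqint_Uf (L2_sqint v).
have st := sqint_tens (L2_sqint alpha) (L2_sqint beta).
rewrite (inner_ae s.1 st.1 (toL2E s) (tensE alpha beta)).
rewrite (cfubini (sq_cintegrable s st)) /=.
have lF := Uf_bounded_fibre beta.
have lFq : Linf mB (fun b => cintegral nA (fun s => u (dis_par DA (q b, s)) * conjc (beta s))).
  split; first exact: (cmeasurable_comp mq lF.1).
  by have [M hM] := lF.2; exists M; exact: ae_q hM.
rewrite (inner_ae (cmeasurableM lFq.1 (L2_meas v)) (L2_meas alpha) (mulopE v lFq)); last exact: nearW.
have [M hM] := hu.
apply: ae_eq_cintegral.
- by apply: (cmeasurable_cfubini _ (cmeasurableM s.1 (cmeasurable_conj st.1))).
- by apply: cmeasurableM; [apply: cmeasurableM; [exact: lFq.1|exact: L2_meas]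
    |apply: cmeasurable_conj; exact: L2_meas].
- apply: filterS (ae_q hM) => b hb.
  have su : square_integrable nA (fun s => u (dis_par DA (q b, s))).
    split; last exact: le_lt_trans hb (ltry _).
    apply: (cmeasurable_comp (f := fun w : Z * dis_type DA => u (dis_par DA w))
      (phi := fun s => (q b, s))); last exact: fibre_fun_meas.
    exact: measurable_pair1.
  rewrite -mulrA mulrC -cintegralZ; last exact: sq_cintegrable su (L2_sqint beta).
  by apply: eq_cintegral => s'; rewrite /Uf /= conjcM; ring.
Qed.

End product_with_bounded.

Lemma total_rtens : total_in [set rtens DA DB u v | u in zeta_bounded DA & v in [set: L2 mB]].
Proof.
have /sigma_finiteP[ZF [TZ ndZ Zoo]] := sigma_finiteT zeta.
have /sigma_finiteP[SF [TS ndS Soo]] := sigma_finiteT nA.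
have /sigma_finiteP[G [TG ndG Goo]] := sigma_finiteT mB.
(* Restricting both the base and the fibre coordinate makes these sets of finite measure and their
   indicators zeta-bounded, with bound the measure of [SF k]. *)
pose E k := p @^-1` (ZF k) `&` kA @^-1` (SF k).
have mE k : measurable (E k).
  apply: measurableI.
    by rewrite -[_ @^-1` _]setTI; apply: mp => //; have [] := Zoo k.
  by rewrite -[_ @^-1` _]setTI; apply: mk => //; have [] := Soo k.
have mG k : measurable (G k) by have [] := Goo k.
have EGoo k : (fib (E k `*` G k) < +oo)%E.
  have [mS Sk] := Soo k; have [_ Gk] := Goo k.
  apply: (@le_lt_trans _ _ (fib (kap @^-1` (G k `*` SF k)))).
    apply: le_measure; rewrite ?inE; first exact: measurableX.
      rewrite -[_ @^-1` _]setTI; apply: mpres_kap.1 => //; exact: measurableX.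
    by move=> [a b] [/= [_ ?] ?].
  rewrite -(mpres_kap.2 _ (measurableX (mG k) mS)).
  by rewrite prodmE// lte_mul_pinfty// ge0_fin_numE.
have Eoo k : (mA (E k) < +oo)%E.
  have [mS Sk] := Soo k; have [mZ Zk] := Zoo k.
  rewrite ((dis_mpres DA).2 _ (mE k)).
  rewrite (_ : _ @^-1` _ = ZF k `*` SF k); first by rewrite prodmE// lte_mul_pinfty// ge0_fin_numE.
  by apply/seteqP; split => -[z t]; rewrite /E /= dis_parK kAK.
apply: total_inS (total_rect mE mG EGoo _); last first.
  move=> [a b] /=.
  have : [set: Z] (p a) by []. rewrite TZ => -[i _ hi].
  have : [set: dis_type DA] (kA a) by []. rewrite TS => -[j _ hj].
  have : [set: B] b by []. rewrite TG => -[l _ hl].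
  exists (maxn (maxn i j) l); split; first split.
  - have /subsetPset sub : (ZF i <= ZF (maxn (maxn i j) l))%O.
      by apply: ndZ; rewrite -maxnA leq_maxl.
    exact: sub.
  - have /subsetPset sub : (SF j <= SF (maxn (maxn i j) l))%O.
      by apply: ndS; rewrite (maxnC i) -maxnA leq_maxl.
    exact: sub.
  - have /subsetPset sub : (G l <= G (maxn (maxn i j) l))%O.
      by apply: ndG; rewrite leq_maxr.
    exact: sub.
move=> _ [A' [mA' [k AE]] [B' [mB' [l BG]] <-]].
have sA : square_integrable mA (fun x => (\1_A' x : R)%:C).
  apply: sqint_indic => //; apply: le_lt_trans (Eoo k).
  by apply: le_measure; rewrite ?inE.
have sB : square_integrable mB (fun x => (\1_B' x : R)%:C).
  apply: sqint_indic => //; have [_ Gl] := Goo l; apply: le_lt_trans Gl.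
  by apply: le_measure; rewrite ?inE.
have ub : zeta_bounded DA (toL2 mA (fun x => (\1_A' x : R)%:C)).
  have [mS Sk] := Soo k.
  exists (fine (nA (SF k))).
  have := ae_fubini (ae_mpres (dis_mpres DA) (toL2E sA)).
  apply: filterS => z hz.
  rewrite fineK ?ge0_fin_numE//.
  rewrite (ge0_ae_eq_integral (g := fun t => (\1_(A') (dis_par DA (z, t)) : R)%:E))//.
  - have mP : measurable ((fun t => dis_par DA (z, t)) @^-1` A').
      rewrite -[_ @^-1` _]setTI.
      apply: (measurableT_comp (dis_mpres DA).1 (measurable_pair1 z)) => //.
    rewrite (integral_indic nA measurableT mP) setIT.
    apply: le_measure; rewrite ?inE//.
    by move=> t /= /AE [_ /=]; rewrite kAK.
  - apply/measurable_EFinP/measurable_sqabs.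
    apply: (cmeasurable_comp (f := toL2 mA (fun x => (\1_A' x : R)%:C))
      (phi := fun t => dis_par DA (z, t))); last exact: L2_meas.
    exact: (measurableT_comp (dis_mpres DA).1 (measurable_pair1 z)).
  - apply/measurable_EFinP.
    apply: (measurableT_comp (measurable_indic mA')).
    exact: (measurableT_comp (dis_mpres DA).1 (measurable_pair1 z)).
  - by move=> t _; rewrite lee_fin sqabs_ge0.
  - apply: filterS hz => t e _; rewrite e sqabs_real indicE.
    by case: (_ \in _); rewrite ?expr1n ?expr0n.
exists (toL2 mA (fun x => (\1_A' x : R)%:C)) => //.
exists (toL2 mB (fun x => (\1_B' x : R)%:C)) => //.
have mAB : measurable (A' `*` B') by exact: measurableX.
have sAB : square_integrable fib (fun w => (\1_A' w.1 : R)%:C * (\1_B' w.2)%:C).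
  rewrite (_ : (fun w => _) = (fun w => (\1_(A' `*` B') w : R)%:C)); last first.
    apply/funext => -[a b]; rewrite -rmorphM !indicE -natrM mulnb.
    by rewrite in_setX.
  apply: sqint_indic => //; apply: le_lt_trans (EGoo (maxn k l)); apply: le_measure; rewrite ?inE//.
    exact: measurableX.
  move=> [a b] [/= /AE [/= h1 h2] /BG h3]; split => /=.
    split => /=.
      have /subsetPset sub : (ZF k <= ZF (maxn k l))%O by apply: ndZ; rewrite leq_maxl.
      exact: sub.
    have /subsetPset sub : (SF k <= SF (maxn k l))%O by apply: ndS; rewrite leq_maxl.
    exact: sub.
  have /subsetPset sub : (G l <= G (maxn k l))%O by apply: ndG; rewrite leq_maxr.
  exact: sub.
have Eae : {ae fib, forall w, (\1_A' w.1 : R)%:C * (\1_B' w.2)%:C =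
    toL2 mA (fun x => (\1_A' x : R)%:C) w.1 * toL2 mB (fun x => (\1_B' x : R)%:C) w.2}.
  apply: filterS2 (ae_fib_fst (toL2E sA))
    (ae_mpres mpres_kap (@ae_fst _ _ _ mB _ _ nA _ (toL2E sB))) => w e1 e2.
  by rewrite e1 e2.
apply: toL2_ae => //; last by apply: filterS Eae => w e; rewrite e.
apply: square_integrable_ae sAB Eae.
by apply: cmeasurableM; [exact: (cmeasurable_comp measurable_fst (L2_meas _))
    |exact: (cmeasurable_comp measurable_snd (L2_meas _))].
Qed.

Definition opK : L2 (mB \X nA) -> L2 fib := comp_op kap.
Definition opK' : L2 fib -> L2 (mB \X nA) := comp_op kap'.

Lemma uni_K : uni opK opK'.
Proof. exact: uni_miso miso_kap. Qed.

(** In the coordinates of [kap], the coefficients of u (x) v along the fibre are products of [v]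
    with functions of the base ([inner_Uf]). As [x] commutes with these functions, amplifying [x]
    has the effect of replacing [v] by [x v], the property that selects [rtens_op]. *)
Lemma rtens_op_ampl (x : L2 mB -> L2 mB) : bounded_op x ->
  (forall F, Linf zeta F -> x \o mulop (F \o q) = mulop (F \o q) \o x) ->
  rtens_op DA DB DA DB id x = Ad opK (ampl nA x).
Proof.
move=> bx hx; have hu := uni_K; have bA := bounded_ampl nA bx.
pose Uf (u : L2 mA) (v : B -> R[i]) (w : B * dis_type DA) := u (dis_par DA (q w.1, w.2)) * v w.1.
have bc : bounded_op (Ad opK (ampl nA x)) by exact: (Ad_bounded hu).
have key u v : zeta_bounded DA u -> Ad opK (ampl nA x) (rtens DA DB u v) = rtens DA DB u (x v).
  move=> ub; rewrite !rtens_kap// (AdE hu) /=; congr comp_op.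
  have [_ K _] := hu; rewrite -/opK K; apply: tens_ext => alpha beta.
  rewrite (ampl_adjoint bx (adjP bx)) amplE; last exact: bounded_adj.
  rewrite (inner_Uf ub) (inner_Uf ub) -(adjP bx).
  have lF := Uf_bounded_fibre ub beta.
  by rewrite (comp_eqP v (hx _ lF)).
have [bc0 hc0] : [set c | bounded_op c /\ forall u v, zeta_bounded DA u ->
    c (rtens DA DB u v) = rtens DA DB (id u) (x v)] (rtens_op DA DB DA DB id x).
  by apply: xgetPex; exists (Ad opK (ampl nA x)).
apply: (bounded_eq_total bc0 bc total_rtens) => _ [u ub [v _ <-]].
by rewrite hc0// key.
Qed.

End relative_tensor.

(** * Compactly supported continuous functions *)

Section measurable_neighbourhoods.
Context (P : topologicalType).
Implicit Types (M : set (set P)) (x : P).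

(** Small neighbourhoods in the collection [M]. Unlike the measurability of all open sets, this
    passes to products with the product sigma-algebra, and it suffices to make compactly supported
    continuous functions measurable. *)
Definition measurable_nbhs M :=
  forall x O, nbhs x O -> exists A, [/\ M A, nbhs x A & A `<=` O].

(** Each point of [K] has a neighbourhood in [M] inside [O], and finite unions stay in [M]. The
    near-covering form of compactness, along the filter of all large enough members of [M] inside
    [O], replaces the choice of a finite subcover. *)
Lemma compact_between M (K O : set P) : M set0 -> (forall A B, M A -> M B -> M (A `|` B)) ->
  measurable_nbhs M -> compact K -> open O -> K `<=` O ->
  exists A, [/\ M A, K `<=` A & A `<=` O].
Proof.
move=> M0 MU hM cK oO KO.
pose F : set_system (set P) := filter_from [set A | M A /\ A `<=` O]
  (fun A => [set B | [/\ M B, B `<=` O & A `<=` B]]).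
have FF : Filter F.
  apply: filter_from_filter; first by exists set0; split => //; exact: sub0set.
  move=> A B [MA AO] [MB BO]; exists (A `|` B).
    by split; [exact: MU|move=> x [/AO|/BO]].
  by move=> C [MC CO ABC]; split; split => // x hx; apply: ABC; [left|right].
move/compact_near_coveringP : cK => /(_ (set P) F (fun B x => B x) FF).
case=> [x /KO Ox|A [MA AO] hA].
  have [A [MA xA AO]] := hM x O (open_nbhs_nbhs (conj oO Ox)).
  exists (A, [set B | [/\ M B, B `<=` O & A `<=` B]]) => /=.
    by split => //; exists A.
  by move=> [y B] /= [Ay [_ _ AB]]; exact: AB.
by exists A; split => //; exact: (hA A (And3 MA AO (@subset_refl _ A))).
Qed.

End measurable_neighbourhoods.

Lemma measurable_nbhs_borel (X : ptopologicalType) :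
  @measurable_nbhs X (@measurable _ (borel X)).
Proof.
move=> x O xO; exists (interior O); split.
- by apply: sub_gen_smallest; exact: open_interior.
- by rewrite nbhsE /=; exists (interior O) => //; split; [exact: open_interior|exact: nbhs_singleton (nbhs_interior xO)].
- exact: interior_subset.
Qed.

Lemma measurable_nbhsX (P1 P2 : topologicalType) d1 (Q1 : measurableType d1)
    d2 (Q2 : measurableType d2) (i1 : Q1 -> P1) (i2 : Q2 -> P2) :
  measurable_nbhs [set A | measurable (i1 @^-1` A)] ->
  measurable_nbhs [set A | measurable (i2 @^-1` A)] ->
  measurable_nbhs [set A | measurable ((fun w : Q1 * Q2 => (i1 w.1, i2 w.2)) @^-1` A)].
Proof.
move=> h1 h2 [x y] O [[/= U V] [/= xU yV] UVO].
have [A [mA xA AU]] := h1 x U xU; have [B [mB yB BV]] := h2 y V yV.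
exists (A `*` B); split.
- by apply: (measurableX mA mB).
- by exists (A, B).
- by move=> [a b] [/= Aa Bb]; apply: UVO; split; [exact: AU|exact: BV].
Qed.

Section compact_support.
Context (R : realType) (P : topologicalType) d (Q : measurableType d) (i : Q -> P).
Hypothesis hM : measurable_nbhs [set A : set P | measurable (i @^-1` A)].

(** For a >= 0 the set where h > a is a countable union of the compact sets h >= a + 1/(n+1). Each
    lies in a measurable set still inside h > a, and these measurable sets have the same union. *)
Lemma measurable_compact_supp (h : P -> R) : continuous h ->
  compact (closure [set x | h x != 0]) -> measurable_fun setT (h \o i).
Proof.
move=> ch cK.
have key (g : P -> R) : continuous g -> compact (closure [set x | g x != 0]) ->
    forall a, 0 <= a -> measurable [set x | g (i x) > a].
  move=> cg cs a a0.
  pose C n := [set x | a + n.+1%:R^-1 <= g x].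
  have cC n : compact (C n).
    apply: subclosed_compact cs _.
      by apply: (@closed_comp _ _ g [set y | a + n.+1%:R^-1 <= y]) => //; exact: closed_ge.
    move=> x /= hx; apply: subset_closure => /=; rewrite gt_eqF//.
    by apply: lt_le_trans hx; rewrite ltr_wpDl// invr_gt0.
  have oO : open [set x | a < g x].
    by apply: (@open_comp _ _ g [set y | a < y]) => //; exact: open_gt.
  have ex n : exists A, [/\ measurable (i @^-1` A), C n `<=` A & A `<=` [set x | a < g x]].
    apply: (compact_between (M := [set A : set P | measurable (i @^-1` A)])) => //.
    - by rewrite /= preimage_set0.
    - by move=> A B /= mA mB; rewrite preimage_setU; exact: measurableU.
    - by move=> x /= hx; apply: lt_le_trans hx; rewrite ltrDl invr_gt0.
  have [A hA] := choice ex.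
  rewrite (_ : [set x | _] = \bigcup_n (i @^-1` (A n))).
    by apply: bigcupT_measurable => n; have [] := hA n.
  apply/seteqP; split => [x /= hx|x [n _ /= Anx]]; last by have [_ _ /(_ _ Anx)] := hA n.
  have h0 : 0 < g (i x) - a by rewrite subr_gt0.
  have [n hn] : exists n : nat, n.+1%:R^-1 <= g (i x) - a.
    exists (Num.truncn (g (i x) - a)^-1).
    rewrite invf_ple ?posrE//; apply/ltW; exact: truncnS_gt.
  exists n => //; have [_ + _] := hA n; apply.
  by rewrite /C /= -lerBrDl.
have kn : forall a, 0 <= a -> measurable [set x | - h (i x) > a].
  apply: (key (fun x => - h x)); first by move=> x; apply: cvgN; exact: ch.
  by rewrite (_ : [set x | - h x != 0] = [set x | h x != 0])//; apply/seteqP; split => x /=; rewrite oppr_eq0.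
apply: (measurability _ (RGenOInfty.measurableE R)) => /= _ [_ [a ->]] <-.
rewrite setTI (_ : _ @^-1` _ = [set x | a < h (i x)]); last first.
  by apply/seteqP; split => x /=; rewrite in_itv /= andbT.
have [a0|a0] := leP 0 a; first exact: key.
(* For a < 0 the complement is where -h >= -a, an intersection of sets -h > -a - 1/(n+1); only those
   n with nonnegative threshold are taken, so that the case already treated applies. *)
rewrite (_ : [set x | _] = ~` \bigcap_(n in [set n : nat | n.+1%:R^-1 <= - a]) [set x | - h (i x) > - a - n.+1%:R^-1]).
  apply: measurableC; apply: bigcap_measurable.
    exists (Num.truncn (- a)^-1) => /=.
    rewrite invf_ple ?posrE ?oppr_gt0//; apply/ltW; exact: truncnS_gt.
  by move=> n /= hn; apply: kn; rewrite subr_ge0.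
apply/seteqP; split => x /=.
  move=> hx; apply/existsNP.
  pose n := Num.truncn (Num.min (h (i x) - a) (- a))^-1.
  have p0 : 0 < Num.min (h (i x) - a) (- a) by rewrite lt_min subr_gt0 hx oppr_gt0.
  have hn : n.+1%:R^-1 <= Num.min (h (i x) - a) (- a).
    by rewrite invf_ple ?posrE//; apply/ltW; exact: truncnS_gt.
  exists n => H; move: hn; rewrite le_min => /andP[hn1 hn2].
  move: (H hn2) hn1 => /=; move: (n.+1%:R^-1 : R) (h (i x)) => r y h1 h2; have h3 : - y <= - a - r by rewrite lerNl opprB opprK -lerBrDr.
  by move: (lt_le_trans h1 h3); rewrite ltxx.
apply: contra_notP => /negP; rewrite -leNgt => hx n hn /=.
rewrite ltrBlDr; apply: (@le_lt_trans _ _ (- h (i x))); first by rewrite lerN2.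
by rewrite ltrDl invr_gt0.
Qed.

End compact_support.

Lemma cintegral_sets_eq0 (R : realType) d (T : measurableType d) (m : {measure set T -> \bar R})
    (h : T -> R[i]) : cintegrable m h ->
  (forall E, measurable E -> cintegral m (fun x => (\1_E x : R)%:C * h x) = 0) ->
  {ae m, forall x, h x = 0}.
Proof.
move=> hi hE.
have key (phi : R[i] -> R) : (forall (r : R) u, phi (r%:C * u) = r * phi u) ->
   m.-integrable setT (EFin \o (phi \o h)) ->
   (forall E, measurable E -> \int[m]_x phi ((\1_E x)%:C * h x) = 0) ->
   {ae m, forall x, phi (h x) = 0}.
  move=> phiZ ip ph0.
  have H0 : ae_eq m setT (EFin \o (phi \o h)) (cst 0%E).
    apply: integral_ae_eq => // E _ mE.
    rewrite integral0.
    have fin : (\int[m]_(x in E) ((phi \o h) x)%:E)%E \is a fin_num.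
      by apply: integrable_fin_num => //; apply: integrableS ip.
    rewrite -(fineK fin); congr EFin; rewrite -[RHS](ph0 E mE).
    rewrite -/(Rintegral _ _ _) Rintegral_mkcond; apply: eq_Rintegral => x _.
    rewrite phiZ patchE /= !indicE.
    by case: (_ \in _); rewrite ?mul1r ?mul0r.
  by apply: filterS H0 => x /(_ I) /= [->].
have hr := key (@complex.Re R) _ (cintegrable_Re hi) _.
have him := key (@complex.Im R) _ (cintegrable_Im hi) _.
apply: filterS2 (hr _ _) (him _ _) => [x e1 e2||E mE||E mE].
- exact: complex_ext.
- by move=> r [a b] /=; ring.
- by have /(congr1 (@complex.Re R)) := hE E mE.
- by move=> r [a b] /=; ring.
- by have /(congr1 (@complex.Im R)) := hE E mE.
Qed.

Lemma total_indic (R : realType) d (T : measurableType d)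
    (m : {sigma_finite_measure set T -> \bar R}) :
  total_in [set toL2 m (fun x => (\1_A x)%:C) | A in [set A | measurable A /\ (m A < +oo)%E]].
Proof.
move=> z hz; have /sigma_finiteP[F [TF ndF Foo]] := sigma_finiteT m.
have hn n : {ae m, forall x, (\1_(F n) x : R)%:C * conjc (z x) = 0}.
  have [mF Fn] := Foo n; have sF := sqint_indic mF Fn.
  apply: cintegral_sets_eq0; first by apply: sq_cintegrable => //; exact: L2_sqint.
  move=> E mE; have mEF : measurable (E `&` F n) by exact: measurableI.
  have EFoo : (m (E `&` F n) < +oo)%E.
    by apply: le_lt_trans Fn; apply: le_measure; rewrite ?inE.
  have sEF := sqint_indic mEF EFoo.
  rewrite -[RHS](hz _ (ex_intro2 _ _ _ (conj mEF EFoo) erefl)).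
  rewrite (inner_ae sEF.1 (L2_meas z) (toL2E sEF)); last exact: nearW.
  by apply: eq_cintegral => x; rewrite indicI rmorphM mulrA.
have all : {ae m, forall x, forall n, (\1_(F n) x : R)%:C * conjc (z x) = 0} by apply: ae_foralln.
apply/L2P; apply: filterS2 all (L2_0E m) => x hx ->.
have : [set: T] x by []. rewrite TF => -[n _ Fnx].
have := hx n; rewrite indicE mem_set// mul1r => /eqP.
by rewrite conjc_eq0 => /eqP.
Qed.

Section urysohn.
Context (R : realType) (X : ptopologicalType).
Hypotheses (hX : hausdorff_space X) (lX : locally_compact [set: X]).

(** Urysohn's lemma in the one-point compactification, which is compact Hausdorff and hence normal,
    separating [K] from a closed set that contains the point at infinity. *)
Lemma urysohn_compact (K O : set X) : compact K -> open O -> K `<=` O ->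
  exists chi : X -> R, [/\ continuous chi, forall x, 0 <= chi x <= 1,
    forall x, K x -> chi x = 1, forall x, ~ O x -> chi x = 0
    & compact (closure [set x | chi x != 0])].
Proof.
move=> cK oO KO; pose opc := one_point_compactification X.
have hopc : hausdorff_space opc by exact: one_point_compactification_hausdorff.
have nopc : normal_space opc.
  by apply: compact_normal => //; exact: one_point_compactification_compact.
have cSome : continuous (Some : X -> opc) by exact: one_point_compactification_some_continuous.
have cA : closed (Some @` K : set opc).
  apply: compact_closed => //; apply: continuous_compact => //.
  exact: continuous_subspaceT.
have cB : closed (~` (Some @` O) : set opc).
  by apply: open_closedC; exact: one_point_compactification_open_some.
have AB0 : (Some @` K : set opc) `&` ~` (Some @` O) = set0.
  by apply/disjoints_subset; rewrite setCK => _ [x /KO Ox <-]; exists x.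
have /(@uniform_separatorP _ R)[f [cf f01 fA fB]] := (@normal_separatorP R opc).1 nopc _ _ cA cB AB0.
have fN : f None = 1 by apply: fB; exists None => // -[].
have f01' y : 0 <= f y <= 1 by have := f01 (f y) (ex_intro2 _ _ y I erefl); rewrite /= in_itv.
(* [f] is 1 at infinity, hence above 1/2 off a compact set. The factor 2 makes the new function
   vanish there, which yields compact support. *)
exists (fun x => Num.max (1 - 2 * f (Some x)) 0); split.
- move=> x; apply: (@continuous_max R X (fun x => 1 - 2 * f (Some x)) (fun=> 0) x); last exact: cvg_cst.
  apply: cvgB; first exact: cvg_cst.
  by apply: cvgM; [exact: cvg_cst|apply: (@continuous_comp _ _ _ (Some : X -> opc) f); [exact: cSome|exact: cf]].
- move=> x; rewrite le_max lexx orbT/= ge_max ler01 andbT.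
  by have /andP[h _] := f01' (Some x); rewrite gerBl mulr_ge0.
- move=> x Kx; have -> : f (Some x) = 0 by apply: fA; exists (Some x) => //; exists x.
  by rewrite mulr0 subr0 max_l.
- move=> x nOx; have -> : f (Some x) = 1.
    by apply: fB; exists (Some x) => // -[y Oy [xy]]; apply: nOx; rewrite -xy.
  by rewrite max_r// mulr1; lra.
- have /(cf None) : nbhs (f None) [set y | 1 / 2 < y].
    rewrite fN; apply: open_nbhs_nbhs; split; first exact: open_gt.
    by rewrite /=; lra.
  move=> [C [cC clC] hC].
  apply: (subclosed_compact _ cC); first exact: closed_closure.
  rewrite [X in _ `<=` X]((closure_id C).1 clC); apply: closureS => x /=.
  apply: contra_neqP => nCx; have /= := hC (Some x) (or_introl (ex_intro2 _ _ x nCx erefl)).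
  by move=> h; rewrite max_r//; lra.
Qed.

End urysohn.

Section Cc_functions.
Context (R : realType) (P : topologicalType).

Lemma Cc_real (chi : P -> R) : continuous chi ->
  compact (closure [set x | chi x != 0]) -> @Cc R P (fun x => (chi x)%:C).
Proof.
move=> cchi cs; split => //; first by move=> x; exact: cvg_cst.
rewrite (_ : [set x | _] = [set x | chi x != 0])//; apply/seteqP; split => x /=;
  by rewrite eq_complex /= eqxx andbT.
Qed.

Lemma Cc_bounded (h : P -> R[i]) : Cc h -> exists M : R, forall x, sqabs (h x) <= M.
Proof.
move=> [cr ci cs]; pose f x := sqabs (h x).
have cf : continuous f.
  by move=> x; apply: cvgD; [apply: cvgM; exact: cr|apply: cvgM; exact: ci].
have /compact_bounded : compact (f @` closure [set x | h x != 0] : set (R^o)).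
  by apply: continuous_compact => //; exact: continuous_subspaceT.
move=> /pinfty_ex_gt0[M M0 hM]; exists M => x.
have [hx|hx] := eqVneq (h x) 0; first by rewrite hx sqabs0 ltW.
apply: le_trans (hM (f x) _); first exact: ler_norm.
by exists x => //; exact: subset_closure.
Qed.

Lemma Cc_cmeasurable d (Q : measurableType d) (i : Q -> P) (h : P -> R[i]) :
  measurable_nbhs [set A : set P | measurable (i @^-1` A)] -> Cc h -> cmeasurable (h \o i).
Proof.
move=> hM [cr ci cs].
have sub (f : P -> R) : (forall x, h x = 0 -> f x = 0) -> compact (closure [set x | f x != 0]).
  move=> hf; apply: subclosed_compact cs _; first exact: closed_closure.
  by apply: closureS => x /=; apply: contra_neq => /hf.
by split; [apply: (measurable_compact_supp hM cr)|apply: (measurable_compact_supp hM ci)]; apply: sub => x ->.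
Qed.

End Cc_functions.

Section radon_density.
Context (R : realType) (X : ptopologicalType).
Hypotheses (hX : hausdorff_space X) (lX : locally_compact [set: X]) (sX : sigma_compact X).
Variable nu : {sigma_finite_measure set (borel X) -> \bar R}.
Hypothesis rnu : radon nu.

Lemma measurable_open (O : set X) : open O -> measurable (O : set (borel X)).
Proof. exact: sub_gen_smallest. Qed.

Lemma measurable_compact (K : set X) : compact K -> measurable (K : set (borel X)).
Proof.
move=> cK; rewrite -[K]setCK; apply: measurableC; apply: measurable_open.
by apply: closed_openC; exact: compact_closed.
Qed.

Lemma Cc_borel (h : X -> R[i]) : Cc h -> cmeasurable (h : borel X -> R[i]).
Proof.
move=> ch; apply: (Cc_cmeasurable (i := fun x : borel X => x : X) _ ch).
exact: measurable_nbhs_borel.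
Qed.

Lemma Cc_Linf (h : X -> R[i]) : Cc h -> Linf nu h.
Proof.
move=> ch; split; first exact: Cc_borel.
by have [M hM] := Cc_bounded ch; exists M; exact: nearW.
Qed.

Lemma Cc_sqint (h : X -> R[i]) : Cc h -> square_integrable nu h.
Proof.
move=> ch; have [_ _ cs] := ch.
have mK := measurable_compact cs; have [roo _ _] := rnu; have Koo := roo _ cs.
have s := sqint_indic mK Koo.
apply: square_integrable_ae (Linf_sqint (Cc_Linf ch) s).1 _; first exact: Cc_borel.
apply: nearW => x /=; rewrite indicE.
have [_|] := boolP (x \in _); first by rewrite mulr1.
rewrite mulr0 notin_setE => hx; apply/esym/eqP/negPn/negP => hx'.
by apply: hx; exact: subset_closure.
Qed.

Lemma indic_approx (A : set (borel X)) (e : R) : measurable A -> (nu A < +oo)%E -> 0 < e ->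
  exists2 h : X -> R[i], Cc h & nsq (toL2 nu (fun x => (\1_A x)%:C) - toL2 nu h) <= e.
Proof.
move=> mA Aoo e0; have [_ rout rin] := rnu.
have e2 : 0 < e / 2 by rewrite divr_gt0.
have Af : nu A \is a fin_num by rewrite ge0_fin_numE.
have [U [oU AU] Ue] : exists2 U : set (borel X), @open X U /\ A `<=` U & (nu U < nu A + (e / 2)%:E)%E.
  have : (nu A < nu A + (e / 2)%:E)%E by rewrite lteDl.
  by rewrite {1}rout// => /ereal_inf_lt[_ [U hU <-] h]; exists U.
have mU := measurable_open oU.
have Uoo : (nu U < +oo)%E by apply: lt_trans Ue _; rewrite lte_add_pinfty// ltry.
have Uf : nu U \is a fin_num by rewrite ge0_fin_numE.
(* Inner regularity is given for open sets, so the compact set is found inside [U] and need not lie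
   in [A]. *)
have [K [cK KU] Ke] : exists2 K : set (borel X), @compact X K /\ K `<=` U & (nu U - (e / 2)%:E < nu K)%E.
  have : (nu U - (e / 2)%:E < nu U)%E by rewrite lteBlDl// lteDr.
  by rewrite {2}rin// => /ereal_sup_gt[_ [K hK <-] h]; exists K.
have mK := measurable_compact cK.
have Kf : nu K \is a fin_num.
  by rewrite ge0_fin_numE//; apply: le_lt_trans Uoo; apply: le_measure; rewrite ?inE.
have [chi [cchi c01 cK1 cU0 cs]] := urysohn_compact R hX lX cK oU KU.
have hC := Cc_real cchi cs; exists (fun x => (chi x)%:C) => //.
have sA := sqint_indic mA Aoo; have sC := Cc_sqint hC.
have mUA : measurable (U `\` A) by exact: measurableD.
have mUK : measurable (U `\` K) by exact: measurableD.
have UAe : (nu (U `\` A) <= (e / 2)%:E)%E.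
  by rewrite measureD// setIidr// leeBlDl// ltW.
have UKe : (nu (U `\` K) <= (e / 2)%:E)%E.
  by rewrite measureD// setIidr// leeBlDl// -leeBlDr// ltW.
rewrite -lee_fin -sqabs_integral.
(* The squared difference of 1_A and [chi] is at most 1; it vanishes off [U] and on the intersection
   of [A] and [K]. *)
apply: (@le_trans _ _ (\int[nu]_x ((\1_(U `\` A) x : R)%:E + (\1_(U `\` K) x : R)%:E))%E); last first.
  rewrite ge0_integralD//.
  - rewrite !integral_indic// !setIT [in leRHS](splitr e) EFinD; exact: leeD.
  - by apply/measurable_EFinP; exact: measurable_indic.
  - by apply/measurable_EFinP; exact: measurable_indic.
apply: ae_ge0_le_integral => //.
- by move=> x _; rewrite lee_fin sqabs_ge0.
- by apply/measurable_EFinP/measurable_sqabs/L2_meas.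
- by move=> x _; rewrite -EFinD lee_fin addr_ge0.
- by apply: emeasurable_funD; apply/measurable_EFinP; exact: measurable_indic.
- apply: filterS3 (L2_subE (toL2 nu (fun x => (\1_A x : R)%:C)) (toL2 nu (fun x => (chi x)%:C)))
    (toL2E sA) (toL2E sC) => x -> -> -> _.
  rewrite -EFinD lee_fin -rmorphB sqabs_real !indicE !in_setD.
  have /andP[c0 c1] := c01 x.
  have le1 (y : R) : 0 <= y -> y <= 1 -> y ^+ 2 <= 1 by move=> ? ?; rewrite exprn_ile1.
  have [xA|xA] := boolP (x \in A).
    have xU : x \in U by rewrite inE; apply: AU; rewrite inE in xA.
    rewrite xU /= add0r; have [xK|xK] := boolP (x \in K).
      by rewrite cK1 ?subrr ?expr0n//=; rewrite inE in xK.
    by apply: le1; rewrite ?subr_ge0// gerBl.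
  rewrite sub0r sqrrN; have [xU|xU] := boolP (x \in U).
    by apply: le_trans (le1 _ c0 c1) _; rewrite /= lerDl ler0n.
  have -> : chi x = 0 by apply: cU0; rewrite notin_setE in xU.
  by rewrite expr0n /= addr0.
Qed.

Lemma total_Cc : total_in [set toL2 nu h | h in @Cc R X].
Proof.
move=> w hw; apply: total_indic => _ [A [mA Aoo] <-].
apply/eqP; rewrite -sqabs_eq0 eq_le sqabs_ge0 andbT; apply/ler_addgt0Pl => e e0.
have K0 : 0 < nsq w + 1 by rewrite ltr_wpDl ?nsq_ge0.
have [h ch hh] := indic_approx mA Aoo (divr_gt0 e0 K0).
have -> : inner (toL2 nu (fun x => (\1_A x)%:C)) w =
    inner (toL2 nu (fun x => (\1_A x)%:C) - toL2 nu h) w.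
  by rewrite innerBl (hw (toL2 nu h)) ?subr0//; exists h.
apply: (le_trans (cauchy_schwarz _ _)); rewrite addr0.
apply: (@le_trans _ _ (e / (nsq w + 1) * (nsq w + 1))); last by rewrite divfK// gt_eqF.
by apply: ler_pM => //; rewrite ?nsq_ge0// lerDl.
Qed.

(** Sigma-compactness gives countably many cut-off functions that are 1 on the members of a cover. A
    vector orthogonal to all these products is annihilated by each cut-off, hence vanishes almost
    everywhere. *)
Lemma total_Cc_mul : total_in [set mulop (h : borel X -> R[i]) u | h in @Cc R X & u in [set: L2 nu]].
Proof.
move=> w hw; have [K [cK TK]] := sX.
have ex n : exists chi : X -> R, @Cc R X (fun x => (chi x)%:C) /\ forall x, K n x -> chi x = 1.
  have [chi [cchi _ cK1 _ cs]] := urysohn_compact R hX lX (cK n) openT (@subsetT _ (K n)).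
  by exists chi; split => //; exact: Cc_real.
have [chi hchi] := choice ex.
have h0 n : mulop (fun x : borel X => (chi n x)%:C) w = 0.
  have lc := Cc_Linf (hchi n).1.
  apply: inner_extr => u; rewrite inner0r.
  have -> : (fun x => (chi n x)%:C) = (fun x => conjc (chi n x)%:C).
    by apply/funext => x; rewrite conjc_real.
  rewrite -(adjoint_mulop lc); apply: hw.
  by exists (fun x => (chi n x)%:C); [exact: (hchi n).1|exists u].
have all : {ae nu, forall x : borel X, forall n, (chi n x)%:C * w x = 0}.
  apply: ae_foralln => n; have lc := Cc_Linf (hchi n).1.
  by apply: filterS2 (mulopE w lc) (L2_0E nu) => x; rewrite h0 => <- ->.
apply/L2P; apply: filterS2 all (L2_0E nu) => x hx ->.
have : [set: X] x by []. rewrite -TK => -[n _ Kx].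
by have := hx n; rewrite (hchi n).2// mul1r.
Qed.

End radon_density.

(** * Kernel operators *)

Section dirac_factor.
Context (R : realType).
Context d1 (T1 : measurableType d1) (m : {sigma_finite_measure set T1 -> \bar R}).
Context d2 (T2 : measurableType d2) (x : T2).
Local Notation dx := (dirac x : {sigma_finite_measure set T2 -> \bar R}).

Lemma mpres_dirac : mpres m (m \X dx) (fun t => (t, x)).
Proof.
have mj : measurable_fun setT (fun t : T1 => (t, x)).
  by apply/measurable_fun_pair => //; exact: measurable_id.
split=> // S mS.
apply: (product_measure_unique (m' := image_mes m mj)) => // A B mA mB.
rewrite /= /pushforward diracE.
have [xB|xB] := boolP (x \in B).
  rewrite mule1; congr (m _); apply/seteqP; split => t /=; first by case.
  by split => //; rewrite inE in xB.
rewrite mule0 (_ : _ @^-1` _ = set0) ?measure0//.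
by apply/seteqP; split => t //= [_ h]; move: xB; rewrite notin_setE.
Qed.

Lemma mpres_diracl : mpres m (dx \X m) (fun t => (x, t)).
Proof. exact: mpres_comp (mpres_swap m dx) mpres_dirac. Qed.

End dirac_factor.

(** Both sides are computed from positive and negative parts, so they agree even where the integral
    diverges. This matters for convolutions, which are written out at every point. *)
Lemma cintegral_mpres_meas (R : realType) d (T : measurableType d) (mu : {measure set T -> \bar R})
    d' (U : measurableType d') (nu : {measure set U -> \bar R}) (c : U -> T)
    (f : T -> R[i]) : mpres nu mu c -> cmeasurable f ->
  cintegral mu f = cintegral nu (f \o c).
Proof.
move=> hc [mr mi].
have key (h : T -> R) : measurable_fun setT h -> \int[mu]_x h x = \int[nu]_y h (c y).
  move=> mh; have mE : measurable_fun setT (EFin \o h) by exact/measurable_EFinP.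
  rewrite /Rintegral; congr fine; rewrite integralE [in RHS]integralE; congr (_ - _)%E.
    rewrite (ge0_integral_mpres hc (measurable_funepos mE))//.
    by apply: eq_integral => y _; rewrite !funeposE.
  rewrite (ge0_integral_mpres hc (measurable_funeneg mE))//.
  by apply: eq_integral => y _; rewrite !funenegE.
by rewrite /cintegral (key _ mr) (key _ mi).
Qed.

Section kernel_operators.
Context (R : realType).
Context d1 (T : measurableType d1) (m : {sigma_finite_measure set T -> \bar R}).
Context d2 (Y : measurableType d2) (n : {sigma_finite_measure set Y -> \bar R}).

(** The partial integral is square integrable by fibrewise Cauchy-Schwarz and Tonelli; by Fubini it
    then has the property that defines the adjoint. *)
Lemma adj_insE (b : L2 n) (z : L2 (m \X n)) :
  {ae m, forall x, adj (ins b) z x = cintegral n (fun y => z (x, y) * conjc (b y))}.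
Proof.
pose f x := cintegral n (fun y => z (x, y) * conjc (b y)).
have mzb : cmeasurable (fun w : T * Y => z w * conjc (b w.2)).
  apply: cmeasurableM; first exact: L2_meas.
  by apply: cmeasurable_conj; apply: cmeasurable_snd; exact: L2_meas.
have mf : cmeasurable f by exact: (cmeasurable_cfubini _ mzb).
have mzE : measurable_fun setT (fun w => (sqabs (z w))%:E : \bar R).
  by apply/measurable_EFinP/measurable_sqabs/L2_meas.
have z0 w : (0 <= (sqabs (z w))%:E :> \bar R)%E by rewrite lee_fin sqabs_ge0.
pose q x := (\int[n]_y (sqabs (z (x, y)))%:E)%E.
have mq : measurable_fun setT q by exact: (measurable_fun_fubini_tonelli_F (m2 := n) _ mzE).
have qI : (\int[m]_x q x = (nsq z)%:E)%E.
  by rewrite -sqabs_integral (@fubini_tonelli1 _ _ _ _ _ m n _ mzE z0).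
have q0 x : (0 <= q x)%E by apply: integral_ge0.
have mz x : cmeasurable (fun y => z (x, y)).
  by apply: (cmeasurable_comp (f := z) (pair1_measurable x)); exact: L2_meas.
have qoo : {ae m, forall x, (q x < +oo)%E}.
  have : m.-integrable setT q.
    apply/integrableP; split => //.
    by under eq_integral do rewrite gee0_abs//; rewrite qI ltry.
  move=> /(integrable_ae measurableT); apply: filterS => x /(_ I) h.
  by rewrite -ge0_fin_numE.
have sq x : (q x < +oo)%E -> square_integrable n (fun y => z (x, y)) by [].
have fle : {ae m, forall x, ((sqabs (f x))%:E <= (nsq b)%:E * q x)%E}.
  apply: filterS qoo => x /sq s.
  have -> : f x = inner (toL2 n (fun y => z (x, y))) b.
    by rewrite (inner_ae s.1 (L2_meas b) (toL2E s))//; exact: nearW.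
  apply: (@le_trans _ _ (nsq (toL2 n (fun y => z (x, y))) * nsq b)%:E).
    by rewrite lee_fin; exact: cauchy_schwarz.
  rewrite EFinM muleC; apply: lee_wpmul2l; first by rewrite lee_fin nsq_ge0.
  rewrite -sqabs_integral le_eqVlt; apply/orP; left; apply/eqP; apply: ge0_ae_eq_integral => //.
  - by apply/measurable_EFinP/measurable_sqabs/L2_meas.
  - by apply/measurable_EFinP/measurable_sqabs; exact: s.1.
  - by move=> y _; rewrite lee_fin sqabs_ge0.
  - by apply: filterS (toL2E s) => y e _; rewrite e.
have sf : square_integrable m f.
  split => //; apply: (@le_lt_trans _ _ (\int[m]_x ((nsq b)%:E * q x))%E).
    apply: ae_ge0_le_integral => //.
    - by move=> x _; rewrite lee_fin sqabs_ge0.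
    - by apply/measurable_EFinP; exact: measurable_sqabs.
    - by move=> x _; rewrite mule_ge0// lee_fin nsq_ge0.
    - exact: measurable_funeM.
    - by apply: filterS fle => x h _.
  rewrite ge0_integralZl//; last by rewrite lee_fin nsq_ge0.
  by rewrite qI -EFinM ltry.
suff -> : adj (ins b) z = toL2 m f by exact: toL2E.
apply: inner_ext => u; rewrite [LHS]innerC -(adjP (bounded_ins m b)) -innerC.
have st := sqint_tens (L2_sqint u) (L2_sqint b).
rewrite (inner_ae (L2_meas z) st.1 _ (tensE u b)); last exact: nearW.
rewrite (cfubini (sq_cintegrable (L2_sqint z) st)).
rewrite (inner_ae sf.1 (L2_meas u) (toL2E sf)); last exact: nearW.
apply: ae_eq_cintegral.
- exact: (cmeasurable_cfubini _ (cmeasurableM (L2_meas z) (cmeasurable_conj st.1))).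
- by apply: cmeasurableM => //; apply: cmeasurable_conj; exact: L2_meas.
apply: filterS qoo => x /sq s; rewrite mulrC -cintegralZ.
  by apply: eq_cintegral => y; rewrite conjcM mulrCA.
exact: sq_cintegrable s (L2_sqint b).
Qed.

Variable sw : T * Y -> T * Y.
Hypothesis hsw : mpres (m \X n) (m \X n) sw.

(** For indicators [a] and [b] this integrates k(x, y) times the value of the vector at the first
    component of sw(x, y), over y. In this factored form boundedness and commutation relations are
    inherited from the factors. *)
Definition kop (k : T * Y -> R[i]) (a b : L2 n) : L2 m -> L2 m :=
  adj (ins b) \o mulop k \o comp_op sw \o ins a.

Lemma bounded_kop k a b : Linf (m \X n) k -> bounded_op (kop k a b).
Proof.
move=> lk; apply: bounded_comp; first exact: bounded_ins.
apply: bounded_comp; first exact: bounded_comp_op.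
apply: bounded_comp; first exact: bounded_mulop.
by apply: bounded_adj; exact: bounded_ins.
Qed.

Lemma kop_comm k a b t : bounded_op t ->
  ampl n t \o mulop k = mulop k \o ampl n t ->
  ampl n t \o comp_op sw = comp_op sw \o ampl n t -> t \o kop k a b = kop k a b \o t.
Proof.
move=> bt h1 h2; apply/funext => u; rewrite /kop /=.
rewrite -(comp_eqP u (ampl_ins a bt)) /= -(comp_eqP (ins a u) h2) -(comp_eqP _ h1).
by rewrite -(comp_eqP _ (adj_ins_ampl b bt)).
Qed.

(* The function k cut off by C in both variables is k itself, so inserting the
   indicator of C on both sides of multiplication by k is harmless. *)
Lemma toL2_kop (k : T * Y -> R[i]) (C : set Y) (xi : L2 m) : Linf (m \X n) k ->
  measurable C -> (n C < +oo)%E ->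
  (forall w, k w = k w * ((\1_C (sw w).2)%:C * (\1_C w.2)%:C)) ->
  let a := toL2 n (fun y => (\1_C y)%:C) in
  square_integrable m (fun x => cintegral n (fun y => k (x, y) * xi (sw (x, y)).1)) /\
  toL2 m (fun x => cintegral n (fun y => k (x, y) * xi (sw (x, y)).1)) = kop k a a xi.
Proof.
move=> lk mC Coo hk a; have sC := sqint_indic mC Coo.
pose F x := cintegral n (fun y => k (x, y) * xi (sw (x, y)).1).
have mG : cmeasurable (fun w : T * Y => k w * xi (sw w).1).
  apply: cmeasurableM; first exact: lk.1.
  apply: (cmeasurable_comp (f := xi) (phi := fun w => (sw w).1)); last exact: L2_meas.
  exact: measurableT_comp measurable_fst hsw.1.
have mF : cmeasurable F by exact: (cmeasurable_cfubini _ mG).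
pose z : L2 (m \X n) := mulop k (comp_op sw (ins a xi)).
have zE : {ae m \X n, forall w, z w * conjc (a w.2) = k w * xi (sw w).1}.
  have h1 := mulopE (comp_op (nu := m \X n) sw (ins a xi)) lk.
  have h2 := comp_opE hsw (ins a xi).
  have h3 := ae_mpres hsw (tensE xi a).
  have h4 := ae_mpres hsw (@ae_snd _ _ _ m _ _ n _ (toL2E sC)).
  have h5 := @ae_snd _ _ _ m _ _ n _ (toL2E sC).
  apply: filterS3 (filterI h1 h2) (filterI h3 h4) h5 => w [e1 e2] [e3 e4] e5.
  rewrite /z e1 e2 [X in _ * X * _]e3 [X in _ * (_ * X) * _]e4 [X in conjc X]e5.
  by rewrite conjc_real [k w in RHS]hk; ring.
have E : {ae m, forall x, kop k a a xi x = F x}.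
  have h := ae_fubini zE; apply: filterS2 (adj_insE a z) h => x e1 e2.
  rewrite [LHS]e1; apply: ae_eq_cintegral => //.
  - apply: cmeasurableM; last by apply: cmeasurable_conj; exact: L2_meas.
    by apply: (cmeasurable_comp (f := z) (pair1_measurable x)); exact: L2_meas.
  - exact: (cmeasurable_comp (f := fun w => k w * xi (sw w).1) (pair1_measurable x)).
have sF : square_integrable m F by apply: square_integrable_ae mF (L2_sqint _) E.
by split => //; apply: eq_toL2 => //; apply: filterS E => x ->.
Qed.

End kernel_operators.

Section tensor_misc.
Context (R : realType).
Context d1 (T1 : measurableType d1) (m1 : {sigma_finite_measure set T1 -> \bar R}).
Context d2 (T2 : measurableType d2) (m2 : {sigma_finite_measure set T2 -> \bar R}).

Lemma Linf_tens (f : T1 -> R[i]) (g : T2 -> R[i]) : Linf m1 f -> Linf m2 g ->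
  Linf (m1 \X m2) (fun w => f w.1 * g w.2).
Proof.
move=> lf lg; apply: (@LinfM _ _ _ _ (fun w => f w.1) (fun w => g w.2)); first exact: Linf_fst.
split; first exact: cmeasurable_snd lg.1.
by have [M hM] := lg.2; exists M; exact: ae_snd hM.
Qed.

Lemma mulop_tens (f : T1 -> R[i]) (g : T2 -> R[i]) (u : L2 m1) (v : L2 m2) :
  Linf m1 f -> Linf m2 g ->
  mulop (fun w => f w.1 * g w.2) (tens u v) = tens (mulop f u) (mulop g v).
Proof.
move=> lf lg; apply/L2P.
apply: filterS3 (filterI (mulopE (tens u v) (Linf_tens lf lg)) (tensE u v))
  (tensE (mulop f u) (mulop g v))
  (filterI (@ae_fst _ _ _ m1 _ _ m2 _ (mulopE u lf)) (@ae_snd _ _ _ m1 _ _ m2 _ (mulopE v lg))).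
by move=> w [-> ->] -> [-> ->]; rewrite mulrACA.
Qed.

Lemma tens_op_rank1_gen (q : L2 m1 -> L2 m1) (e f : L2 m2) : bounded_op q ->
  tens_op q (rank1 e f) = ins e \o q \o adj (ins f).
Proof.
move=> bq; apply/esym/tens_op_uniq => //; first exact: bounded_rank1.
  apply: bounded_comp; first by apply: bounded_adj; exact: bounded_ins.
  by apply: bounded_comp bq _; exact: bounded_ins.
by move=> u v /=; rewrite adj_ins_tens (linZ _ _ bq.1) /ins /rank1 tensZl tensZr.
Qed.

Lemma total_tensl (E1 : set (L2 m1)) : total_in E1 ->
  total_in [set tens x phi | x in E1 & phi in [set: L2 m2]].
Proof.
move=> tE w hw; apply: ext_adj_ins => phi.
rewrite (lin0 (bounded_adj (bounded_ins m1 phi)).1).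
apply: tE => x Ex; rewrite -(adjP (bounded_ins m1 phi)); apply: hw.
by exists x => //; exists phi.
Qed.

(* The operators q (x) |phi><psi| act nondegenerately: A ranging over them,
   t (1 (x) b) A = (1 (x) b) A t = (1 (x) b) t A. *)
Lemma comm_rank1_idtens (Q : set (L2 m1 -> L2 m1)) (E : set (L2 m2)) (e0 : L2 m2) t b :
  nsq e0 = 1 -> Q `<=` bounded_op (nu := m1) ->
  total_in [set q u | q in Q & u in [set: L2 m1]] -> total_in E ->
  bounded_op t -> bounded_op b ->
  (forall q phi psi, Q q -> E phi -> E psi ->
     t \o tens_op q (rank1 phi psi) = tens_op q (rank1 phi psi) \o t) ->
  t \o tens_op id b = tens_op id b \o t.
Proof.
move=> e1 bQ tQ tE bt bb h; have bi := bounded_id m1.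
(* If every member of [E] were zero, totality would force the unit vector [e0] to vanish. *)
have [psi [Epsi psi0]] : exists psi, E psi /\ nsq psi <> 0.
  apply: contrapT => hn; have : e0 = 0.
    apply: tE => psi Epsi; have -> : psi = 0; last exact: inner0l.
    by apply: nsq_eq0; apply: contrapT => h0; apply: hn; exists psi.
  by move=> e00; move: e1; rewrite e00 nsq0 => /eqP; rewrite eq_sym oner_eq0.
(* For fixed [q] and argument, both sides depend linearly and boundedly on [phi], so that totality
   of [E] extends the commutation to all [phi]. *)
have key q phi : Q q -> t \o tens_op q (rank1 phi psi) = tens_op q (rank1 phi psi) \o t.
  move=> Qq; have bq := bQ _ Qq; rewrite (tens_op_rank1_gen _ _ bq); apply/funext => z /=.
  pose T1' : L2 m2 -> L2 (m1 \X m2) := t \o tens (q (adj (ins psi) z)).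
  pose T2' : L2 m2 -> L2 (m1 \X m2) := tens (q (adj (ins psi) (t z))).
  suff E12 : T1' = T2' by exact: (congr1 (fun g => g phi) E12).
  apply: (bounded_eq_total (E := E)) => //.
  - by apply: bounded_comp bt; exact: tens_linr.
  - exact: tens_linr.
  - move=> x Ex; have := h q x psi Qq Ex Epsi; rewrite (tens_op_rank1_gen _ _ bq).
      by move=> /(congr1 (fun g => g z)).
apply: (bounded_eq_total (E := [set tens x phi | x in [set q u | q in Q & u in [set: L2 m1]] & phi in [set: L2 m2]])).
- by apply: bounded_comp bt; exact: bounded_tens_op.
- by apply: bounded_comp bt _; exact: bounded_tens_op.
- exact: total_tensl.
move=> _ [_ [q Qq [u _ <-]] [phi _ <-]] /=; have bq := bQ _ Qq.
have A x : tens_op q (rank1 x psi) (tens u psi) = (nsq psi)%:C *: tens (q u) x.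
  by rewrite (tens_op_rank1_gen _ _ bq) /= adj_ins_tens (linZ _ _ bq.1) /ins tensZl inner_self.
have B x : (nsq psi)%:C *: t (tens (q u) x) = tens_op q (rank1 x psi) (t (tens u psi)).
  by rewrite -(linZ _ _ bt.1) -A; exact: (congr1 (fun g => g (tens u psi)) (key _ x Qq)).
have nz : (nsq psi)%:C != 0 by rewrite eq_complex /= eqxx andbT; apply/eqP.
apply: (scalerI nz); rewrite (tens_opE _ _ bi bb) B.
have bib := bounded_tens_op bi bb; rewrite -(linZ _ _ bib.1) B.
have br := bounded_rank1 phi psi.
have -> : tens_op q (rank1 (b phi) psi) = tens_op id b \o tens_op q (rank1 phi psi); last by [].
rewrite (tens_op_comp bi bq bb br); congr tens_op.
by apply/funext => v; rewrite /rank1 /= (linZ _ _ bb.1).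
Qed.

End tensor_misc.

Section composition_transfer.
Context (R : realType).
Context d1 (T : measurableType d1) (m : {sigma_finite_measure set T -> \bar R}).
Context d2 (T' : measurableType d2) (m' : {sigma_finite_measure set T' -> \bar R}).
Context d3 (S : measurableType d3) (n : {sigma_finite_measure set S -> \bar R}).

Lemma miso_mapl (c : T' -> T) c' : mpres m' m c -> measurable_fun setT c' -> cancel c c' ->
  miso (m \X n) (m' \X n) (map_pair c id) (map_pair c' id).
Proof.
by move=> hc mc' K; apply: miso_map => //; exact: mpres_id.
Qed.

Lemma ampl_Ad (c : T' -> T) c' x : mpres m' m c -> measurable_fun setT c' -> cancel c c' ->
  bounded_op x ->
  ampl n (Ad (@comp_op _ _ _ m _ _ m' c) x) =
  Ad (@comp_op _ _ _ (m \X n) _ _ (m' \X n) (map_pair c id)) (ampl n x).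
Proof.
move=> hc mc' K bx; have hu := uni_miso (miso_cancel hc mc' K).
have hu' := uni_miso (miso_mapl hc mc' K); have hi := mpres_id n.
have hc' := miso_mpres (miso_cancel hc mc' K).
apply/esym/ampl_uniq.
- exact: (Ad_bounded hu).
- by apply: (Ad_bounded hu'); exact: bounded_ampl.
- move=> u v; rewrite (AdE hu') (AdE hu) /=.
  by rewrite (comp_map_tens _ _ hc' hi) (amplE _ _ bx) (comp_map_tens _ _ hc hi) !comp_op_id.
Qed.

End composition_transfer.

Section swap23.
Context (R : realType).
Context d1 (T1 : measurableType d1) (m1 : {sigma_finite_measure set T1 -> \bar R}).
Context d2 (T2 : measurableType d2) (m2 : {sigma_finite_measure set T2 -> \bar R}).
Context d3 (T3 : measurableType d3) (m3 : {sigma_finite_measure set T3 -> \bar R}).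

Definition swap23 (A B C : Type) (w : A * B * C) : A * C * B := ((w.1.1, w.2), w.1.2).

Lemma mpres_swap23 : mpres (m1 \X m2 \X m3) (m1 \X m3 \X m2) (@swap23 T1 T2 T3).
Proof.
exact: mpres_comp (mpres_unassoc m1 m3 m2)
  (mpres_comp (mpres_map (mpres_id m1) (mpres_swap m2 m3)) (mpres_assoc m1 m2 m3)).
Qed.

Lemma comp_swap23_tens (u : L2 m1) (v : L2 m2) (w : L2 m3) :
  comp_op (@swap23 T1 T2 T3) (tens (tens u w) v) = tens (tens u v) w.
Proof.
have h1 := mpres_assoc m1 m2 m3; have h2 := mpres_map (mpres_id m1) (mpres_swap m2 m3).
have h3 := mpres_unassoc m1 m3 m2.
rewrite -[@swap23 T1 T2 T3]/(@unassoc_pair T1 T3 T2 \o (map_pair id (@swap_pair T2 T3) \o @assoc_pair T1 T2 T3)).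
rewrite -(comp_op_comp _ h3 (mpres_comp h2 h1)) -(comp_op_comp _ h2 h1).
rewrite comp_unassoc_tens (comp_map_tens _ _ (mpres_id m1) (mpres_swap m2 m3)).
by rewrite comp_op_id comp_swap_tens comp_assoc_tens.
Qed.

End swap23.

Section kernel_transfer.
Context (R : realType).
Context d1 (T : measurableType d1) (m : {sigma_finite_measure set T -> \bar R}).
Context d2 (T' : measurableType d2) (m' : {sigma_finite_measure set T' -> \bar R}).
Context d3 (X : measurableType d3) (l : {sigma_finite_measure set X -> \bar R}).
Context d4 (Y : measurableType d4) (n : {sigma_finite_measure set Y -> \bar R}).
Variables (sigma : T -> T' * X) (sigma' : T' * X -> T).
Hypotheses (hs : mpres m (m' \X l) sigma) (ms' : measurable_fun setT sigma')
  (sK : cancel sigma sigma').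
Variables (sw : T * Y -> T * Y) (sw' : T' * Y -> T' * Y).
Hypotheses (hsw : mpres (m \X n) (m \X n) sw) (hsw' : mpres (m' \X n) (m' \X n) sw').

(** Moves the coordinate in [X] to the end, behind the integration variable. *)
Let alpha := @swap23 T' X Y \o map_pair sigma id.
Hypothesis alphaK : forall w, alpha (sw w) = map_pair sw' id (alpha w).

Let mpres_alpha : mpres (m \X n) (m' \X n \X l) alpha.
Proof. exact: mpres_comp (mpres_swap23 m' l n) (mpres_map hs (mpres_id n)). Qed.

Let alpha_tens (u : L2 m') (a : L2 n) (v : L2 l) :
  comp_op (nu := m \X n) alpha (tens (tens u a) v) = tens (comp_op sigma (tens u v)) a.
Proof.
rewrite -(comp_op_comp _ (mpres_swap23 m' l n) (mpres_map hs (mpres_id n))).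
by rewrite comp_swap23_tens (comp_map_tens _ _ hs (mpres_id n)) comp_op_id.
Qed.

Let adj_ins_alpha (b : L2 n) (v : L2 l) (z : L2 (m' \X n)) :
  adj (ins b) (comp_op (nu := m \X n) alpha (tens z v)) = comp_op sigma (tens (adj (ins b) z) v).
Proof.
pose L1 := adj (ins b) \o comp_op (nu := m \X n) alpha \o ins (m1 := m' \X n) v.
pose L2' := comp_op (nu := m) sigma \o ins (m1 := m') v \o adj (ins b).
suff E : L1 = L2' by exact: (congr1 (fun g => g z) E).
apply: bounded_tens_ext.
- apply: bounded_comp; first exact: bounded_ins.
  by apply: bounded_comp; [exact: bounded_comp_op|apply: bounded_adj; exact: bounded_ins].
- apply: bounded_comp; first by apply: bounded_adj; exact: bounded_ins.
  by apply: bounded_comp; [exact: bounded_ins|exact: bounded_comp_op].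
- move=> u a; rewrite /L1 /L2' /= /ins alpha_tens !adj_ins_tens tensZl.
  by rewrite (linZ _ _ (comp_op_linear hs)).
Qed.

(** Once [alpha] has moved the coordinate in [X] to the end, every ingredient of [kop] leaves it
    alone: insertion, exchange of variables, multiplication by the kernel and partial
    integration. *)
Lemma kop_transfer (k' : T' * Y -> R[i]) (a b : L2 n) : Linf (m' \X n) k' ->
  kop sw (fun w => k' ((sigma w.1).1, w.2)) a b =
  Ad (@comp_op _ _ _ (m' \X l) _ _ m sigma) (ampl l (kop sw' k' a b)).
Proof.
move=> lk; have hu := uni_miso (miso_cancel hs ms' sK).
have lk1 := Linf_fst l lk.
have lk2 := Linf_comp mpres_alpha lk1.
have bk := bounded_kop hsw' a b lk.
have bk1 : bounded_op (kop (m := m) sw (fun w => k' ((sigma w.1).1, w.2)) a b) by exact: (bounded_kop hsw a b lk2).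
apply: (Ad_inj (uni_sym hu)); rewrite (AdK hu).
apply: ampl_uniq => //; first exact: (Ad_bounded (uni_sym hu)).
move=> u v; rewrite (AdE (uni_sym hu)) /=.
rewrite /kop /= /ins -alpha_tens.
rewrite (comp_op_comp _ mpres_alpha hsw) (_ : alpha \o sw = map_pair sw' id \o alpha); last first.
  by apply/funext => w; rewrite /= alphaK.
have hm := mpres_map hsw' (mpres_id l).
rewrite -(comp_op_comp _ hm mpres_alpha) (comp_map_tens _ _ hsw' (mpres_id l)) comp_op_id.
pose Z : L2 (m' \X n \X l) := tens (comp_op (nu := m' \X n) sw' (tens u a)) v.
have E : comp_op (nu := m \X n) alpha (mulop (fun w => k' w.1) Z) =
    mulop (fun w : T * Y => k' ((sigma w.1).1, w.2)) (comp_op alpha Z).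
  exact (comp_op_mulop mpres_alpha Z lk1).
rewrite -E /Z.
rewrite -(ampl_mulop l lk) (amplE _ _ (bounded_mulop lk)) adj_ins_alpha.
by have [_ _ K] := uni_sym hu; rewrite K.
Qed.

End kernel_transfer.

(** * Right regular algebras *)

Section regular_X1.
Context (R : realType) (X1 : ptopologicalType).
Local Notation Y1 := (borel X1).
Hypotheses (hX : hausdorff_space X1) (lX : locally_compact [set: X1]).
Variable n : {sigma_finite_measure set Y1 -> \bar R}.
Hypotheses (rn : radon n) (fn : full_support n).

Lemma unit_full_support : exists e : L2 n, nsq e = 1.
Proof.
apply: unit_exists; have -> : [set: Y1] = ([set: X1] : set Y1) by [].
by apply: fn; [exact: openT|exists point].
Qed.

Definition conv_X1 (h : Y1 * Y1 -> R[i]) : L2 (n \X n) -> L2 (n \X n) :=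
  right_conv snd (fun g h : Y1 * Y1 => (g.1, h.2)) (haar_X1 n) h.

Definition sw_X1 (w : Y1 * Y1 * Y1) : Y1 * Y1 * Y1 := ((w.1.1, w.2), w.1.2).

Lemma measurable_nbhs_X1X1 : measurable_nbhs [set A : set (X1 * X1)%type | measurable (A : set (Y1 * Y1))].
Proof.
have h := @measurable_nbhs_borel X1.
have := measurable_nbhsX (i1 := fun x : Y1 => x : X1) (i2 := fun x : Y1 => x : X1) h h.
by rewrite (_ : (fun w => (w.1, w.2)) = id)//; apply/funext => -[].
Qed.

Lemma Cc_Linf_X1X1 (h : X1 * X1 -> R[i]) : Cc h -> Linf (n \X n) (h : Y1 * Y1 -> R[i]).
Proof.
move=> ch; split.
  exact: (Cc_cmeasurable (i := fun w : Y1 * Y1 => w : (X1 * X1)%type) measurable_nbhs_X1X1 ch).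
by have [M hM] := Cc_bounded ch; exists M; exact: nearW.
Qed.

Definition kop_X1 (h : Y1 * Y1 -> R[i]) (C : set Y1) : L2 n -> L2 n :=
  let a := toL2 n (fun y => (\1_C y)%:C) in kop (@swap_pair Y1 Y1) h a a.

(** Right convolution sends xi to the function whose value at (x, y) is the integral of h(y, z)
    xi(x, z) over z. The variable x is idle, and an integral operator acts on the second one. *)
Lemma conv_X1E (h : X1 * X1 -> R[i]) (C : set Y1) : Cc h ->
  measurable C -> (n C < +oo)%E -> (forall y z, h (y, z) != 0 -> C y /\ C z) ->
  conv_X1 h = tens_op id (kop_X1 h C).
Proof.
move=> ch mC Coo hC; have lh := Cc_Linf_X1X1 ch.
set a := toL2 n (fun y => (\1_C y)%:C).
have hsw : mpres (n \X n \X n) (n \X n \X n) sw_X1 by exact: mpres_swap23.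
have lk : Linf (n \X n \X n) (fun w : Y1 * Y1 * Y1 => h (w.1.2, w.2)).
  have hp : mpres (n \X n \X n) (n \X (n \X n)) (@assoc_pair Y1 Y1 Y1) by exact: mpres_assoc.
  have ls : Linf (n \X (n \X n)) (fun w => h w.2).
    split; first exact: cmeasurable_snd lh.1.
    by have [M hM] := lh.2; exists M; exact: ae_snd hM.
  exact (Linf_comp hp ls).
have E : conv_X1 h = kop sw_X1 (fun w => h (w.1.2, w.2)) a a.
  apply/funext => xi.
  have [|_ <-] := toL2_kop hsw xi lk mC Coo.
    move=> [[x y] z] /=; have [->|/hC[Cy Cz]] := eqVneq (h (y, z)) 0; first by rewrite mul0r.
    by rewrite !indicE !mem_set// !mulr1.
  rewrite /conv_X1 /right_conv; congr toL2; apply/funext => -[x y] /=.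
  (* The Haar measure at y is the product of the Dirac mass at y with [n], so that only the second
     coordinate is integrated. *)
  rewrite (cintegral_mpres_meas (mpres_diracl n y))//.
  apply: cmeasurableM; first exact: lh.1.
  apply: (cmeasurable_comp (f := xi) (phi := fun g1 : Y1 * Y1 => (x, g1.2))); last exact: L2_meas.
  by apply/measurable_fun_pair.
have hs := mpres_swap n n.
have sK : cancel (@swap_pair Y1 Y1) (@swap_pair Y1 Y1) by case.
rewrite E (kop_transfer hs hs.1 sK hsw (sw' := @swap_pair Y1 Y1) hs _ a a lh)//.
have bk : bounded_op (kop_X1 h C) by exact: (bounded_kop hs a a lh).
have bi := bounded_id n.
exact: (Ad_swap_tens bi bk).
Qed.

End regular_X1.

Section Cc_products.
Context (R : realType) (P Q : topologicalType).

Lemma Cc_conj (f : P -> R[i]) : Cc f -> Cc (fun x => conjc (f x)).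
Proof.
move=> [cr ci cs]; split.
- by rewrite (_ : (fun x => _) = (fun x => complex.Re (f x)))//; apply/funext => x; case: (f x).
- rewrite (_ : (fun x => _) = (fun x => - complex.Im (f x))).
    by move=> x; apply: cvgN; exact: ci.
  by apply/funext => x; case: (f x).
- by rewrite (_ : [set x | _] = [set x | f x != 0])//; apply/seteqP; split => x /=; rewrite conjc_eq0.
Qed.

Lemma Cc_tens (f : P -> R[i]) (g : Q -> R[i]) : Cc f -> Cc g ->
  Cc (fun w : P * Q => f w.1 * g w.2).
Proof.
move=> [fr fi fs] [gr gi gs].
have c1 (u : P -> R) : continuous u -> continuous (fun w : P * Q => u w.1).
  by move=> cu w; apply: (@continuous_comp _ _ _ (@fst P Q) u); [exact: cvg_fst|exact: cu].
have c2 (u : Q -> R) : continuous u -> continuous (fun w : P * Q => u w.2).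
  by move=> cu w; apply: (@continuous_comp _ _ _ (@snd P Q) u); [exact: cvg_snd|exact: cu].
have mulE (z w : R[i]) : complex.Re (z * w) = complex.Re z * complex.Re w - complex.Im z * complex.Im w /\
   complex.Im (z * w) = complex.Re z * complex.Im w + complex.Im z * complex.Re w.
  by case: z w => [a b] [c d].
split.
- under eq_fun do rewrite (mulE _ _).1.
  move=> w; apply: cvgB; apply: cvgM; first [exact: (c1 _ fr)|exact: (c1 _ fi)|exact: (c2 _ gr)|exact: (c2 _ gi)].
- under eq_fun do rewrite (mulE _ _).2.
  move=> w; apply: cvgD; apply: cvgM; first [exact: (c1 _ fr)|exact: (c1 _ fi)|exact: (c2 _ gr)|exact: (c2 _ gi)].
- apply: (subclosed_compact _ (compact_setX fs gs)); first exact: closed_closure.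
  move=> [x y] hxy; split => /= U hU.
  + have [[a b] [/= hab [Ua _]]] := hxy (U `*` setT) (ex_intro2 _ _ (U, setT) (conj hU filterT) (@subset_refl _ _)).
    by exists a; split => //=; apply: contra_neq hab => ->; rewrite mul0r.
  + have [[a b] [/= hab [_ Ub]]] := hxy (setT `*` U) (ex_intro2 _ _ (setT, U) (conj filterT hU) (@subset_refl _ _)).
    by exists b; split => //=; apply: contra_neq hab => ->; rewrite mulr0.
Qed.

End Cc_products.

Section compact_projections.
Context (R : realType) (X1 : ptopologicalType) (P : topologicalType).
Hypothesis hX : hausdorff_space X1.
Variable n : {measure set (borel X1) -> \bar R}.
Hypothesis rn : radon n.

(** The union of the two projections of the support. Its indicator is the vector inserted on both
    sides when a convolution is written as a [kop]. *)
Lemma Cc_projections (h : P -> R[i]) (p q : P -> X1) : Cc h -> continuous p -> continuous q ->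
  exists C : set (borel X1), [/\ measurable C, (n C < +oo)%E & forall x, h x != 0 -> C (p x) /\ C (q x)].
Proof.
move=> [_ _ cs] cp cq; set K := closure _ in cs.
have cC : compact (p @` K `|` q @` K).
  by apply: compactU; apply: continuous_compact => //; exact: continuous_subspaceT.
exists (p @` K `|` q @` K); split.
- exact: measurable_compact.
- by have [h1 _ _] := rn; exact: h1.
- by move=> x hx; split; [left|right]; exists x => //; exact: subset_closure.
Qed.

End compact_projections.

Section indicator_multiplication.
Context (R : realType) d (T : measurableType d) (m : {measure set T -> \bar R}).

Lemma mulop_cutoff (f : T -> R[i]) (C : set T) : Linf m f -> measurable C -> (m C < +oo)%E ->
  (forall x, f x != 0 -> C x) -> square_integrable m f ->
  mulop f (toL2 m (fun x => (\1_C x)%:C)) = toL2 m f.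
Proof.
move=> lf mC Coo hC sf; have sC := sqint_indic mC Coo; apply/esym/eq_toL2 => //.
apply: filterS2 (mulopE (toL2 m (fun x => (\1_C x)%:C)) lf) (toL2E sC) => x e1 e2.
rewrite e1 e2; have [->|/hC Cx] := eqVneq (f x) 0; first by rewrite mul0r.
by rewrite indicE mem_set// mulr1.
Qed.

End indicator_multiplication.

Section regular_X1_algebra.
Context (R : realType) (X1 : ptopologicalType).
Local Notation Y1 := (borel X1).
Hypotheses (hX : hausdorff_space X1) (lX : locally_compact [set: X1]).
Variable n : {sigma_finite_measure set Y1 -> \bar R}.
Hypotheses (rn : radon n) (fn : full_support n).

Lemma kop_X1_rank1 (phi psi : X1 -> R[i]) (C : set Y1) : Cc phi -> Cc psi ->
  measurable C -> (n C < +oo)%E -> (forall x, phi x != 0 -> C x) -> (forall x, psi x != 0 -> C x) ->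
  @kop_X1 R X1 n (fun w => phi w.1 * conjc (psi w.2)) C = rank1 (toL2 n phi) (toL2 n psi).
Proof.
move=> cphi cpsi mC Coo hphi hpsi.
have lphi := Cc_Linf n cphi; have lpsi := Cc_Linf n cpsi.
have sphi := Cc_sqint hX rn cphi; have spsi := Cc_sqint hX rn cpsi.
apply/funext => v; rewrite /kop_X1 /kop /= /ins comp_swap_tens.
have lpsi' := Linf_conj lpsi; rewrite (mulop_tens _ _ lphi lpsi') adj_ins_tens.
have E1 := mulop_cutoff lphi mC Coo hphi sphi.
have E2 := mulop_cutoff lpsi mC Coo hpsi spsi.
have E3 := adjoint_mulop lpsi' v (toL2 n (fun x => (\1_C x)%:C)).
have E4 : (fun x => conjc (conjc (psi x))) = psi by apply/funext => x; rewrite conjcK.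
rewrite E4 E2 in E3; apply: (congr2 (fun c z => c *: z) E3 E1).
Qed.

Lemma conv_X1_bounded (h : X1 * X1 -> R[i]) : Cc h ->
  exists2 b, bounded_op b & @conv_X1 R X1 n h = tens_op id b.
Proof.
move=> ch; have [C [mC Coo hC]] := Cc_projections hX rn (p := fst) (q := snd) ch (fun x => cvg_fst) (fun x => cvg_snd).
exists (@kop_X1 R X1 n h C); last by apply: conv_X1E => // y z; exact: (hC (y, z)).
by apply: bounded_kop; [exact: mpres_swap|exact: Cc_Linf_X1X1].
Qed.

Lemma conv_X1_rank1 (phi psi : X1 -> R[i]) : Cc phi -> Cc psi ->
  @conv_X1 R X1 n (fun w => phi w.1 * conjc (psi w.2)) = tens_op id (rank1 (toL2 n phi) (toL2 n psi)).
Proof.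
move=> cphi cpsi; have ch := Cc_tens cphi (Cc_conj cpsi).
have [_ _ k1] := cphi; have [_ _ k2] := cpsi.
set K1 := closure _ in k1; set K2 := closure _ in k2.
pose C : set Y1 := K1 `|` K2.
have mC : measurable C by apply: measurable_compact => //; exact: compactU.
have Coo : (n C < +oo)%E by have [h _ _] := rn; apply: h; exact: compactU.
have hphi x : phi x != 0 -> C x by move=> h; left; exact: subset_closure.
have hpsi x : psi x != 0 -> C x by move=> h; right; exact: subset_closure.
rewrite (conv_X1E ch mC Coo); first by rewrite (kop_X1_rank1 cphi cpsi mC Coo hphi hpsi).
move=> y z /=; rewrite mulf_eq0 negb_or conjc_eq0 => /andP[h1 h2]; exact: (conj (hphi _ h1) (hpsi _ h2)).
Qed.

(* The rank one operators |phi><psi| with phi, psi in C_c come from the kernels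
   phi (x) psi. *)
Lemma R_X1_eq : R_X1 n = [set tens_op id b | b in all_ops n].
Proof.
have [e e1] := unit_full_support fn; have bi := bounded_id n.
have bS : [set @conv_X1 R X1 n h | h in @Cc R (X1 * X1)%type] `<=` bounded_op (nu := n \X n).
  by move=> _ [h ch <-]; have [b bb ->] := conv_X1_bounded ch; exact: bounded_tens_op.
apply/seteqP; split => [x|_ [b bb <-]].
  rewrite -[in X in _ -> X](vN_gen_all n) -(vN_gen_idtens e1)//.
  apply: vN_gen_sub => //; first by move=> _ [s bs <-]; exact: bounded_tens_op.
  move=> _ [h ch <-]; have [b bb hb] := conv_X1_bounded ch; rewrite -/(@conv_X1 R X1 n h) hb.
  apply: sub_vN_gen; first by move=> _ [s bs <-]; exact: bounded_tens_op.
  by exists b.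
apply/vN_genP; split; first exact: bounded_tens_op.
move=> t bt ht; apply/esym.
apply: (comm_rank1_idtens (Q := [set id]) (E := [set toL2 n h | h in @Cc R X1]) e1) => //.
- by move=> _ ->.
- by move=> w hw; apply/nsq_eq0; rewrite /nsq hw//; exists id => //; exists w.
- exact: total_Cc.
- move=> _ _ _ -> [phi cphi <-] [psi cpsi <-]; rewrite -conv_X1_rank1//.
  apply: ht; left; exists (fun w => phi w.1 * conjc (psi w.2)); last by [].
  exact: (Cc_tens cphi (Cc_conj cpsi)).
Qed.

End regular_X1_algebra.

Section regular_G1.
Context (R : realType) (X1 X2 : ptopologicalType).
Local Notation Y1 := (borel X1).
Local Notation Y2 := (borel X2).
Hypotheses (hX1 : hausdorff_space X1) (lX1 : locally_compact [set: X1]).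
Hypotheses (hX2 : hausdorff_space X2) (lX2 : locally_compact [set: X2]) (sX2 : sigma_compact X2).
Variable n1 : {sigma_finite_measure set Y1 -> \bar R}.
Variable n2 : {sigma_finite_measure set Y2 -> \bar R}.
Hypotheses (rn1 : radon n1) (fn1 : full_support n1) (rn2 : radon n2).
Local Notation mu1 := (n1 \X n1 \X n2).

Definition conv_G1 (h : Y1 * Y1 * Y2 -> R[i]) : L2 mu1 -> L2 mu1 :=
  right_conv (@s1 X1 X2) (@mul1 X1 X2) (haar1 n1) h.

(* Right convolution acts neither on x1 nor on x2: the former is split off as an
   amplification, the latter is a parameter on which the kernel depends. *)
Definition sig_G1 (g : Y1 * Y1 * Y2) : Y2 * Y1 * Y1 := ((g.2, g.1.2), g.1.1).
Definition sig_G1' (w : Y2 * Y1 * Y1) : Y1 * Y1 * Y2 := ((w.2, w.1.2), w.1.1).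

Lemma mpres_sig_G1 : mpres mu1 (n2 \X n1 \X n1) sig_G1.
Proof.
exact: mpres_comp (mpres_unassoc n2 n1 n1)
  (mpres_comp (mpres_swap (n1 \X n1) n2) (mpres_map (mpres_swap n1 n1) (mpres_id n2))).
Qed.

Lemma mpres_sig_G1' : mpres (n2 \X n1 \X n1) mu1 sig_G1'.
Proof.
exact: mpres_comp (mpres_map (mpres_swap n1 n1) (mpres_id n2))
  (mpres_comp (mpres_swap n2 (n1 \X n1)) (mpres_assoc n2 n1 n1)).
Qed.

Lemma sig_G1K : cancel sig_G1 sig_G1'. Proof. by case=> [[]]. Qed.

Lemma uni_sig_G1 : uni (@comp_op _ _ _ (n2 \X n1 \X n1) _ _ mu1 sig_G1) (comp_op sig_G1').
Proof. exact: uni_miso (miso_cancel mpres_sig_G1 mpres_sig_G1'.1 sig_G1K). Qed.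

Definition sw_G1 (w : Y1 * Y1 * Y2 * Y1) : Y1 * Y1 * Y2 * Y1 :=
  (((w.1.1.1, w.2), w.1.2), w.1.1.2).

Lemma mpres_sw_G1 : mpres (mu1 \X n1) (mu1 \X n1) sw_G1.
Proof.
exact: mpres_comp (mpres_swap23 (n1 \X n1) n1 n2)
  (mpres_comp (mpres_map (mpres_swap23 n1 n1 n1) (mpres_id n2)) (mpres_swap23 (n1 \X n1) n2 n1)).
Qed.

Lemma Cc_bounded_meas (h : X1 * X1 * X2 -> R[i]) : Cc h -> cmeasurable (h : Y1 * Y1 * Y2 -> R[i]).
Proof.
have h2 := @measurable_nbhs_borel X2.
have := measurable_nbhsX (i1 := fun x : Y1 * Y1 => x : (X1 * X1)%type) (i2 := fun x : Y2 => x : X2)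
  (@measurable_nbhs_X1X1 X1) h2.
rewrite (_ : (fun w => (w.1, w.2)) = id); last by apply/funext => -[].
exact: (Cc_cmeasurable (i := fun w : Y1 * Y1 * Y2 => w : (X1 * X1 * X2)%type)).
Qed.

Definition ker_G1 (h : Y1 * Y1 * Y2 -> R[i]) (w : Y2 * Y1 * Y1) : R[i] :=
  h ((w.1.2, w.2), w.1.1).

Lemma Linf_ker_G1 (h : X1 * X1 * X2 -> R[i]) : Cc h -> Linf (n2 \X n1 \X n1) (ker_G1 h).
Proof.
move=> ch; split; last by have [M hM] := Cc_bounded ch; exists M; apply: nearW => w; exact: hM.
have hp : mpres (n2 \X n1 \X n1) mu1 (fun w => ((w.1.2, w.2), w.1.1)).
  exact: mpres_comp (mpres_swap n2 (n1 \X n1)) (mpres_assoc n2 n1 n1).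
exact (cmeasurable_comp hp.1 (Cc_bounded_meas ch)).
Qed.

Definition kop_G1 (h : Y1 * Y1 * Y2 -> R[i]) (C : set Y1) : L2 (n2 \X n1) -> L2 (n2 \X n1) :=
  let a := toL2 n1 (fun y => (\1_C y)%:C) in kop (@swap23 Y2 Y1 Y1) (ker_G1 h) a a.

Lemma bounded_kop_G1 (h : X1 * X1 * X2 -> R[i]) C : Cc h -> bounded_op (kop_G1 h C).
Proof. move=> ch; exact (bounded_kop (mpres_swap23 n2 n1 n1) _ _ (Linf_ker_G1 ch)). Qed.

(** At (x, y, x2) the convolution is the integral of h(y, z, x2) xi(x, z, x2) over z; [sig_G1]
    reorders the coordinates as ((x2, y), x), with the idle one last. *)
Lemma conv_G1E (h : X1 * X1 * X2 -> R[i]) (C : set Y1) : Cc h ->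
  measurable C -> (n1 C < +oo)%E -> (forall y z x2, h ((y, z), x2) != 0 -> C y /\ C z) ->
  conv_G1 h = Ad (comp_op sig_G1) (ampl n1 (kop_G1 h C)).
Proof.
move=> ch mC Coo hC; have lk' := Linf_ker_G1 ch.
pose a := toL2 n1 (fun y => (\1_C y)%:C).
have hs := mpres_sig_G1; have hsw := mpres_sw_G1; have hsw' := mpres_swap23 n2 n1 n1.
have aK w : (@swap23 _ _ _ \o map_pair sig_G1 id) (sw_G1 w) =
    map_pair (@swap23 Y2 Y1 Y1) id ((@swap23 _ _ _ \o map_pair sig_G1 id) w) by case: w => [[[? ?] ?] ?].
have KE := kop_transfer hs mpres_sig_G1'.1 sig_G1K hsw hsw' aK a a lk'.
rewrite -[RHS]KE; apply/funext => xi.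
have lk : Linf (mu1 \X n1) (fun w : Y1 * Y1 * Y2 * Y1 => ker_G1 h ((sig_G1 w.1).1, w.2)).
  have hp : mpres (mu1 \X n1) (n2 \X n1 \X n1 \X n1) (@swap23 _ _ _ \o map_pair sig_G1 id).
    exact: mpres_comp (mpres_swap23 (n2 \X n1) n1 n1) (mpres_map hs (mpres_id n1)).
  exact (Linf_comp hp (Linf_fst n1 lk')).
have [|_ <-] := toL2_kop hsw xi lk mC Coo.
  move=> [[[x y] x2] z]; rewrite /ker_G1 /=.
  have [->|/hC[Cy Cz]] := eqVneq (h ((y, z), x2)) 0; first by rewrite mul0r.
  by rewrite !indicE !mem_set// !mulr1.
rewrite /conv_G1 /right_conv; congr toL2; apply/funext => -[[x y] x2] /=.
(* The Haar measure has Dirac masses in its first and third coordinates, so that the integral runs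
   over z alone. *)
rewrite (cintegral_mpres_meas (mpres_comp (mpres_dirac (dirac y \X n1) x2) (mpres_diracl n1 y)))//.
apply: cmeasurableM; first exact: Cc_bounded_meas.
apply: (cmeasurable_comp (f := xi) (phi := fun g1 : Y1 * Y1 * Y2 => ((x, g1.1.2), x2))); last exact: L2_meas.
apply/measurable_fun_pair => //; apply/measurable_fun_pair => //.
exact: (measurableT_comp measurable_snd measurable_fst).
Qed.

End regular_G1.

Section regular_G1_algebra.
Context (R : realType) (X1 X2 : ptopologicalType).
Local Notation Y1 := (borel X1).
Local Notation Y2 := (borel X2).
Hypotheses (hX1 : hausdorff_space X1) (lX1 : locally_compact [set: X1]).
Hypotheses (hX2 : hausdorff_space X2) (lX2 : locally_compact [set: X2]) (sX2 : sigma_compact X2).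
Variable n1 : {sigma_finite_measure set Y1 -> \bar R}.
Variable n2 : {sigma_finite_measure set Y2 -> \bar R}.
Hypotheses (rn1 : radon n1) (fn1 : full_support n1) (rn2 : radon n2).
Local Notation mu1 := (n1 \X n1 \X n2).
Local Notation Vs := (@comp_op _ _ _ (n2 \X n1 \X n1) _ _ mu1 (@sig_G1 X1 X2)).

Definition kernels_G1 : set (L2 (n2 \X n1) -> L2 (n2 \X n1)) :=
  [set b | exists (h : X1 * X1 * X2 -> R[i]) (C : set Y1),
    [/\ Cc h, measurable C, (n1 C < +oo)%E, forall y z x2, h ((y, z), x2) != 0 -> C y /\ C z
      & b = kop_G1 h C]].

Lemma kernels_G1_bounded : kernels_G1 `<=` bounded_op (nu := n2 \X n1).
Proof. by move=> _ [h [C [ch _ _ _ ->]]]; exact: bounded_kop_G1. Qed.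

Lemma R_G1_eq : @R_G1 R X1 X2 n1 n2 = [set Ad Vs (ampl n1 b) | b in vN_gen kernels_G1].
Proof.
have [e e1] := unit_full_support fn1; have hu := uni_sig_G1 n1 n2.
have -> : [set Ad Vs (ampl n1 b) | b in vN_gen kernels_G1] =
    vN_gen [set Ad Vs x | x in [set ampl n1 b | b in kernels_G1]].
  rewrite (Ad_vN_gen _ hu) (vN_gen_ampl e1 kernels_G1_bounded).
  by apply/seteqP; split => [_ [b hb <-]|_ [_ [b hb <-] <-]]; [exists (ampl n1 b) => //; exists b|exists b].
rewrite /R_G1 /right_regular; congr vN_gen; apply/seteqP; split.
  move=> _ [h ch <-].
  have c1 : continuous (fun g : X1 * X1 * X2 => g.1.1).
    move=> g; apply: (@continuous_comp _ _ _ (@fst (X1 * X1)%type X2) (@fst X1 X1)); exact: cvg_fst.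
  have c2 : continuous (fun g : X1 * X1 * X2 => g.1.2).
    move=> g; apply: (@continuous_comp _ _ _ (@fst (X1 * X1)%type X2) (@snd X1 X1)); [exact: cvg_fst|exact: cvg_snd].
  have [C [mC Coo hC]] := Cc_projections hX1 rn1 ch c1 c2.
  have hC' y z x2 : h ((y, z), x2) != 0 -> C y /\ C z := hC ((y, z), x2).
  exists (ampl n1 (kop_G1 h C)); last by rewrite -(conv_G1E n2 ch mC Coo hC').
  by exists (kop_G1 h C) => //; exists h, C.
move=> _ [_ [_ [h [C [ch mC Coo hC ->]]] <-] <-].
exists h; [exact: ch|exact: (conv_G1E n2 ch mC Coo hC)].
Qed.

(** Functions of x2 commute with multiplication by the kernel, and also with the exchange of
    variables, which does not touch x2. *)
Lemma kernels_G1_decomp : vN_gen kernels_G1 `<=` vN_tens (Linf_ops n2) (all_ops n1).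
Proof.
have [e e1] := unit_full_support fn1.
apply: vN_gen_sub; [exact: kernels_G1_bounded|exact: decomp_gen_bounded|].
move=> _ [h [C [ch mC Coo hC ->]]]; apply/(decompP e1); split; first exact: bounded_kop_G1.
move=> tau lt; have l1 := Linf_fst n1 lt; have l2 := Linf_fst n1 l1.
have lk := Linf_ker_G1 n1 n2 ch; have bt := bounded_mulop l1.
have hsw := mpres_swap23 n2 n1 n1.
apply/esym; apply: (kop_comm _ _ bt).
- rewrite (ampl_mulop n1 l1) (mulop_comp l2 lk) (mulop_comp lk l2).
  by congr mulop; apply/funext => w; rewrite mulrC.
- rewrite (ampl_mulop n1 l1); apply/funext => u.
  exact: (esym (comp_op_mulop hsw u l2)).
Qed.

Lemma kop_G1_rank1 (phi psi : X1 -> R[i]) (chi : X2 -> R[i]) (C : set Y1) :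
  Cc phi -> Cc psi -> Cc chi ->
  measurable C -> (n1 C < +oo)%E -> (forall x, phi x != 0 -> C x) -> (forall x, psi x != 0 -> C x) ->
  @kop_G1 R X1 X2 n1 n2 (fun w => phi w.1.1 * conjc (psi w.1.2) * chi w.2) C =
  tens_op (@mulop _ _ _ n2 chi) (rank1 (toL2 n1 phi) (toL2 n1 psi)).
Proof.
move=> cphi cpsi cchi mC Coo hphi hpsi.
have lphi := Cc_Linf n1 cphi; have lpsi := Cc_Linf n1 cpsi; have lchi := Cc_Linf n2 cchi.
have sphi := Cc_sqint hX1 rn1 cphi; have spsi := Cc_sqint hX1 rn1 cpsi.
have lpsi' := Linf_conj lpsi.
have ch := Cc_tens (Cc_tens cphi (Cc_conj cpsi)) cchi.
have bk := bounded_kop_G1 n1 n2 C ch.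
have bm := bounded_mulop lchi; have br := bounded_rank1 (toL2 n1 phi) (toL2 n1 psi).
apply: (tens_op_uniq bm br bk) => u v.
pose a := toL2 n1 (fun x => (\1_C x)%:C).
have kE : ker_G1 (fun w => phi w.1.1 * conjc (psi w.1.2) * chi w.2) =
    (fun w : Y2 * Y1 * Y1 => (chi w.1.1 * phi w.1.2) * conjc (psi w.2)).
  by apply/funext => -[[x2 y] z]; rewrite /ker_G1 /=; ring.
have lcp := Linf_tens lchi lphi.
have E0 : comp_op (@swap23 Y2 Y1 Y1) (ins a (tens u v)) = tens (tens u a) v.
  exact: comp_swap23_tens.
have E1 : mulop (fun w : Y2 * Y1 * Y1 => (chi w.1.1 * phi w.1.2) * conjc (psi w.2)) (tens (tens u a) v) =
    tens (tens (@mulop _ _ _ n2 chi u) (@mulop _ _ _ n1 phi a)) (@mulop _ _ _ n1 (fun x => conjc (psi x)) v).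
  by rewrite -(mulop_tens u a lchi lphi); exact: (mulop_tens (tens u a) v lcp lpsi').
have E3 := adjoint_mulop lpsi' v a.
have E4 : (fun x => conjc (conjc (psi x))) = psi by apply/funext => x; rewrite conjcK.
have E5 := mulop_cutoff lphi mC Coo hphi sphi.
have E6 := mulop_cutoff lpsi mC Coo hpsi spsi.
rewrite E4 {2}/a E6 in E3.
rewrite /kop_G1 kE /kop -/a; cbn beta; rewrite [LHS]/= E0 E1 adj_ins_tens E3 {1}/a E5.
by rewrite /rank1 tensZr.
Qed.

(** Product kernels give the operators chi (x) |phi><psi| with chi compactly supported, whereas 1
    (x) |phi><psi| need not come from such a kernel. The multiplications by chi are jointly
    nondegenerate, which is what [comm_rank1_idtens] asks for. *)
Lemma idtens_kernels_G1 b : bounded_op b -> vN_gen kernels_G1 (tens_op id b).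
Proof.
move=> bb; have [e e1] := unit_full_support fn1.
apply/vN_genP; split; first by apply: bounded_tens_op => //; exact: bounded_id.
move=> t bt ht; apply/esym.
apply: (comm_rank1_idtens (Q := [set @mulop _ _ _ n2 (chi : Y2 -> R[i]) | chi in @Cc R X2])
  (E := [set toL2 n1 h | h in @Cc R X1]) e1) => //.
- by move=> _ [chi cchi <-]; apply: bounded_mulop; exact: Cc_Linf.
- apply: total_inS (total_Cc_mul hX2 lX2 sX2 (nu := n2)) => _ [chi cchi [u _ <-]].
  by exists (@mulop _ _ _ n2 (chi : Y2 -> R[i])); [exists chi|exists u].
- exact: total_Cc.
- move=> _ _ _ [chi cchi <-] [phi cphi <-] [psi cpsi <-].
  have [_ _ k1] := cphi; have [_ _ k2] := cpsi.
  set K1 := closure _ in k1; set K2 := closure _ in k2.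
  pose C : set Y1 := K1 `|` K2.
  have mC : measurable C by apply: measurable_compact => //; exact: compactU.
  have Coo : (n1 C < +oo)%E by have [h _ _] := rn1; apply: h; exact: compactU.
  have hphi x : phi x != 0 -> C x by move=> h; left; exact: subset_closure.
  have hpsi x : psi x != 0 -> C x by move=> h; right; exact: subset_closure.
  rewrite -(kop_G1_rank1 cphi cpsi cchi mC Coo hphi hpsi).
  apply: ht; left; exists (fun w => phi w.1.1 * conjc (psi w.1.2) * chi w.2), C; split => //.
    exact (Cc_tens (Cc_tens cphi (Cc_conj cpsi)) cchi).
  move=> y z x2 /=; rewrite !mulf_eq0 !negb_or conjc_eq0 => /andP[/andP[h1 h2] _].
  exact: (conj (hphi _ h1) (hpsi _ h2)).
Qed.

End regular_G1_algebra.

(** Measurability of maps that only rearrange, repeat or drop coordinates. *)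
Ltac meas_coord := lazymatch goal with
  | |- measurable_fun _ (fun w : ?A => (@?f w, @?g w)) => apply/measurable_fun_pair; meas_coord
  | |- measurable_fun _ (fun w : ?A => fst (@?f w)) => refine (measurableT_comp (g := f) measurable_fst _); meas_coord
  | |- measurable_fun _ (fun w : ?A => snd (@?f w)) => refine (measurableT_comp (g := f) measurable_snd _); meas_coord
  | |- _ => first [exact: measurable_id | exact: measurable_fst | exact: measurable_snd]
  end.

(** A fibre product measure is an image measure: a map out of it is tested after composition with
    the parametrization, where product measures are available. *)
Lemma mpres_factor (R : realType) d1 (T1 : measurableType d1) d2 (T2 : measurableType d2)
    d3 (T3 : measurableType d3) (m1 : set T1 -> \bar R) (m2 : set T2 -> \bar R)
    (m3 : set T3 -> \bar R) (phi : T1 -> T2) (c : T2 -> T3) :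
  mpres m1 m2 phi -> measurable_fun setT c -> mpres m1 m3 (c \o phi) -> mpres m2 m3 c.
Proof.
move=> [mphi hphi] mc [_ hc]; split => // S mS.
by rewrite (hc _ mS) hphi// -[_ @^-1` _]setTI; exact: mc.
Qed.

Section Ad_composition.
Context (R : realType) d (T : measurableType d) (mu : {measure set T -> \bar R}).
Context d' (U : measurableType d') (nu : {measure set U -> \bar R}).
Context d'' (V : measurableType d'') (xi : {measure set V -> \bar R}).

Lemma Ad_mulop (c : U -> T) c' f : miso mu nu c c' -> Linf mu f ->
  Ad (@comp_op _ _ _ mu _ _ nu c) (mulop f) = mulop (f \o c).
Proof.
move=> hc lf; rewrite (AdE (uni_miso hc)); apply/funext => u /=.
by have [h _ _] := hc; rewrite (comp_op_mulop h _ lf) (miso_cancel_op u hc).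
Qed.

Lemma Ad_comp_op (c : U -> T) c' (c1 : V -> U) c1' x : miso mu nu c c' -> miso nu xi c1 c1' ->
  Ad (@comp_op _ _ _ nu _ _ xi c1) (Ad (@comp_op _ _ _ mu _ _ nu c) x) =
  Ad (@comp_op _ _ _ mu _ _ xi (c \o c1)) x.
Proof.
move=> hc hc1; rewrite (Ad_Ad _ (uni_miso hc) (uni_miso hc1)); congr Ad.
by apply/funext => u /=; have [h _ _] := hc; have [h1 _ _] := hc1; rewrite comp_op_comp.
Qed.

(** Adds one more coordinate map to a conjugation that is already known; long chains of
    identifications are collected in this way into a single map. *)
Lemma Ad_comp_step (c : U -> T) c' (c1 : V -> U) c1' (z : L2 mu -> L2 mu) x (W : L2 nu -> L2 xi) :
  x = Ad (@comp_op _ _ _ mu _ _ nu c) z -> W = comp_op c1 -> miso mu nu c c' -> miso nu xi c1 c1' ->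
  Ad W x = Ad (@comp_op _ _ _ mu _ _ xi (c \o c1)) z.
Proof. by move=> -> -> hc hc1; exact: Ad_comp_op hc hc1. Qed.

End Ad_composition.

Section decomposable_transfer.
Context (R : realType).
Context d1 (T1 : measurableType d1) (m : {sigma_finite_measure set T1 -> \bar R}).
Context d2 (T2 : measurableType d2) (n : {sigma_finite_measure set T2 -> \bar R}).
Context d3 (T3 : measurableType d3) (l : {sigma_finite_measure set T3 -> \bar R}).

Lemma miso_swap23 : miso (m \X n \X l) (m \X l \X n) (@swap23 T1 T3 T2) (@swap23 T1 T2 T3).
Proof.
apply: miso_cancel; [exact: mpres_swap23|exact: (mpres_swap23 m n l).1|by case=> [[]]].
Qed.

Lemma Ad_swap23_tens a b c : bounded_op a -> bounded_op b -> bounded_op c ->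
  Ad (@comp_op _ _ _ (m \X n \X l) _ _ (m \X l \X n) (@swap23 T1 T3 T2))
    (tens_op (tens_op a b) c) = tens_op (tens_op a c) b.
Proof.
move=> ba bb bc; have hu := uni_miso miso_swap23.
have bab := bounded_tens_op ba bb; have bac := bounded_tens_op ba bc.
apply: bounded_tens3_ext.
- by apply: (Ad_bounded hu); exact: bounded_tens_op.
- exact: bounded_tens_op.
- move=> u w v; rewrite (AdE hu) /= comp_swap23_tens (tens_opE _ _ bab bc) (tens_opE _ _ ba bb).
  by rewrite comp_swap23_tens (tens_opE _ _ bac bb) (tens_opE _ _ ba bc).
Qed.

(** An idle variable may be counted among the diagonal ones, as 1 belongs to L^oo(l). *)
Lemma decomp_ampl y : vN_tens (Linf_ops m) (all_ops n) y ->
  vN_tens (Linf_ops (m \X l)) (all_ops n)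
    (Ad (@comp_op _ _ _ (m \X n \X l) _ _ (m \X l \X n) (@swap23 T1 T3 T2)) (ampl l y)).
Proof.
move=> hy; have hu := uni_miso miso_swap23.
have := Ad_vN_gen_sub hu (vN_gen_ampl_sub l (@decomp_gen_bounded _ _ _ m _ _ n) hy).
apply: vN_gen_sub.
- by move=> _ [_ [s hs <-] <-]; apply: (Ad_bounded hu); apply: bounded_ampl; exact: decomp_gen_bounded.
- exact: decomp_gen_bounded.
- move=> _ [_ [_ [_ [f lf <-] [b bb <-]] <-] <-]; apply: sub_vN_gen; first exact: decomp_gen_bounded.
  have bf := bounded_mulop lf; have bi := bounded_id l.
  rewrite /ampl (Ad_swap23_tens bf bb bi); exists (tens_op (mulop f) id); last by exists b.
  by exists (fun w => f w.1); [exact: Linf_fst|rewrite -(ampl_mulop l lf)].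
Qed.

(** After [swap23] the amplification is decomposable over [m \X l], hence commutes with functions of
    the diagonal and the idle variable jointly. *)
Lemma ampl_decomp_comm y Phi : vN_tens (Linf_ops m) (all_ops n) y -> (exists e : L2 n, nsq e = 1) ->
  Linf (m \X l) Phi ->
  ampl l y \o mulop (fun w : T1 * T2 * T3 => Phi (w.1.1, w.2)) =
  mulop (fun w : T1 * T2 * T3 => Phi (w.1.1, w.2)) \o ampl l y.
Proof.
move=> hy [e e1] lP; have hu := uni_miso miso_swap23.
have lP1 := Linf_fst n lP.
have lP2 : Linf (m \X n \X l) (fun w : T1 * T2 * T3 => Phi (w.1.1, w.2)).
  exact (Linf_comp (mpres_swap23 m n l) lP1).
set F := fun w : T1 * T2 * T3 => _ in lP2 *.
have E := Ad_mulop miso_swap23 lP2.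
have EF : F \o @swap23 T1 T3 T2 = (fun w => Phi w.1) by apply/funext => -[[]].
have C := ((decompP e1 _).1 (decomp_ampl hy)).2 Phi lP.
rewrite -EF -E in C.
have E1 := Ad_comp hu (ampl l y) (mulop F); have E2 := Ad_comp hu (mulop F) (ampl l y).
exact: (Ad_inj hu (etrans E1 (etrans C (esym E2)))).
Qed.

Lemma ampl_swap (x : L2 m -> L2 m) : bounded_op x ->
  ampl l (ampl n x) =
  Ad (@comp_op _ _ _ (m \X l \X n) _ _ (m \X n \X l) (@swap23 T1 T2 T3)) (ampl n (ampl l x)).
Proof.
move=> bx; have bn := bounded_id n; have bl := bounded_id l.
rewrite /ampl -(Ad_swap23_tens bx bn bl).
have hu := uni_miso miso_swap23.
by rewrite (AdK hu).
Qed.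

Lemma decomp_map (c : T3 -> T1) c' y : mpres l m c -> measurable_fun setT c' -> cancel c c' ->
  vN_tens (Linf_ops m) (all_ops n) y ->
  vN_tens (Linf_ops l) (all_ops n)
    (Ad (@comp_op _ _ _ (m \X n) _ _ (l \X n) (map_pair c id)) y).
Proof.
move=> hc mc' K hy; have hm := miso_mapl n hc mc' K; have hu := uni_miso hm.
have := Ad_vN_gen_sub hu hy; apply: vN_gen_sub.
- by move=> _ [s hs <-]; apply: (Ad_bounded hu); exact: decomp_gen_bounded.
- exact: decomp_gen_bounded.
- move=> _ [_ [_ [f lf <-] [b bb <-]] <-]; apply: sub_vN_gen; first exact: decomp_gen_bounded.
  exists (mulop (f \o c)); first by exists (f \o c) => //; exact: Linf_comp hc _ lf.
  exists b => //; have bf := bounded_mulop lf.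
  apply/esym/tens_op_uniq => //.
  + by apply: bounded_mulop; exact: Linf_comp hc _ lf.
  + by apply: (Ad_bounded hu); exact: bounded_tens_op.
  have hc' := miso_mpres (miso_cancel hc mc' K).
  move=> u v; rewrite (AdE hu) /= (comp_map_tens _ _ hc' (mpres_id n)) (tens_opE _ _ bf bb).
  rewrite (comp_map_tens _ _ hc (mpres_id n)) !comp_op_id (comp_op_mulop hc _ lf).
  by rewrite (miso_cancel_op _ (miso_cancel hc mc' K)).
Qed.

End decomposable_transfer.

(** * The crossed product *)

Section crossed_product.
Context (R : realType) (X1 X2 : ptopologicalType).
Local Notation Y1 := (borel X1).
Local Notation Y2 := (borel X2).
Local Notation G1 := (Y1 * Y1 * Y2)%type.
Local Notation G2 := (Y2 * Y2 * Y1)%type.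
Variable n1 : {sigma_finite_measure set Y1 -> \bar R}.
Variable n2 : {sigma_finite_measure set Y2 -> \bar R}.
Local Notation mu1 := (n1 \X n1 \X n2).
Local Notation mu2 := (n2 \X n2 \X n1).
Local Notation mH := (n2 \X n2 \X (n1 \X n1)).
Local Notation fibG := (fibre_mes (dis_s2 n1 n2) (dis_r1 n1 n2)).
Local Notation fibX := (fibre_mes (dis_pr3 n1 n2) (dis_rX1 n1)).

Definition Sig_map (w : G2 * (Y1 * Y1)) : G2 * G1 := (w.1, (w.2.1, w.2.2, w.1.1.2)).
Definition Sig_map' (w : G2 * G1) : G2 * (Y1 * Y1) := (w.1, (w.2.1.1, w.2.1.2)).

Lemma miso_Sig : miso fibG fibX Sig_map Sig_map'.
Proof.
apply: miso_cancel; last by case=> [? []].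
- apply: (mpres_factor (phi := @fibre_par _ _ _ _ _ _ _ _ _ _ _ _ (dis_pr3 n1 n2) (dis_rX1 n1))).
  + exact (mpres_fpar (dis_pr3 n1 n2) (dis_rX1 n1)).
  + by rewrite /Sig_map; meas_coord.
  (* Passes from the parameters of [fibX], with x1 in the base, to those of [fibG], with (x1, y2) in
     the base. *)
  + pose pm (w : Y1 * (Y2 * Y2) * Y1) : Y1 * Y2 * Y2 * Y1 := ((w.1.1, w.1.2.2), w.1.2.1, w.2).
    have hpm : mpres (n1 \X (n2 \X n2) \X n1) (n1 \X n2 \X n2 \X n1) pm.
      exact: mpres_map (mpres_comp (mpres_unassoc n1 n2 n2)
        (mpres_map (mpres_id n1) (mpres_swap n2 n2))) (mpres_id n1).
    have hf : mpres (n1 \X n2 \X n2 \X n1) fibG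
      (@fibre_par _ _ _ _ _ _ _ _ _ _ _ _ (dis_s2 n1 n2) (dis_r1 n1 n2)).
      exact (mpres_fpar (dis_s2 n1 n2) (dis_r1 n1 n2)).
    rewrite (_ : _ \o _ = @fibre_par _ _ _ _ _ _ _ _ _ _ _ _ (dis_s2 n1 n2) (dis_r1 n1 n2) \o pm).
      exact: mpres_comp hf hpm.
    by apply/funext => -[[x1 [x2 y2]] y1].
- by rewrite /Sig_map'; meas_coord.
Qed.

Definition act_map (w : G2 * G1) : G2 := co2 (gp2 (gmul (emb2 w.1) (emb1 w.2))).

(** Essential boundedness has to survive composition with a map that drops the coordinate x1; what
    is shown is that null sets pull back to null sets. *)
Lemma Linf_act f : Linf mu2 f -> Linf fibG (f \o act_map).
Proof.
move=> lf; have mph : measurable_fun setT act_map.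
  by rewrite /act_map /co2 /gp2 /gmul /emb1 /emb2 /=; meas_coord.
(* [act_map] in parameters. Keeping x1 next to it gives a measure preserving map, under which a null
   set N is replaced by X1 x N. *)
pose ph (w : Y1 * Y2 * Y2 * Y1) : G2 := ((w.1.2, w.1.1.2), w.2).
have hp : mpres (n1 \X n2 \X n2 \X n1) (n1 \X mu2) (fun w => (w.1.1.1, ph w)).
  exact: mpres_comp (mpres_map (mpres_id n1) (mpres_map (mpres_swap n2 n2) (mpres_id n1)))
    (mpres_comp (mpres_assoc n1 (n2 \X n2) n1) (mpres_map (mpres_assoc n1 n2 n2) (mpres_id n1))).
split; first exact: cmeasurable_comp mph lf.1.
have [M [N [mN N0 hM]]] := lf.2; exists M, (act_map @^-1` N); split.
- by rewrite -[_ @^-1` _]setTI; exact: mph.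
- have h0 : (n1 \X mu2) (setT `*` N) = 0%E by rewrite prodmE// N0 mule0.
  by rewrite (hp.2 _ (measurableX measurableT mN)) in h0; rewrite -[RHS]h0; congr ((_ \X _) _);
    apply/seteqP; split => -[[[a b] c] e]//=; case.
- by move=> w /= hw; apply: hM.
Qed.

Lemma act_tildeE f : Linf mu2 f -> act_tilde n1 n2 f = Ad (Sigma n1 n2) (act n1 n2 f).
Proof.
move=> /Linf_act lF; rewrite /Sigma [in RHS]/act (Ad_mulop miso_Sig lF); congr mulop.
by apply/funext => -[[[x2 y2] x1] [a b]].
Qed.

Definition theta_map (w : Y2 * Y2 * (Y1 * Y1)) : G2 * (Y1 * Y1) := ((w.1, w.2.1), w.2).
Definition theta_map' (w : G2 * (Y1 * Y1)) : Y2 * Y2 * (Y1 * Y1) := (w.1.1, (w.1.2, w.2.2)).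

Lemma miso_theta_map : miso fibX mH theta_map theta_map'.
Proof.
apply: miso_cancel; last by case=> [? []].
- have hpm : mpres mH (n1 \X (n2 \X n2) \X n1) (fun w => ((w.2.1, w.1), w.2.2)).
    exact: mpres_comp (mpres_map (mpres_swap (n2 \X n2) n1) (mpres_id n1)) (mpres_unassoc (n2 \X n2) n1 n1).
  have hf : mpres (n1 \X (n2 \X n2) \X n1) fibX
     (@fibre_par _ _ _ _ _ _ _ _ _ _ _ _ (dis_pr3 n1 n2) (dis_rX1 n1)).
    exact (mpres_fpar (dis_pr3 n1 n2) (dis_rX1 n1)).
  rewrite (_ : theta_map = @fibre_par _ _ _ _ _ _ _ _ _ _ _ _ (dis_pr3 n1 n2) (dis_rX1 n1) \o
     (fun w => ((w.2.1, w.1), w.2.2))).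
    exact: mpres_comp hf hpm.
  by apply/funext => -[[x2 y2] [x1 y1]].
- by rewrite /theta_map'; meas_coord.
Qed.

Definition Vmap := Sig_map \o theta_map.
Definition Vmap' := theta_map' \o Sig_map'.

Lemma miso_V : miso fibG mH Vmap Vmap'.
Proof. exact: miso_comp miso_Sig miso_theta_map. Qed.

Lemma SigmaE : Sigma' n1 n2 \o Sigma n1 n2 = comp_op Vmap.
Proof.
have [h _ _] := miso_Sig; have [h' _ _] := miso_theta_map.
exact (funext (fun u => comp_op_comp u h h')).
Qed.

Lemma uni_V : uni (Sigma' n1 n2 \o Sigma n1 n2) (comp_op Vmap').
Proof. by rewrite SigmaE; exact: uni_miso miso_V. Qed.

Local Notation J := (@opJ _ _ _ (n2 \X n2) _ _ n1).

Lemma theta_act f : Linf mu2 f -> theta n1 n2 (act n1 n2 f) = Ad J (ampl n1 (mulop f)).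
Proof.
move=> lf; have lF := Linf_act lf.
have mJ : miso (n2 \X n2 \X n1 \X n1) mH (@perm_J _ _ _ _) (@perm_J' _ _ _ _).
  by apply: miso_cancel; [exact: mpres_J|exact: (mpres_J' (n2 \X n2) n1).1|case=> [? []]].
rewrite /theta SigmaE [in LHS]/act (Ad_mulop miso_V lF) (ampl_mulop n1 lf).
rewrite (Ad_mulop mJ (Linf_fst n1 lf)); congr mulop.
by apply/funext => -[[x2 y2] [x1 y1]].
Qed.

(** Brings to the front the factor X2 x X1 on which the operators coming from [R_G1] act; the other
    copy of X2 is idle. *)
Definition rho_map (w : Y2 * Y2 * Y1) : Y2 * Y1 * Y2 := ((w.1.2, w.2), w.1.1).
Definition rho_map' (w : Y2 * Y1 * Y2) : Y2 * Y2 * Y1 := ((w.2, w.1.1), w.1.2).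

Lemma miso_rho : miso (n2 \X n1 \X n2) mu2 rho_map rho_map'.
Proof.
apply: miso_cancel; last by case=> [[]].
  exact: mpres_comp (mpres_swap23 n2 n2 n1) (mpres_map (mpres_swap n2 n2) (mpres_id n1)).
exact: (mpres_comp (mpres_map (mpres_swap n2 n2) (mpres_id n1)) (mpres_swap23 n2 n1 n2)).1.
Qed.

Local Notation Adrho := (Ad (@comp_op _ _ _ (n2 \X n1 \X n2) _ _ mu2 rho_map)).
Local Notation Vs := (@comp_op _ _ _ (n2 \X n1 \X n1) _ _ mu1 (@sig_G1 X1 X2)).

Lemma Adrho_decomp y : vN_tens (Linf_ops n2) (all_ops n1) y ->
  vN_tens (Linf_ops (n2 \X n2)) (all_ops n1) (Adrho (ampl n2 y)).
Proof.
move=> hy; have K : cancel (@swap_pair Y2 Y2) (@swap_pair Y2 Y2) by case.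
have := decomp_map (mpres_swap n2 n2) (mpres_swap n2 n2).1 K (decomp_ampl n2 hy).
have m1 := miso_swap23 n2 n1 n2; have m2 := miso_mapl n1 (mpres_swap n2 n2) (mpres_swap n2 n2).1 K.
by rewrite (Ad_comp_op _ m1 m2).
Qed.

(** On L^2(G), a right convolution by G1 acts on y1 with y2 as a diagonal parameter, while x1 and x2
    are idle. Hence an amplification of [y] by X2 and then by X1. *)
Lemma theta_rtens y : vN_tens (Linf_ops n2) (all_ops n1) y -> (exists e : L2 n1, nsq e = 1) ->
  let x := rtens_op (dis_s2 n1 n2) (dis_r1 n1 n2) (dis_s2 n1 n2) (dis_r1 n1 n2) id (Ad Vs (ampl n1 y)) in
  bounded_op x /\ theta n1 n2 x = Ad J (ampl n1 (Adrho (ampl n2 y))).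
Proof.
move=> hy he x; have b_y := vN_gen_bounded hy; have hs := uni_sig_G1 n1 n2.
have mp : measurable_fun setT (@s2 X1 X2) by rewrite /s2 /gs /emb2 /=; meas_coord.
have mq : measurable_fun setT (@r1 X1 X2) by rewrite /r1 /gr /emb1 /=; meas_coord.
have mk : measurable_fun setT (fun g : G2 => g.1.1) by meas_coord.
have bx : bounded_op (Ad Vs (ampl n1 y)) by apply: (Ad_bounded hs); exact: bounded_ampl.
have ms := miso_cancel (mpres_sig_G1 n1 n2) (mpres_sig_G1' n1 n2).1 (@sig_G1K X1 X2).
(* Of the two components of [r1], the first is idle for [y] and the second is its diagonal
   parameter. *)
have hF F : Linf (n1 \X n2) F -> Ad Vs (ampl n1 y) \o mulop (F \o @r1 X1 X2) =
    mulop (F \o @r1 X1 X2) \o Ad Vs (ampl n1 y).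
  move=> lF; have lF' := Linf_comp (mpres_swap n2 n1) lF.
  have lF2 : Linf (n2 \X n1 \X n1) (fun w : Y2 * Y1 * Y1 => F (w.2, w.1.1)).
    exact (Linf_comp (mpres_swap23 n2 n1 n1) (Linf_fst n1 lF')).
  have C := ampl_decomp_comm hy he lF'.
  have E := Ad_mulop ms lF2.
  have -> : F \o @r1 X1 X2 = (fun w : Y2 * Y1 * Y1 => F (w.2, w.1.1)) \o @sig_G1 X1 X2 by [].
  rewrite -E; exact (etrans (esym (Ad_comp hs _ _)) (etrans (congr1 _ C) (Ad_comp hs _ _))).
have kAK z t : (fun g : G2 => g.1.1) (dis_par (dis_s2 n1 n2) (z, t)) = t by [].
have xE := rtens_op_ampl (DA := dis_s2 n1 n2) (dis_r1 n1 n2) (kA := fun g : G2 => g.1.1) mp mq mk kAK bx hF.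
have mK := miso_kap (DA := dis_s2 n1 n2) (dis_r1 n1 n2) (kA := fun g : G2 => g.1.1) mq mk kAK.
split; first by rewrite /x xE; apply: (Ad_bounded (uni_miso mK)); exact: bounded_ampl.
have mmap := miso_mapl n2 (mpres_sig_G1 n1 n2) (mpres_sig_G1' n1 n2).1 (@sig_G1K X1 X2).
have msw := miso_swap23 (n2 \X n1) n2 n1.
have mJ : miso (n2 \X n2 \X n1 \X n1) mH (@perm_J _ _ _ _) (@perm_J' _ _ _ _).
  by apply: miso_cancel; [exact: mpres_J|exact: (mpres_J' (n2 \X n2) n1).1|case=> [? []]].
have [hr mr' _] := miso_rho; have rK : cancel rho_map rho_map' by case=> [[]].
have mrho := miso_mapl n1 hr mr' rK.
have b2 := bounded_ampl n2 b_y; have b1 := bounded_ampl n1 b_y.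
have E1 := ampl_Ad n2 (mpres_sig_G1 n1 n2) (mpres_sig_G1' n1 n2).1 (@sig_G1K X1 X2) b1.
have E2 := ampl_swap n1 n2 b_y.
have E3 := ampl_Ad n1 hr mr' rK b2.
have mSM := miso_comp msw mmap.
(* Both sides are collected into a conjugation of [ampl n1 (ampl n2 y)] by one coordinate map; the
   two maps are then compared pointwise. *)
have L1 := etrans E1 (etrans (congr1 _ E2) (Ad_comp_op (ampl n1 (ampl n2 y)) msw mmap)).
have L2 := etrans (congr1 _ L1) (Ad_comp_op (ampl n1 (ampl n2 y)) mSM mK).
have L3 := etrans (congr1 _ L2) (Ad_comp_op (ampl n1 (ampl n2 y)) (miso_comp mSM mK) miso_V).
have L4 := congr2 (fun V t => Ad V t) SigmaE xE.
have Rr := etrans (congr1 _ E3) (Ad_comp_op (ampl n1 (ampl n2 y)) mrho mJ).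
apply: (etrans L4 (etrans L3 (etrans _ (esym Rr)))).
congr (Ad (comp_op _) _); by apply/funext => -[[x2 y2] [x1 y1]].
Qed.

End crossed_product.

Section generated_image.
Context (R : realType).
Context d1 (T1 : measurableType d1) (m : {sigma_finite_measure set T1 -> \bar R}).
Context d2 (T2 : measurableType d2) (n : {sigma_finite_measure set T2 -> \bar R}).
Context d3 (T3 : measurableType d3) (l : {measure set T3 -> \bar R}).
Local Notation J := (@opJ _ _ _ m _ _ n).
Local Notation decomp := (vN_tens (Linf_ops m) (all_ops n)).

(** One inclusion holds because the generators land in the target. For the other, f (x) 1 and 1 (x)
    b are each hit by a generator, and their products generate the target. *)
Lemma Ad_vN_gen_decomp (V : L2 l -> L2 (m \X (n \X n))) V' (S : set (L2 l -> L2 l)) (e : L2 n) :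
  uni V V' -> S `<=` bounded_op (nu := l) -> nsq e = 1 ->
  (forall s, S s -> exists2 y, decomp y & Ad V s = Ad J (ampl n y)) ->
  (forall f, Linf m f -> exists2 s, S s & Ad V s = Ad J (ampl n (ampl n (mulop f)))) ->
  (forall b, bounded_op b -> exists2 s, S s & Ad V s = Ad J (ampl n (tens_op id b))) ->
  [set Ad V x | x in vN_gen S] = vN_tens (Linf_ops m) (vN_tens (scalar_ops n) (all_ops n)).
Proof.
move=> hV bS e1 h1 h2 h3; have hJ := uni_J m n.
rewrite -(Ad_vN_gen S hV) (vN_tens_ampl m e1).
have bA : [set Ad V s | s in S] `<=` bounded_op (nu := _).
  by move=> _ [s hs <-]; exact: (Ad_bounded hV (bS _ hs)).
have bD := @decomp_gen_bounded _ _ _ m _ _ n.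
have bT : [set Ad J x | x in [set ampl n s | s in @decomp_gen _ _ _ m _ _ n]] `<=` bounded_op (nu := _).
  by move=> _ [_ [s hs <-] <-]; exact: (Ad_bounded hJ (bounded_ampl n (bD _ hs))).
have tE : [set Ad J (ampl n x) | x in decomp] =
    vN_gen [set Ad J x | x in [set ampl n s | s in @decomp_gen _ _ _ m _ _ n]].
  rewrite (Ad_vN_gen _ hJ) (vN_gen_ampl e1 bD).
  apply/seteqP; split => [_ [y hy <-]|_ [_ [y hy <-] <-]].
    by exists (ampl n y) => //; exists y.
  by exists y.
rewrite tE; apply: (vN_gen_eq bA bT).
  by rewrite -tE => _ [s /h1[y hy E] <-]; exists y.
move=> _ [_ [_ [_ [f lf <-] [b bb <-]] <-] <-].
have bf := bounded_mulop lf; have bi := bounded_id n; have bi2 := bounded_id m.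
have -> : tens_op (@mulop _ _ _ m f) b = tens_op (mulop f) id \o tens_op id b.
  by rewrite (tens_op_comp bf bi2 bi bb).
have b1 := bounded_tens_op bf bi; have b2 := bounded_tens_op bi2 bb.
rewrite (ampl_comp _ b1 b2) (Ad_comp hJ); apply: vN_gen_comp; apply: (sub_vN_gen bA).
  by have [s hs E] := h2 _ lf; exists s.
by have [s hs E] := h3 _ bb; exists s.
Qed.

End generated_image.
Section crossed_product_iso.
Context (R : realType) (X1 X2 : ptopologicalType).
Local Notation Y1 := (borel X1).
Local Notation Y2 := (borel X2).
Variable n1 : {sigma_finite_measure set Y1 -> \bar R}.
Variable n2 : {sigma_finite_measure set Y2 -> \bar R}.
Hypotheses (hX1 : hausdorff_space X1) (lX1 : locally_compact [set: X1]).
Hypotheses (hX2 : hausdorff_space X2) (lX2 : locally_compact [set: X2]) (sX2 : sigma_compact X2).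
Hypotheses (rn1 : radon n1) (fn1 : full_support n1) (rn2 : radon n2).
Local Notation mu2 := (n2 \X n2 \X n1).
Local Notation J := (@opJ _ _ _ (n2 \X n2) _ _ n1).
Local Notation target := (vN_tens (Linf_ops (n2 \X n2)) (vN_tens (scalar_ops n1) (all_ops n1))).
Local Notation Vs := (@comp_op _ _ _ (n2 \X n1 \X n1) _ _ (n1 \X n1 \X n2) (@sig_G1 X1 X2)).

Let gens := [set act n1 n2 f | f in Linf mu2] `|`
  [set rtens_op (dis_s2 n1 n2) (dis_r1 n1 n2) (dis_s2 n1 n2) (dis_r1 n1 n2) id x | x in @R_G1 R X1 X2 n1 n2].

Let he := unit_full_support fn1.

Let R_G1P x : @R_G1 R X1 X2 n1 n2 x ->
  exists2 y, vN_tens (Linf_ops n2) (all_ops n1) y & x = Ad Vs (ampl n1 y).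
Proof.
rewrite (R_G1_eq hX1 n2 rn1 fn1) => -[y hy <-]; exists y => //.
exact: (kernels_G1_decomp fn1).
Qed.

Lemma crossed_gens_bounded : gens `<=` bounded_op (nu := _).
Proof.
move=> _ [[f lf <-]|[x /R_G1P[y hy ->] <-]].
  exact: (bounded_mulop (Linf_act lf)).
by have [] := theta_rtens hy he.
Qed.

Lemma targetP z : target z <-> exists2 y, vN_tens (Linf_ops (n2 \X n2)) (all_ops n1) y & z = Ad J (ampl n1 y).
Proof.
have [e e1] := he; rewrite (vN_tens_ampl (n2 \X n2) e1).
by split => [[y hy <-]|[y hy ->]]; exists y.
Qed.

Lemma theta_image : [set theta n1 n2 x | x in crossed_product n1 n2] = target.
Proof.
have hV := uni_V n1 n2; have [e e1] := he.
apply: (Ad_vN_gen_decomp hV crossed_gens_bounded e1).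
- move=> _ [[f lf <-]|[x /R_G1P[y hy ->] <-]].
    by exists (mulop f); [exact: (decomp_mulop e1)|exact: theta_act].
  exists (Ad (@comp_op _ _ _ (n2 \X n1 \X n2) _ _ mu2 (@rho_map X1 X2)) (ampl n2 y)).
    exact: Adrho_decomp.
  exact: (theta_rtens hy he).2.
- move=> f lf; exists (act n1 n2 (fun w => f w.1)).
    by left; exists (fun w => f w.1); [exact: Linf_fst|].
  exact (etrans (theta_act (Linf_fst n1 lf)) (congr1 (fun x => Ad J (ampl n1 x)) (esym (ampl_mulop n1 lf)))).
move=> b bb; have bi2 := bounded_id (n2 \X n2).
have hb : vN_tens (Linf_ops n2) (all_ops n1) (tens_op id b).
  apply: sub_vN_gen; first exact: decomp_gen_bounded.
  by exists id; [exact: Linf_ops_id|exists b].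
have bi2' := bounded_id n2.
have E : Ad (@comp_op _ _ _ (n2 \X n1 \X n2) _ _ mu2 (@rho_map X1 X2)) (ampl n2 (tens_op id b)) = tens_op id b.
  have hr := miso_rho n1 n2; have hur := uni_miso hr.
  apply: (Ad_inj (uni_sym hur)); rewrite (AdK hur).
  have [hr1 _ _] := hr; have [hr1' _ _] := miso_sym hr.
  have bid := bounded_tens_op bi2' bb.
  apply/esym; apply: (bounded_tens3_ext _ (bounded_ampl n2 bid)).
    exact: (Ad_bounded (uni_sym hur) (bounded_tens_op bi2 bb)).
  have K (u : L2 n2) (v : L2 n1) (w : L2 n2) :
      comp_op (nu := mu2) (@rho_map X1 X2) (tens (tens u v) w) = tens (tens w u) v.
    have h1 := mpres_swap23 n2 n2 n1; have h2 := mpres_map (mpres_swap n2 n2) (mpres_id n1).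
    rewrite -[LHS]/(comp_op (nu := mu2) (@swap23 Y2 Y2 Y1 \o map_pair (@swap_pair Y2 Y2) id) (tens (tens u v) w)).
    rewrite -(comp_op_comp _ h1 h2) comp_swap23_tens (comp_map_tens _ _ (mpres_swap n2 n2) (mpres_id n1)).
    by rewrite comp_op_id comp_swap_tens.
  move=> u v w; rewrite (AdE (uni_sym hur)) /= K (tens_opE _ _ bi2 bb) (amplE _ _ bid) (tens_opE _ _ bi2' bb).
  by rewrite -K; have [_ K' _] := hur; rewrite K'.
exists (rtens_op (dis_s2 n1 n2) (dis_r1 n1 n2) (dis_s2 n1 n2) (dis_r1 n1 n2) id (Ad Vs (ampl n1 (tens_op id b)))).
  right; exists (Ad Vs (ampl n1 (tens_op id b))) => //.
  rewrite (R_G1_eq hX1 n2 rn1 fn1); exists (tens_op id b) => //.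
  exact: idtens_kernels_G1.
exact (etrans (theta_rtens hb he).2 (congr1 (fun x => Ad J (ampl n1 x)) E)).
Qed.

Lemma crossed_bounded x : crossed_product n1 n2 x -> bounded_op x.
Proof. exact: vN_gen_bounded. Qed.

Lemma vN_iso_theta : vN_iso (crossed_product n1 n2) target (theta n1 n2).
Proof.
have hV := uni_V n1 n2; split; first exact: (uni_star_hom hV crossed_bounded).
split.
- by move=> x hx; rewrite -theta_image; exists x.
- by move=> x y _ _; exact: (Ad_inj hV).
- by move=> z; rewrite -theta_image.
Qed.

Lemma vN_isomorphic_crossed :
  vN_isomorphic (crossed_product n1 n2) (vN_tens (Linf_ops (n2 \X n2)) (all_ops n1)).
Proof.
have [e e1] := he.
have [psi hpsi] := vN_iso_inv (@decomp_gen_bounded _ _ _ _ _ _ _) (vN_iso_decomp (n2 \X n2) e1).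
exists (psi \o theta n1 n2); exact: vN_iso_trans vN_iso_theta hpsi.
Qed.

Lemma target_R_X1 : target = vN_tens (Linf_ops (n2 \X n2)) (R_X1 n1).
Proof.
have [e e1] := he.
by rewrite (vN_tens_scalar_all n1 e1) (R_X1_eq hX1 lX1 rn1 fn1).
Qed.

End crossed_product_iso.

(** * The tensor product of the coproducts *)

Section interchange_tensors.
Context (R : realType).
Context d1 (T1 : measurableType d1) (m1 : {sigma_finite_measure set T1 -> \bar R}).
Context d2 (T2 : measurableType d2) (m2 : {sigma_finite_measure set T2 -> \bar R}).
Context d3 (T3 : measurableType d3) (m3 : {sigma_finite_measure set T3 -> \bar R}).
Context d4 (T4 : measurableType d4) (m4 : {sigma_finite_measure set T4 -> \bar R}).

Lemma miso_interchange : miso (m1 \X m3 \X (m2 \X m4)) (m1 \X m2 \X (m3 \X m4))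
  (@Defs.interchange _ T1 _ T2 _ T3 _ T4) (@Defs.interchange _ T1 _ T3 _ T2 _ T4).
Proof.
apply: miso_cancel; [exact: mpres_interchange|exact: (mpres_interchange m1 m3 m2 m4).1|].
by case=> [[? ?] [? ?]].
Qed.

Lemma comp_interchange_tens (u : L2 m1) (v : L2 m2) (w : L2 m3) (z : L2 m4) :
  comp_op (@Defs.interchange _ T1 _ T2 _ T3 _ T4) (tens (tens u w) (tens v z)) = tens (tens u v) (tens w z).
Proof.
have h := mpres_interchange m1 m2 m3 m4; apply/L2P.
have e1 := comp_opE h (tens (tens u w) (tens v z)).
have e2 := ae_mpres h (tensE (tens u w) (tens v z)).
have e3 := ae_mpres h (@ae_fst _ _ _ (m1 \X m3) _ _ (m2 \X m4) _ (tensE u w)).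
have e4 := ae_mpres h (@ae_snd _ _ _ (m1 \X m3) _ _ (m2 \X m4) _ (tensE v z)).
have f1 := tensE (tens u v) (tens w z).
have f2 := @ae_fst _ _ _ (m1 \X m2) _ _ (m3 \X m4) _ (tensE u v).
have f3 := @ae_snd _ _ _ (m1 \X m2) _ _ (m3 \X m4) _ (tensE w z).
apply: filterS3 (filterI e1 e2) (filterI e3 e4) (filterI f1 (filterI f2 f3)).
by move=> x [-> ->] [-> ->] [-> [-> ->]]; rewrite /Defs.interchange /= mulrACA.
Qed.

Lemma total_tens2 (E1 : set (L2 m1)) (E2 : set (L2 m2)) : total_in E1 -> total_in E2 ->
  total_in [set tens x y | x in E1 & y in E2].
Proof.
move=> t1 t2 w hw; apply: (total_tensl (m2 := m2) t1) => _ [x Ex [y _ <-]].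
have bt := tens_linr m2 x.
rewrite (adjP bt); suff -> : adj (tens x : L2 m2 -> L2 (m1 \X m2)) w = 0 by exact: inner0r.
by apply: t2 => z Ez; rewrite -(adjP bt); apply: hw; exists x => //; exists z.
Qed.

End interchange_tensors.

Section interchange_Ad.
Context (R : realType).
Context d1 (T1 : measurableType d1) (m1 : {sigma_finite_measure set T1 -> \bar R}).
Context d2 (T2 : measurableType d2) (m2 : {sigma_finite_measure set T2 -> \bar R}).
Context d3 (T3 : measurableType d3) (m3 : {sigma_finite_measure set T3 -> \bar R}).
Context d4 (T4 : measurableType d4) (m4 : {sigma_finite_measure set T4 -> \bar R}).

Lemma Ad_interchange_tens a b c d :
  bounded_op a -> bounded_op b -> bounded_op c -> bounded_op d ->
  Ad (@comp_op _ _ _ (m1 \X m3 \X (m2 \X m4)) _ _ (m1 \X m2 \X (m3 \X m4))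
    (@Defs.interchange _ T1 _ T2 _ T3 _ T4)) (tens_op (tens_op a c) (tens_op b d)) =
  tens_op (tens_op a b) (tens_op c d).
Proof.
move=> ba bb bc bd; have hu := uni_miso (miso_interchange m1 m2 m3 m4).
have bac := bounded_tens_op ba bc; have bbd := bounded_tens_op bb bd.
have bab := bounded_tens_op ba bb; have bcd := bounded_tens_op bc bd.
have B1 := Ad_bounded hu (bounded_tens_op bac bbd); have B2 := bounded_tens_op bab bcd.
apply: (bounded_eq_total B1 B2 (total_tens2 (@total_tens _ _ _ m1 _ _ m2) (@total_tens _ _ _ m3 _ _ m4))).
move=> _ [_ [u _ [v _ <-]] [_ [w _ [z _ <-]] <-]].
rewrite (AdE hu) /= comp_interchange_tens (tens_opE _ _ bac bbd) (tens_opE _ _ ba bc).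
rewrite (tens_opE _ _ bb bd) comp_interchange_tens.
by rewrite (tens_opE _ _ bab bcd) (tens_opE _ _ ba bb) (tens_opE _ _ bc bd).
Qed.

Lemma Ad_mapl_tens (c : T2 -> T1) c' a b : mpres m2 m1 c -> measurable_fun setT c' -> cancel c c' ->
  bounded_op a -> bounded_op b ->
  Ad (@comp_op _ _ _ (m1 \X m3) _ _ (m2 \X m3) (map_pair c id)) (tens_op a b) =
  tens_op (Ad (@comp_op _ _ _ m1 _ _ m2 c) a) b.
Proof.
move=> hc mc' K ba bb; have hm := miso_mapl m3 hc mc' K; have hu := uni_miso hm.
have h1 := uni_miso (miso_cancel hc mc' K).
have hc' := miso_mpres (miso_cancel hc mc' K).
apply: tens_op_uniq => //; first exact: Ad_bounded h1 _ ba.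
  by apply: (Ad_bounded hu); exact: bounded_tens_op.
move=> u v; rewrite (AdE hu) (AdE h1) /= (comp_map_tens _ _ hc' (mpres_id m3)) (tens_opE _ _ ba bb).
by rewrite (comp_map_tens _ _ hc (mpres_id m3)) !comp_op_id.
Qed.

End interchange_Ad.

Section coproduct.
Context (R : realType) (X1 X2 : ptopologicalType).
Local Notation Y1 := (borel X1).
Local Notation Y2 := (borel X2).
Variable n1 : {sigma_finite_measure set Y1 -> \bar R}.
Variable n2 : {sigma_finite_measure set Y2 -> \bar R}.
Local Notation mH := (n2 \X n2 \X (n1 \X n1)).
Local Notation mK' := (n2 \X n2 \X n2 \X (n1 \X n1 \X n1)).

(** The function selected in [Gamma_X2] may differ from [f] on a null set; the value is therefore
    expressed through the operator [mulop f], which is the same for both. *)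
Lemma Gamma_X2E f : Linf (n2 \X n2) f -> Gamma_X2 (@mulop _ _ _ (n2 \X n2) f) =
  Ad (@comp_op _ _ _ (n2 \X n2 \X n2) _ _ (n2 \X n2 \X n2) (@swap23 Y2 Y2 Y2)) (ampl n2 (mulop f)).
Proof.
have E g : Linf (n2 \X n2) g -> mulop (fun w : Y2 * Y2 * Y2 => g (w.1.1, w.2)) =
    Ad (@comp_op _ _ _ (n2 \X n2 \X n2) _ _ (n2 \X n2 \X n2) (@swap23 Y2 Y2 Y2)) (ampl n2 (mulop g)).
  move=> lg; rewrite (ampl_mulop n2 lg).
  by rewrite (Ad_mulop (miso_swap23 n2 n2 n2) (Linf_fst n2 lg)).
move=> lf; rewrite /Gamma_X2.
set S := [set y | _].
have : S (xget (fun=> 0) S) by apply: xgetPex; exists (mulop (fun w : Y2 * Y2 * Y2 => f (w.1.1, w.2))); exists f.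
by move=> [g [lg fg ->]]; rewrite (E _ lg) fg.
Qed.

Lemma Gamma_hat_X1E c : bounded_op c ->
  Gamma_hat_X1 (tens_op (@id (L2 n1)) c) = ampl n1 (tens_op id c).
Proof.
move=> bc; rewrite /Gamma_hat_X1; set S := [set y | _].
have : S (xget (fun=> 0) S) by apply: xgetPex; exists (tens_op (tens_op id c) id); exists c.
by move=> [a [ba E ->]]; rewrite E.
Qed.

Definition coprod_map (w : Y2 * Y2 * Y2 * (Y1 * Y1 * Y1)) : Y2 * Y2 * (Y1 * Y1) * (Y2 * Y1) :=
  Defs.interchange (map_pair (@swap23 Y2 Y2 Y2) id w).
Definition coprod_map' (w : Y2 * Y2 * (Y1 * Y1) * (Y2 * Y1)) : Y2 * Y2 * Y2 * (Y1 * Y1 * Y1) :=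
  map_pair (@swap23 Y2 Y2 Y2) id (Defs.interchange w).

Let miso_sw : miso (n2 \X n2 \X n2 \X (n1 \X n1 \X n1)) mK' (map_pair (@swap23 Y2 Y2 Y2) id) (map_pair (@swap23 Y2 Y2 Y2) id).
Proof.
apply: miso_mapl; [exact: mpres_swap23|exact: (mpres_swap23 n2 n2 n2).1|by case=> [[]]].
Qed.

Lemma miso_coprod : miso (mH \X (n2 \X n1)) mK' coprod_map coprod_map'.
Proof. exact: miso_comp (miso_interchange (n2 \X n2) n2 (n1 \X n1) n1) miso_sw. Qed.

(** Candidate for the tensor product of the coproducts. Each of them is an amplification, up to
    [swap23] in the case of X2, so that one amplification by X2 x X1 followed by a permutation
    performs both. *)
Definition coprod (x : L2 mH -> L2 mH) : L2 mK' -> L2 mK' :=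
  Ad (comp_op coprod_map) (ampl (n2 \X n1) x).

Lemma coprod_tens a b : bounded_op a -> bounded_op b -> coprod (tens_op a b) =
  tens_op (Ad (@comp_op _ _ _ (n2 \X n2 \X n2) _ _ (n2 \X n2 \X n2) (@swap23 Y2 Y2 Y2)) (ampl n2 a)) (ampl n1 b).
Proof.
move=> ba bb; have b1 := bounded_id n1; have b2 := bounded_id n2.
have m1 := miso_interchange (n2 \X n2) n2 (n1 \X n1) n1.
have K : cancel (@swap23 Y2 Y2 Y2) (@swap23 Y2 Y2 Y2) by case=> [[]].
rewrite /coprod -[coprod_map]/(@Defs.interchange _ _ _ _ _ _ _ _ \o map_pair (@swap23 Y2 Y2 Y2) id).
rewrite -(Ad_comp_op _ m1 miso_sw) /ampl -(tens_op_id n2 n1) (Ad_interchange_tens ba b2 bb b1).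
have A2 := bounded_tens_op ba b2; have A1 := bounded_tens_op bb b1.
exact: (Ad_mapl_tens (mpres_swap23 n2 n2 n2) (mpres_swap23 n2 n2 n2).1 K A2 A1).
Qed.

Lemma coprod_star_hom M : M `<=` bounded_op (nu := mH) -> star_hom M coprod.
Proof. exact: star_hom_Ad_ampl (uni_miso miso_coprod). Qed.

End coproduct.

Section star_hom_projections.
Context (R : realType) d (T : measurableType d) (mu : {measure set T -> \bar R}).
Context d' (U : measurableType d') (nu : {measure set U -> \bar R}).
Context (M : set (L2 mu -> L2 mu)) (phi : (L2 mu -> L2 mu) -> (L2 nu -> L2 nu)).
Hypothesis h : star_hom M phi.

Lemma star_hom_bounded a : M a -> bounded_op (phi a).
Proof. by case: h => b _ _ _; exact: b. Qed.

Lemma star_hom_comp a b : M a -> M b -> phi (a \o b) = phi a \o phi b.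
Proof. by case: h => _ _ c _; exact: c. Qed.

End star_hom_projections.

Section coproduct_uniqueness.
Context (R : realType) (X1 X2 : ptopologicalType).
Local Notation Y1 := (borel X1).
Local Notation Y2 := (borel X2).
Variable n1 : {sigma_finite_measure set Y1 -> \bar R}.
Variable n2 : {sigma_finite_measure set Y2 -> \bar R}.
Hypothesis RE : R_X1 n1 = [set tens_op id b | b in all_ops n1].
Variables (e0 : L2 n1) (e1 : nsq e0 = 1).
Local Notation n22 := (n2 \X n2).
Local Notation N := (vN_tens (Linf_ops n22) (R_X1 n1)).
Local Notation J := (@opJ _ _ _ n22 _ _ n1).

Definition coprod_formula (phi : (L2 (n22 \X (n1 \X n1)) -> L2 (n22 \X (n1 \X n1))) ->
    L2 (n22 \X n2 \X (n1 \X n1 \X n1)) -> L2 (n22 \X n2 \X (n1 \X n1 \X n1))) :=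
  forall a b, Linf_ops n22 a -> R_X1 n1 b -> phi (tens_op a b) = tens_op (Gamma_X2 a) (Gamma_hat_X1 b).

Lemma R_X1_bounded : R_X1 n1 `<=` bounded_op (nu := n1 \X n1).
Proof. by rewrite RE => _ [b bb <-]; exact: (bounded_tens_op (bounded_id n1) bb). Qed.

Lemma N_gens_bounded : [set tens_op a b | a in Linf_ops n22 & b in R_X1 n1] `<=` bounded_op (nu := n22 \X (n1 \X n1)).
Proof.
move=> _ [a ha [b hb <-]].
exact: bounded_tens_op (Linf_ops_bounded ha) (R_X1_bounded hb).
Qed.

Lemma coprod_formulaP : coprod_formula (@coprod R X1 X2 n1 n2).
Proof.
move=> _ b [f lf <-] hb; have [c bc <-] : [set tens_op id b | b in all_ops n1] b by rewrite -RE.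
have bf := bounded_mulop lf; have bi := bounded_id n1; have bic := bounded_tens_op bi bc.
by rewrite (coprod_tens bf bic) (Gamma_X2E lf) (Gamma_hat_X1E bc).
Qed.

(** The common value at [E r] of all maps that satisfy [coprod_formula]. *)
Let P (r : L2 n1 -> L2 n1) : L2 (n22 \X n2 \X (n1 \X n1 \X n1)) -> L2 (n22 \X n2 \X (n1 \X n1 \X n1)) :=
  tens_op id (ampl n1 (tens_op id r)).
Let E (r : L2 n1 -> L2 n1) : L2 (n22 \X (n1 \X n1)) -> L2 (n22 \X (n1 \X n1)) :=
  tens_op id (tens_op id r).

Let E_gen r : bounded_op r -> N (E r).
Proof.
move=> br; apply: sub_vN_gen; first exact: N_gens_bounded.
exists id; first exact: Linf_ops_id.
by exists (tens_op id r) => //; rewrite RE; exists r.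
Qed.

Let P_formula phi r : coprod_formula phi -> bounded_op r -> phi (E r) = P r.
Proof.
move=> hphi br; rewrite /E hphi; last 2 first.
- exact: Linf_ops_id.
- by rewrite RE; exists r.
rewrite (Gamma_hat_X1E br) /P -[in LHS](mulop1 n22) (Gamma_X2E (Linf_cst _ _)) mulop1.
have hu := uni_miso (miso_swap23 n2 n2 n2).
have -> : ampl n2 (@id (L2 n22)) = id by exact: tens_op_id.
exact (congr1 (fun a => tens_op a _) (Ad_id hu)).
Qed.

(** Write [x] as the amplification of a decomposable operator. Its corner is then a slice of that
    operator tensored with |e0><e0|, and such a slice commutes with L^oo, hence is a
    multiplication. *)
Let corner x e f : N x -> exists2 g, Linf n22 g &
  E (rank1 e0 e) \o x \o E (rank1 f e0) = tens_op (mulop g) (tens_op id (rank1 e0 e0)).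
Proof.
have NE : N = [set Ad J (ampl n1 y) | y in vN_tens (Linf_ops n22) (all_ops n1)].
  by rewrite RE -(vN_tens_scalar_all n1 e1) (vN_tens_ampl n22 e1).
rewrite {1}NE => -[y hy <-]; have hJ := uni_J n22 n1.
have b_y := vN_gen_bounded hy; have bi := bounded_id n22.
have br1 := bounded_rank1 e0 e; have br2 := bounded_rank1 f e0; have br0 := bounded_rank1 e0 e0.
have bs := bounded_slice e f b_y.
have [|tau lt tE] := Linf_masa bs.
  move=> g lg; have bg := bounded_mulop lg; apply: (slice_comm _ _ bg).
  by have [_ h] := (decompP e1 _).1 hy; rewrite (ampl_mulop n1 lg); exact: h.
exists tau => //; rewrite -tE.
apply: etrans (AdJ_tens bs br0).
pose T1 := tens_op (@id (L2 n22)) (rank1 e0 e); pose T2 := tens_op (@id (L2 n22)) (rank1 f e0).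
have bt1 : bounded_op T1 := bounded_tens_op bi br1.
have bt2 : bounded_op T2 := bounded_tens_op bi br2.
have TE : tens_op (slice e f y) (rank1 e0 e0) = (T1 \o y) \o T2.
  have t1 : T1 = ins e0 \o adj (ins e) by exact: tens_op_rank1.
  have t2 : T2 = ins f \o adj (ins e0) by exact: tens_op_rank1.
  by rewrite t1 t2; exact: (tens_op_rank1_gen e0 e0 bs).
have bt1y : bounded_op (T1 \o y) := bounded_comp b_y bt1.
have E1 := ampl_comp n1 bt1y bt2; have E2 := ampl_comp n1 bt1 b_y.
have A1 : Ad J (ampl n1 T1) = E (rank1 e0 e) := AdJ_tens bi br1.
have A2 : Ad J (ampl n1 T2) = E (rank1 f e0) := AdJ_tens bi br2.
clearbody T1 T2.
have B1 := Ad_comp hJ (ampl n1 (T1 \o y)) (ampl n1 T2).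
have B2 := Ad_comp hJ (ampl n1 T1) (ampl n1 y).
have B3 : Ad J (ampl n1 ((T1 \o y) \o T2)) = Ad J (ampl n1 T1) \o Ad J (ampl n1 y) \o Ad J (ampl n1 T2).
  exact (etrans (congr1 (Ad J) E1) (etrans B1
    (congr1 (fun a => a \o Ad J (ampl n1 T2)) (etrans (congr1 (Ad J) E2) B2)))).
exact (etrans (congr2 (fun a b => a \o Ad J (ampl n1 y) \o b) (esym A1) (esym A2))
  (esym (etrans (congr1 (fun t => Ad J (ampl n1 t)) TE) B3))).
Qed.

Let adjoint_rank1 (e f : L2 n1) : is_adjoint (rank1 e f) (rank1 f e).
Proof. by move=> u v; rewrite /rank1 innerZl innerZr -innerC mulrC. Qed.

Let P_adjoint e f : is_adjoint (P (rank1 e f)) (P (rank1 f e)).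
Proof.
have bi := bounded_id n1; have br := bounded_rank1 e f; have bt := bounded_tens_op bi br.
apply: tens_op_adjoint.
- exact: bounded_id.
- exact: bounded_ampl.
- by [].
- apply: (ampl_adjoint bt); apply: (tens_op_adjoint bi br) => //.
Qed.

Let total_P : total_in [set P (rank1 f e0) z | f in [set: L2 n1] & z in [set: _]].
Proof.
apply: total_inS (total_tens2 (@total_tens _ _ _ n22 _ _ n2) (total_tensl (m2 := n1) (@total_tens _ _ _ n1 _ _ n1))).
move=> _ [u _ [_ [_ [v _ [f _ <-]] [w _ <-]] <-]].
exists f => //; exists (tens u (tens (tens v e0) w)) => //.
have bi := bounded_id n1; have br := bounded_rank1 f e0; have bt := bounded_tens_op bi br.
have bi2 := bounded_id (n22 \X n2).
rewrite /P (tens_opE _ _ bi2 (bounded_ampl n1 bt)) (amplE _ _ bt) (tens_opE _ _ bi br).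
by rewrite /rank1 inner_self e1 scale1r.
Qed.

Let P_corner phi x e f G : star_hom N phi -> coprod_formula phi -> N x ->
  E (rank1 e0 e) \o x \o E (rank1 f e0) = G ->
  P (rank1 e0 e) \o phi x \o P (rank1 f e0) = phi G.
Proof.
move=> hphi h Nx gE.
have br1 := bounded_rank1 e0 e; have br2 := bounded_rank1 f e0.
have N1 := E_gen br1; have N2 := E_gen br2; have N3 := vN_gen_comp N1 Nx.
exact (etrans (congr2 (fun a b => a \o phi x \o b) (esym (P_formula h br1)) (esym (P_formula h br2)))
  (etrans (congr1 (fun a => a \o phi (E (rank1 f e0))) (esym (star_hom_comp hphi N1 Nx)))
    (etrans (esym (star_hom_comp hphi N3 N2)) (congr1 phi gE)))).
Qed.

(* Both maps are determined on the corners (1 (x) |e0><e|) x (1 (x) |f><e0|),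
   which are elementary tensors. *)
Lemma coprod_uniq phi1 phi2 x : star_hom N phi1 -> star_hom N phi2 ->
  coprod_formula phi1 -> coprod_formula phi2 -> N x -> phi1 x = phi2 x.
Proof.
move=> h1 h2 f1 f2 Nx; have b1 := star_hom_bounded h1 Nx; have b2 := star_hom_bounded h2 Nx.
have key e f : P (rank1 e0 e) \o phi1 x \o P (rank1 f e0) = P (rank1 e0 e) \o phi2 x \o P (rank1 f e0).
  have [g lg gE] := corner e f Nx.
  have lo : Linf_ops n22 (mulop g) by exists g.
  have ro : R_X1 n1 (tens_op id (rank1 e0 e0)) by rewrite RE; exists (rank1 e0 e0); [exact: bounded_rank1|].
  exact (etrans (P_corner h1 f1 Nx gE) (etrans (etrans (f1 _ _ lo ro) (esym (f2 _ _ lo ro)))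
    (esym (P_corner h2 f2 Nx gE)))).
apply: (bounded_eq_total b1 b2 total_P) => _ [f _ [z _ <-]].
(* The difference is orthogonal to every [P (rank1 e e0) z'], because the adjoint [P (rank1 e0 e)]
   annihilates it by [key]. *)
apply/eqP; rewrite -subr_eq0; apply/eqP; apply: total_P => _ [e _ [z' _ <-]].
rewrite P_adjoint; set u := phi1 x _; set v := phi2 x _.
have k : P (rank1 e0 e) u = P (rank1 e0 e) v := congr1 (fun h => h z) (key e f).
clearbody u v.
have bP : bounded_op (P (rank1 e0 e)).
  apply: bounded_tens_op; first exact: bounded_id.
  by apply: bounded_ampl; apply: bounded_tens_op; [exact: bounded_id|exact: bounded_rank1].
have L := linB u v bP.1; rewrite k subrr in L.
exact (etrans (congr1 (inner z') L) (inner0r z')).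
Qed.

End coproduct_uniqueness.

(** * Normality of amplifications *)

Section orthogonal_series.
Context (R : realType) d (T : measurableType d) (mu : {measure set T -> \bar R}).
Local Notation Re := (@complex.Re R).
Local Notation Im := (@complex.Im R).
Local Notation H := (L2 mu).

Lemma L2_cvg_inner_const (s : nat -> H) w x c N : L2_cvg s w ->
  (forall n, (N <= n)%N -> inner x (s n) = c) -> inner x w = c.
Proof.
move=> sw hc; apply/eqP; rewrite -subr_eq0 -sqabs_eq0 eq_le sqabs_ge0 andbT.
apply/ler_addgt0Pl => e e0; rewrite addr0.
have K0 : 0 < nsq x + 1 by rewrite ltr_wpDl ?nsq_ge0.
have e20 : 0 < e / (nsq x + 1) by rewrite divr_gt0.
move/cvgrPdist_le : sw => /(_ _ e20) [N' _ hN'].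
pose n := maxn N N'; have := hN' n (leq_maxr N N').
rewrite /= sub0r normrN ger0_norm ?nsq_ge0// => h.
rewrite -(hc n (leq_maxl N N')) -innerBr; apply: (le_trans (cauchy_schwarz _ _)).
rewrite nsq_sym; apply: (@le_trans _ _ ((nsq x + 1) * (e / (nsq x + 1)))).
  by apply: ler_pM => //; rewrite ?nsq_ge0// lerDl.
by rewrite mulrC divfK// gt_eqF.
Qed.

Lemma L2_cvg_inner_Re (s : nat -> H) w x : L2_cvg s w ->
  (fun n => Re (inner (s n) x)) @ \oo --> Re (inner w x).
Proof.
move=> sw; have E v : Re (inner v x) = Re (inner x v) by rewrite innerC; case: (inner x v).
by rewrite E; under eq_fun do rewrite E; exact: L2_cvg_Re_inner.
Qed.

Lemma L2_cvg_inner_Im (s : nat -> H) w x : L2_cvg s w ->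
  (fun n => Im (inner (s n) x)) @ \oo --> Im (inner w x).
Proof.
move=> sw; have E v : Im (inner v x) = Re (inner ((0 +i* 1) *: x) v).
  rewrite innerZl innerC; case: (inner x v) => a b /=; ring.
by rewrite E; under eq_fun do rewrite E; exact: L2_cvg_Re_inner.
Qed.

Variable f : nat -> H.
Hypothesis fo : forall i j, i <> j -> inner (f i) (f j) = 0.

Lemma nsq_orth_sum (a b : nat) : nsq (\sum_(a <= i < b) f i) = \sum_(a <= i < b) nsq (f i).
Proof.
have [ab|ba] := leqP b a; first by rewrite !big_geq// nsq0.
elim: b ba => // b IH; rewrite ltnS => ab.
have {}IH : nsq (\sum_(a <= i < b) f i) = \sum_(a <= i < b) nsq (f i).
  by move: ab; rewrite leq_eqVlt => /orP[/eqP ->|/IH//]; rewrite !big_geq// nsq0.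
have z : inner (\sum_(a <= i < b) f i) (f b) = 0.
  rewrite inner_suml big_nat_cond big1// => i; rewrite andbT => /andP[_ ib].
  by apply: fo => /eqP; rewrite ltn_eqF.
by rewrite !big_nat_recr//= nsqD IH z /= mulr0 addr0.
Qed.

(** Distances between partial sums are differences of partial sums of the squared norms, a bounded
    monotone sequence of numbers. *)
Lemma orth_series (K : R) : (forall N, \sum_(0 <= i < N) nsq (f i) <= K) ->
  exists w, L2_cvg (fun N => \sum_(0 <= i < N) f i) w.
Proof.
move=> hK; pose S N := \sum_(0 <= i < N) nsq (f i).
have ndS : nondecreasing_seq S.
  by apply/nondecreasing_seqP => n; rewrite /S big_nat_recr//= lerDl nsq_ge0.
have cS : cvgn S.
  apply: nondecreasing_is_cvgn => //; exists K => _ [n _ <-]; exact: hK.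
have diff a b : (a <= b)%N -> nsq (\sum_(0 <= i < b) f i - \sum_(0 <= i < a) f i) = S b - S a.
  move=> ab; have E1 := @big_cat_nat _ _ _ a 0 b xpredT f (leq0n a) ab.
  have E2 := @big_cat_nat _ _ _ a 0 b xpredT (fun i => nsq (f i)) (leq0n a) ab.
  have h (V : zmodType) (x y : V) : x + y - x = y by rewrite addrAC subrr add0r.
  rewrite E1 h /S E2 h; exact: nsq_orth_sum.
have [|w hw] := L2_complete (u := fun N => \sum_(0 <= i < N) f i).
  move=> e e0; move/cvg_cauchy/cauchy_ballP/(_ e e0) : cS => /=.
  move=> [[A B] /= [[N1 _ hN1] [N2 _ hN2]] hAB].
  exists (maxn N1 N2) => a b; rewrite !geq_max => /andP[a1 a2] /andP[b1 b2].
  have h u v : (N1 <= u)%N -> (N2 <= v)%N -> `|S u - S v| < e.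
    by move=> hu hv; apply: (hAB (S u, S v)); split; [exact: hN1|exact: hN2].
  have [ab|/ltnW ba] := leqP b a.
    by rewrite diff//; apply: le_lt_trans (ler_norm _) (h a b _ _).
  by rewrite nsq_sym diff//; apply: le_lt_trans (ler_norm _) (h b a _ _).
exists w; apply/cvgrPdist_le => e e0; have [N hN] := hw e e0.
exists N => // n /= Nn; rewrite sub0r normrN ger0_norm ?nsq_ge0//; exact: hN.
Qed.

End orthogonal_series.

Section square_summability.
Context (R : realType) d (T : measurableType d) (mu : {measure set T -> \bar R}).

Lemma square_summable_bound (u : nat -> L2 mu) : square_summable u ->
  exists K : R, forall N, \sum_(0 <= i < N) nsq (u i) <= K.
Proof.
move=> hu; have E i : (normL2 (u i) ^+ 2)%:E = (nsq (u i))%:E by rewrite sqr_normL2.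
exists (fine (\sum_(n <oo) (nsq (u n))%:E)%E) => N.
have s0 : (0 <= \sum_(n <oo) (nsq (u n))%:E)%E.
  by apply: nneseries_ge0 => i _ _; rewrite lee_fin nsq_ge0.
have soo : (\sum_(n <oo) (nsq (u n))%:E < +oo)%E.
  by move: hu; rewrite /square_summable; under eq_eseriesr do rewrite E.
rewrite -lee_fin fineK ?ge0_fin_numE// -sumEFin.
by apply: nneseries_lim_ge => i _ _; rewrite lee_fin nsq_ge0.
Qed.

Lemma square_summableP (u : nat -> L2 mu) (K : R) :
  (forall N, \sum_(0 <= i < N) nsq (u i) <= K) -> square_summable u.
Proof.
move=> hK; rewrite /square_summable.
have E i : (normL2 (u i) ^+ 2)%:E = (nsq (u i))%:E by rewrite sqr_normL2.
under eq_eseriesr do rewrite E.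
apply: (@le_lt_trans _ _ K%:E); last exact: ltry.
apply: lime_le.
  by apply: is_cvg_nneseries => i _ _; rewrite lee_fin nsq_ge0.
by apply: nearW => N; rewrite sumEFin lee_fin; exact: hK.
Qed.

End square_summability.

Lemma inner_sumr (R : realType) d (T : measurableType d) (mu : {measure set T -> \bar R})
    I (r : seq I) (F : I -> L2 mu) w :
  inner w (\sum_(i <- r) F i) = \sum_(i <- r) inner w (F i).
Proof. exact: (big_morph (inner w) (fun u v => innerDr u v w) (inner0r w)). Qed.

Section adapted_sequence.
Context (R : realType).
Context d1 (T1 : measurableType d1) (m : {sigma_finite_measure set T1 -> \bar R}).
Context d2 (T2 : measurableType d2) (n : {sigma_finite_measure set T2 -> \bar R}).
Implicit Types (e : nat -> L2 n) (U V : L2 (m \X n)).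

(** Orthonormal up to zeros: a greedy choice may run out of vectors, in particular in finite
    dimension, and zeros then fill the remaining places. *)
Definition onz e := (forall i j, i <> j -> inner (e i) (e j) = 0) /\
  forall i, e i = 0 \/ nsq (e i) = 1.

Local Notation coef e U i := (adj (ins (e i)) U : L2 m).

Lemma adj_ins0 U : adj (ins (0 : L2 n)) U = 0 :> L2 m.
Proof.
have t0 (u : L2 m) : tens u (0 : L2 n) = 0 := lin0 (tens_linr n u).1.
by apply: inner_extr => u; rewrite -(adjP (bounded_ins m _)) /ins t0 inner0l inner0r.
Qed.

Lemma onz_coef_nsq e U i : onz e -> nsq (tens (coef e U i) (e i)) = nsq (coef e U i).
Proof.
by move=> [_ h]; rewrite nsq_tens; have [->|->] := h i; rewrite ?adj_ins0 ?nsq0 ?mul0r ?mulr1.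
Qed.

Lemma onz_orth e U i j : onz e -> i <> j ->
  inner (tens (coef e U i) (e i)) (tens (coef e U j) (e j)) = 0.
Proof. by move=> [h _] ij; rewrite inner_tens h// mulr0. Qed.

Lemma bessel e U N : onz e -> \sum_(0 <= i < N) nsq (coef e U i) <= nsq U.
Proof.
move=> he; pose s := \sum_(0 <= i < N) tens (coef e U i) (e i).
have s2 : nsq s = \sum_(0 <= i < N) nsq (coef e U i).
  rewrite /s (nsq_orth_sum (fun i j => onz_orth U he)).
  by apply: eq_bigr => i _; exact: onz_coef_nsq.
have sU : complex.Re (inner s U) = \sum_(0 <= i < N) nsq (coef e U i).
  rewrite /s inner_suml raddf_sum; apply: eq_bigr => i _.
  rewrite (_ : inner _ U = inner (coef e U i) (coef e U i)); first by rewrite inner_self.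
  exact: (adjP (bounded_ins m (e i))).
have := nsq_ge0 (U - s); rewrite nsq_sym nsqB sU s2; lra.
Qed.

(** The supremum of the coefficients need not be attained, so a factor 2 is conceded and some
    admissible [x] reaches half of it. If the supremum is 0, the zero vector will do. *)
Lemma coef_small U (s : seq (L2 n)) : exists x,
  [/\ x = 0 \/ nsq x = 1, forall y, y \in s -> inner y x = 0 &
    forall x', x' = 0 \/ nsq x' = 1 -> (forall y, y \in s -> inner y x' = 0) ->
      nsq (adj (ins x') U : L2 m) <= 2 * nsq (adj (ins x) U : L2 m)].
Proof.
pose E := [set x : L2 n | (x = 0 \/ nsq x = 1) /\ forall y, y \in s -> inner y x = 0].
pose val (x : L2 n) : R := nsq (adj (ins x) U : L2 m).
pose S := [set val x | x in E].
have E0 : E 0 by split; [left|move=> y _; exact: inner0r].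
have bd x : E x -> val x <= nsq U.
  move=> [hx _]; have := @bessel (fun i => if i is 0%N then x else 0) U 1 _.
  rewrite big_nat1; apply; split; first by move=> [|i] [|j] //= _; rewrite ?inner0l ?inner0r.
  by case=> [|i] //; left.
have hS : has_sup S.
  by split; [exists (val 0), 0|exists (nsq U) => _ [x Ex <-]; exact: bd].
have [s0|s0] := leP (sup S) 0.
  exists 0; split; [by left|by move=> y _; exact: inner0r|].
  move=> x' h1 h2; apply: (@le_trans _ _ (sup S)).
    by apply: sup_upper_bound => //; exists x'.
  by apply: (le_trans s0); rewrite mulr_ge0// nsq_ge0.
have [_ [x [Ex1 Ex2] <-] hx] := @sup_adherent _ S (sup S / 2) (divr_gt0 s0 (ltr0Sn R 1)) hS.
exists x; split => // x' h1 h2; apply: (@le_trans _ _ (sup S)).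
  by apply: sup_upper_bound => //; exists x'.
by rewrite -/(val x); lra.
Qed.

(* Greedy choice: e_k almost maximizes the coefficient of U among the unit
   vectors orthogonal to the previous ones. *)
Lemma adapted_exists U : exists2 e, onz e &
  L2_cvg (fun N => \sum_(0 <= i < N) tens (coef e U i) (e i)) U.
Proof.
have [pick hpick] := choice (coef_small U).
pose ss := fix ss k : seq (L2 n) := if k is k'.+1 then pick (ss k') :: ss k' else [::].
pose e k := pick (ss k).
have mem i k : (i < k)%N -> e i \in ss k.
  elim: k => // k IH; rewrite ltnS leq_eqVlt => /orP[/eqP ->|/IH h] /=.
    by rewrite inE eqxx.
  by rewrite inE h orbT.
have he : onz e.
  split=> [i j ij|i]; last by have [] := hpick (ss i).
  have [ltij|ltji|//] := ltngtP i j.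
    by have [_ h _] := hpick (ss j); apply: h; exact: mem.
  by rewrite innerC; have [_ h _] := hpick (ss i); rewrite h ?conjc0//; exact: mem.
exists e => //.
have [N|w hw] := orth_series (fun i j => onz_orth U he) (K := nsq U).
  rewrite (eq_bigr (fun i => nsq (coef e U i))); first exact: bessel.
  by move=> i _; exact: onz_coef_nsq.
suff E : U = w by rewrite [X in L2_cvg _ X]E; exact: hw.
apply/eqP; rewrite -subr_eq0; apply/eqP.
have small : (fun i => nsq (coef e U i)) @ \oo --> (0 : R).
  apply: cvg_series_cvg_0; apply: nondecreasing_is_cvgn.
    by apply/nondecreasing_seqP => N; rewrite /series /= big_nat_recr//= lerDl nsq_ge0.
  by exists (nsq U) => _ [N _ <-]; exact: bessel.
(* The vectors at which the remainder [U - w] has zero coefficient. They turn out to be total, so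
   that the remainder vanishes. *)
pose E0 := [set x : L2 n | adj (ins x) (U - w) = 0 :> L2 m].
have lw (x : L2 n) (y : L2 m) (c : R[i]) N : (forall k, (N <= k)%N ->
    \sum_(0 <= i < k) inner y (coef e U i) * inner x (e i) = c) -> inner y (adj (ins x) w) = c.
  move=> h; rewrite -(adjP (bounded_ins m x)); apply: (L2_cvg_inner_const hw (N := N)) => k Nk.
  rewrite -(h k Nk) inner_sumr; apply: eq_bigr => i _.
  by rewrite /ins inner_tens.
have bl (x : L2 n) : linear (adj (ins x) : L2 (m \X n) -> L2 m) := (bounded_adj (bounded_ins m x)).1.
have E0e j : E0 (e j).
  rewrite /E0 /= (linB _ _ (bl _)); apply/eqP; rewrite subr_eq0; apply/eqP.
  apply: inner_extr => y; apply/esym/(lw _ _ _ j.+1) => k jk.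
  rewrite (bigD1_seq j) ?mem_index_iota ?iota_uniq//= big1.
    have [_ /(_ j)[->|h]] := he; first by rewrite adj_ins0 !inner0r mul0r addr0.
    by rewrite inner_self h mulr1 addr0.
  by move=> i ij; have [h _] := he; rewrite h ?mulr0// => ji; rewrite ji eqxx in ij.
(* By greediness the coefficient of [U] at such an [x] is, in squared norm, at most twice the one at
   [e N], for every [N]; the latter tend to 0 by Bessel's inequality. *)
have E0o x : nsq x = 1 -> (forall k, inner (e k) x = 0) -> E0 x.
  move=> x1 hx; rewrite /E0 /= (linB _ _ (bl _)).
  have -> : adj (ins x) w = 0 :> L2 m.
    apply: inner_extr => y; rewrite inner0r; apply: (lw _ _ _ 0%N) => k _.
    by rewrite big1// => i _; rewrite (innerC (e i) x) hx conjc0 mulr0.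
  rewrite subr0; apply: nsq_eq0; apply/eqP; rewrite eq_le nsq_ge0 andbT.
  apply/ler_addgt0Pl => eps eps0; rewrite addr0.
  move/cvgrPdist_le : small => /(_ (eps / 2)) [|N _ hN]; first by rewrite divr_gt0.
  have := hN N (leqnn N); rewrite /= sub0r normrN ger0_norm ?nsq_ge0// => h.
  have [_ _ hmax] := hpick (ss N).
  apply: le_trans (hmax x (or_intror x1) _) _; last by rewrite -/(e N); lra.
  move=> y ys; have [i ->] : exists i, y = e i.
    elim: (N) ys => //= k IH; rewrite inE => /orP[/eqP ->|/IH//]; by exists k.
  exact: hx.
have tE0 : total_in E0.
  move=> x hx; have ex k : inner (e k) x = 0 by exact: hx.
  have [x0|x0] := eqVneq (nsq x) 0; first exact: nsq_eq0.
  have xp : 0 < nsq x by rewrite lt_neqAle eq_sym x0 nsq_ge0.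
  pose c : R[i] := ((Num.sqrt (nsq x))^-1)%:C.
  have c1 : nsq (c *: x) = 1.
    by rewrite nsqZ sqabs_real exprVn sqr_sqrtr ?nsq_ge0// mulVf.
  have := hx (c *: x) (E0o _ c1 _); rewrite innerZl inner_self => h.
  have ce k : inner (e k) (c *: x) = 0 by rewrite innerZr ex mulr0.
  have /eqP := h ce; rewrite mulf_eq0 => /orP[|].
    rewrite eq_complex /= eqxx andbT invr_eq0 sqrtr_eq0 leNgt xp//.
  by rewrite eq_complex /= eqxx andbT (negbTE x0).
apply: (total_tens2 (m1 := m) (E1 := setT) _ tE0) => [y hy|_ [y _ [x Ex <-]]].
  by apply: nsq_eq0; rewrite /nsq hy.
by rewrite (adjP (bounded_ins m x)) Ex inner0r.
Qed.

End adapted_sequence.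

Section counting_nat.
Context (R : realType).

(** A copy of the counting measure carrying a sigma-finite structure, so that l^2(N) is available as
    a tensor factor. *)
Definition count_nat : set nat -> \bar R := @counting nat R.

HB.instance Definition _ := Measure.copy count_nat
  (@counting nat R : {measure set nat -> \bar R}).
HB.instance Definition _ := Measure_isSigmaFinite.Build _ _ _ count_nat (sigma_finite_counting R).

End counting_nat.

Section normality.
Context (R : realType).
Local Notation Re := (@complex.Re R).
Local Notation Im := (@complex.Im R).

Lemma csum_cvg (z : nat -> R[i]) (l : R[i]) :
  (fun N => Re (\sum_(0 <= i < N) z i)) @ \oo --> Re l ->
  (fun N => Im (\sum_(0 <= i < N) z i)) @ \oo --> Im l -> csum z = l.
Proof.
move=> hr hi; rewrite /csum.
have -> : series (fun n => Re (z n)) = (fun N => Re (\sum_(0 <= i < N) z i)).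
  by apply/funext => N; rewrite /series /= raddf_sum.
have -> : series (fun n => Im (z n)) = (fun N => Im (\sum_(0 <= i < N) z i)).
  by apply/funext => N; rewrite /series /= raddf_sum.
by rewrite (cvg_lim _ hr)// (cvg_lim _ hi)//; case: l {hr hi}.
Qed.

Lemma orthonormal_nat : exists eps : nat -> L2 (count_nat R),
  (forall i j, i <> j -> inner (eps i) (eps j) = 0) /\ forall i, nsq (eps i) = 1.
Proof.
have c1 i : count_nat R [set i] = 1%E.
  by rewrite /count_nat /counting asboolT//= fset_set1 finmap.cardfs1.
have s i : square_integrable (count_nat R) (fun x => (\1_[set i] x : R)%:C).
  by apply: sqint_indic => //; rewrite [X in (X < _)%E](c1 i) ltry.
exists (fun i => toL2 (count_nat R) (fun x => (\1_[set i] x)%:C)); split.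
  move=> i j ij; rewrite (inner_ae (s i).1 (s j).1 (toL2E (s i)) (toL2E (s j))).
  rewrite [X in cintegral _ X](_ : _ = fun=> 0); first by rewrite /cintegral /= /Rintegral integral0.
  apply/funext => x; rewrite !indicE; have [xi|] := boolP (x \in [set i]); last by rewrite mul0r.
  have [xj|] := boolP (x \in [set j]); last by rewrite conjc0 mulr0.
  by move: xi xj; rewrite !inE /= => -> /ij.
move=> i; apply/eqP; rewrite -eqe -sqabs_integral; apply/eqP.
rewrite (ge0_ae_eq_integral (g := fun x => (\1_[set i] x : R)%:E))//.
- by rewrite integral_indic// setIT; exact: c1.
- by move=> x _; rewrite lee_fin sqabs_ge0.
- apply: filterS (toL2E (s i)) => x e _; rewrite e sqabs_real indicE.
  by case: (_ \in _); rewrite ?expr1n ?expr0n.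
Qed.

Section amplification_series.
Context d1 (T1 : measurableType d1) (m : {sigma_finite_measure set T1 -> \bar R}).
Context d2 (T2 : measurableType d2) (n : {sigma_finite_measure set T2 -> \bar R}).

(** With U the sum of the u_i (x) e_i, the functional <(b (x) 1) U, V> unfolds into the series of
    the <b u_i, V_i>, where V_i is the coefficient of V at e_i. *)
Lemma csum_ampl (u : nat -> L2 m) (e : nat -> L2 n) (U V : L2 (m \X n)) (b : L2 m -> L2 m) :
  bounded_op b -> L2_cvg (fun N => \sum_(0 <= i < N) tens (u i) (e i)) U ->
  csum (fun i => inner (b (u i)) (adj (ins (e i)) V)) = inner (ampl n b U) V.
Proof.
move=> bb hU; have bB := bounded_ampl n bb.
have E N : \sum_(0 <= i < N) inner (b (u i)) (adj (ins (e i)) V) =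
    inner (\sum_(0 <= i < N) tens (u i) (e i)) (adj (ampl n b) V).
  rewrite inner_suml; apply: eq_bigr => i _.
  by rewrite -(adjP bB) (amplE _ _ bb) -(adjP (bounded_ins m (e i))).
rewrite (adjP bB); apply: csum_cvg.
  by under eq_fun do rewrite E; exact: L2_cvg_inner_Re.
by under eq_fun do rewrite E; exact: L2_cvg_inner_Im.
Qed.

Lemma assemble (eps : nat -> L2 n) (u : nat -> L2 m) :
  (forall i j, i <> j -> inner (eps i) (eps j) = 0) -> (forall i, nsq (eps i) = 1) ->
  square_summable u -> exists U : L2 (m \X n),
    L2_cvg (fun N => \sum_(0 <= i < N) tens (u i) (eps i)) U /\ forall i, adj (ins (eps i)) U = u i.
Proof.
move=> o1 o2 /square_summable_bound[K hK].
have [| |U hU] := @orth_series _ _ _ (m \X n) (fun i => tens (u i) (eps i)) _ K.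
- by move=> i j ij; rewrite inner_tens o1// mulr0.
- move=> N; rewrite (eq_bigr (fun i => nsq (u i))); first exact: hK.
  by move=> i _; rewrite nsq_tens o2 mulr1.
exists U; split => // j; apply: inner_extr => y; rewrite -(adjP (bounded_ins m (eps j))).
apply: (L2_cvg_inner_const hU (N := j.+1)) => k jk.
rewrite inner_sumr (bigD1_seq j) ?mem_index_iota ?iota_uniq//= big1.
  by rewrite addr0 /ins inner_tens inner_self o2 mulr1.
by move=> i ij; rewrite /ins inner_tens o1 ?mulr0// => ji; rewrite ji eqxx in ij.
Qed.

End amplification_series.

Section amplification_normal.
Context d1 (T1 : measurableType d1) (m : {sigma_finite_measure set T1 -> \bar R}).
Context d2 (T2 : measurableType d2) (n : {sigma_finite_measure set T2 -> \bar R}).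

(* The sequences u and v are assembled into single vectors of a bigger space,
   on which an adapted orthonormal sequence diagonalizes the functional. *)
Lemma ampl_normal (M : set (L2 m -> L2 m)) : M `<=` bounded_op (nu := m) -> normal_map M (ampl n).
Proof.
move=> bM u v su sv; have [eps [eps1 eps2]] := orthonormal_nat.
pose c : {sigma_finite_measure set nat -> \bar R} := count_nat R.
have [U [hU1 hU2]] := assemble (n := c) eps1 eps2 su.
have [V [hV1 hV2]] := assemble (n := c) eps1 eps2 sv.
have hA := uni_assoc m n c.
pose A' : L2 (m \X n \X c) -> L2 (m \X (n \X c)) := comp_op (@unassoc_pair T1 T2 nat).
(* Only the first vector has to be expanded along the adapted sequence; the second one enters
   through its coefficients, which are square summable by Bessel's inequality. *)
have [e he hU'] := adapted_exists (A' U).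
exists (fun i => adj (ins (e i)) (A' U)), (fun i => adj (ins (e i)) (A' V)); split.
- by apply: square_summableP => N; exact: bessel.
- by apply: square_summableP => N; exact: bessel.
move=> a /bM ba; rewrite (csum_ampl (A' V) ba hU').
have bn := bounded_ampl n ba.
have -> : (fun i => inner (ampl n a (u i)) (v i)) =
    (fun i => inner (ampl n a (u i)) (adj (ins (eps i)) V)).
  by apply/funext => i; rewrite hV2.
rewrite (csum_ampl V bn hU1).
have bi := bounded_id n; have bc := bounded_id c.
have E := Ad_assoc_tens ba bi bc.
have tid : tens_op (@id (L2 n)) (@id (L2 c)) = id by exact: tens_op_id.
have -> : ampl c (ampl n a) U = Ad (comp_op (@assoc_pair T1 T2 nat)) (ampl (n \X c) a) U.
  by rewrite /ampl -tid E.
by rewrite (AdE hA) /=; have [h _ _] := hA; rewrite h.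
Qed.

End amplification_normal.

Lemma normal_Ad d (T : measurableType d) (mu : {measure set T -> \bar R})
    d' (U : measurableType d') (nu : {measure set U -> \bar R})
    d'' (W : measurableType d'') (xi : {measure set W -> \bar R})
    (M : set (L2 mu -> L2 mu)) phi (V : L2 nu -> L2 xi) V' :
  uni V V' -> normal_map (nu := nu) M phi -> normal_map (nu := xi) M (Ad V \o phi).
Proof.
move=> hV hphi u v su sv; have [h K K'] := hV; have [h' _ _] := uni_sym hV.
have s w : square_summable w -> square_summable (V' \o w).
  have E i : (normL2 ((V' \o w) i) ^+ 2)%:E = (normL2 (w i) ^+ 2)%:E.
    by rewrite !sqr_normL2 /= /nsq h' K'.
  by rewrite /square_summable; under [X in _ -> (X < _)%E]eq_eseriesr do rewrite E.
have [u1 [v1 [su1 sv1 E]]] := hphi _ _ (s _ su) (s _ sv).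
exists u1, v1; split => // a Ma; rewrite -(E a Ma); congr csum; apply/funext => i.
by rewrite [in LHS]/= (AdE hV) /= h.
Qed.

End normality.

(** * The multiplicative unitary *)

Section density.
Context (R : realType) d1 (T1 : measurableType d1) d2 (T2 : measurableType d2).
Context (m : {measure set T1 -> \bar R}) (n : {measure set T2 -> \bar R}).
Variables (v : T2 -> T1) (v' : T1 -> T2) (hv : miso m n v v').
Variable E : nat -> set T2.
Hypotheses (mE : forall k, measurable (E k)) (Eoo : forall k, (n (E k) < +oo)%E)
  (TE : forall y, exists k, E k y).

(** The constant 1 is a density, since [v] preserves the measures. The selected density has the same
    integrals, which determine it on each set of a countable cover by sets of finite measure. *)
Lemma density_along_ae1 : measurable_fun setT (density_along m n v) /\
  {ae n, forall y, density_along m n v y = 1}.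
Proof.
have [hm mv' K] := hv; have [mv hvm] := hm.
set S := [set D : T2 -> R | [/\ measurable_fun [set: T2] D, forall y, 0 <= D y
    & forall S, measurable S -> m S = (\int[n]_(y in v @^-1` S) (D y)%:E)%E]].
have [mD D0 hD] : S (density_along m n v).
  apply: xgetPex; exists (fun=> 1); split => // A mA.
  have mvA : measurable (v @^-1` A) by rewrite -[_ @^-1` _]setTI; exact: mv.
  by rewrite integral_cst// mul1e; exact: hvm.
split => //; set D := density_along m n v in mD D0 hD *.
have mDE : measurable_fun setT (EFin \o D) by exact/measurable_EFinP.
have key A : measurable A -> (\int[n]_(y in A) (D y)%:E = n A)%E.
  move=> mA; have [mv2 hv2] := miso_mpres hv.
  have mS : measurable (v' @^-1` A) by rewrite -[_ @^-1` _]setTI; exact: mv2.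
  have mvS : measurable (v @^-1` (v' @^-1` A)) by rewrite -[_ @^-1` _]setTI; exact: mv.
  have mR (B : set T2) : measurable B -> measurable_fun setT ((EFin \o D) \_ B).
    by move=> mB; apply/(measurable_restrictT _ mB); exact: measurable_funS mDE.
  have R0 (B : set T2) y : (0 <= ((EFin \o D) \_ B) y)%E.
    by rewrite patchE; case: ifP => // _; rewrite lee_fin.
  rewrite (hv2 _ mA) (hD _ mS) integral_mkcond [in RHS]integral_mkcond.
  apply: (ge0_ae_eq_integral measurableT (mR _ mA) (mR _ mvS)) => //.
  apply: filterS (K _ (cmeasurable_indic R mA)) => y h _.
  rewrite !patchE; have -> : (y \in v @^-1` (v' @^-1` A)) = (v' (v y) \in A).
    by apply/idP/idP; rewrite !inE.
  by case: h; rewrite !indicE; do 2 case: (_ \in A) => //=; move/eqP; rewrite ?oner_eq0// eq_sym oner_eq0.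
have loc k : {ae n, forall y, E k y -> D y = 1}.
  have mDk (B : set T2) : measurable_fun B (EFin \o D) by exact: measurable_funS mDE.
  have iD : n.-integrable (E k) (EFin \o D).
    apply/integrableP; split => //.
    rewrite (eq_integral (fun y => (D y)%:E)); first by rewrite key.
    by move=> y _; rewrite /= ger0_norm.
  have := @integral_ae_eq _ _ _ n (E k) (mE k) (cst 1%E) _ iD (measurable_cst _).
  have h (B : set T2) : B `<=` E k -> measurable B ->
      (\int[n]_(y in B) (EFin \o D) y = \int[n]_(y in B) cst 1%E y)%E.
    by move=> _ mB; rewrite integral_cst// mul1e; exact: key.
  move=> /(_ h); apply: filterS => y e Ey; have [] := e Ey.
  by [].
apply: filterS (ae_foralln loc) => y e; have [k] := TE y.
exact: e.
Qed.

End density.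

(** The fibre measures are not declared sigma-finite; the map [k] to a sigma-finite space provides
    the cover by sets of finite measure. *)
Lemma toL2_density (R : realType) d1 (T1 : measurableType d1) d2 (T2 : measurableType d2)
    d3 (T3 : measurableType d3) (m : {measure set T1 -> \bar R}) (n : {measure set T2 -> \bar R})
    (l : {sigma_finite_measure set T3 -> \bar R}) (v : T2 -> T1) v' (k : T2 -> T3) (xi : L2 m) :
  miso m n v v' -> mpres n l k ->
  toL2 n (fun w => (Num.sqrt (density_along m n v w))%:C * xi (v w)) = comp_op v xi.
Proof.
move=> hv hk; have /sigma_finiteP[F [TF _ Foo]] := sigma_finiteT l.
pose E j := k @^-1` F j.
have mE j : measurable (E j).
  by rewrite /E -[X in measurable X]setTI; apply: hk.1 => //; have [] := Foo j.
have Eoo j : (n (E j) < +oo)%E by have [mF hF] := Foo j; rewrite -(hk.2 _ mF).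
have TE y : exists j, E j y.
  have : [set: T3] (k y) by [].
  by rewrite TF => -[j _ h]; exists j.
have [mD D1] := density_along_ae1 hv mE Eoo TE; have [hm _ _] := hv.
have s := square_integrable_mpres hm (L2_sqint xi).
have e : {ae n, forall w, (xi \o v) w = (Num.sqrt (density_along m n v w))%:C * xi (v w)}.
  by apply: filterS D1 => w h; rewrite h sqrtr1 mul1r.
apply/esym/(toL2_ae s _ e); apply: (square_integrable_ae _ s e).
apply: cmeasurableM; last exact: s.1.
apply: cmeasurable_real.
exact: (measurableT_comp (continuous_measurable_fun (@sqrt_continuous R)) mD).
Qed.

Section multiplicative_unitary.
Context (R : realType) (X1 X2 : ptopologicalType).
Local Notation Y1 := (borel X1).
Local Notation Y2 := (borel X2).
Variable n1 : {sigma_finite_measure set Y1 -> \bar R}.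
Variable n2 : {sigma_finite_measure set Y2 -> \bar R}.
Local Notation X := (Y1 * Y2)%type.
Local Notation G := (X * X)%type.
Local Notation nu := (n1 \X n2).
Local Notation mu_sm := (fibre_mes (dis_s n1 n2) (dis_m n1 n2)).
Local Notation mu_mr := (fibre_mes (dis_m n1 n2) (dis_r n1 n2)).

(** Inverts [W_map] on pairs with m(g) = r(g'), which carry the measure. *)
Definition W_map' (w : G * G) : G * G :=
  ((w.1.1, (w.2.1.1, w.1.2.2)), ((w.2.1.1, w.1.1.2), w.2.2)).

Lemma miso_W : miso mu_sm mu_mr (@W_map X1 X2) W_map'.
Proof.
have hmr : mpres (nu \X nu \X nu) mu_mr (@fibre_par _ _ _ _ _ _ _ _ _ _ _ _ (dis_m n1 n2) (dis_r n1 n2)).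
  exact (mpres_fpar (dis_m n1 n2) (dis_r n1 n2)).
have hsm : mpres (nu \X nu \X nu) mu_sm (@fibre_par _ _ _ _ _ _ _ _ _ _ _ _ (dis_s n1 n2) (dis_m n1 n2)).
  exact (mpres_fpar (dis_s n1 n2) (dis_m n1 n2)).
apply: (miso_base hmr).
- apply: (mpres_factor hmr).
    by rewrite /W_map /gmul /gp1 /gp2 /ginv /=; meas_coord.
  (* Reads the parameters of the image pair, for which s(g) = m(g'), off those of a pair with m(g) =
     r(g'). Only the six coordinates are permuted. *)
  pose pm (w : X * X * X) : X * X * X := ((w.2.1, w.1.2.2), (w.1.2.1, w.1.1.2), (w.1.1.1, w.2.2)).
  have hpm : mpres (nu \X nu \X nu) (nu \X nu \X nu) pm.
    have e12 := mpres_map (dis_m_subproof n1 n2) (mpres_id nu).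
    have e13 := mpres_comp (mpres_swap23 nu nu nu) (mpres_comp e12 (mpres_swap23 nu nu nu)).
    exact: mpres_comp e13 (mpres_comp (mpres_map (mpres_swap nu nu) (mpres_id nu)) e12).
  rewrite (_ : _ \o _ = @fibre_par _ _ _ _ _ _ _ _ _ _ _ _ (dis_s n1 n2) (dis_m n1 n2) \o pm).
    exact: mpres_comp hsm hpm.
  by apply/funext => -[[[z1 z2] [t1 t2]] [s1' s2']].
- by rewrite /W_map'; meas_coord.
- by move=> [[[z1 z2] [t1 t2]] [s1' s2']].
Qed.
End multiplicative_unitary.

Section tensor_coproduct.
Context (R : realType) (X1 X2 : ptopologicalType).
Variable n1 : {sigma_finite_measure set (borel X1) -> \bar R}.
Variable n2 : {sigma_finite_measure set (borel X2) -> \bar R}.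
Hypothesis RE : R_X1 n1 = [set tens_op id b | b in all_ops n1].
Variables (e0 : L2 n1) (e1 : nsq e0 = 1).
Local Notation N := (vN_tens (Linf_ops (n2 \X n2)) (R_X1 n1)).

Lemma Gamma_tensE x : N x -> Gamma_tens n1 n2 x = coprod x.
Proof.
move=> Nx; have bN : N `<=` bounded_op (nu := n2 \X n2 \X (n1 \X n1)) by move=> ? /vN_gen_bounded.
have h := coprod_star_hom bN; have hf := coprod_formulaP (n2 := n2) RE.
have [h1 _ f1] : [set phi | [/\ star_hom N phi, normal_map N phi & coprod_formula phi]] (Gamma_tens n1 n2).
  apply: xgetPex; exists (@coprod R X1 X2 n1 n2); split => //.
  exact: (normal_Ad (uni_miso (miso_coprod n1 n2)) (ampl_normal (n := n2 \X n1) bN)).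
exact: (coprod_uniq RE e1 h1 h f1 hf Nx).
Qed.

End tensor_coproduct.

Lemma adjoint_comp_miso (R : realType) d (T : measurableType d) (mu : {measure set T -> \bar R})
    d' (U : measurableType d') (nu : {measure set U -> \bar R}) (c : U -> T) c' (r : L2 nu -> L2 nu) :
  miso mu nu c c' ->
  adj (@comp_op _ _ _ mu _ _ nu c) \o r \o comp_op c = Ad (@comp_op _ _ _ nu _ _ mu c') r.
Proof.
move=> h; have hu := uni_miso h.
by rewrite (uni_adj hu) (AdE (uni_sym hu)).
Qed.

Section multiplicative_unitary_op.
Context (R : realType) (X1 X2 : ptopologicalType).
Local Notation Y1 := (borel X1).
Local Notation Y2 := (borel X2).
Variable n1 : {sigma_finite_measure set Y1 -> \bar R}.
Variable n2 : {sigma_finite_measure set Y2 -> \bar R}.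
Local Notation X := (Y1 * Y2)%type.
Local Notation G := (X * X)%type.
Local Notation nu := (n1 \X n2).
Local Notation mu := (nu \X nu).
Local Notation mu_mr := (fibre_mes (dis_m n1 n2) (dis_r n1 n2)).

Definition kA_m (g : G) : X := (g.1.1, g.2.2).

Lemma measurable_kA_m : measurable_fun setT kA_m.
Proof. by rewrite /kA_m; meas_coord. Qed.

Lemma kA_mK z t : kA_m (dis_par (dis_m n1 n2) (z, t)) = t.
Proof. by case: t. Qed.

Lemma WE : @W R X1 X2 n1 n2 = comp_op (@W_map X1 X2).
Proof.
have hk : mpres mu_mr (mu \X nu) (kap (DA := dis_m n1 n2) kA_m).
  exact (mpres_kap (DA := dis_m n1 n2) (dis_r n1 n2) measurable_kA_m kA_mK).
by apply/funext => xi; exact (toL2_density xi (miso_W n1 n2) hk).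
Qed.

Lemma GammaE x : Gamma n1 n2 x =
  Ad (comp_op (@W_map' X1 X2)) (rtens_op (dis_m n1 n2) (dis_r n1 n2) (dis_m n1 n2) (dis_r n1 n2) id (Ad (@ident R X1 X2 n1 n2) x)).
Proof.
exact (etrans (congr1 (fun w => adj w \o _ \o w) WE) (adjoint_comp_miso _ (miso_W n1 n2))).
Qed.

End multiplicative_unitary_op.

(** * The transported coproduct *)

Section relative_tensor_maps.
Context (R : realType) d0 (Z : measurableType d0).
Context (zeta : {sigma_finite_measure set Z -> \bar R}).
Context dA (A : measurableType dA) (mA : {measure set A -> \bar R}) (p : A -> Z).
Context dB (B : measurableType dB) (mB : {sigma_finite_measure set B -> \bar R}) (q : B -> Z).
Context dA' (A' : measurableType dA') (mA' : {measure set A' -> \bar R}) (p' : A' -> Z).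
Context dB' (B' : measurableType dB') (mB' : {sigma_finite_measure set B' -> \bar R}) (q' : B' -> Z).
Context (DA : disintegration mA zeta p) (DB : disintegration mB zeta q).
Context (DA' : disintegration mA' zeta p') (DB' : disintegration mB' zeta q').
Variables (kA : A -> dis_type DA) (kA' : A' -> dis_type DA').
Hypotheses (mp : measurable_fun setT p) (mq : measurable_fun setT q)
  (mk : measurable_fun setT kA) (kAK : forall z t, kA (dis_par DA (z, t)) = t).
Hypotheses (mk' : measurable_fun setT kA') (kAK' : forall z t, kA' (dis_par DA' (z, t)) = t).
Variables (cA : A' -> A) (cB : B' -> B).
Hypotheses (hA : mpres mA' mA cA) (hB : mpres mB' mB cB).
Hypothesis hAB : mpres (fibre_mes DA' DB') (fibre_mes DA DB) (map_pair cA cB).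

Lemma rtens_comp_op (u : L2 mA) (v : L2 mB) : zeta_bounded DA u ->
  comp_op (map_pair cA cB) (rtens DA DB u v) = rtens DA' DB' (comp_op cA u) (comp_op cB v).
Proof.
move=> ub; have [sr _] := sqint_rtens DB mq mk kAK ub (L2_sqint v).
rewrite (comp_op_toL2 hAB sr).
have s := square_integrable_mpres hAB sr.
have e : {ae fibre_mes DA' DB', forall w, ((fun w => u w.1 * v w.2) \o map_pair cA cB) w =
    (comp_op (nu := mA') cA u) w.1 * (comp_op (nu := mB') cB v) w.2}.
  have hk := mpres_kap (DA := DA') DB' mk' kAK'.
  apply: filterS2 (ae_fib_fst DA' DB' (comp_opE hA u))
    (ae_mpres hk (ae_fst (dis_mes DA') (comp_opE hB v))) => w e1 e2.
  by rewrite e1 e2.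
apply: toL2_ae => //; apply: square_integrable_ae s e.
by apply: cmeasurableM; [exact: (cmeasurable_comp measurable_fst (L2_meas _))
  |exact: (cmeasurable_comp measurable_snd (L2_meas _))].
Qed.

Lemma rtens_op_comp_op :
  rtens_op DA DB DA' DB' (comp_op cA) (comp_op cB) = comp_op (map_pair cA cB).
Proof.
have bc : bounded_op (comp_op (mu := fibre_mes DA DB) (nu := fibre_mes DA' DB') (map_pair cA cB)).
  exact: bounded_comp_op.
have [bc0 hc0] : [set c | bounded_op c /\ forall u v, zeta_bounded DA u ->
    c (rtens DA DB u v) = rtens DA' DB' (comp_op cA u) (comp_op cB v)]
    (rtens_op DA DB DA' DB' (comp_op cA) (comp_op cB)).
  by apply: xgetPex; exists (comp_op (map_pair cA cB)); split => //; exact: rtens_comp_op.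
apply: (bounded_eq_total bc0 bc (total_rtens (DB := DB) mp mk kAK)) => _ [u ub [v _ <-]].
by rewrite hc0// rtens_comp_op.
Qed.

End relative_tensor_maps.

Section amplification_map.
Context (R : realType).
Context d1 (T : measurableType d1) (m : {sigma_finite_measure set T -> \bar R}).
Context d2 (S : measurableType d2) (n : {sigma_finite_measure set S -> \bar R}).
Context d3 (S' : measurableType d3) (n' : {sigma_finite_measure set S' -> \bar R}).

Lemma miso_mapr (s : S' -> S) s' : mpres n' n s -> measurable_fun setT s' -> cancel s s' ->
  miso (m \X n) (m \X n') (map_pair id s) (map_pair id s').
Proof. by move=> hs ms' K; apply: miso_map => //; exact: mpres_id. Qed.

Lemma Ad_mapr_ampl (s : S' -> S) s' x : mpres n' n s -> measurable_fun setT s' -> cancel s s' ->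
  bounded_op x ->
  Ad (@comp_op _ _ _ (m \X n) _ _ (m \X n') (map_pair id s)) (ampl n x) = ampl n' x.
Proof.
move=> hs ms' K bx; have hu := uni_miso (miso_mapr hs ms' K).
have h0 := miso_cancel hs ms' K; have hs' := miso_mpres h0; have hi := mpres_id m.
apply: (ampl_uniq bx); first by apply: (Ad_bounded hu); exact: bounded_ampl.
move=> u v; rewrite (AdE hu) /= (comp_map_tens _ _ hi hs') comp_op_id (amplE _ _ bx).
by rewrite (comp_map_tens _ _ hi hs) comp_op_id (miso_cancel_op v h0).
Qed.

End amplification_map.

Section spatial_maps.
Context (R : realType) (X1 X2 : ptopologicalType).
Local Notation Y1 := (borel X1).
Local Notation Y2 := (borel X2).
Variable n1 : {sigma_finite_measure set Y1 -> \bar R}.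
Variable n2 : {sigma_finite_measure set Y2 -> \bar R}.
Local Notation X := (Y1 * Y2)%type.
Local Notation G := (X * X)%type.
Local Notation G1 := (Y1 * Y1 * Y2)%type.
Local Notation G2 := (Y2 * Y2 * Y1)%type.
Local Notation H := (Y2 * Y2 * (Y1 * Y1))%type.
Local Notation nu := (n1 \X n2).
Local Notation mu := (nu \X nu).
Local Notation mH := (n2 \X n2 \X (n1 \X n1)).
Local Notation fibG := (fibre_mes (dis_s2 n1 n2) (dis_r1 n1 n2)).
Local Notation mu_sm := (fibre_mes (dis_s n1 n2) (dis_m n1 n2)).
Local Notation fib_th := (fibre_mes (dis_ths n1 n2) (dis_thm n1 n2)).

Definition ident_map (g : G) : G2 * G1 := (co2 g, (g.1.1, g.2.1, g.2.2)).
Definition ident_map' (w : G2 * G1) : G := ((w.1.2, w.1.1.1), (w.2.1.2, w.1.1.2)).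

Lemma miso_ident : miso fibG mu ident_map ident_map'.
Proof.
apply: miso_cancel; last by case=> [[? ?] []].
- pose pm (g : G) : X * Y2 * Y1 := ((g.1.1, g.2.2), g.1.2, g.2.1).
  have hpm : mpres mu (nu \X n2 \X n1) pm.
    exact: mpres_comp (mpres_map (mpres_swap23 n1 n2 n2) (mpres_id n1))
      (mpres_comp (mpres_unassoc nu n2 n1) (mpres_map (mpres_id nu) (mpres_swap n1 n2))).
  have hf : mpres (nu \X n2 \X n1) fibG
      (@fibre_par _ _ _ _ _ _ _ _ _ _ _ _ (dis_s2 n1 n2) (dis_r1 n1 n2)).
    exact (mpres_fpar (dis_s2 n1 n2) (dis_r1 n1 n2)).
  rewrite (_ : ident_map = @fibre_par _ _ _ _ _ _ _ _ _ _ _ _ (dis_s2 n1 n2) (dis_r1 n1 n2) \o pm).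
    exact: mpres_comp hf hpm.
  by apply/funext => -[[x1 x2] [y1 y2]].
- by rewrite /ident_map'; meas_coord.
Qed.

Definition toG' (g : G) : H := ((g.1.2, g.2.2), (g.1.1, g.2.1)).

Lemma miso_toG : miso mu mH (@toG X1 X2) toG'.
Proof. exact: miso_comp (miso_sym miso_ident) (miso_V n1 n2). Qed.

Lemma ThetaE : @Theta R X1 X2 n1 n2 = comp_op (@toG X1 X2).
Proof.
have h := uni_adj (uni_miso miso_ident).
rewrite /Theta SigmaE /ident -[fun g : G => _]/ident_map h; apply/funext => u.
have [hV _ _] := miso_V n1 n2; exact: (comp_op_comp u (miso_mpres miso_ident) hV).
Qed.

Lemma Ad_ident_theta_inv x :
  Ad (@ident R X1 X2 n1 n2) (theta_inv n1 n2 x) = Ad (comp_op toG') x.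
Proof.
rewrite /theta_inv (uni_adj (uni_V n1 n2)).
exact: (Ad_comp_op x (miso_sym (miso_V n1 n2)) miso_ident).
Qed.

(** The two fibre products share their parameter space, and applying [toG] to both components
    carries one parametrization to the other. *)
Lemma mpres_toG2 : mpres fib_th mu_sm (map_pair (@toG X1 X2) (@toG X1 X2)).
Proof.
have hth : mpres (nu \X nu \X nu) fib_th (@fibre_par _ _ _ _ _ _ _ _ _ _ _ _ (dis_ths n1 n2) (dis_thm n1 n2)).
  exact (mpres_fpar (dis_ths n1 n2) (dis_thm n1 n2)).
have hsm : mpres (nu \X nu \X nu) mu_sm (@fibre_par _ _ _ _ _ _ _ _ _ _ _ _ (dis_s n1 n2) (dis_m n1 n2)).
  exact (mpres_fpar (dis_s n1 n2) (dis_m n1 n2)).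
have [[mt _] _ _] := miso_toG.
apply: (mpres_factor hth).
  by apply/measurable_fun_pair; exact: measurableT_comp.
rewrite (_ : _ \o _ = @fibre_par _ _ _ _ _ _ _ _ _ _ _ _ (dis_s n1 n2) (dis_m n1 n2)) //.
by apply/funext => -[[[z1 z2] [t1 t2]] [s1' s2']].
Qed.

Lemma miso_toG2 : miso mu_sm fib_th (map_pair (@toG X1 X2) (@toG X1 X2)) (map_pair toG' toG').
Proof.
apply: miso_cancel; first exact: mpres_toG2.
- by have [_ mt _] := miso_toG; apply/measurable_fun_pair; exact: measurableT_comp.
- by case=> [[[? ?] [? ?]] [[? ?] [? ?]]].
Qed.

Lemma Theta2E : rtens_op (dis_s n1 n2) (dis_m n1 n2) (dis_ths n1 n2) (dis_thm n1 n2)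
    (@Theta R X1 X2 n1 n2) (@Theta R X1 X2 n1 n2) =
  comp_op (map_pair (@toG X1 X2) (@toG X1 X2)).
Proof.
have [ht _ _] := miso_toG.
have mp : measurable_fun setT (@gs X1 X2) by exact: measurable_snd.
have mq : measurable_fun setT (@gm X1 X2) by rewrite /gm /gs /gp1 /=; meas_coord.
have mk : measurable_fun setT (fun g : G => g.1) by exact: measurable_fst.
have mk' : measurable_fun setT (fun w : H => (w.2.1, w.1.1)) by meas_coord.
rewrite ThetaE.
have kAK z t : (fun g : G => g.1) (dis_par (dis_s n1 n2) (z, t)) = t by [].
have kAK' z t : (fun w : H => (w.2.1, w.1.1)) (dis_par (dis_ths n1 n2) (z, t)) = t by case: t.
exact (rtens_op_comp_op (DA := dis_s n1 n2) (DB := dis_m n1 n2) (DA' := dis_ths n1 n2)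
  (DB' := dis_thm n1 n2) mp mq mk kAK mk' kAK' ht ht mpres_toG2).
Qed.

End spatial_maps.

Lemma eq_mpres (R : realType) d1 (T1 : measurableType d1) d2 (T2 : measurableType d2)
    (m1 : set T1 -> \bar R) (m2 : set T2 -> \bar R) (f g : T1 -> T2) :
  mpres m1 m2 f -> f =1 g -> mpres m1 m2 g.
Proof. by move=> hf /funext <-. Qed.

Section coproduct_transfer.
Context (R : realType) (X1 X2 : ptopologicalType).
Local Notation Y1 := (borel X1).
Local Notation Y2 := (borel X2).
Variable n1 : {sigma_finite_measure set Y1 -> \bar R}.
Variable n2 : {sigma_finite_measure set Y2 -> \bar R}.
Local Notation H := (Y2 * Y2 * (Y1 * Y1))%type.
Local Notation nu := (n1 \X n2).
Local Notation fib_th := (fibre_mes (dis_ths n1 n2) (dis_thm n1 n2)).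
Local Notation K := (Y2 * Y2 * Y1 * Y2 * Y1 * Y1)%type.
Local Notation K' := (Y2 * Y2 * Y2 * (Y1 * Y1 * Y1))%type.
Local Notation mK := (n2 \X n2 \X n1 \X n2 \X n1 \X n1).
Local Notation mK' := (n2 \X n2 \X n2 \X (n1 \X n1 \X n1)).

Definition tau_map (k : K) : K' :=
  ((k.1.1.1.1.1, k.1.1.1.1.2, k.1.1.2), (k.1.1.1.2, k.1.2, k.2)).
Definition tau_map' (k : K') : K :=
  (k.1.1.1, k.1.1.2, k.2.1.1, k.1.2, k.2.1.2, k.2.2).

Lemma miso_tau : miso mK' mK tau_map tau_map'.
Proof.
apply: miso_cancel; last by case=> [[[[[]]]]].
- have h1 := mpres_map (mpres_map (mpres_swap23 (n2 \X n2) n1 n2) (mpres_id n1)) (mpres_id n1).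
  have h2 := mpres_assoc (n2 \X n2 \X n2 \X n1) n1 n1.
  have h3 := mpres_assoc (n2 \X n2 \X n2) n1 (n1 \X n1).
  have h4 := mpres_map (mpres_id (n2 \X n2 \X n2)) (mpres_unassoc n1 n1 n1).
  apply: (eq_mpres (mpres_comp h4 (mpres_comp h3 (mpres_comp h2 h1)))).
  by case=> [[[[[]]]]].
- by rewrite /tau_map'; meas_coord.
Qed.

Lemma tauE : tau n1 n2 = comp_op tau_map.
Proof.
suff e : (fun k : K => let: (x2, y2, x1, z2, y1, z1) := k in ((x2, y2, z2), (x1, y1, z1))) = tau_map.
  exact (congr1 (fun c => comp_op c) e).
by apply/funext => -[[[[[x2 y2] x1] z2] y1] z1].
Qed.

Definition Psi_map (k : K) : H * H :=
  (((k.1.1.1.1.1, k.1.1.1.1.2), (k.1.1.1.2, k.1.2)),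
   ((k.1.1.1.1.2, k.1.1.2), (k.2, k.1.2))).
Definition Psi_map' (w : H * H) : K :=
  (w.1.1.1, w.1.1.2, w.1.2.1, w.2.1.2, w.1.2.2, w.2.2.1).

Lemma PsiE : @Psi R X1 X2 n1 n2 = comp_op Psi_map.
Proof.
suff e : (fun k : K => let: (x2, y2, x1, z2, y1, z1) := k in (((x2, y2), (x1, y1)), ((y2, z2), (z1, y1)))) = Psi_map.
  exact (congr1 (fun c => comp_op c) e).
by apply/funext => -[[[[[x2 y2] x1] z2] y1] z1].
Qed.

Lemma miso_Psi : miso fib_th mK Psi_map Psi_map'.
Proof.
apply: miso_cancel; last by case=> [[[[[]]]]].
- have h1 := mpres_interchange (n2 \X n2) n2 (n1 \X n1) n1.
  have h2 := mpres_map (mpres_interchange n2 n2 n1 n1) (mpres_swap n2 n1).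
  have h3 := mpres_map (mpres_swap (n2 \X n1) (n2 \X n1)) (mpres_id nu).
  have h4 := mpres_map (mpres_map (mpres_swap n2 n1) (mpres_swap n2 n1)) (mpres_id nu).
  have [ht _ _] := miso_tau.
  have h := mpres_comp h4 (mpres_comp h3 (mpres_comp h2 (mpres_comp h1 ht))).
  have hf : mpres (nu \X nu \X nu) fib_th (@fibre_par _ _ _ _ _ _ _ _ _ _ _ _ (dis_ths n1 n2) (dis_thm n1 n2)).
    exact (mpres_fpar (dis_ths n1 n2) (dis_thm n1 n2)).
  by apply: (eq_mpres (mpres_comp hf h)) => -[[[[[]]]]].
- by rewrite /Psi_map'; meas_coord.
Qed.

End coproduct_transfer.

Section coproduct_comparison.
Context (R : realType) (X1 X2 : ptopologicalType).
Local Notation Y1 := (borel X1).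
Local Notation Y2 := (borel X2).
Variable n1 : {sigma_finite_measure set Y1 -> \bar R}.
Variable n2 : {sigma_finite_measure set Y2 -> \bar R}.
Local Notation nu := (n1 \X n2).
Local Notation mu := (nu \X nu).

Local Notation J_map := (@perm_J _ (Y2 * Y2)%type _ Y1).

Let miso_Jt : miso (n2 \X n2 \X n1 \X n1) mu (J_map \o @toG' X1 X2) (@toG X1 X2 \o @perm_J' _ _ _ _).
Proof.
apply: (miso_comp _ (miso_sym (miso_toG n1 n2))).
by apply: miso_cancel; [exact: mpres_J|exact: (mpres_J' (n2 \X n2) n1).1|case=> [? []]].
Qed.

Lemma rtens_toG y : vN_tens (Linf_ops (n2 \X n2)) (all_ops n1) y -> (exists e : L2 n1, nsq e = 1) ->
  rtens_op (dis_m n1 n2) (dis_r n1 n2) (dis_m n1 n2) (dis_r n1 n2) id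
    (Ad (@comp_op _ _ _ _ _ _ mu (J_map \o @toG' X1 X2)) (ampl n1 y)) =
  Ad (opK (DA := dis_m n1 n2) (dis_r n1 n2) (@kA_m X1 X2))
    (ampl nu (Ad (@comp_op _ _ _ _ _ _ mu (J_map \o @toG' X1 X2)) (ampl n1 y))).
Proof.
move=> hy he; have hu := uni_miso miso_Jt; have bA := bounded_ampl n1 (vN_gen_bounded hy).
apply: (rtens_op_ampl (DA := dis_m n1 n2) (dis_r n1 n2)).
- by rewrite /gm /gs /gp1 /=; meas_coord.
- exact: measurable_fst.
- exact: measurable_kA_m.
- exact: kA_mK.
- exact: (Ad_bounded hu).
move=> F lF.
(* A function of r = (x1, x2): here x2 is among the diagonal variables of [y], and x1 is idle, so
   that [ampl_decomp_comm] applies. *)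
pose Phi (w : Y2 * Y2 * Y1) : R[i] := F (w.2, w.1.1).
have lP : Linf (n2 \X n2 \X n1) Phi.
  exact (Linf_comp (mpres_swap23 n2 n2 n1) (Linf_fst n2 (Linf_comp (mpres_swap n2 n1) lF))).
have lP' : Linf (n2 \X n2 \X n1 \X n1) (fun w => Phi (w.1.1, w.2)).
  exact (Linf_comp (mpres_swap23 (n2 \X n2) n1 n1) (Linf_fst n1 lP)).
have E := Ad_mulop miso_Jt lP'.
have -> : F \o @gr X1 X2 = (fun w => Phi (w.1.1, w.2)) \o (J_map \o @toG' X1 X2).
  by apply/funext => -[[x1 x2] [y1 y2]].
have C := ampl_decomp_comm hy he lP.
have C1 := Ad_comp hu (ampl n1 y) (mulop (fun w => Phi (w.1.1, w.2))).
have C2 := Ad_comp hu (mulop (fun w => Phi (w.1.1, w.2))) (ampl n1 y).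
rewrite -E; exact: etrans (esym C1) (etrans (congr1 _ C) C2).
Qed.

End coproduct_comparison.

Section iterated_amplification.
Context (R : realType).
Context d1 (T1 : measurableType d1) (m : {sigma_finite_measure set T1 -> \bar R}).
Context d2 (T2 : measurableType d2) (n : {sigma_finite_measure set T2 -> \bar R}).
Context d3 (T3 : measurableType d3) (l : {sigma_finite_measure set T3 -> \bar R}).
Context d4 (T4 : measurableType d4) (k : {sigma_finite_measure set T4 -> \bar R}).

Lemma ampl_ampl (y : L2 m -> L2 m) : bounded_op y ->
  ampl l (ampl n y) =
  Ad (@comp_op _ _ _ (m \X (n \X l)) _ _ (m \X n \X l) (@assoc_pair T1 T2 T3)) (ampl (n \X l) y).
Proof.
move=> hy; have h := Ad_assoc_tens hy (bounded_id n) (bounded_id l).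
by rewrite tens_op_id in h; rewrite /ampl h.
Qed.

Lemma ampl_Ad_ampl (c : T4 -> T1 * T2) c' y : mpres k (m \X n) c -> measurable_fun setT c' ->
  cancel c c' -> bounded_op y ->
  ampl l (Ad (@comp_op _ _ _ (m \X n) _ _ k c) (ampl n y)) =
  Ad (@comp_op _ _ _ (m \X (n \X l)) _ _ (k \X l) (@assoc_pair T1 T2 T3 \o map_pair c id))
    (ampl (n \X l) y).
Proof.
move=> hc mc' K hy; have ba := bounded_ampl n hy.
exact (etrans (ampl_Ad l hc mc' K ba) (etrans (congr1 _ (ampl_ampl hy))
  (Ad_comp_op _ (miso_assoc m n l) (miso_mapl l hc mc' K)))).
Qed.

Lemma miso_ampl_Ad (c : T4 -> T1 * T2) c' : mpres k (m \X n) c -> measurable_fun setT c' ->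
  cancel c c' ->
  miso (m \X (n \X l)) (k \X l) (@assoc_pair T1 T2 T3 \o map_pair c id)
    (map_pair c' id \o @unassoc_pair T1 T2 T3).
Proof. by move=> hc mc' K; exact: miso_comp (miso_assoc m n l) (miso_mapl l hc mc' K). Qed.

End iterated_amplification.

Section coproduct_formula.
Context (R : realType) (X1 X2 : ptopologicalType).
Local Notation Y1 := (borel X1).
Local Notation Y2 := (borel X2).
Variable n1 : {sigma_finite_measure set Y1 -> \bar R}.
Variable n2 : {sigma_finite_measure set Y2 -> \bar R}.
Local Notation X := (Y1 * Y2)%type.
Local Notation nu := (n1 \X n2).
Local Notation mu := (nu \X nu).
Local Notation mH := (n2 \X n2 \X (n1 \X n1)).
Local Notation mu_sm := (fibre_mes (dis_s n1 n2) (dis_m n1 n2)).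
Local Notation mu_mr := (fibre_mes (dis_m n1 n2) (dis_r n1 n2)).
Local Notation K := (Y2 * Y2 * Y1 * Y2 * Y1 * Y1)%type.
Local Notation mK := (n2 \X n2 \X n1 \X n2 \X n1 \X n1).

Local Notation J := (@opJ _ _ _ (n2 \X n2) _ _ n1).
Local Notation J_map := (@perm_J _ (Y2 * Y2)%type _ Y1).
Local Notation toGi := (@toG' X1 X2).

Definition lhs_map (k : K) : Y2 * Y2 * Y1 * (Y1 * X) :=
  ((k.1.1.1.1.1, k.1.1.2, k.1.2), (k.2, (k.1.1.1.2, k.1.1.1.1.2))).

Let hJ : mpres mu (n2 \X n2 \X n1 \X n1) (J_map \o toGi).
Proof. exact: mpres_comp (mpres_J _ _) (miso_mpres (miso_toG n1 n2)). Qed.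

Let mJ : measurable_fun setT (@toG X1 X2 \o @perm_J' _ _ _ _).
Proof. by have [[mt _] _ _] := miso_toG n1 n2; exact: measurableT_comp mt (mpres_J' (n2 \X n2) n1).1. Qed.

Let KJ : cancel (J_map \o toGi) (@toG X1 X2 \o @perm_J' _ _ _ _).
Proof. by case=> [[? ?] []]. Qed.

Let mq : measurable_fun setT (@gr X1 X2). Proof. exact: measurable_fst. Qed.

Let iso1 := miso_ampl_Ad nu hJ mJ KJ.
Let iso2 := miso_kap (DA := dis_m n1 n2) (dis_r n1 n2) mq (@measurable_kA_m X1 X2) (@kA_mK R X1 X2 n1 n2).
Let iso3 := miso_sym (miso_W n1 n2).
Let iso4 := miso_comp (miso_toG2 n1 n2) (miso_Psi n1 n2).

Lemma miso_lhs : exists lhs_map', miso (n2 \X n2 \X n1 \X (n1 \X nu)) mK lhs_map lhs_map'.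
Proof. eexists; exact (miso_comp (miso_comp (miso_comp iso1 iso2) iso3) iso4). Qed.

Lemma theta_Gamma y : vN_tens (Linf_ops (n2 \X n2)) (all_ops n1) y -> (exists e : L2 n1, nsq e = 1) ->
  theta_star_theta n1 n2 (Gamma n1 n2 (theta_inv n1 n2 (Ad J (ampl n1 y)))) =
  Ad (@comp_op _ _ _ (n2 \X n2 \X n1 \X (n1 \X nu)) _ _ mK lhs_map) (ampl (n1 \X nu) y).
Proof.
move=> hy he; have by' := vN_gen_bounded hy.
have mJ0 : miso (n2 \X n2 \X n1 \X n1) mH J_map (@perm_J' _ _ _ _).
  by apply: miso_cancel; [exact: mpres_J|exact: (mpres_J' (n2 \X n2) n1).1|case=> [? []]].
(* Each of the following identities adds one coordinate map: the passage to L^2(G), the fibre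
   coordinates of 1 (x) x, the inverse of [W_map], the two copies of [toG], and [Psi_map]. Their
   composite is [lhs_map]. *)
have e1 := etrans (Ad_ident_theta_inv (Ad J (ampl n1 y)))
  (Ad_comp_op (ampl n1 y) mJ0 (miso_sym (miso_toG n1 n2))).
have e2 := Ad_comp_step (ampl_Ad_ampl nu hJ mJ KJ by') erefl iso1 iso2.
have e3 := etrans (congr1 _ e1) (etrans (rtens_toG hy he) e2).
have k2 := miso_comp iso1 iso2; have k3 := miso_comp k2 iso3.
have e4 := etrans (GammaE _) (Ad_comp_step e3 erefl k2 iso3).
have e5 := Ad_comp_step e4 (Theta2E n1 n2) k3 (miso_toG2 n1 n2).
exact (Ad_comp_step e5 (PsiE n1 n2) (miso_comp k3 (miso_toG2 n1 n2)) (miso_Psi n1 n2)).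
Qed.

End coproduct_formula.

Section coproduct_identity.
Context (R : realType) (X1 X2 : ptopologicalType).
Local Notation Y1 := (borel X1).
Local Notation Y2 := (borel X2).
Variable n1 : {sigma_finite_measure set Y1 -> \bar R}.
Variable n2 : {sigma_finite_measure set Y2 -> \bar R}.
Local Notation X := (Y1 * Y2)%type.
Local Notation nu := (n1 \X n2).
Local Notation K := (Y2 * Y2 * Y1 * Y2 * Y1 * Y1)%type.
Local Notation mK := (n2 \X n2 \X n1 \X n2 \X n1 \X n1).
Local Notation mK' := (n2 \X n2 \X n2 \X (n1 \X n1 \X n1)).

Local Notation J := (@opJ _ _ _ (n2 \X n2) _ _ n1).
Local Notation J_map := (@perm_J _ (Y2 * Y2)%type _ Y1).

Definition rhs_map (k : K) : Y2 * Y2 * Y1 * (Y1 * (Y2 * Y1)) :=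
  ((k.1.1.1.1.1, k.1.1.2, k.1.2), (k.1.1.1.2, (k.1.1.1.1.2, k.2))).

Lemma tau_coprod y : bounded_op y -> Ad (tau n1 n2) (coprod (Ad J (ampl n1 y))) =
  Ad (@comp_op _ _ _ (n2 \X n2 \X n1 \X (n1 \X (n2 \X n1))) _ _ mK rhs_map) (ampl (n1 \X (n2 \X n1)) y).
Proof.
move=> bY; have hJ := mpres_J (n2 \X n2) n1; have mJ := (mpres_J' (n2 \X n2) n1).1.
have KJ : cancel J_map (@perm_J' _ _ _ _) by case=> [? []].
have k1 := miso_ampl_Ad (n2 \X n1) hJ mJ KJ.
have e1 := Ad_comp_step (ampl_Ad_ampl (n2 \X n1) hJ mJ KJ bY) erefl k1 (miso_coprod n1 n2).
have k2 := miso_comp k1 (miso_coprod n1 n2).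
exact (Ad_comp_step e1 (tauE n1 n2) k2 (miso_tau n1 n2)).
Qed.

(** [lhs_map] and [rhs_map] agree in the coordinates (x2, z2, y1) on which [y] acts; this rotation
    takes the idle ones from (z1, (x1, y2)) to (x1, (y2, z1)). *)
Definition rot3 (w : Y1 * X) : Y1 * (Y2 * Y1) := (w.2.1, (w.2.2, w.1)).
Definition rot3' (w : Y1 * (Y2 * Y1)) : Y1 * X := (w.2.2, (w.1, w.2.1)).

Lemma theta_star_theta_coprod y : vN_tens (Linf_ops (n2 \X n2)) (all_ops n1) y ->
  (exists e : L2 n1, nsq e = 1) ->
  theta_star_theta n1 n2 (Gamma n1 n2 (theta_inv n1 n2 (Ad J (ampl n1 y)))) =
  Ad (tau n1 n2) (coprod (Ad J (ampl n1 y))).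
Proof.
move=> hy he; have bY := vN_gen_bounded hy.
have hr : mpres (n1 \X nu) (n1 \X (n2 \X n1)) rot3.
  exact: mpres_comp (mpres_assoc n1 n2 n1) (mpres_swap n1 nu).
have mr : measurable_fun setT rot3' by rewrite /rot3'; meas_coord.
have Kr : cancel rot3 rot3' by case=> [? []].
have kr := miso_mapr (n2 \X n2 \X n1) hr mr Kr.
have [l' kl] := miso_lhs n1 n2.
have e := Ad_comp_op (ampl (n1 \X (n2 \X n1)) y) kr kl.
rewrite (Ad_mapr_ampl hr mr Kr bY) in e.
exact (etrans (theta_Gamma hy he) (etrans e (esym (tau_coprod bY)))).
Qed.

End coproduct_identity.

Theorem theorem5p2p2 (R : realType) (X1 X2 : ptopologicalType)
    (nu1 : {sigma_finite_measure set (borel X1) -> \bar R})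
    (nu2 : {sigma_finite_measure set (borel X2) -> \bar R}) :
  hausdorff_space X1 -> locally_compact [set: X1] -> sigma_compact X1 ->
  hausdorff_space X2 -> locally_compact [set: X2] -> sigma_compact X2 ->
  radon nu1 -> full_support nu1 -> radon nu2 -> full_support nu2 ->
  [/\ forall f, Linf (nu2 \X nu2 \X nu1) f ->
        act_tilde nu1 nu2 f = Ad (Sigma nu1 nu2) (act nu1 nu2 f),
      [/\ unitary (Sigma' nu1 nu2 \o Sigma nu1 nu2),
          vN_iso (crossed_product nu1 nu2)
            (vN_tens (Linf_ops (nu2 \X nu2))
               (vN_tens (scalar_ops nu1) (all_ops nu1)))
            (theta nu1 nu2),
          vN_isomorphic (crossed_product nu1 nu2)
            (vN_tens (Linf_ops (nu2 \X nu2)) (all_ops nu1))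
        & vN_isomorphic (crossed_product nu1 nu2)
            (vN_tens (Linf_ops (nu2 \X nu2)) (R_X1 nu1))]
    & forall x,
        vN_tens (Linf_ops (nu2 \X nu2))
          (vN_tens (scalar_ops nu1) (all_ops nu1)) x ->
        theta_star_theta nu1 nu2 (Gamma nu1 nu2 (theta_inv nu1 nu2 x)) =
        Ad (tau nu1 nu2) (Gamma_tens nu1 nu2 x)].
Proof.
move=> hX1 lX1 sX1 hX2 lX2 sX2 rn1 fn1 rn2 _.
have ht := vN_iso_theta nu2 hX1 lX1 hX2 lX2 sX2 rn1 fn1.
have eT := target_R_X1 nu2 hX1 lX1 rn1 fn1.
have RE := R_X1_eq hX1 lX1 rn1 fn1.
have [e e1] := unit_full_support fn1; have he : exists e : L2 nu1, nsq e = 1 by exists e.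
split; first by move=> f lf; exact: act_tildeE.
  split; first exact: uni_unitary (uni_V nu1 nu2).
  - exact: ht.
  - exact: vN_isomorphic_crossed nu2 hX1 lX1 hX2 lX2 sX2 rn1 fn1.
  - by rewrite -eT; exists (theta nu1 nu2).
move=> x hx; have [y hy E] := (targetP fn1 x).1 hx.
(* The target is also the tensor product of L^oo with [R_X1], the algebra on which the selected
   tensor product of the coproducts is known to be [coprod]. *)
move: (hx); rewrite eT => /(Gamma_tensE RE e1) ->.
by rewrite E; exact: theta_star_theta_coprod hy he.
Qed.
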